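(* Let $p\in[1,\infty)$, $0<\psi_M<\pi$ and $0<C_*\le C^*$. There exists a constant $C>0$ depending only on $p$, $\psi_M$, $C_*$ and $C^*$ such that the following holds. Let $K\subset\mathbb{R}^2$ be an arbitrary convex quadrilateral satisfying $MAC(\psi_M)$ and $clos(C_*,C^* )$ (equivalently, the double angle condition $DAC$ and $clos$). If $l_1$ and $l_2$ are two neighboring sides of $K$ such that the parallelogram determined by them contains $K$ entirely, then for every $u\in W^{2,p}(K)$ $$|u-Qu|_{1,p,K}\le C\left[\,|l_1|\,\left\|\partial_{l_1}\nabla u\right\|_{0,p,K}+|l_2|\,\left\|\partial_{l_2}\nabla u\right\|_{0,p,K}\right].$$
   Context: A convex quadrilateral $K$ satisfies the maximum angle condition $MAC(\psi_M)$ if all its inner angles $\theta$ satisfy $\theta\le\psi_M<\pi$; it satisfies the minimum angle condition $mac(\psi_m)$ if all its inner angles satisfy $0<\psi_m\le\theta$; it satisfies the double angle condition $DAC(\psi_m,\psi_M)$ if it satisfies both $MAC(\psi_M)$ and $mac(\psi_m)$. It satisfies the property of comparable lengths for opposite sides $clos(C_*,C^* )$ if for any two opposite sides $s_1,s_2$ of $K$ one has $C_*\le |s_1|/|s_2|\le C^*$. The $\mathcal{Q}_1$-isoparametric Lagrange interpolation $Q$ on $K$: let $\widehat K=[0,1]^2$ with vertices $\widehat V_1=(0,0),\widehat V_2,\widehat V_3,\widehat V_4$ in counterclockwise order, let $V_1,\dots,V_4$ be the vertices of $K$ in counterclockwise order (with $V_1$ chosen arbitrarily), let $\widehat\phi_i$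 be the bilinear function on $\widehat K$ with $\widehat\phi_i(\widehat V_j)=\delta_{ij}$, and let $F_K:\widehat K\to K$, $F_K(\hat x)=\sum_{i=1}^4 V_i\widehat\phi_i(\hat x)$. Then $Qu(x)=\widehat Q\hat u(\hat x)$, where $x=F_K(\hat x)$, $\hat u=u\circ F_K$ and $\widehat Q\hat u=\sum_{i=1}^4\hat u(\widehat V_i)\widehat\phi_i$ (point values of $u$ refer to its continuous representative). Notation: $|l|$ is the length of the segment $l$; $\partial_{l}$ is the directional derivative along the (unit) direction of $l$; $\|\cdot\|_{0,p,K}$ is the $L^p(K)$ norm (applied to vector fields as well); $|v|_{1,p,K}=\|\nabla v\|_{0,p,K}$. The parallelogram determined by two neighboring sides is the one having these two segments as sides emanating from their common vertex. *)

(* Defs.v *)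
From HB Require Import structures.
From mathcomp Require Import all_boot all_order all_algebra.
From mathcomp Require Import all_classical all_reals all_analysis.

Set Implicit Arguments.
Unset Strict Implicit.
Unset Printing Implicit Defensive.

Import Order.TTheory GRing.Theory Num.Theory.
Import numFieldNormedType.Exports.

Local Open Scope classical_set_scope.
Local Open Scope ring_scope.

Section Plane.
Variable R : realType.
Implicit Types (a b x v : R * R) (D : set (R * R)) (f g phi u : R * R -> R).

(* The norm that the library puts on R * R is the sup norm, hence the explicit
   Euclidean structure. *)
Definition dot a b : R := a.1 * b.1 + a.2 * b.2.
Definition enorm a : R := Num.sqrt (dot a a).
Definition cross a b : R := a.1 * b.2 - a.2 * b.1.
Definition unit_dir a b : R * R := (enorm (b - a))^-1 *: (b - a).

Definition e1 : R * R := (1, 0).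
Definition e2 : R * R := (0, 1).

Definition lebesgue2 : {measure set (measurableTypeR R * measurableTypeR R)
    -> \bar R} :=
  (@lebesgue_measure R \x @lebesgue_measure R)%E.

Fixpoint Ck (k : nat) phi : Prop :=
  continuous phi /\
  if k is k'.+1 then
    forall v, v \in [:: e1; e2] ->
      (forall x, derivable phi x v) /\ Ck k' (fun x => 'D_v phi x)
  else True.

Definition closed_support phi : set (R * R) := closure [set x | phi x != 0].

Definition test_function D phi : Prop :=
  [/\ forall k, Ck k phi, compact (closed_support phi) &
    closed_support phi `<=` D].

Definition loc_integrable D f : Prop :=
  forall A, compact A -> A `<=` D -> lebesgue2.-integrable A (EFin \o f).

(* In what follows D is an open set; g is the distributional derivative of f
   on D in the direction v. *)
Definition is_weak_derivative D v f g : Prop :=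
  [/\ loc_integrable D f, loc_integrable D g &
    forall phi, test_function D phi ->
      \int[lebesgue2]_(x in D) (f x * 'D_v phi x) =
      - \int[lebesgue2]_(x in D) (g x * phi x)].

(* Weak derivatives are unique almost everywhere; this picks a representative
   (and is 0 when there is no weak derivative). *)
Definition weak_derivative D v f : R * R -> R :=
  xget (cst 0) [set g | is_weak_derivative D v f g].

Definition in_Lp (p : R) D f : Prop := f \_ D \in Lfun lebesgue2 p%:E.

Fixpoint sobolev (k : nat) (p : R) D f : Prop :=
  in_Lp p D f /\
  if k is k'.+1 then
    forall v, v \in [:: e1; e2] ->
      exists2 g, is_weak_derivative D v f g & sobolev k' p D g
  else True.

Definition Lp_norm_vect (p : R) D (F : R * R -> R * R) : \bar R :=
  'N[lebesgue2]_(p%:E) [EFin \o ((fun x => enorm (F x)) \_ D)].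

Definition weak_grad D f (x : R * R) : R * R :=
  (weak_derivative D e1 f x, weak_derivative D e2 f x).

Definition weak_derivative_vect D v (F : R * R -> R * R) (x : R * R) : R * R :=
  (weak_derivative D v (fun y => (F y).1) x,
   weak_derivative D v (fun y => (F y).2) x).

Definition sobolev_seminorm1 (p : R) D f : \bar R :=
  Lp_norm_vect p D (weak_grad D f).

End Plane.

(* A quadrilateral is given by its vertices V 0, V 1, V 2, V 3; the indices are
   added modulo 4, so that i + 1 and i - 1 are the neighbors of i. *)
Section Quadrilateral.
Variable R : realType.
Implicit Types (V : 'I_4 -> R * R) (u : R * R -> R).

(* Four vertices in counterclockwise order and in strictly convex position:
   any three of them are cyclically consecutive, and make a left turn. *)
Definition convex_ccw V : Prop :=
  forall i, 0 < cross (V (i + 1) - V i) (V (i + 2) - V (i + 1)).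

Definition quad V : set (R * R) :=
  [set x | exists t : 'I_4 -> R,
    [/\ forall i, 0 <= t i, \sum_i t i = 1 & x = \sum_i t i *: V i]].

Definition side_length V (i : 'I_4) : R := enorm (V (i + 1) - V i).

Definition inner_angle V (i : 'I_4) : R :=
  let a := V (i - 1) - V i in
  let b := V (i + 1) - V i in
  acos (dot a b / (enorm a * enorm b)).

Definition MAC (psiM : R) V : Prop := forall i, inner_angle V i <= psiM.

Definition clos (Clow Cup : R) V : Prop :=
  forall i, Clow <= side_length V i / side_length V (i + 2) <= Cup.

Definition parallelogram (o a b : R * R) : set (R * R) :=
  [set x | exists s t : R, [/\ 0 <= s <= 1, 0 <= t <= 1 &
    x = o + s *: (a - o) + t *: (b - o)]].

Definition ref_square : set (R * R) :=
  [set xh | 0 <= xh.1 <= 1 /\ 0 <= xh.2 <= 1].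

Definition ref_vertex (i : 'I_4) : R * R :=
  match val i with
  | 0 => (0, 0)
  | 1 => (1, 0)
  | 2 => (1, 1)
  | _ => (0, 1)
  end.

(* Bilinear, with Q1_shape i (ref_vertex j) = (i == j)%:R. *)
Definition Q1_shape (i : 'I_4) (xh : R * R) : R :=
  match val i with
  | 0 => (1 - xh.1) * (1 - xh.2)
  | 1 => xh.1 * (1 - xh.2)
  | 2 => xh.1 * xh.2
  | _ => (1 - xh.1) * xh.2
  end.

Definition FK V (xh : R * R) : R * R := \sum_i Q1_shape i xh *: V i.

Definition FK_inv V (x : R * R) : R * R :=
  xget 0 [set xh | ref_square xh /\ FK V xh = x].

Definition is_continuous_rep (K : set (R * R)) u w : Prop :=
  {within K, continuous w} /\
  {ae (@lebesgue2 R), forall x, K° x -> u x = w x}.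

(* For u in W^{2,p}(K) the continuous representative on K exists, by the
   Sobolev embedding, and is unique on K. *)
Definition continuous_rep (K : set (R * R)) u : R * R -> R :=
  xget (cst 0) [set w | is_continuous_rep K u w].

Definition Q1_interp_ref (uh : R * R -> R) (xh : R * R) : R :=
  \sum_i uh (ref_vertex i) * Q1_shape i xh.

Definition Q1_interp V u (x : R * R) : R :=
  Q1_interp_ref (continuous_rep (quad V) u \o FK V) (FK_inv V x).

End Quadrilateral.

(* Main.v *)
(* Write a and b for the sides at A = V i, B and D for their other endpoints, and
   C = A + al a + be b for the opposite vertex; the hypothesis on the parallelogram says that
   al, be <= 1.  In the affine coordinates (s, t) along a and b the interpolant is
     Qu = w A + (w B - w A) s + (w D - w A) t + e xi eta,
   where w is the continuous representative of u, xi and eta are the reference coordinates and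
     e = w C - w A - al (w B - w A) - be (w D - w A).
   Here w B - w A is the mean of the derivative of u along a over the edge AB, and e is
   al times the difference of the means of this derivative over DC and AB, plus 1 - be times
   the difference of the means over AD and DC of the derivative along b.  Differences between
   functions and their edge means are estimated by integrating along segments of K: their
   directions are combinations of a and b with coefficients in [-1, 1], so that only
   H = |a| |d_a grad u| + |b| |d_b grad u| enters.  The angles and the side ratios bound the sine
   at A and al + be - 1 from below, and (1 - be) |b| / |a| and (1 - al) |a| / |b| from above.

   There is no trace theory: the estimates are first proved on the homothetic copies
   (1 - h) K + h y, which lie in the interior of K, for almost every y, and then h tends to 0. *)

Require Import Defs.
From HB Require Import structures.
From mathcomp Require Import all_boot all_order all_algebra.
From mathcomp Require Import all_classical all_reals all_analysis.
From mathcomp Require Import measurable_realfun ring lra.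
Import Order.TTheory GRing.Theory Num.Theory.
Import numFieldNormedType.Exports.
Local Open Scope classical_set_scope.
Local Open Scope ring_scope.

Set Implicit Arguments.
Unset Strict Implicit.
Unset Printing Implicit Defensive.

(** Weak derivatives are known almost everywhere only, while the edges of K are null sets, so a
    statement about one given segment has no direct meaning. The centre y of the homothety supplies
    the missing parameter: for fixed h, the fundamental theorem of calculus holds on the image of a
    fixed segment for almost every y. Hence one y serves finitely many segments and, by Tonelli,
    almost all segments of a measurable family. The second obstacle is uniformity, since |a| / |b|
    is arbitrary. The Poincare and trace inequalities on K are therefore not stated with a diameter
    and a full gradient, but with a function that bounds the derivative along every chord of K;
    their constants are then absolute, and the shape enters only through the bounds listed at the
    end of the overview's main paragraph. Finally p = 1 is allowed, so continuity of u cannot come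
    from a Hoelder estimate. It comes from a formula that writes u near each corner as an average,
    over a small parallelogram, of u, its first derivatives and one mixed second derivative. *)

Ltac meas := lazymatch goal with
  | |- measurable_fun _ (fun _ => (_, _)) => apply: measurable_fun_pair; meas
  | |- measurable_fun _ (fun _ => (_ + _)%R) => apply: measurable_funD; meas
  | |- measurable_fun _ (fun _ => (- _)%R) => apply: measurable_funN; meas
  | |- measurable_fun _ (fun _ => (_ * _)%R) => apply: measurable_funM; meas
  | |- _ => first [exact: measurable_cst | exact: measurable_id |
      exact: measurable_fst | exact: measurable_snd | idtac]
  end.

(** * Affine changes of variables and open sets of the plane *)

Section LinearChange.
Context {R : realType}.
Notation mu := (@lebesgue_measure R).
Notation mu2 := (@lebesgue2 R).
Notation plane := (measurableTypeR R * measurableTypeR R)%type.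
Local Open Scope ereal_scope.

(** Both sides are measures that agree on the intervals []a, b]], which determine Lebesgue measure.
    For c < 0 the preimage is closed on the left instead, with the same length. *)
Lemma lebesgue_measure_affine (c d : R) (A : set R) : c != 0%R -> measurable A ->
  mu A = `|c|%:E * pushforward mu (fun x : R => c * x + d : measurableTypeR R)%R A.
Proof.
move=> c0 mA.
pose g : measurableTypeR R -> measurableTypeR R := (fun x : R => c * x + d)%R.
have mg : measurable_fun [set: measurableTypeR R] g.
  by apply: measurable_funD => //; exact: mulrl_measurable.
pose mg' := isMeasurableFun.Build _ _ _ _ _ mg.
pose F : {mfun measurableTypeR R >-> measurableTypeR R} := HB.pack g mg'.
have -> : `|c|%:E * pushforward mu (fun x : R => c * x + d : measurableTypeR R)%R A =
  mscale (NngNum (normr_ge0 c)) (pushforward mu F) A by [].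
apply: lebesgue_measure_unique => // X [[a b] _ <-] /=.
rewrite /mscale /pushforward.
have gE : g @^-1` `]a, b] =
  if (0 < c)%R then `]((a - d) / c)%R, ((b - d) / c)%R]%classic
  else `[((b - d) / c)%R, ((a - d) / c)%R[%classic.
  apply/seteqP; split=> x /=; case: ltP => c1; rewrite /= !in_itv /=.
  - by rewrite ltr_pdivrMr// ler_pdivlMr// ltrBlDr lerBrDr mulrC.
  - have c2 : (c < 0)%R by rewrite lt_neqAle c0.
    by rewrite ltr_ndivlMr// ler_ndivrMr// ltrBlDr lerBrDr mulrC andbC.
  - by rewrite ltr_pdivrMr// ler_pdivlMr// ltrBlDr lerBrDr mulrC.
  - have c2 : (c < 0)%R by rewrite lt_neqAle c0.
    by rewrite ltr_ndivlMr// ler_ndivrMr// ltrBlDr lerBrDr mulrC andbC.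
rewrite [X in _ = _ * X](congr1 mu gE); case: ltP => c1; rewrite !lebesgue_measure_itv /= !lte_fin.
- rewrite ltr_pM2r ?invr_gt0// ltrD2r; case: ifPn => _; last by rewrite mule0.
  rewrite -!EFinD -EFinM; congr _%:E; rewrite gtr0_norm//; field; exact: lt0r_neq0.
- have c2 : (c < 0)%R by rewrite lt_neqAle c0.
  rewrite ltr_nM2r ?invr_lt0// ltrD2r; case: ifPn => _; last by rewrite mule0.
  rewrite -!EFinD -EFinM; congr _%:E; rewrite ltr0_norm//; field; done.
Qed.

Lemma ge0_integral_affine (c d : R) (f : R -> \bar R) : c != 0%R ->
  measurable_fun [set: measurableTypeR R] f -> (forall x, 0 <= f x) ->
  \int[mu]_x f x = `|c|%:E * \int[mu]_x f (c * x + d)%R.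
Proof.
move=> c0 mf f0.
pose g : measurableTypeR R -> measurableTypeR R := (fun x : R => c * x + d)%R.
have mg : measurable_fun [set: measurableTypeR R] g.
  by apply: measurable_funD => //; exact: mulrl_measurable.
pose pm := measure_function_pushforward__canonical__measure_function_Measure mu mg.
transitivity (\int[mscale (NngNum (normr_ge0 c)) pm]_x f x).
  by apply: eq_measure_integral => A mA _; exact: (lebesgue_measure_affine d c0 mA).
rewrite ge0_integral_mscale//; congr (_ * _).
by rewrite (ge0_integral_pushforward mg mu measurableT mf).
Qed.

Lemma measurable_plane (o p q : R * R) :
  measurable_fun [set: plane]
    (fun z => o + z.1 *: p + z.2 *: q :> plane)%R.
Proof.
apply: measurable_fun_pair => /=; rewrite /GRing.scale /=.
all: by meas.
Qed.

(** Two one-dimensional substitutions: x2 into t at fixed x1, with factor [cross p q / p.1], then x1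
    into s at fixed t, with factor [p.1]. This is where [p.1] must be nonzero; [ge0_integral_plane]
    removes the restriction by exchanging p and q. *)
Lemma ge0_integral_plane_aux (o p q : R * R) (f : R * R -> \bar R) :
  p.1 != 0%R -> cross p q != 0%R ->
  measurable_fun [set: plane] f ->
  (forall x, 0 <= f x) ->
  \int[mu2]_x f x = `|cross p q|%:E * \int[mu2]_z f (o + z.1 *: p + z.2 *: q)%R.
Proof.
move=> p0 pq mf f0.
have mfp : measurable_fun [set: plane]
    (fun z : plane => f (o + z.1 *: p + z.2 *: q)%R).
  by apply: (measurableT_comp mf); exact: measurable_plane.
rewrite /lebesgue2 fubini_tonelli2//= [in RHS]fubini_tonelli2//= /fubini_G /=.
(* The second coordinate of the point with first coordinate x1 on the line of constant t. *)
pose k t x1 : R := (o.2 + (x1 - o.1 - t * q.1) / p.1 * p.2 + t * q.2)%R.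
have mk : measurable_fun [set: plane]
    (fun z => (z.1, k z.2 z.1)).
  apply: measurable_fun_pair => //=; rewrite /k.
  by meas.
have E t : `|p.1|%:E * \int[mu]_s f (o + s *: p + t *: q)%R =
    \int[mu]_x1 f (x1, k t x1).
  rewrite [RHS](@ge0_integral_affine p.1 (o.1 + t * q.1))//; last first.
    apply: (measurableT_comp mf).
    by rewrite /k; meas.
  congr (_ * _); apply: eq_integral => s _; congr f.
  rewrite /k; apply/pair_equal_spec; split; rewrite /= /GRing.scale /=; first by ring.
  by field.
transitivity (\int[mu]_x1 \int[mu]_x2 f (x1, x2)).
  by rewrite -fubini_tonelli.
have c0 : (cross p q / p.1 != 0)%R by rewrite mulf_neq0// invr_neq0.
transitivity (\int[mu]_x1 (`|cross p q / p.1|%:E * \int[mu]_t f (x1, k t x1))).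
  apply: eq_integral => x1 _.
  rewrite (@ge0_integral_affine (cross p q / p.1)
     (o.2 + (x1 - o.1) / p.1 * p.2))//; last first.
    by apply: (measurableT_comp mf); apply: measurable_fun_pair.
  congr (_ * _); apply: eq_integral => t _; congr (f (_, _)).
  by rewrite /k /cross; field.
have mfk : measurable_fun [set: plane]
    (fun z : plane => f (z.1, k z.2 z.1)).
  by apply: (measurableT_comp mf).
rewrite ge0_integralZl; [|exact: measurableT| |by move=> x _; exact: integral_ge0|by rewrite lee_fin]; last first.
  by apply: (measurable_fun_fubini_tonelli_F (m2 := mu) (fun z => f (z.1, k z.2 z.1)) mfk).
have -> : \int[mu]_x1 \int[mu]_t f (x1, k t x1) = \int[mu]_t \int[mu]_x1 f (x1, k t x1).
  by apply: (fubini_tonelli (m1 := mu) (m2 := mu) (fun z => f (z.1, k z.2 z.1))).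
under [in LHS]eq_integral do rewrite -E.
rewrite ge0_integralZl; [|exact: measurableT| |by move=> x _; exact: integral_ge0|by rewrite lee_fin]; last first.
  by apply: (measurable_fun_fubini_tonelli_G (m1 := mu)
    (fun z : plane =>
      f (o + z.1 *: p + z.2 *: q)%R) mfp).
by rewrite muleA -EFinM -normrM divfK.
Qed.

Lemma ge0_integral_plane (o p q : R * R) (f : R * R -> \bar R) :
  cross p q != 0%R ->
  measurable_fun [set: plane] f ->
  (forall x, 0 <= f x) ->
  \int[mu2]_x f x = `|cross p q|%:E * \int[mu2]_z f (o + z.1 *: p + z.2 *: q)%R.
Proof.
move=> pq mf f0.
have [p0|p0] := eqVneq p.1 0%R; last exact: ge0_integral_plane_aux.
have q0 : q.1 != 0%R.
  by apply: contra_neq pq => q0; rewrite /cross p0 q0 !mul0r mulr0 subrr.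
have qp : cross q p = (- cross p q)%R by rewrite /cross; ring.
rewrite (@ge0_integral_plane_aux o q p)//; last by rewrite qp oppr_eq0.
rewrite qp normrN; congr (_ * _).
have mfp (p' q' : R * R) : measurable_fun [set: plane]
    (fun z : plane => f (o + z.1 *: p' + z.2 *: q')%R).
  by apply: (measurableT_comp mf); exact: measurable_plane.
rewrite /lebesgue2 fubini_tonelli1; [|exact: mfp|by move=> ?; exact: f0].
rewrite fubini_tonelli2; [|exact: mfp|by move=> ?; exact: f0].
rewrite /fubini_F /fubini_G.
apply: eq_integral => s _; apply: eq_integral => t _; congr f => /=.
by rewrite addrAC.
Qed.

End LinearChange.

Section PlaneTopology.
Context {R : realType}.
Notation mu := (@lebesgue_measure R).
Notation mu2 := (@lebesgue2 R).
Notation plane := (measurableTypeR R * measurableTypeR R)%type.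

Definition orect (r : (R * R) * (R * R)) : set (R * R) :=
  `]r.1.1, r.2.1[ `*` `]r.1.2, r.2.2[.
Definition crect (r : (R * R) * (R * R)) : set (R * R) :=
  `[r.1.1, r.2.1] `*` `[r.1.2, r.2.2].

Lemma measurable_orect r : measurable (orect r : set plane).
Proof. by apply: measurableX; exact: measurable_itv. Qed.

(** Rectangles with rational corners. The closed rectangles are kept inside U as well, so that
    functions supported in them are test functions on U. *)
Lemma open_bigcup_orect (U : set (R * R)) : open U ->
  exists F : nat -> (R * R) * (R * R),
    (forall k, crect (F k) `<=` U) /\ U = \bigcup_k orect (F k).
Proof.
move=> oU.
pose toR (q : (rat * rat) * (rat * rat)) : (R * R) * (R * R) :=
  ((ratr q.1.1, ratr q.1.2), (ratr q.2.1, ratr q.2.2)).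
(* Codes without a suitable rectangle are sent to reversed corners, which give an empty
   rectangle. *)
pose F k : (R * R) * (R * R) :=
  if (unpickle k : option ((rat * rat) * (rat * rat))) is Some q then
    if `[< crect (toR q) `<=` U >] then toR q else ((1, 1), (0, 0))
  else ((1, 1), (0, 0)).
have c0 : crect ((1, 1), (0, 0)) = set0.
  apply/seteqP; split => // -[x y] [] /=; rewrite !in_itv /= => /andP[a b].
  by have := le_trans a b; rewrite ler10.
have FU k : crect (F k) `<=` U.
  rewrite /F; case: unpickle => [q|]; last by rewrite c0; exact: sub0set.
  by case: asboolP => // _; rewrite c0; exact: sub0set.
exists F; split => //; apply/seteqP; split => [x Ux|x [k _ kx]]; last first.
  apply: (FU k); case: kx; rewrite /= !in_itv /= => /andP[a b] /andP[c d].
  by split; rewrite /= in_itv /= !ltW.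
have /nbhs_ballP[e /= e0 eU] : nbhs x U by exact: open_nbhs_nbhs.
have q1 : x.1 - e < x.1 by rewrite ltrBlDr ltrDl.
have q2 : x.1 < x.1 + e by rewrite ltrDl.
have q3 : x.2 - e < x.2 by rewrite ltrBlDr ltrDl.
have q4 : x.2 < x.2 + e by rewrite ltrDl.
have [a] := rat_in_itvoo q1; have [b] := rat_in_itvoo q2.
have [c] := rat_in_itvoo q3; have [d] := rat_in_itvoo q4.
rewrite !in_itv /= => /andP[d1 d2] /andP[c1 c2] /andP[b1 b2] /andP[a1 a2].
pose q := ((a, c), (b, d)).
have qU : crect (toR q) `<=` U.
  move=> y [] /=; rewrite !in_itv /= => /andP[u1 u2] /andP[v1 v2].
  apply: eU; split; rewrite /ball /= ltr_distlC; apply/andP; split; lra.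
exists (pickle q) => //; rewrite /F pickleK; case: asboolP => // _.
by split; rewrite /= in_itv /=; apply/andP.
Qed.

Lemma open_measurable_plane (U : set (R * R)) : open U -> measurable (U : set plane).
Proof.
move=> /open_bigcup_orect[F [_ ->]]; apply: bigcupT_measurable => k.
exact: measurable_orect.
Qed.

Lemma continuous_measurable_plane (f : R * R -> R) : continuous f ->
  measurable_fun [set: plane] f.
Proof.
move=> cf; apply: (measurability _ (RGenOpens.measurableE R)).
move=> _ [_ [a [b ->] <-]]; rewrite setTI.
apply: open_measurable_plane; apply: open_comp; last exact: interval_open.
by move=> x _; exact: cf.
Qed.

Lemma closed_measurable_plane (U : set (R * R)) : closed U -> measurable (U : set plane).
Proof.
by move=> cU; rewrite -[U]setCK; apply: measurableC; apply: open_measurable_plane; exact: closed_openC.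
Qed.

End PlaneTopology.

Section VanishingIntegrals.
Local Open Scope ereal_scope.

(** The sets A for which the integral vanishes are closed under complements and countable disjoint
    unions, so Dynkin's theorem extends the property from the pi-system G to the sigma-algebra that
    it generates. *)
Lemma integral_preimage_eq0 d d' (Y : measurableType d) (T : measurableType d')
    (R : realType) (m : {measure set Y -> \bar R}) (D : set Y) (h : Y -> \bar R)
    (f : Y -> T) (G : set (set T)) :
  measurable D -> m.-integrable D h -> measurable_fun setT f ->
  @measurable _ T = <<s G >> -> setI_closed G ->
  \int[m]_(x in D) h x = 0 ->
  (forall A, G A -> \int[m]_(x in D `&` f @^-1` A) h x = 0) ->
  forall A, measurable A -> \int[m]_(x in D `&` f @^-1` A) h x = 0.
Proof.
move=> mD ih mf GE GI hD hG A; rewrite GE; move: A.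
have mfA A : measurable A -> measurable (D `&` f @^-1` A).
  by move=> mA; apply: measurableI => //; rewrite -[_ @^-1` _]setTI; exact: mf.
apply: (dynkin_induction GE GI) => //.
- by rewrite preimage_setT setIT.
- move=> S mS hS.
  have : \int[m]_(x in D) h x =
      \int[m]_(x in D `&` f @^-1` S) h x + \int[m]_(x in D `&` f @^-1` (~` S)) h x.
    rewrite -integral_setU.
    + by rewrite -setIUr -preimage_setU setUv preimage_setT setIT.
    + exact: mfA.
    + by apply: mfA; exact: measurableC.
    + rewrite -setIUr -preimage_setU setUv preimage_setT setIT.
      exact: measurable_int ih.
    + apply/disj_setPS => x [[_ /= ?] [_ ]] //.
  by rewrite hD hS add0e.
- move=> F mF tF hF; rewrite preimage_bigcup setI_bigcupr integral_bigcup.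
  + by rewrite eseries0.
  + move=> i j _ _ [y [[_ yi] [_ yj]]]; apply: tF => //; by exists (f y).
  + by move=> k; exact: mfA.
  + apply: (integrableS mD _ _ ih); last by move=> y [k _ []].
    by apply: bigcupT_measurable => k; exact: mfA.
Qed.

End VanishingIntegrals.

(** * Test functions and the fundamental lemma *)

Section Derivatives.
Context {R : realType}.
Implicit Types (f g phi : R * R -> R) (a v x : R * R).

Lemma is_derive_line f a v t d :
  is_derive (a + t *: v) v f d <-> is_derive t 1 (fun h : R => f (a + h *: v)) d.
Proof.
have E : (fun h => h^-1 *: ((f \o shift (a + t *: v)) (h *: v) - f (a + t *: v))) =
   (fun h => h^-1 *: (((fun h : R => f (a + h *: v)) \o shift t) (h *: 1) -
                       f (a + t *: v))).
  apply/funext => h /=; congr (_ *: (f _ - _)).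
  by rewrite [h%:A]mulr1 scalerDl addrCA.
split=> -[]; rewrite /derivable /derive.
- by rewrite E => c1 c2; split; rewrite /derivable /derive.
- by rewrite -E => c1 c2; split; rewrite /derivable /derive.
Qed.

Lemma mean_value0 (F F' : R -> R) (s : R) :
  (forall t : R, is_derive t 1 F (F' t)) ->
  exists2 c, `|c| <= `|s| & F s - F 0 = F' c * s.
Proof.
move=> dF.
have cF : continuous F.
  by move=> t; apply: differentiable_continuous; apply/derivable1_diffP; case: (dF t).
have [s0|s0] := leP 0 s.
  have [] := @MVT_segment R F F' 0 s s0.
  - exact: continuous_subspaceT.
  move=> c; rewrite in_itv /= => /andP[c0 cs] E; exists c.
    by rewrite !ger0_norm.
  by rewrite E subr0.
have [] := @MVT_segment R F F' s 0 (ltW s0).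
- exact: continuous_subspaceT.
move=> c; rewrite in_itv /= => /andP[c0 cs] E; exists c.
  by rewrite ler0_norm// ltr0_norm// lerN2.
by rewrite -[LHS]opprB E sub0r mulrN opprK.
Qed.

(** [Ck] speaks of the directions [e1] and [e2] only. The increment along w is split into its two
    coordinate legs, with the mean value theorem on each, and the continuity of both partial
    derivatives gives the limit. *)
Lemma is_derive_dir phi (phi1 phi2 : R * R -> R) x w :
  (forall y, is_derive y (e1 R) phi (phi1 y)) ->
  (forall y, is_derive y (e2 R) phi (phi2 y)) ->
  continuous phi1 -> continuous phi2 ->
  is_derive x w phi (w.1 * phi1 x + w.2 * phi2 x).
Proof.
move=> d1 d2 c1 c2.
suff L : h^-1 *: ((phi \o shift x) (h *: w) - phi x) @[h --> 0^'] -->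
    w.1 * phi1 x + w.2 * phi2 x.
  by apply: DeriveDef; [exact: cvgP L|exact: (@cvg_lim R^o)].
apply/(@cvgrPdist_le _ R^o) => e e0.
(* With this M, both legs are shorter than r as soon as |h| < r / M, and two errors e / M weighted
   by |w.1| and |w.2| sum to at most e. *)
pose M := `|w.1| + `|w.2| + 1.
have M0 : 0 < M by rewrite ltr_wpDl// addr_ge0.
have /nbhs_ballP[r1 /= r10 B1] :
    nbhs x [set y | `|phi1 x - phi1 y| < e / M].
  by move/(@cvgrPdist_lt _ R^o): (c1 x); apply; rewrite divr_gt0.
have /nbhs_ballP[r2 /= r20 B2] :
    nbhs x [set y | `|phi2 x - phi2 y| < e / M].
  by move/(@cvgrPdist_lt _ R^o): (c2 x); apply; rewrite divr_gt0.
near=> h.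
have hn0 : h != 0 by near: h; exact: nbhs_dnbhs_neq.
have hr (r : R) : 0 < r -> `|h| < r / M -> `|h * w.1| < r /\ `|h * w.2| < r.
  rewrite ltr_pdivlMr// => r0 hM; rewrite !normrM; split; apply: le_lt_trans hM;
  by apply: ler_wpM2l => //; rewrite /M -addrA ?lerDl ?addr_ge0// addrCA lerDl addr_ge0.
have hr1 : `|h * w.1| < r1 /\ `|h * w.2| < r1.
  apply: hr => //; near: h; apply: dnbhs0_lt; exact: divr_gt0.
have hr2 : `|h * w.1| < r2 /\ `|h * w.2| < r2.
  apply: hr => //; near: h; apply: dnbhs0_lt; exact: divr_gt0.
have [c ch E1] := @mean_value0 (fun s => phi ((x.1, x.2 + h * w.2) + s *: (e1 R)))
    (fun s => phi1 ((x.1, x.2 + h * w.2) + s *: (e1 R))) (h * w.1)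
    (fun t => (is_derive_line _ _ _ _ _).1 (d1 _)).
have [c' ch' E2] := @mean_value0 (fun s => phi (x + s *: (e2 R)))
    (fun s => phi2 (x + s *: (e2 R))) (h * w.2)
    (fun t => (is_derive_line _ _ _ _ _).1 (d2 _)).
have X1 s : (x.1, x.2 + h * w.2) + s *: e1 R = (x.1 + s, x.2 + h * w.2).
  by apply/pair_equal_spec; rewrite /= /GRing.scale /= !mulr1 mulr0 addr0.
have X2 s : x + s *: e2 R = (x.1, x.2 + s).
  by apply/pair_equal_spec; rewrite /= /GRing.scale /= !mulr1 mulr0 addr0.
move: E1 E2; rewrite !X1 !X2 !addr0 => E1 E2.
have -> : (phi \o shift x) (h *: w) - phi x =
    phi1 (x.1 + c, x.2 + h * w.2) * (h * w.1) + phi2 (x.1, x.2 + c') * (h * w.2).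
  rewrite -E1 -E2 addrA subrK -surjective_pairing; congr (phi _ - phi _).
  by apply/pair_equal_spec; rewrite /= /GRing.scale /= ![_ + h * _]addrC.
have -> : w.1 * phi1 x + w.2 * phi2 x - h^-1 *:
   (phi1 (x.1 + c, x.2 + h * w.2) * (h * w.1) + phi2 (x.1, x.2 + c') * (h * w.2)) =
   w.1 * (phi1 x - phi1 (x.1 + c, x.2 + h * w.2)) + w.2 * (phi2 x - phi2 (x.1, x.2 + c')).
  by rewrite /GRing.scale /=; field.
have A1 : `|phi1 x - phi1 (x.1 + c, x.2 + h * w.2)| <= e / M.
  apply: ltW; apply: B1; split; rewrite /ball /= opprD addrA subrr sub0r normrN.
    exact: le_lt_trans ch hr1.1.
  exact: hr1.2.
have A2 : `|phi2 x - phi2 (x.1, x.2 + c')| <= e / M.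
  apply: ltW; apply: B2; split; rewrite /ball /=; first by rewrite subrr normr0.
  by rewrite opprD addrA subrr sub0r normrN; exact: le_lt_trans ch' hr2.2.
apply: le_trans (ler_normD _ _) _; rewrite !normrM.
apply: (@le_trans _ _ (`|w.1| * (e / M) + `|w.2| * (e / M))).
  by apply: lerD; apply: ler_wpM2l.
rewrite -mulrDl mulrA ler_pdivrMr// mulrC ler_pM2l// /M lerDl ler01 //.
Unshelve. all: by end_near. Qed.

Lemma Ck_pred k phi : Ck k.+1 phi -> Ck k phi.
Proof.
elim: k phi => [phi [] //|k IH phi [c d]]; split => // v vi.
by have [d1 d2] := d v vi; split => //; exact: IH.
Qed.

Lemma Ck_cst k (c : R) : Ck k (fun=> c).
Proof.
elim: k c => [c|k IH c]; split => //; try exact: cst_continuous.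
move=> v _; split; first by move=> x; exact: derivable_cst.
rewrite (_ : 'D_v _ = fun=> 0); first exact: IH.
by apply/funext => x; exact: derive_cst.
Qed.

Lemma CkD k f g : Ck k f -> Ck k g -> Ck k (fun x => f x + g x).
Proof.
elim: k f g => [f g [cf _] [cg _]|k IH f g [cf df] [cg dg]]; split => //.
- by move=> x; apply: cvgD; [exact: cf|exact: cg].
- by move=> x; apply: cvgD; [exact: cf|exact: cg].
move=> v vi; have [df1 df2] := df v vi; have [dg1 dg2] := dg v vi; split.
  by move=> x; apply: derivableD.
rewrite (_ : 'D_v _ = fun x => 'D_v f x + 'D_v g x); first exact: IH.
by apply/funext => x; apply: deriveD.
Qed.

Lemma CkM k f g : Ck k f -> Ck k g -> Ck k (fun x => f x * g x).
Proof.
elim: k f g => [f g [cf _] [cg _]|k IH f g Cf Cg].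
  by split => // x; apply: cvgM; [exact: cf|exact: cg].
have [[cf df] [cg dg]] := (Cf, Cg); split => //.
  by move=> x; apply: cvgM; [exact: cf|exact: cg].
move=> v vi; have [df1 df2] := df v vi; have [dg1 dg2] := dg v vi; split.
  by move=> x; apply: derivableM.
rewrite (_ : 'D_v _ = fun x => f x * 'D_v g x + g x * 'D_v f x).
  by apply: CkD; apply: IH => //; exact: Ck_pred.
by apply/funext => x; apply: deriveM.
Qed.

End Derivatives.

(** * Smoothness of exp (-1/t) extended by zero *)

Section ExpBump.
Context {R : realType}.
Implicit Types (P : {poly R}).

(** A polynomial factor in 1/t makes the family stable under derivation, P becoming X^2 (P - P');
    smoothness then follows by induction on the order. *)
Definition flat P (t : R) : R := if 0 < t then P.[t^-1] * expR (- t^-1) else 0.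

(** The factor [y ^+ k] is what lets the induction on P go through: multiplying P by X is absorbed
    into k. *)
Lemma poly_expR_bound P k :
  exists2 C : R, 0 <= C & forall y : R, 0 <= y -> y ^+ k * `|P.[y]| * expR (- y) <= C.
Proof.
elim/poly_ind: P k => [k|P c IH k].
  by exists 0 => // y y0; rewrite horner0 normr0 mulr0 mul0r.
have [C C0 HC] := IH k.+1.
exists (C + `|c| * k`!%:R); first by rewrite addr_ge0// mulr_ge0.
move=> y y0; rewrite hornerD hornerC hornerMX.
have Hk : y ^+ k * expR (- y) <= k`!%:R.
  rewrite expRN ler_pdivrMr ?expR_gt0//.
  case: k {IH HC} => [|k]; first by rewrite expr0 mul1r; apply: le_trans (expR_ge1Dx y); rewrite lerDl.
  have := @expR_ge1Dxn R y k y0.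
  have f0 : 0 < (k.+1)`!%:R :> R by rewrite ltr0n fact_gt0.
  move=> H; have {}H : y ^+ k.+1 / k.+1`!%:R <= expR y.
    by apply: le_trans H; rewrite lerDr.
  by rewrite mulrC -ler_pdivrMr.
have e0 : 0 <= expR (- y) by exact: ltW (expR_gt0 _).
apply: (@le_trans _ _ (y ^+ k * (`|P.[y]| * y + `|c|) * expR (- y))).
  rewrite ler_wpM2r// ler_wpM2l ?exprn_ge0//.
  by apply: le_trans (ler_normD _ _) _; rewrite normrM (ger0_norm y0).
rewrite mulrDr mulrDl lerD//.
  rewrite (_ : y ^+ k * _ * _ = y ^+ k.+1 * `|P.[y]| * expR (- y)); first exact: HC.
  by rewrite exprS; ring.
by rewrite -mulrA mulrCA ler_wpM2l.
Qed.

Lemma flat_sq_bound P : exists2 C : R, 0 <= C & forall t : R, `|flat P t| <= C * t ^+ 2.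
Proof.
have [C C0 HC] := poly_expR_bound P 2; exists C => // t; rewrite /flat.
case: ltP => [t0|_]; last by rewrite normr0 mulr_ge0// sqr_ge0.
rewrite normrM (ger0_norm (ltW (expR_gt0 _))) -ler_pdivrMr ?exprn_gt0//.
have := HC t^-1; rewrite invr_ge0 (ltW t0) => /(_ isT).
by rewrite exprVn mulrC mulrA [_ * expR _]mulrC mulrC mulrCA mulrA.
Qed.

Lemma is_derive_flat P (t : R) : is_derive t 1 (flat P) (flat ('X^2 * (P - P^`())) t).
Proof.
have [t0|t0|t0] := ltgtP 0 t.
- apply: (@near_eq_is_derive _ _ _ (fun s : R => P.[s^-1] * expR (- s^-1) : R)).
    near=> s; rewrite /flat; have -> // : 0 < s.
    by near: s; exact: lt_nbhsr.
  have tn : t != 0 by rewrite gt_eqF.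
  have dV : is_derive t 1 (fun s : R => s^-1) (- t ^- 2).
    by apply: is_derive_eq; [apply: is_deriveV => //; exact: is_derive_id|rewrite [LHS]mulr1].
  have dP : is_derive t 1 (fun s : R => P.[s^-1]) (P^`().[t^-1] * (- t ^- 2)).
    exact: (@is_derive1_comp R (horner P) (fun s => s^-1)).
  have dN : is_derive t 1 (fun s : R => - s^-1) (t ^- 2).
    by rewrite -[t ^- 2]opprK; exact: is_deriveN.
  have dE : is_derive t 1 (fun s : R => expR (- s^-1)) (expR (- t^-1) * t ^- 2).
    exact: (@is_derive1_comp R expR (fun s => - s^-1)).
  apply: is_derive_eq.
  rewrite /flat t0 hornerM hornerXn hornerD hornerN.
  move: (P.[_]) (P^`().[_]) (expR _) => A B E; rewrite /GRing.scale /=; field; exact: tn.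
- apply: (@near_eq_is_derive _ _ _ (fun _ : R => 0 : R)).
    near=> s; rewrite /flat; have -> // : (0 < s) = false.
    apply/negbTE; rewrite -leNgt ltW//.
    by near: s; exact: lt_nbhsl.
  by rewrite /flat ltNge (ltW t0) /=; exact: is_derive_cst.
(* At the origin the quadratic bound makes the difference quotient at most C |h|. *)
- subst t; rewrite {2}/flat ltxx.
  have [C C0 HC] := flat_sq_bound P.
  suff L : h^-1 *: ((flat P \o shift 0) (h *: 1) - flat P 0) @[h --> (0:R)^'] --> (0 : R).
    by apply: DeriveDef; [exact: cvgP L|exact: (@cvg_lim R^o)].
  apply/(@cvgr0Pnorm_le _ R^o) => e e0; near=> h.
  rewrite /= addr0 [h%:A]mulr1 {2}/flat ltxx subr0.
  have hn0 : h != 0 by near: h; exact: nbhs_dnbhs_neq.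
  rewrite normrM normfV mulrC ler_pdivrMr ?normr_gt0//.
  apply: le_trans (HC h) _; rewrite -real_normK ?num_real// expr2 mulrA ler_wpM2r//.
  apply: (@le_trans _ _ ((C + 1) * `|h|)); first by rewrite ler_wpM2r// lerDl.
  rewrite mulrC -ler_pdivlMr ?ltr_wpDl//; apply: ltW.
  by near: h; apply: dnbhs0_lt; rewrite divr_gt0// ltr_wpDl.
Unshelve. all: by end_near. Qed.

Lemma continuous_flat P : continuous (flat P).
Proof.
move=> t; apply: differentiable_continuous; apply/derivable1_diffP.
by case: (is_derive_flat P t).
Qed.

Lemma Ck_flat k P (c d : R) (i : bool) :
  Ck k (fun x : R * R => flat P (c * (if i then x.1 else x.2) + d)).
Proof.
elim: k P => [|k IH] P; have C0 : continuous (fun x : R * R => flat P (c * (if i then x.1 else x.2) + d)).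
- move=> x; apply: (@continuous_comp _ _ _ (fun x : R * R => c * (if i then x.1 else x.2) + d) (flat P)); last exact: continuous_flat.
  apply: cvgD; last exact: cvg_cst.
  by apply: cvgMr; case: (i); [exact: cvg_fst|exact: cvg_snd].
- by [].
- move=> x; apply: (@continuous_comp _ _ _ (fun x : R * R => c * (if i then x.1 else x.2) + d) (flat P)); last exact: continuous_flat.
  apply: cvgD; last exact: cvg_cst.
  by apply: cvgMr; case: (i); [exact: cvg_fst|exact: cvg_snd].
split => // v vi.
pose k1 : R := c * (if i then v.1 else v.2).
have D x : is_derive x v (fun x : R * R => flat P (c * (if i then x.1 else x.2) + d))
    (k1 * flat ('X^2 * (P - P^`())) (c * (if i then x.1 else x.2) + d)).
  have -> : x = x + 0 *: v by rewrite scale0r addr0.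
  apply/is_derive_line.
  have -> : (fun h : R => flat P (c * (if i then (x + h *: v).1 else (x + h *: v).2) + d)) =
     flat P \o (fun h : R => (k1 * h) + (c * (if i then x.1 else x.2) + d)).
    apply/funext => h /=; congr flat; rewrite /k1 /GRing.scale /=.
    by case: i {IH C0 k1} => /=; rewrite /GRing.scale /=; ring.
  apply: is_derive_eq.
    apply: is_derive1_comp; first exact: is_derive_flat.
  rewrite mulr0 add0r addr0 [k1%:A]mulr1 scale0r addr0; exact: mulrC.
split => [x|]; first by case: (D x).
rewrite (_ : 'D_v _ = (fun x : R * R =>
  k1 * flat ('X^2 * (P - P^`())) (c * (if i then x.1 else x.2) + d))).
  by apply: CkM; [exact: Ck_cst|exact: IH].
by apply/funext => x; apply: derive_val.
Qed.

End ExpBump.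

Section TestFunctions.
Context {R : realType}.
Implicit Types (f g phi : R * R -> R) (a v x w : R * R) (U : set (R * R)).

Lemma closure_minimal (T : topologicalType) (A B : set T) :
  A `<=` B -> closed B -> closure A `<=` B.
Proof. by move=> /closureS + cB; rewrite -(closure_id B).1. Qed.

Lemma closed_crect (r : (R * R) * (R * R)) : closed (crect r).
Proof.
have -> : crect r = (fst @^-1` `[r.1.1, r.2.1]) `&` (snd @^-1` `[r.1.2, r.2.2]).
  by apply/seteqP; split => x [].
apply: closedI; apply: closed_comp; try exact: itv_closed.
- by move=> x _; exact: cvg_fst.
- by move=> x _; exact: cvg_snd.
Qed.

Lemma compact_crect (r : (R * R) * (R * R)) : compact (crect r).
Proof. by apply: compact_setX; exact: segment_compact. Qed.

Lemma test_function_support U phi x : test_function U phi -> ~ U x -> phi x = 0.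
Proof.
move=> [_ _ sU] nU; apply/eqP; apply: contra_notT nU => px; apply: sU.
exact: subset_closure.
Qed.

Lemma test_function_Ck U phi k : test_function U phi -> Ck k phi.
Proof. by case. Qed.

Lemma test_functionS U U' phi : U `<=` U' -> test_function U phi -> test_function U' phi.
Proof. by move=> UU [h1 h2 h3]; split => //; exact: subset_trans UU. Qed.

Lemma Ck_is_derive phi v x : Ck 1 phi -> v \in [:: e1 R; e2 R] ->
  is_derive x v phi ('D_v phi x).
Proof. by move=> [_ d] vi; apply/derivableP; exact: (d v vi).1. Qed.

Lemma Ck_continuous k phi : Ck k phi -> continuous phi.
Proof. by case: k => [|k] []. Qed.

Lemma e1_mem : e1 R \in [:: e1 R; e2 R]. Proof. by rewrite !inE eqxx. Qed.
Lemma e2_mem : e2 R \in [:: e1 R; e2 R]. Proof. by rewrite !inE eqxx orbT. Qed.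

Lemma Ck_derive k phi v : Ck k.+1 phi -> v \in [:: e1 R; e2 R] -> Ck k ('D_v phi).
Proof. by move=> [_ d] vi; exact: (d v vi).2. Qed.

Lemma test_is_derive U phi x w : test_function U phi ->
  is_derive x w phi (w.1 * 'D_(e1 R) phi x + w.2 * 'D_(e2 R) phi x).
Proof.
move=> [Cp _ _]; apply: (is_derive_dir (phi1 := 'D_(e1 R) phi) (phi2 := 'D_(e2 R) phi)).
- by move=> y; apply: Ck_is_derive => //; exact: e1_mem.
- by move=> y; apply: Ck_is_derive => //; exact: e2_mem.
- by apply: (@Ck_continuous 0); apply: Ck_derive; [exact: Cp|exact: e1_mem].
- by apply: (@Ck_continuous 0); apply: Ck_derive; [exact: Cp|exact: e2_mem].
Qed.

Lemma test_deriveE U phi x w : test_function U phi ->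
  'D_w phi x = w.1 * 'D_(e1 R) phi x + w.2 * 'D_(e2 R) phi x.
Proof. by move=> tp; have ? := test_is_derive x w tp; apply: derive_val. Qed.

Lemma closed_supportS phi psi : (forall x, phi x = 0 -> psi x = 0) ->
  closed_support psi `<=` closed_support phi.
Proof. by move=> h; apply: closureS => x /=; apply: contra_neq => /h. Qed.

Lemma test_function_of_Ck U phi psi : test_function U phi -> (forall k, Ck k psi) ->
  (closed_support psi `<=` closed_support phi) -> test_function U psi.
Proof.
move=> [_ c s] Cp sub; split => //; last exact: subset_trans s.
by apply: (subclosed_compact _ c sub); exact: closed_closure.
Qed.

(** Off its closed support phi vanishes in a neighbourhood of each point, hence so does its
    derivative. *)
Lemma test_derive U phi w : test_function U phi -> test_function U ('D_w phi).
Proof.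
move=> tp; apply: (test_function_of_Ck tp).
  move=> k; rewrite (_ : 'D_w phi = fun x => w.1 * 'D_(e1 R) phi x + w.2 * 'D_(e2 R) phi x).
    apply: CkD; apply: CkM; try exact: Ck_cst.
    - by apply: Ck_derive; [exact: test_function_Ck tp|exact: e1_mem].
    - by apply: Ck_derive; [exact: test_function_Ck tp|exact: e2_mem].
  by apply/funext => x; exact: test_deriveE tp.
apply: closure_minimal; last exact: closed_closure.
move=> x /=; apply: contra_neqP => nx.
have : nbhs x (~` closed_support phi).
  by apply: open_nbhs_nbhs; split => //; apply: closed_openC; exact: closed_closure.
move=> nn; rewrite (@near_eq_derive _ _ _ _ (fun=> 0)) ?derive_cst//.
apply: filterS nn => y /= ny; apply/eqP; apply: contra_notT ny => py.
exact: subset_closure.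
Qed.

Lemma Ck_shift k phi w : Ck k phi -> Ck k (fun x => phi (x + w)).
Proof.
have D f v x : 'D_v (fun x => f (x + w)) x = 'D_v f (x + w) /\
     (derivable f (x + w) v -> derivable (fun x => f (x + w)) x v).
  rewrite /derive /derivable.
  rewrite (_ : (fun h : R => h^-1 *: (((fun x => f (x + w)) \o shift x) (h *: v) - _)) =
     (fun h => h^-1 *: ((f \o shift (x + w)) (h *: v) - f (x + w)))) //.
  by apply/funext => h /=; rewrite addrA.
have C f : continuous f -> continuous (fun x => f (x + w)).
  move=> cf x; apply: (@continuous_comp _ _ _ (fun x => x + w) f); last exact: cf.
  by apply: cvgD; [exact: cvg_id|exact: cvg_cst].
elim: k phi => [phi [cp _]|k IH phi [cp dp]]; split => //; try exact: C.
move=> v vi; have [d1 d2] := dp v vi; split.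
  by move=> x; apply: (D phi v x).2.
rewrite (_ : 'D_v _ = fun x => 'D_v phi (x + w)); first exact: (IH ('D_v phi) d2).
by apply/funext => x; rewrite (D phi v x).1.
Qed.

Lemma derive_shiftE phi w v x : 'D_v (fun x => phi (x + w)) x = 'D_v phi (x + w).
Proof.
rewrite /derive (_ : (fun h : R => h^-1 *: (((fun x => phi (x + w)) \o shift x) (h *: v) - _)) =
     (fun h => h^-1 *: ((phi \o shift (x + w)) (h *: v) - phi (x + w)))) //.
by apply/funext => h /=; rewrite addrA.
Qed.

Lemma test_shift U U' phi w : test_function U phi ->
  (forall x, U x -> U' (x - w)) -> test_function U' (fun x => phi (x + w)).
Proof.
move=> [C c s] UU.
have cw (z : R * R) : continuous (fun x : R * R => x + z).
  by move=> x; apply: cvgD; [exact: cvg_id|exact: cvg_cst].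
have sub : closed_support (fun x => phi (x + w)) `<=` (fun x => x - w) @` closed_support phi.
  have -> : (fun x => x - w) @` closed_support phi = (fun x => x + w) @^-1` closed_support phi.
    apply/seteqP; split => [x [y sy <-] /=|x /= sx]; first by rewrite subrK.
    by exists (x + w) => //; rewrite addrK.
  apply: closure_minimal; first by move=> x /= px; exact: subset_closure.
  by apply: closed_comp; [move=> x _; exact: cw|exact: closed_closure].
split => [k||].
- exact: Ck_shift.
- apply: (subclosed_compact _ _ sub); first exact: closed_closure.
  by apply: continuous_compact => //; apply: continuous_subspaceT; exact: cw.
- by move=> x /sub[y sy <-]; apply: UU; exact: s.
Qed.

Lemma test_bounded U phi : test_function U phi -> exists2 M : R, 0 < M & forall x, `|phi x| <= M.
Proof.
move=> tp; have [C c s] := tp.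
have : compact (phi @` closed_support phi).
  by apply: continuous_compact => //; apply: continuous_subspaceT; exact: Ck_continuous (C 0).
move/compact_bounded => [M [Mr HM]].
exists (`|M| + 1); first by rewrite ltr_wpDl.
move=> x; have [sx|nsx] := pselect (closed_support phi x).
  by apply: HM; [rewrite ltr_pwDr// ler_norm|exists x].
rewrite (_ : phi x = 0) ?normr0 ?addr_ge0//.
by apply/eqP; apply: contra_notT nsx => px; exact: subset_closure.
Qed.

End TestFunctions.

(** * The fundamental lemma of the calculus of variations *)

Section FundamentalLemma.
Context {R : realType}.
Notation mu := (@lebesgue_measure R).
Notation mu2 := (@lebesgue2 R).
Notation plane := (measurableTypeR R * measurableTypeR R)%type.

(** Each factor is exp (-1 / ((n + 1) d)) with d the distance to one side, and tends to 1 where d >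
    0. The functions thus tend to the indicator of the open rectangle while staying in [0, 1]. *)
Definition bump (r : (R * R) * (R * R)) (n : nat) (x : R * R) : R :=
  flat 1 (n.+1%:R * x.1 - n.+1%:R * r.1.1) * flat 1 (- n.+1%:R * x.1 + n.+1%:R * r.2.1) *
  (flat 1 (n.+1%:R * x.2 - n.+1%:R * r.1.2) * flat 1 (- n.+1%:R * x.2 + n.+1%:R * r.2.2)).

Lemma Ck_bump r n k : Ck k (bump r n).
Proof.
by apply: CkM; apply: CkM;
  [exact: (@Ck_flat _ _ _ _ _ true)|exact: (@Ck_flat _ _ _ _ _ true)|
   exact: (@Ck_flat _ _ _ _ _ false)|exact: (@Ck_flat _ _ _ _ _ false)].
Qed.

Lemma flat1_itv (t : R) : 0 <= flat 1 t <= 1.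
Proof.
rewrite /flat; case: ltP => [t0|_]; last by rewrite lexx ler01.
rewrite hornerE mul1r (ltW (expR_gt0 _)) /= -expR0 ler_expR oppr_le0 invr_ge0.
exact: ltW.
Qed.

Lemma flat1_eq0 (t : R) : t <= 0 -> flat 1 t = 0.
Proof. by rewrite /flat leNgt; case: ltP. Qed.

Lemma bump_itv r n x : 0 <= bump r n x <= 1.
Proof.
have mul01 (a b : R) : 0 <= a <= 1 -> 0 <= b <= 1 -> 0 <= a * b <= 1.
  move=> /andP[a0 a1] /andP[b0 b1]; rewrite mulr_ge0//=.
  by rewrite -[leRHS]mulr1 ler_pM.
by apply: (mul01); apply: (mul01); exact: flat1_itv.
Qed.

Lemma bump_eq0 r n x : ~ orect r x -> bump r n x = 0.
Proof.
move=> nx; have n0 : 0 < n.+1%:R :> R by rewrite ltr0n.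
rewrite /bump -!mulrBr !mulNr ![- (_ * _) + _]addrC -!mulrBr.
have [a|a] := leP x.1 r.1.1.
  by rewrite (@flat1_eq0 (_ * (x.1 - _))) ?mul0r// pmulr_rle0// subr_le0.
have [b|b] := leP r.2.1 x.1.
  by rewrite (@flat1_eq0 (_ * (_ - x.1))) ?mulr0 ?mul0r// pmulr_rle0// subr_le0.
have [c|c] := leP x.2 r.1.2.
  by rewrite (@flat1_eq0 (_ * (x.2 - _))) ?mul0r ?mulr0// pmulr_rle0// subr_le0.
have [d|d] := leP r.2.2 x.2.
  by rewrite (@flat1_eq0 (_ * (_ - x.2))) ?mulr0// pmulr_rle0// subr_le0.
by case: nx; split; rewrite /= in_itv /= ?a ?b ?c ?d.
Qed.

Lemma flat1_cvg (s : R) : 0 < s -> flat 1 (n.+1%:R * s) @[n --> \oo] --> (1 : R).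
Proof.
move=> s0.
rewrite (_ : (fun n => _) = (fun n => expR (- (harmonic n * s^-1)))).
  rewrite -[X in _ --> X](@expR0 R).
  apply: continuous_cvg; first exact: continuous_expR.
  rewrite -[X in _ --> X]oppr0; apply: cvgN.
  rewrite -[X in _ --> X](mul0r s^-1); apply: cvgMl; exact: cvg_harmonic.
apply/funext => n; rewrite /flat mulr_gt0 ?ltr0n// hornerE mul1r.
by rewrite /harmonic invfM.
Qed.

Lemma bump_cvg r x : orect r x -> bump r n x @[n --> \oo] --> (1 : R).
Proof.
move=> [/=]; rewrite !in_itv /= => /andP[a b] /andP[c d].
rewrite (_ : (fun n => _) = (fun n =>
   (flat 1 (n.+1%:R * (x.1 - r.1.1)) * flat 1 (n.+1%:R * (r.2.1 - x.1))) *
   (flat 1 (n.+1%:R * (x.2 - r.1.2)) * flat 1 (n.+1%:R * (r.2.2 - x.2))))); last first.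
  by apply/funext => n; rewrite /bump -!mulrBr !mulNr ![- (_ * _) + _]addrC -!mulrBr.
have a' : 0 < x.1 - r.1.1 by rewrite subr_gt0.
have b' : 0 < r.2.1 - x.1 by rewrite subr_gt0.
have c' : 0 < x.2 - r.1.2 by rewrite subr_gt0.
have d' : 0 < r.2.2 - x.2 by rewrite subr_gt0.
have := cvgM (cvgM (flat1_cvg a') (flat1_cvg b')) (cvgM (flat1_cvg c') (flat1_cvg d')).
by rewrite !mulr1; exact.
Qed.

Lemma test_bump r n U : crect r `<=` U -> test_function U (bump r n).
Proof.
move=> rU; have sub : closed_support (bump r n) `<=` crect r.
  apply: closure_minimal; last exact: closed_crect.
  move=> x /=; apply: contra_neqP => nx; apply: bump_eq0 => -[/=].
  rewrite !in_itv /= => /andP[a b] /andP[c d]; apply: nx.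
  by split; rewrite /= in_itv /= !ltW.
split => [k||]; first exact: Ck_bump.
- by apply: (subclosed_compact _ _ sub); [exact: closed_closure|exact: compact_crect].
- exact: subset_trans rU.
Qed.

Local Open Scope ereal_scope.

(** Dominated convergence along [bump r n], whose members are test functions on U because the closed
    rectangle lies in U. *)
Lemma fundamental_lemma_orect (U : set (R * R)) (h : R * R -> R) (r : (R * R) * (R * R)) :
  mu2.-integrable setT (EFin \o h) ->
  (forall phi, test_function U phi -> (\int[mu2]_x (h x * phi x))%R = 0%R) ->
  crect r `<=` U -> \int[mu2]_(x in orect r) (h x)%:E = 0.
Proof.
move=> ih hU rU.
have mh : measurable_fun [set: plane] h by have /integrableP[/measurable_EFinP] := ih.
have mb n : measurable_fun [set: plane] (bump r n).
  by apply: continuous_measurable_plane; exact: Ck_continuous (Ck_bump r n 0).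
have mr := measurable_orect r.
have mrh : measurable_fun [set: plane] (fun x => (h x * \1_(orect r) x)%R).
  by apply: measurable_funM => //; exact: measurable_indic.
have [] := @dominated_convergence _ plane R mu2 setT measurableT
   (fun n x => (h x * bump r n x)%:E) (fun x => (h x * \1_(orect r) x)%:E)
   (abse \o (EFin \o h)).
- by move=> n; apply/measurable_EFinP; exact: measurable_funM.
- by apply/measurable_EFinP.
- apply: aeW => x _; apply: cvg_EFin; first exact: nearW.
  have [xr|xr] := pselect (orect r x).
    rewrite indicE mem_set//=; apply: cvgMr; exact: bump_cvg.
  rewrite (_ : (fun n => _) = fun=> 0%R); last by apply/funext => n /=; rewrite bump_eq0// mulr0.
  by rewrite indicE memNset//= mulr0; exact: cvg_cst.
- exact: integrable_abse.
- apply: aeW => x n _ /=; rewrite lee_fin normrM -[leRHS]mulr1 ler_wpM2l//.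
  by have /andP[b0 b1] := bump_itv r n x; rewrite ger0_norm.
move=> ihr _ L.
have Z n : \int[mu2]_x (h x * bump r n x)%:E = 0.
  have := hU _ (test_bump n rU); rewrite /Rintegral => /eqP.
  rewrite fine_eq0; first by move/eqP.
  apply: integrable_fin_num => //; apply: (le_integrable measurableT _ _ (integrable_abse ih)).
    by apply/measurable_EFinP; exact: measurable_funM.
  move=> x _ /=; rewrite lee_fin normr_id normrM -[leRHS]mulr1 ler_wpM2l//.
  by have /andP[b0 b1] := bump_itv r n x; rewrite ger0_norm.
have E : \int[mu2]_(x in orect r) (h x)%:E = \int[mu2]_x (h x * \1_(orect r) x)%:E.
  rewrite integral_mkcond; apply: eq_integral => x _.
  rewrite /= patchE indicE; case: ifPn => _; first by rewrite mulr1.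
  by rewrite mulr0.
rewrite E; move: L; under eq_fun do rewrite Z.
by move/(cvg_lim (@ereal_hausdorff R)) => <-; apply: lim_cst; exact: ereal_hausdorff.
Qed.

(** Vanishing integrals over open subrectangles extend to all measurable subsets of a rectangle,
    which forces h to be zero almost everywhere there; countably many rectangles exhaust U. *)
Lemma fundamental_lemma (U : set (R * R)) (h : R * R -> R) : open U ->
  mu2.-integrable setT (EFin \o h) ->
  (forall phi, test_function U phi -> (\int[mu2]_x (h x * phi x))%R = 0%R) ->
  {ae mu2, forall x, U x -> h x = 0%R}.
Proof.
move=> oU ih hU.
have mh : measurable_fun [set: plane] h by have /integrableP[/measurable_EFinP] := ih.
have loc r : crect r `<=` U -> {ae mu2, forall x, orect r x -> h x = 0%R}.
  move=> rU; have mr := measurable_orect r.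
  have ihr : mu2.-integrable (orect r) (EFin \o h) by exact: integrableS ih.
  have Z r' : crect r' `<=` crect r -> \int[mu2]_(x in orect r') (h x)%:E = 0.
    by move=> rr; apply: (fundamental_lemma_orect ih hU); exact: subset_trans rU.
  have GI : setI_closed (RGenOpens.G (R := R)).
    move=> _ _ [a [b ->]] [c [d ->]]; exists (Num.max a c), (Num.min b d).
    apply/seteqP; split => x /=; rewrite !in_itv /= gt_max lt_min.
      by move=> [/andP[-> ->] /andP[-> ->]].
    by move=> /andP[/andP[-> ->] /andP[-> ->]].
  (* The first coordinate may now range over any measurable set; [H2] does the same for the second
     one, and [H3] passes from product sets to the whole sigma-algebra. *)
  have H1 c d A : measurable A ->
      \int[mu2]_(x in (orect r `&` snd @^-1` `]c, d[%classic) `&` fst @^-1` A) (h x)%:E = 0.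
    have Ecd : orect r `&` snd @^-1` `]c, d[%classic =
        orect ((r.1.1, Num.max r.1.2 c), (r.2.1, Num.min r.2.2 d)).
      apply/seteqP; split => x; rewrite /orect /= !in_itv /= gt_max lt_min.
        by move=> [[/= -> /andP[-> ->]] /andP[-> ->]].
      by move=> [/= -> /andP[/andP[-> ->] /andP[-> ->]]].
    have Zcd a b : \int[mu2]_(x in (orect r `&` snd @^-1` `]c, d[%classic) `&`
        fst @^-1` `]a, b[%classic) (h x)%:E = 0.
      rewrite (_ : _ `&` _ = orect ((Num.max r.1.1 a, Num.max r.1.2 c),
          (Num.min r.2.1 b, Num.min r.2.2 d))); last first.
        apply/seteqP; split => x; rewrite /orect /= !in_itv /= !gt_max !lt_min.
          by move=> [[[/= /andP[-> ->] /andP[-> ->]] /andP[-> ->]] /andP[-> ->]].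
        by move=> [/= /andP[/andP[-> ->] /andP[-> ->]] /andP[/andP[-> ->] /andP[-> ->]]].
      apply: Z => x; rewrite /crect /= !in_itv /= !ge_max !le_min.
      by move=> [/= /andP[/andP[-> _] /andP[-> _]] /andP[/andP[-> _] /andP[-> _]]].
    apply: (integral_preimage_eq0 (G := RGenOpens.G (R := R))).
    - by rewrite Ecd; exact: measurable_orect.
    - apply: (integrableS mr _ _ ihr); last exact: subIsetl.
      by rewrite Ecd; exact: measurable_orect.
    - exact: measurable_fst.
    - exact: RGenOpens.measurableE.
    - exact: GI.
    - rewrite Ecd; apply: Z => x; rewrite /crect /= !in_itv /= !ge_max !le_min.
      by move=> [/= -> /andP[/andP[-> _] /andP[-> _]]].
    - by move=> _ [a [b ->]]; exact: Zcd.
  have H2 A B : measurable A -> measurable B ->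
      \int[mu2]_(x in orect r `&` id @^-1` (A `*` B)) (h x)%:E = 0.
    move=> mA mB.
    rewrite (_ : _ `&` _ = (orect r `&` fst @^-1` A) `&` snd @^-1` B); last first.
      by apply/seteqP; split => x /=; rewrite /setX /=; tauto.
    have mrA : measurable (orect r `&` fst @^-1` A : set plane).
      apply: measurableI => //; rewrite -[_ @^-1` _]setTI; exact: measurable_fst.
    apply: (integral_preimage_eq0 (G := RGenOpens.G (R := R))) => //.
    - by apply: (integrableS mr _ _ ihr) => //; exact: subIsetl.
    - exact: RGenOpens.measurableE.
    - rewrite (_ : _ `&` _ = (orect r `&` snd @^-1` `]r.1.2, r.2.2[%classic) `&` fst @^-1` A).
        exact: H1.
      by congr (_ `&` _); apply/seteqP; split => x; [move=> [? ?]|move=> []].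
    - move=> _ [c [d ->]]; rewrite setIAC; exact: H1.
  have H3 E : measurable E -> \int[mu2]_(x in orect r `&` id @^-1` E) (h x)%:E = 0.
    apply: (integral_preimage_eq0 (G := [set A `*` B | A in measurable & B in measurable])) => //.
    - exact: measurable_prod_measurableType.
    - move=> _ _ [A mA [B mB <-]] [A' mA' [B' mB' <-]].
      exists (A `&` A'); first exact: measurableI.
      by exists (B `&` B'); [exact: measurableI|rewrite setXI].
    - exact: Z.
    - by move=> _ [A mA [B mB <-]]; exact: H2.
  have := @integral_ae_eq _ plane R mu2 (orect r) mr (cst 0) (EFin \o h) ihr.
  case=> [|E Er mE|N].
  - exact: measurable_cst.
  - rewrite integral0; have := H3 E mE; rewrite preimage_id.
    by rewrite (setIidr Er).
  - move=> [mN N0 sN]; exists N; split => //; apply: subset_trans sN => x /= nx.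
    by apply: contra_not nx => k rx; move: (k rx) => -[].
have [F [FU UE]] := open_bigcup_orect oU.
have : mu2.-negligible (\bigcup_k [set x | ~ (orect (F k) x -> h x = 0%R)]).
  by apply: negligible_bigcup => k; exact: loc.
apply: negligibleS => x /=; move/not_implyP => [Ux hx].
by move: Ux; rewrite {1}UE => -[k _ kx]; exists k => //= H; apply: hx; exact: H.
Qed.

End FundamentalLemma.

Ltac vec := by apply/pair_equal_spec; split; rewrite /= /GRing.scale /=; ring.

(** * Weak derivatives along lines *)

Section RealIntegrals.
Local Open Scope ereal_scope.

(** The inner integrals are finite only almost everywhere, and taking [fine] changes them on a null
    set. H is extended by zero outside A; the uniform bound M together with the finite measure of A
    makes the extension integrable on the product. *)
Lemma Rfubini d (T : measurableType d) (R : realType)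
    (m : {sigma_finite_measure set T -> \bar R}) (H : T * measurableTypeR R -> R)
    (A : set R) (M : R) :
  measurable_fun setT H -> measurable (A : set (measurableTypeR R)) ->
  (@lebesgue_measure R A < +oo) ->
  (forall r, A r -> \int[m]_x `|H (x, r)|%:E <= M%:E) ->
  [/\ m.-integrable setT (fun x => (\int[@lebesgue_measure R]_(r in A) H (x, r))%R%:E),
   {ae m, forall x, (@lebesgue_measure R).-integrable A (fun r => (H (x, r))%:E)} &
   (\int[m]_x \int[@lebesgue_measure R]_(r in A) H (x, r) =
    \int[@lebesgue_measure R]_(r in A) \int[m]_x H (x, r))%R].
Proof.
move=> mH mA finA HM.
pose mu := @lebesgue_measure R.
pose H' (z : T * measurableTypeR R) := (H z * \1_A z.2)%:E.
have mH' : measurable_fun setT H'.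
  apply/measurable_EFinP; apply: measurable_funM => //.
  by apply: measurableT_comp => //; exact: measurable_indic.
have M0 : A !=set0 -> (0 <= M)%R.
  move=> [r Ar]; rewrite -lee_fin; apply: le_trans (HM r Ar); exact: integral_ge0.
have iH' : (m \x mu).-integrable setT H'.
  apply/(integrable21ltyP m mu mH').
  have -> : \int[mu]_y \int[m]_x `|H' (x, y)| = \int[mu]_(y in A) \int[m]_x `|H (x, y)|%:E.
    rewrite [RHS]integral_mkcond; apply: eq_integral => y _.
    rewrite patchE /H' /= indicE; case: ifPn => yA.
      by apply: eq_integral => x _; rewrite mulr1.
    by rewrite integral0_eq// => x _; rewrite mulr0 normr0.
  apply: (@le_lt_trans _ _ (\int[mu]_(y in A) (`|M|)%:E)).
    apply: ge0_le_integral => //.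
    - by move=> y _; exact: integral_ge0.
    - apply: measurable_funTS.
      apply: (measurable_fun_fubini_tonelli_G (m1 := m) (fun z => (`|H z|%R)%:E)) => //.
      by apply/measurable_EFinP; exact: measurableT_comp.
    - by move=> y Ay; apply: le_trans (HM y Ay) _; rewrite lee_fin ler_norm.
  by rewrite integral_cst// lte_mul_pinfty.
have FE x : fubini_F mu H' x = \int[mu]_(r in A) (H (x, r))%:E.
  rewrite [RHS]integral_mkcond; apply: eq_integral => r _.
  by rewrite patchE /H' /= indicE; case: ifPn => _; rewrite ?mulr1 ?mulr0.
have iF := integrable_fubini_F iH'.
have mfine f : measurable_fun setT f -> measurable_fun setT (fun x : T => (fine (f x) : R)).
  by move=> mf; apply: measurableT_comp.
have fle (y : \bar R) : `|(fine y)%:E| <= `|y| by case: y => //=; rewrite normr0 leey.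
have aeF : ae_eq m setT (fun x => (fine (fubini_F mu H' x))%:E) (fubini_F mu H').
  have := integrable_ae measurableT iF; apply: filterS => x /= /(_ I) xf _.
  by rewrite fineK.
have iFf : m.-integrable setT (fun x => (fine (fubini_F mu H' x))%:E).
  apply: (le_integrable measurableT _ _ iF).
    by apply/measurable_EFinP; apply: mfine; exact: measurable_int iF.
  by move=> x _; exact: fle.
split.
- by rewrite (_ : (fun x => _) = (fun x => (fine (fubini_F mu H' x))%:E))//;
    apply/funext => x; rewrite FE.
- have := ae_integrable1 iH'; apply: filterS => x ix.
  have : mu.-integrable setT ((fun r => (H (x, r))%:E) \_ A).
    apply: eq_integrable ix => // r _.
    by rewrite patchE /H' /= indicE; case: ifPn => _; rewrite ?mulr1 ?mulr0.
  by move/(integrable_mkcond _ mA).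
- rewrite /Rintegral; congr fine.
  transitivity (\int[m]_x fubini_F mu H' x).
    transitivity (\int[m]_x (fine (fubini_F mu H' x))%:E).
      by apply: eq_integral => x _; rewrite FE.
    apply: ae_eq_integral => //.
    + exact: measurable_int iFf.
    + exact: measurable_int iF.
  rewrite integral12_prod_meas1// -integral21_prod_meas1//.
  have mG := measurable_fubini_G iH'.
  have aeG : ae_eq mu setT (fun y => (fine (fubini_G m H' y))%:E) (fubini_G m H').
    have := ae_integrable2 iH'; apply: filterS => x ix _.
    by rewrite fineK//; exact: integrable_fin_num.
  rewrite [RHS]integral_mkcond.
  rewrite (_ : _ \_ A = fun y => (fine (fubini_G m H' y))%:E); last first.
    apply/funext => y; rewrite patchE /Rintegral; case: ifPn => yA.
      congr (fine _)%:E; apply: eq_integral => x _.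
      by rewrite /H' /= indicE yA mulr1.
    rewrite /fubini_G integral0_eq// => x _.
    by rewrite /H' /= indicE (negbTE yA) mulr0.
  apply/esym; apply: ae_eq_integral => //.
  by apply/measurable_EFinP; apply: measurableT_comp.
Qed.

Lemma measurable_shift (R : realType) (z : R * R) :
  measurable_fun [set: measurableTypeR R * measurableTypeR R]
    (fun x => x + z : measurableTypeR R * measurableTypeR R)%R.
Proof. by apply: measurable_fun_pair; meas. Qed.

Lemma integral_shift (R : realType) (z : R * R) (F : R * R -> \bar R) :
  measurable_fun [set: measurableTypeR R * measurableTypeR R] F ->
  \int[@lebesgue2 R]_x F (x + z)%R = \int[@lebesgue2 R]_x F x.
Proof.
move=> mF.
have pq : cross (e1 R) (e2 R) = 1%R by rewrite /cross /= mulr1 mulr0 subr0.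
have S G : measurable_fun [set: measurableTypeR R * measurableTypeR R] G ->
   (forall x, 0 <= G x) -> \int[@lebesgue2 R]_x G (x + z)%R = \int[@lebesgue2 R]_x G x.
  move=> mG G0; rewrite [RHS](@ge0_integral_plane _ z (e1 R) (e2 R))// ?pq ?oner_eq0//.
  rewrite normr1 mul1e; apply: eq_integral => x _; congr G.
  vec.
rewrite integralE [RHS]integralE; congr (_ - _).
- rewrite -(S F^\+ (measurable_funepos mF) (funepos_ge0 F)).
  by apply: eq_integral => x _; rewrite !funeposE.
- rewrite -(S F^\- (measurable_funeneg mF) (funeneg_ge0 F)).
  by apply: eq_integral => x _; rewrite !funenegE.
Qed.

Lemma integrable_shift (R : realType) (z : R * R) (f : R * R -> R) :
  (@lebesgue2 R).-integrable setT (EFin \o f) ->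
  (@lebesgue2 R).-integrable setT (EFin \o (fun x => f (x + z)%R)).
Proof.
move=> /integrableP[mf ff]; apply/integrableP; split.
  apply: (measurableT_comp mf).
  have := measurable_plane z (e1 R) (e2 R).
  apply: eq_measurable_fun => x _.
  vec.
by rewrite (integral_shift z (F := fun x => `|(f x)%:E|))//; exact: measurableT_comp.
Qed.

Lemma continuous_integral_derive (R : realType) (F f : R -> R) (a b : R) : (a <= b)%R ->
  (forall t : R, is_derive t 1%R F (f t)) -> continuous f ->
  (\int[@lebesgue_measure R]_(t in `[a, b]) f t = F b - F a)%R.
Proof.
move=> ab dF cf.
have cF : continuous F.
  by move=> t; apply: differentiable_continuous; apply/derivable1_diffP; case: (dF t).
move: ab; rewrite le_eqVlt => /predU1P[<-|ab].
  by rewrite subrr /Rintegral set_itv1 integral_set1.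
rewrite /Rintegral (@continuous_FTC2 _ f F)//.
- exact: continuous_subspaceT.
- split.
  + by move=> x _; case: (dF x).
  + by apply: cvg_at_right_filter; exact: cF.
  + by apply: cvg_at_left_filter; exact: cF.
- by move=> x _; rewrite derive1E; apply: derive_val.
Qed.

(** Hoelder's inequality against the indicator of A, whose dual norm is at most 1 because A has
    measure at most 1. *)
Lemma integral_powR_le d (T : measurableType d) (R : realType)
    (m : {measure set T -> \bar R}) (A : set T) (g : T -> R) (p : R) :
  (1 <= p)%R -> measurable A -> m A <= 1 -> measurable_fun setT g ->
  (\int[m]_(x in A) `|g x|%:E) `^ p <= \int[m]_(x in A) (`|g x| `^ p)%:E.
Proof.
move=> p1 mA A1 mg; have p0 : (0 < p)%R by exact: lt_le_trans p1.
have le_of_eq (x y : \bar R) : x = y -> x <= y by move=> ->.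
have [->|pn1] := eqVneq p 1%R.
  rewrite poweRe1; last by exact: integral_ge0.
  by apply: (le_of_eq); apply: eq_integral => x _; rewrite powRr1.
pose q := (p / (p - 1))%R.
have p1' : (0 < p - 1)%R by rewrite subr_gt0 lt_neqAle eq_sym pn1.
have q0 : (0 < q)%R by rewrite divr_gt0.
have pq : (p^-1 + q^-1 = 1)%R.
  by rewrite /q; field; rewrite !gt_eqF.
pose f x := (g x * \1_A x)%R.
have mf : measurable_fun setT f.
  by apply: measurable_funM => //; exact: measurable_indic.
have m1 : measurable_fun setT (\1_A : T -> R) by exact: measurable_indic.
have := @hoelder _ T R m f (\1_A) p q mf m1 p0 q0 pq.
have -> : 'N[m]_1[EFin \o (f \* (\1_A : T -> R))%R] = \int[m]_(x in A) `|g x|%:E.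
  rewrite Lnorm1 [RHS]integral_mkcond; apply: eq_integral => x _.
  by rewrite patchE /f /= indicE; case: ifPn => _; rewrite ?mulr1// ?mulr0 ?mul0r normr0.
have N1 : 'N[m]_q%:E[EFin \o (\1_A : T -> R)] <= 1.
  rewrite unlock.
  rewrite (_ : \int[m]_x _ = m A).
    rewrite -[leRHS](@poweR1r _ q^-1); apply: gt0_ler_poweR => //.
    - by rewrite invr_ge0 ltW.
    - by rewrite in_itv /= leey andbT.
    - by rewrite in_itv /= leey andbT lee01.
  rewrite -[RHS]mul1e -integral_cst// [RHS]integral_mkcond; apply: eq_integral => x _.
  rewrite patchE /= indicE; case: ifPn => _; first by rewrite normr1 powR1.
  by rewrite normr0 powR0// gt_eqF.
move=> H; have {}H : \int[m]_(x in A) `|g x|%:E <= 'N[m]_p%:E[EFin \o f].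
  apply: le_trans H _; rewrite -[leRHS]mule1; apply: lee_pmul => //; exact: Lnorm_ge0.
have := gt0_ler_poweR (ltW p0) _ _ H.
rewrite poweR_Lnorm ?gt_eqF// => /(_ _ _)/le_trans; apply.
- by rewrite in_itv /= leey andbT; exact: integral_ge0.
- by rewrite in_itv /= leey andbT; exact: Lnorm_ge0.
rewrite [leRHS]integral_mkcond; apply: (le_of_eq); apply: eq_integral => x _.
rewrite patchE /f /= indicE; case: ifPn => _; first by rewrite mulr1.
by rewrite mulr0 normr0 powR0// gt_eqF.
Qed.

End RealIntegrals.

(* The library proves that products of sigma-finite measures are sigma-finite, but its
   canonical structure is shadowed by the one for products of subprobabilities. *)
Definition product_measure d1 d2 (T1 : measurableType d1) (T2 : measurableType d2)
    (R : realType) (m1 : {sigma_finite_measure set T1 -> \bar R})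
    (m2 : {sigma_finite_measure set T2 -> \bar R}) : set (T1 * T2) -> \bar R :=
  (m1 \x m2)%E.
HB.instance Definition _ d1 d2 (T1 : measurableType d1) (T2 : measurableType d2)
    (R : realType) (m1 : {sigma_finite_measure set T1 -> \bar R})
    (m2 : {sigma_finite_measure set T2 -> \bar R}) :=
  Measure.on (product_measure m1 m2).
HB.instance Definition _ d1 d2 (T1 : measurableType d1) (T2 : measurableType d2)
    (R : realType) (m1 : {sigma_finite_measure set T1 -> \bar R})
    (m2 : {sigma_finite_measure set T2 -> \bar R}) :=
  @Measure_isSigmaFinite.Build _ _ _ (product_measure m1 m2)
    (isSigmaFinite.sigma_finiteT
      (lebesgue_integral_fubini.measure_function_Measure_isSigmaFinite__to__measure_function_isSigmaFinite m1 m2)).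

Definition plane_measure (R : realType) :
    {sigma_finite_measure set (measurableTypeR R * measurableTypeR R)%type -> \bar R} :=
  product_measure (@lebesgue_measure R) (@lebesgue_measure R).

Lemma Rfubini2 (R : realType) (H : (measurableTypeR R * measurableTypeR R) * measurableTypeR R -> R)
    (A : set R) (M : R) :
  measurable_fun setT H -> measurable (A : set (measurableTypeR R)) ->
  (@lebesgue_measure R A < +oo)%E ->
  (forall r, A r -> \int[@lebesgue2 R]_x `|H (x, r)|%:E <= M%:E)%E ->
  [/\ (@lebesgue2 R).-integrable setT (fun x => (\int[@lebesgue_measure R]_(r in A) H (x, r))%:E),
   {ae @lebesgue2 R, forall x, (@lebesgue_measure R).-integrable A (fun r => (H (x, r))%:E)} &
   \int[@lebesgue2 R]_x \int[@lebesgue_measure R]_(r in A) H (x, r) =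
    \int[@lebesgue_measure R]_(r in A) \int[@lebesgue2 R]_x H (x, r)].
Proof. exact: (@Rfubini _ _ R (@plane_measure R) H A M). Qed.

Section IntegrableReal.
Context d (T : measurableType d) (R : realType) (m : {measure set T -> \bar R}) (D : set T).
Hypothesis mD : measurable D.
Implicit Types f g : T -> R.

Lemma integrable_EFinD f g : m.-integrable D (EFin \o f) -> m.-integrable D (EFin \o g) ->
  m.-integrable D (EFin \o (fun x => f x + g x)).
Proof. by move=> fi gi; apply: (integrableD mD fi gi). Qed.

Lemma integrable_EFinB f g : m.-integrable D (EFin \o f) -> m.-integrable D (EFin \o g) ->
  m.-integrable D (EFin \o (fun x => f x - g x)).
Proof. by move=> fi gi; apply: (integrableB mD fi gi). Qed.

Lemma integrable_EFinZ f k : m.-integrable D (EFin \o f) ->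
  m.-integrable D (EFin \o (fun x => k * f x)).
Proof. by move=> fi; apply: (integrableZl mD k fi). Qed.

End IntegrableReal.

Section WeakDerivatives.
Context {R : realType}.
Notation mu := (@lebesgue_measure R).
Notation mu2 := (@lebesgue2 R).
Notation plane := (measurableTypeR R * measurableTypeR R)%type.
Implicit Types (f g phi : R * R -> R) (D U : set (R * R)) (v w : R * R).

Lemma ae2_imp (P Q : R * R -> Prop) : {ae mu2, forall x, P x} ->
  (forall x, P x -> Q x) -> {ae mu2, forall x, Q x}.
Proof. by move=> h PQ; apply: negligibleS h => x /=; apply: contra_not; exact: PQ. Qed.

Lemma ae2_and (P Q : R * R -> Prop) : {ae mu2, forall x, P x} ->
  {ae mu2, forall x, Q x} -> {ae mu2, forall x, P x /\ Q x}.
Proof.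
move=> h k; apply: negligibleS (negligibleU h k) => x /= /not_andP[n|n]; [by left|by right].
Qed.

Lemma ae2_of_all (P : R * R -> Prop) : (forall x, P x) -> {ae mu2, forall x, P x}.
Proof. by move=> h; apply: negligibleS (negligible_set0 mu2) => x /=; apply; exact: h. Qed.

(* Integrable functions on the whole plane, tested against functions supported in D;
   this is the form in which weak derivatives are used once all the functions are
   extended by zero outside D. *)
Definition plane_wd D v f g : Prop :=
  [/\ mu2.-integrable setT (EFin \o f), mu2.-integrable setT (EFin \o g) &
    forall phi, test_function D phi ->
      \int[mu2]_x (f x * 'D_v phi x) = - \int[mu2]_x (g x * phi x)].

Lemma integrable_bounded_mul f (k : R * R -> R) (M : R) : mu2.-integrable setT (EFin \o f) ->
  measurable_fun [set: plane] k -> (forall x, `|k x| <= M) ->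
  mu2.-integrable setT (EFin \o (fun x => f x * k x)).
Proof.
move=> fi mk kM; have /integrableP[/measurable_EFinP mf _] := fi.
apply: (le_integrable measurableT _ _ (integrableZl measurableT M (integrable_abse fi))).
  by apply/measurable_EFinP; exact: measurable_funM.
move=> x _ /=; rewrite lee_fin !normrM normr_id mulrC ler_wpM2r//.
by apply: le_trans (kM x) _; exact: ler_norm.
Qed.

Lemma test_measurable U phi : test_function U phi -> measurable_fun [set: plane] phi.
Proof. by move=> [C _ _]; apply: continuous_measurable_plane; exact: Ck_continuous (C 0%N). Qed.

Lemma integrable_mul_test U phi f : test_function U phi ->
  mu2.-integrable setT (EFin \o f) ->
  mu2.-integrable setT (EFin \o (fun x => f x * phi x)).
Proof.
move=> tp fi; have [M _ HM] := test_bounded tp.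
exact: (integrable_bounded_mul fi (test_measurable tp) HM).
Qed.

Lemma plane_wd_dir D f f1 f2 w : plane_wd D (e1 R) f f1 -> plane_wd D (e2 R) f f2 ->
  plane_wd D w f (fun x => w.1 * f1 x + w.2 * f2 x).
Proof.
move=> [fi f1i h1] [_ f2i h2].
have i12 : mu2.-integrable setT (EFin \o (fun x => w.1 * f1 x + w.2 * f2 x)).
  by apply: integrable_EFinD => //; apply: integrable_EFinZ.
split => // phi tp.
have t1 := test_derive (e1 R) tp; have t2 := test_derive (e2 R) tp.
have iZ k g phi' : test_function D phi' -> mu2.-integrable setT (EFin \o g) ->
    mu2.-integrable setT (EFin \o (fun x => k * (g x * phi' x))).
  by move=> t' gi; exact: (integrableZl measurableT k (integrable_mul_test t' gi)).
transitivity (\int[mu2]_x (w.1 * (f x * 'D_(e1 R) phi x) + w.2 * (f x * 'D_(e2 R) phi x))).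
  by apply: eq_Rintegral => x _; rewrite (test_deriveE x w tp); ring.
rewrite RintegralD//; [|exact: iZ|exact: iZ].
rewrite !RintegralZl//; [|exact: integrable_mul_test t2 fi|exact: integrable_mul_test t1 fi].
rewrite h1// h2//.
transitivity (- \int[mu2]_x (w.1 * (f1 x * phi x) + w.2 * (f2 x * phi x))); last first.
  by congr (- _); apply: eq_Rintegral => x _; ring.
rewrite RintegralD//; [|exact: iZ|exact: iZ].
rewrite !RintegralZl//; [|exact: integrable_mul_test tp f2i|exact: integrable_mul_test tp f1i].
ring.
Qed.

Lemma Rintegral_shift (z : R * R) f : measurable_fun [set: plane] f ->
  \int[mu2]_x f (x + z) = \int[mu2]_x f x.
Proof.
by move=> mf; rewrite /Rintegral (integral_shift z (F := EFin \o f))//; exact/measurable_EFinP.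
Qed.

Lemma continuous_line (k : R * R -> R) (z w : R * R) : continuous k ->
  continuous (fun r : R => k (z - r *: w)).
Proof.
move=> ck r; apply: (@continuous_comp _ _ _ (fun r : R => z - r *: w) k); last exact: ck.
by apply: cvgB; [exact: cvg_cst|apply: cvgZr_tmp; exact: cvg_id].
Qed.

Lemma derive_along U phi w (z : R * R) (t0 t1 : R) : test_function U phi -> t0 <= t1 ->
  \int[mu]_(r in `[t0, t1]) 'D_w phi (z - r *: w) = phi (z - t0 *: w) - phi (z - t1 *: w).
Proof.
move=> tp t01.
apply: etrans (@continuous_integral_derive _ (fun r => - phi (z - r *: w))
    (fun r => 'D_w phi (z - r *: w)) t0 t1 t01 _ _) _; last by rewrite opprK addrC.
- move=> t.
  have E : (fun r : R => - phi (z - r *: w)) = - (fun r : R => phi (z + r *: - w)).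
    by apply/funext => r; rewrite /= -[RHS]/(- phi (z + r *: - w)) scalerN.
  rewrite E -['D_w phi _]opprK; apply: is_deriveN; apply/is_derive_line.
  have := test_is_derive (z + t *: - w) (- w) tp.
  by rewrite (test_deriveE _ w tp) scalerN /= !mulNr -opprD.
- apply: (@continuous_line ('D_w phi)).
  exact: (Ck_continuous (test_function_Ck 0 (test_derive w tp))).
Qed.

Lemma measurable_line_shift (g : R * R -> R) w : measurable_fun [set: plane] g ->
  measurable_fun [set: plane * measurableTypeR R] (fun z => g (z.1 + z.2 *: w)).
Proof.
move=> mg; apply: (measurableT_comp mg).
apply: measurable_fun_pair => /=; rewrite /GRing.scale /=.
  apply: measurable_funD; first exact: (measurableT_comp measurable_fst).
  by apply: measurable_funM.
apply: measurable_funD; first exact: (measurableT_comp measurable_snd).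
by apply: measurable_funM.
Qed.

(** The difference of the two sides is tested against phi supported in U. Translations move from f
    and g onto phi; the translates are test functions on D, so the weak derivative may be used under
    the integral over r, where the derivative of phi along w integrates to a difference of two
    translates. *)
Lemma weak_ftc D U w f g (t0 t1 : R) : plane_wd D w f g -> open U -> t0 <= t1 ->
  (forall x r, U x -> t0 <= r <= t1 -> D (x + r *: w)) ->
  {ae mu2, forall x, U x -> f (x + t1 *: w) - f (x + t0 *: w) =
     \int[mu]_(r in `[t0, t1]) g (x + r *: w)} /\
  {ae mu2, forall x, mu.-integrable `[t0, t1] (fun r => (g (x + r *: w))%:E)}.
Proof.
move=> [fi gi wd] oU t01 UD.
have /integrableP[/measurable_EFinP mf ff] := fi.
have /integrableP[/measurable_EFinP mg gf] := gi.
have mgs := measurable_line_shift w mg.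
have finA : (mu `[t0, t1]%classic < +oo)%E.
  by rewrite lebesgue_measure_itv; case: ifP => // _; rewrite -EFinB ltry.
have mA : measurable (`[t0, t1]%classic : set (measurableTypeR R)) by exact: measurable_itv.
have gfin : (\int[mu2]_x `|g x|%:E)%E \is a fin_num.
  by rewrite ge0_fin_numE//; exact: integral_ge0.
have Nshift (r : R) : (\int[mu2]_x `|g (x + r *: w)|%:E = \int[mu2]_x `|g x|%:E)%E.
  apply: (integral_shift (r *: w) (F := fun x => `|g x|%:E)%E).
  by apply/measurable_EFinP; exact: measurableT_comp.
have [] := @Rfubini2 R (fun z => g (z.1 + z.2 *: w)) `[t0, t1]%classic
  (fine (\int[mu2]_x `|g x|%:E)%E) mgs mA finA.
  by move=> r _; rewrite fineK//= Nshift.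
move=> iG aeG _.
split; last exact: aeG.
pose G x := \int[mu]_(r in `[t0, t1]) g (x + r *: w).
have if1 := integrable_shift (t1 *: w) fi; have if0 := integrable_shift (t0 *: w) fi.
have ih : mu2.-integrable setT (EFin \o (fun x => f (x + t1 *: w) - f (x + t0 *: w) - G x)).
  by do 2 apply: integrable_EFinB => //.
have H : {ae mu2, forall x, U x -> f (x + t1 *: w) - f (x + t0 *: w) - G x = 0}.
  apply: (fundamental_lemma oU ih) => phi tp.
  have [M M0 HM] := test_bounded tp.
  have [M' M'0 HM'] := test_bounded (test_derive w tp).
  have mp := test_measurable tp.
  have tps r : t0 <= r <= t1 -> test_function D (fun x => phi (x - r *: w)).
    move=> rt; apply: (test_shift (U := U)) => // x Ux.
    by rewrite opprK; exact: UD.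
  have shiftE r (k : R * R -> R) : measurable_fun [set: plane] k ->
      \int[mu2]_x (k (x + r *: w) * phi x) = \int[mu2]_x (k x * phi (x - r *: w)).
    move=> mk; rewrite -(Rintegral_shift (r *: w) (f := fun x => k x * phi (x - r *: w))).
      by apply: eq_Rintegral => x _; rewrite addrK.
    apply: measurable_funM => //.
    by apply: (test_measurable (U := setT)); apply: (test_shift (U := U)).
  have iGp := integrable_mul_test tp iG.
  transitivity (\int[mu2]_x (f (x + t1 *: w) * phi x) - \int[mu2]_x (f (x + t0 *: w) * phi x)
      - \int[mu2]_x (G x * phi x)).
    rewrite -RintegralB//; [|exact: integrable_mul_test tp if1|exact: integrable_mul_test tp if0].
    rewrite -RintegralB//; last first.
      by apply: integrable_EFinB => //; [exact: integrable_mul_test tp if1|exact: integrable_mul_test tp if0].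
    by apply: eq_Rintegral => x _; ring.
  rewrite !shiftE//.
  have mgr r : measurable_fun [set: plane] (fun x => g (x + r *: w)).
    exact: (measurableT_comp mg (measurable_shift (r *: w))).
  have GE : \int[mu2]_x (G x * phi x) =
      \int[mu]_(r in `[t0, t1]) \int[mu2]_x (g (x + r *: w) * phi x).
    have mgp : measurable_fun [set: plane * measurableTypeR R]
        (fun z => g (z.1 + z.2 *: w) * phi z.1).
      by apply: measurable_funM => //; exact: (measurableT_comp mp measurable_fst).
    have gpM r : `[t0, t1]%classic r -> (\int[mu2]_x `|g (x + r *: w) * phi x|%:E <=
        (M * fine (\int[mu2]_x `|g x|%:E))%:E)%E.
      have mab := measurableT_comp (@normr_measurable R setT) (mgr r).
      move=> _; rewrite EFinM fineK//= -(Nshift r) -ge0_integralZl//; last 2 first.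
      + exact/measurable_EFinP.
      + exact: ltW.
      have m1 : measurable_fun [set: plane] (fun x => g (x + r *: w) * phi x).
        exact: measurable_funM.
      apply: ge0_le_integral => //=.
      + by apply/measurable_EFinP; exact: (measurableT_comp (@normr_measurable R setT) m1).
      + by apply/measurable_EFinP; apply: measurable_funM.
      + by move=> x _; rewrite -EFinM lee_fin normrM mulrC ler_wpM2r.
    have [_ _ <-] := @Rfubini2 R (fun z => g (z.1 + z.2 *: w) * phi z.1)
      `[t0, t1]%classic (M * fine (\int[mu2]_x `|g x|%:E)%E) mgp mA finA gpM.
    rewrite /Rintegral; congr fine; apply: ae_eq_integral => //.
    + by apply: (measurable_int mu2); exact: iGp.
    + have [i1 _ _] := @Rfubini2 R (fun z => g (z.1 + z.2 *: w) * phi z.1)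
        `[t0, t1]%classic (M * fine (\int[mu2]_x `|g x|%:E)%E) mgp mA finA gpM.
      exact: (measurable_int mu2 i1).
    + by apply: filterS aeG => x ix _; rewrite /G -RintegralZr.
  rewrite GE.
  (* Prepares the second exchange of integrals, after which the integral over r is computed by
     [derive_along]. *)
  have dK : measurable_fun [set: plane * measurableTypeR R]
      (fun z => - f z.1 * 'D_w phi (z.1 - z.2 *: w)).
    apply: measurable_funM.
      by apply: measurable_funN; exact: (measurableT_comp mf measurable_fst).
    have := measurable_line_shift (- w) (test_measurable (test_derive w tp)).
    by apply: eq_measurable_fun => z _; rewrite scalerN.
  have fM r : `[t0, t1]%classic r ->
      (\int[mu2]_x `|- f x * 'D_w phi (x - r *: w)|%:E <= (M' * fine (\int[mu2]_x `|f x|%:E))%:E)%E.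
    move=> _; have ffin : (\int[mu2]_x `|f x|%:E)%E \is a fin_num.
      by rewrite ge0_fin_numE//; exact: integral_ge0.
    have mab := measurableT_comp (@normr_measurable R setT) mf.
    rewrite EFinM fineK// -ge0_integralZl//; last 2 first.
    - exact/measurable_EFinP.
    - exact: ltW.
    have m1 : measurable_fun [set: plane] (fun x => - f x * 'D_w phi (x - r *: w)).
      apply: measurable_funM; first exact: measurable_funN.
      rewrite -scaleNr.
      exact: (measurableT_comp (test_measurable (test_derive w tp)) (measurable_shift (- r *: w))).
    apply: ge0_le_integral => //=.
    - by apply/measurable_EFinP; exact: (measurableT_comp (@normr_measurable R setT) m1).
    - by apply/measurable_EFinP; apply: measurable_funM.
    - by move=> x _; rewrite -EFinM lee_fin normrM normrN mulrC ler_wpM2r.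
  have [_ _ FE] := @Rfubini2 R (fun z => - f z.1 * 'D_w phi (z.1 - z.2 *: w))
    `[t0, t1]%classic _ dK mA finA fM.
  transitivity (\int[mu2]_x (f x * phi (x - t1 *: w)) - \int[mu2]_x (f x * phi (x - t0 *: w))
     - \int[mu]_(r in `[t0, t1]) \int[mu2]_x (- f x * 'D_w phi (x - r *: w))).
    congr (_ - _); apply: eq_Rintegral => r; rewrite inE /= in_itv /= => rt.
    rewrite (shiftE r g mg) -[LHS]opprK -(wd _ (tps r rt)).
    rewrite -mulN1r -RintegralZl//; last first.
      exact: (integrable_mul_test (test_derive w (tps r rt)) fi).
    apply: eq_Rintegral => x _; rewrite mulN1r mulNr; congr (- (_ * _)).
    exact: derive_shiftE.
  rewrite -FE.
  have it r : mu2.-integrable setT (EFin \o (fun x => f x * phi (x - r *: w))).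
    apply: (integrable_mul_test (U := setT)) => //.
    exact: (test_shift (U := U)).
  rewrite -RintegralB//.
  have [iK _ _] := @Rfubini2 R (fun z => - f z.1 * 'D_w phi (z.1 - z.2 *: w))
    `[t0, t1]%classic _ dK mA finA fM.
  rewrite -RintegralB//; last by apply: integrable_EFinB => //; exact: it.
  transitivity (\int[mu2]_x (fun=> 0 : R) x); last by rewrite /Rintegral integral0.
  apply: eq_Rintegral => x _ /=.
  rewrite RintegralZl//; last first.
    apply: continuous_compact_integrable; first exact: segment_compact.
    apply: continuous_subspaceT; apply: (@continuous_line ('D_w phi)).
    exact: (Ck_continuous (test_function_Ck 0 (test_derive w tp))).
  rewrite (derive_along w x tp t01); ring.
apply: (ae2_imp H) => x h Ux; apply/eqP; rewrite -subr_eq0; apply/eqP; exact: h.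
Qed.

End WeakDerivatives.

(** * Homotheties and exceptional null sets *)

Section Homothety.
Context {R : realType}.
Notation mu := (@lebesgue_measure R).
Notation mu2 := (@lebesgue2 R).
Notation plane := (measurableTypeR R * measurableTypeR R)%type.
Implicit Types (f g : R * R -> R) (D U K : set (R * R)) (v w X y : R * R).

(** The homothety with centre y and ratio 1 - h, applied to X. It is also affine of ratio h in y for
    fixed X, so that null sets of image points come from null sets of centres. *)
Definition hom (h : R) X y : R * R := (1 - h) *: X + h *: y.

Lemma ge0_integral_homothety (c : R * R) (h : R) (F : R * R -> \bar R) : h != 0 ->
  measurable_fun [set: plane] F -> (forall x, 0 <= F x)%E ->
  (\int[mu2]_x F x = (h ^+ 2)%:E * \int[mu2]_y F (c + h *: y)%R)%E.
Proof.
move=> h0 mF F0.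
have cr : cross (h *: e1 R) (h *: e2 R) = h ^+ 2.
  by rewrite /cross /= /GRing.scale /=; ring.
rewrite (@ge0_integral_plane _ c (h *: e1 R) (h *: e2 R))// ?cr ?expf_neq0//.
rewrite ger0_norm ?sqr_ge0//; congr (_ * _)%E; apply: eq_integral => y _; congr F; vec.
Qed.

Lemma measurable_affine2 (c : R * R) (h : R) :
  measurable_fun [set: plane] (fun y => c + h *: y : plane).
Proof. by apply: measurable_fun_pair; rewrite /= /GRing.scale /=; meas. Qed.

Lemma ae2_affine (c : R * R) (h : R) (P : R * R -> Prop) : h != 0 ->
  {ae mu2, forall x, P x} -> {ae mu2, forall y, P (c + h *: y)}.
Proof.
move=> h0 [N [mN N0 PN]].
pose aff : plane -> plane := fun y => c + h *: y.
have maff : measurable_fun [set: plane] aff := measurable_affine2 c h.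
have mN' : measurable (aff @^-1` N) by rewrite -[_ @^-1` _]setTI; exact: maff.
exists (aff @^-1` N); split => //; last by move=> y /= nP; apply: PN.
have mI : measurable_fun [set: plane] (fun x : plane => (\1_N x)%:E : \bar R).
  by apply/measurable_EFinP; exact: measurable_indic.
have I0 (x : R * R) : (0 <= (\1_N x)%:E :> \bar R)%E by rewrite lee_fin.
have := @ge0_integral_homothety c h (fun x => (\1_N x)%:E) h0 mI I0.
rewrite integral_indic// setIT [LHS]N0.
rewrite (_ : (fun y => _) = fun y => (\1_(aff @^-1` N) y)%:E) ?integral_indic ?setIT//.
by move/esym/eqP; rewrite mule_eq0 => /orP[|/eqP//]; rewrite eqe expf_eq0 /= (negbTE h0).
Qed.

Lemma ae_integrable_line f w (t0 t1 : R) : mu2.-integrable setT (EFin \o f) ->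
  {ae mu2, forall x, mu.-integrable `[t0, t1] (fun r => (f (x + r *: w))%:E)}.
Proof.
move=> fi; have /integrableP[/measurable_EFinP mf ff] := fi.
have ffin : (\int[mu2]_x `|f x|%:E)%E \is a fin_num.
  by rewrite ge0_fin_numE//; exact: integral_ge0.
have finA : (mu `[t0, t1]%classic < +oo)%E.
  by rewrite lebesgue_measure_itv; case: ifP => // _; rewrite -EFinB ltry.
have [] := @Rfubini2 R (fun z => f (z.1 + z.2 *: w)) `[t0, t1]%classic
  (fine (\int[mu2]_x `|f x|%:E)%E) (measurable_line_shift w mf) (measurable_itv _) finA.
  move=> r _; rewrite fineK//= (integral_shift (r *: w) (F := fun x => `|f x|%:E)%E)//.
  by apply/measurable_EFinP; exact: measurableT_comp.
by [].
Qed.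

(** Tonelli exchanges the quantifiers: a null set of bad y for every t becomes, for almost every y,
    a null set of bad t. *)
Lemma null_sections d (T : measurableType d) (nu : {sigma_finite_measure set T -> \bar R})
    (B : set (plane * T)) : measurable B ->
  (forall t, mu2 [set y | B (y, t)] = 0)%E ->
  {ae mu2, forall y, {ae nu, forall t, ~ B (y, t)}}.
Proof.
move=> mB B0.
have mI : measurable_fun setT (fun z => (\1_B z)%:E : \bar R).
  by apply/measurable_EFinP; exact: measurable_indic.
have I0 z : (0 <= (\1_B z)%:E :> \bar R)%E by rewrite lee_fin.
have E := @fubini_tonelli _ _ _ _ R (@plane_measure R) nu (fun z => (\1_B z)%:E) mI I0.
have Z : (\int[nu]_t \int[@plane_measure R]_y (\1_B (y, t))%:E = 0)%E.
  apply: integral0_eq => t _.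
  rewrite -[RHS](B0 t) (_ : (fun y => _) = fun y => (\1_[set y | B (y, t)] y)%:E).
    have mBt : measurable [set y | B (y, t)].
      have := measurable_ysection t mB; rewrite /ysection.
      by rewrite (_ : [set x | _] = [set y | B (y, t)])//; apply/seteqP; split => x /=; rewrite ?inE.
    by rewrite (@integral_indic _ _ _ (@plane_measure R))// setIT.
  apply/funext => y; rewrite !indicE; congr (_%:R)%:E.
move: E; rewrite Z => E.
have mF := measurable_fun_fubini_tonelli_F (m2 := nu) (fun z => (\1_B z)%:E : \bar R) mI I0.
have F0 y : (0 <= fubini_F nu (fun z => (\1_B z)%:E : \bar R) y)%E by exact: integral_ge0.
have : (\int[@plane_measure R]_y `|fubini_F nu (fun z => (\1_B z)%:E) y| = 0)%E.
  by rewrite -[RHS]E; apply: eq_integral => y _; rewrite gee0_abs.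
move/(ae_eq_integral_abs _ measurableT mF) => H.
apply: (ae2_imp H) => y /= /(_ I) yB.
have mBy : measurable [set t | B (y, t)].
  have := measurable_xsection y mB; rewrite /xsection.
  by rewrite (_ : [set x | _] = [set t | B (y, t)])//; apply/seteqP; split => x /=; rewrite ?inE.
exists [set t | B (y, t)]; split => //.
  rewrite -[RHS]yB /fubini_F (_ : (fun t => _) = fun t => (\1_[set t | B (y, t)] t)%:E).
    by rewrite integral_indic// setIT.
  apply/funext => t; rewrite !indicE; congr (_%:R)%:E.
by move=> t /= /contrapT.
Qed.

End Homothety.

(** * Integration along segments of homothetic copies *)

Section LineEstimates.
Context {R : realType}.
Notation mu := (@lebesgue_measure R).
Notation mu2 := (@lebesgue2 R).
Notation plane := (measurableTypeR R * measurableTypeR R)%type.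
Variables (D K : set (R * R)) (f f1 f2 G : R * R -> R) (p h : R).
Hypothesis oD : open D.
Hypothesis convK : forall X Y t, K X -> K Y -> 0 <= t <= 1 -> K (X + t *: (Y - X)).
Hypothesis h01 : 0 < h < 1.
Hypothesis homD : forall X y, K X -> D y -> D (hom h X y).
Hypothesis wd1 : plane_wd D (e1 R) f f1.
Hypothesis wd2 : plane_wd D (e2 R) f f2.
Hypothesis mG : measurable_fun [set: plane] G.
Hypothesis G0 : forall x, 0 <= G x.
Hypothesis p1 : 1 <= p.

(** f1 and f2 are the partial derivatives of f. Only the derivative along w is compared with G, so
    that no ratio of side lengths enters. *)
Definition gradient_le (w : R * R) (c : R) : Prop :=
  forall x, `|w.1 * f1 x + w.2 * f2 x| <= c * G x.

(** The image of the segment has direction (1 - h) w and issues from (1 - h) X + h y. [weak_ftc]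
    handles almost every such starting point, and the exceptional set is pulled back to the centres
    y. *)
Lemma ae_line_ftc X w (t0 t1 : R) : K X -> K (X + w) -> 0 <= t0 -> t0 <= t1 -> t1 <= 1 ->
  {ae mu2, forall y, D y -> f (hom h (X + t1 *: w) y) - f (hom h (X + t0 *: w) y) =
     (1 - h) * \int[mu]_(s in `[t0, t1]) (w.1 * f1 (hom h (X + s *: w) y) +
                                w.2 * f2 (hom h (X + s *: w) y))} /\
  {ae mu2, forall y, mu.-integrable `[t0, t1] (fun s => (w.1 * f1 (hom h (X + s *: w) y) +
                                w.2 * f2 (hom h (X + s *: w) y))%:E)}.
Proof.
move=> KX KXw t00 t01 t11; have /andP[h0 h1] := h01.
have hn0 : h != 0 by rewrite gt_eqF.
pose w' := (1 - h) *: w; pose c := (1 - h) *: X.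
(* The starting points whose centre y lies in D. *)
pose U := (fun x => h^-1 *: (x - c)) @^-1` D.
have oU : open U.
  apply: open_comp => // x _; apply: cvgZl_tmp.
  by apply: cvgB; [exact: cvg_id|exact: cvg_cst].
have homE s y : c + h *: y + s *: w' = hom h (X + s *: w) y.
  by rewrite /hom /w' /c; vec.
have UD x r : U x -> t0 <= r <= t1 -> D (x + r *: w').
  move=> Ux /andP[r0 r1].
  have -> : x = c + h *: (h^-1 *: (x - c)) by rewrite scalerA divff// scale1r addrC subrK.
  rewrite homE; apply: homD => //.
  have -> : w = X + w - X by rewrite addrC addrA addNr add0r.
  by apply: convK => //; rewrite (le_trans t00 r0) (le_trans r1 t11).
have [A B] := weak_ftc (plane_wd_dir w' wd1 wd2) oU t01 UD.
have gE x : w'.1 * f1 x + w'.2 * f2 x = (1 - h) * (w.1 * f1 x + w.2 * f2 x).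
  by rewrite /w' /= /GRing.scale /=; ring.
have [A' B'] := (ae2_affine c hn0 A, ae2_affine c hn0 B).
have h1n : 1 - h != 0 by rewrite subr_eq0 eq_sym lt_eqF.
have mA : measurable (`[t0, t1]%classic : set (measurableTypeR R)) by exact: measurable_itv.
have int y : mu.-integrable `[t0, t1] (fun r => (w'.1 * f1 (c + h *: y + r *: w') +
     w'.2 * f2 (c + h *: y + r *: w'))%:E) ->
   mu.-integrable `[t0, t1] (fun s => (w.1 * f1 (hom h (X + s *: w) y) +
                                w.2 * f2 (hom h (X + s *: w) y))%:E).
  move=> iy; have := integrable_EFinZ mA (1 - h)^-1 iy.
  apply: eq_integrable => // s _; congr EFin.
  by rewrite homE gE// mulrA mulVf// mul1r.
split; last by apply: (ae2_imp B') => y; exact: int.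
apply: (ae2_imp (ae2_and A' B')) => y [Ay By] Dy.
have Uy : U (c + h *: y).
  by rewrite /U /= addrC addKr scalerA mulVf// scale1r.
have := Ay Uy; rewrite !homE => ->.
rewrite -RintegralZl//; last exact: int.
by apply: eq_Rintegral => s _; rewrite homE gE.
Qed.

(** Jensen on an interval of length at most 1, then (c G)^p <= c G^p because c <= 1. The factor c is
    kept to the first power because [ae_link] uses it as a Jacobian. *)
Lemma ae_line_powR X w (t0 t1 c : R) : K X -> K (X + w) -> 0 <= t0 -> t0 <= t1 -> t1 <= 1 ->
  0 <= c <= 1 -> gradient_le w c ->
  {ae mu2, forall y, D y ->
    ((`|f (hom h (X + t1 *: w) y) - f (hom h (X + t0 *: w) y)| `^ p)%:E <=
     c%:E * \int[mu]_(s in `[t0, t1]) (G (hom h (X + s *: w) y) `^ p)%:E)%E}.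
Proof.
move=> KX KXw t00 t01 t11 /andP[c0 c1] wc; have /andP[h0 h1] := h01.
have [A B] := ae_line_ftc KX KXw t00 t01 t11.
apply: (ae2_imp (ae2_and A B)) => y [Ay By] Dy; rewrite Ay//.
have p0 : 0 <= p by exact: le_trans p1.
have [[_ /integrableP[/measurable_EFinP m1 _] _] [_ /integrableP[/measurable_EFinP m2 _] _]] := (wd1, wd2).
have mh : measurable_fun [set: measurableTypeR R] (fun s : R => hom h (X + s *: w) y : plane).
  by apply: measurable_fun_pair; rewrite /= /GRing.scale /=; meas.
pose k s := w.1 * f1 (hom h (X + s *: w) y) + w.2 * f2 (hom h (X + s *: w) y).
have mk : measurable_fun [set: measurableTypeR R] k.
  apply: measurable_funD; apply: measurable_funM => //.
  - exact: (measurableT_comp m1 mh).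
  - exact: (measurableT_comp m2 mh).
have mI : (mu `[t0, t1]%classic <= 1)%E.
  rewrite lebesgue_measure_itv /= ; case: ifP => // _.
  by rewrite -EFinB lee_fin; lra.
have mGh : measurable_fun [set: measurableTypeR R] (fun s => (G (hom h (X + s *: w) y) `^ p)%:E).
  apply/measurable_EFinP; apply: (measurableT_comp (measurable_powR p)).
  exact: (measurableT_comp mG mh).
apply: (@le_trans _ _ (\int[mu]_(s in `[t0, t1]) (`|k s| `^ p)%:E)%E).
  have mA : measurable (`[t0, t1]%classic : set (measurableTypeR R)) by exact: measurable_itv.
  have J := integral_powR_le p1 mA mI mk; apply: le_trans; last exact: J.
  have fin : (\int[mu]_(s in `[t0, t1]) `|k s|%:E)%E \is a fin_num.
    rewrite ge0_fin_numE; last exact: integral_ge0.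
    by have /integrableP[] := By.
  rewrite -(fineK fin) poweR_EFin lee_fin ge0_ler_powR//; first by rewrite nnegrE fine_ge0// integral_ge0.
  rewrite normrM -[leRHS]mul1r ler_pM//; first by rewrite ger0_norm; lra.
  have J' := le_normr_Rintegral mA By; exact: J'.
rewrite -ge0_integralZl//; last 2 first.
- exact: measurable_funTS.
- by move=> s _; rewrite lee_fin powR_ge0.
apply: ge0_le_integral => //.
- apply/measurable_EFinP; apply: measurable_funTS; apply: (measurableT_comp (measurable_powR p)).
  exact: measurableT_comp.
- by apply: measurable_funTS; exact: (measurable_funeM c%:E).
move=> s _; rewrite -EFinM lee_fin.
apply: (@le_trans _ _ ((c * G (hom h (X + s *: w) y)) `^ p)).
  by rewrite ge0_ler_powR ?nnegrE ?mulr_ge0//; exact: wc.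
have [->|cn0] := eqVneq c 0; first by rewrite !mul0r powR0// gt_eqF// (lt_le_trans ltr01).
by apply: ge1r_powRZ => //; rewrite lt_neqAle eq_sym cn0 c0.
Qed.

Section SegmentFamilies.
Variables (d : measure_display) (T : measurableType d) (nu : {sigma_finite_measure set T -> \bar R}).
Variables (X w : T -> R * R) (t0 t1 c k : T -> R).
Hypothesis mX : measurable_fun setT (X : T -> plane).
Hypothesis mw : measurable_fun setT (w : T -> plane).
Hypothesis mt0 : measurable_fun setT (t0 : T -> measurableTypeR R).
Hypothesis mt1 : measurable_fun setT (t1 : T -> measurableTypeR R).
Hypothesis mc : measurable_fun setT (c : T -> measurableTypeR R).
Hypothesis mk : measurable_fun setT (k : T -> measurableTypeR R).
Hypothesis k0 : forall z, 0 <= k z.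
Hypothesis adm : forall z, 0 < k z ->
  [/\ K (X z), K (X z + w z), 0 <= t0 z, t0 z <= t1 z & t1 z <= 1] /\
  (0 <= c z <= 1 /\ gradient_le (w z) (c z)).

(** The null set of [ae_line_powR] depends on the segment; by [null_sections], for almost every y
    the estimate holds for almost all segments of the family and can be integrated. The weight k
    selects the segments to which the assumptions apply. *)
Lemma ae_lines_powR : {ae mu2, forall y, D y ->
  measurable_fun setT (fun z =>
    ((k z)%:E * ((c z)%:E * \int[mu]_(s in `[t0 z, t1 z]) (G (hom h (X z + s *: w z) y) `^ p)%:E))%E) /\
  (\int[nu]_z (k z * `|f (hom h (X z + t1 z *: w z) y) - f (hom h (X z + t0 z *: w z) y)| `^ p)%:E <=
   \int[nu]_z ((k z)%:E * ((c z)%:E * \int[mu]_(s in `[t0 z, t1 z]) (G (hom h (X z + s *: w z) y) `^ p)%:E)))%E}.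
Proof.
have [[/integrableP[/measurable_EFinP mf _] _ _] _] := (wd1, wd1).
pose L (u : plane * T) : \bar R :=
  (k u.2 * `|f (hom h (X u.2 + t1 u.2 *: w u.2) u.1) - f (hom h (X u.2 + t0 u.2 *: w u.2) u.1)| `^ p)%:E.
(* Extension by zero turns the variable limits t0 and t1 into a jointly measurable integrand. *)
pose S (u : (plane * T) * measurableTypeR R) : R :=
  if t0 u.1.2 <= u.2 <= t1 u.1.2 then G (hom h (X u.1.2 + u.2 *: w u.1.2) u.1.1) `^ p else 0.
pose Q (u : plane * T) : \bar R :=
  ((k u.2)%:E * ((c u.2)%:E * \int[mu]_s (S (u, s))%:E))%E.
have msnd g : measurable_fun setT (g : T -> measurableTypeR R) ->
    measurable_fun setT (fun u : plane * T => g u.2 : measurableTypeR R).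
  by move=> mg; exact: (measurableT_comp mg measurable_snd).
have mX1 := measurableT_comp (@measurable_fst _ _ (measurableTypeR R) (measurableTypeR R)) mX.
have mX2 := measurableT_comp (@measurable_snd _ _ (measurableTypeR R) (measurableTypeR R)) mX.
have mw1 := measurableT_comp (@measurable_fst _ _ (measurableTypeR R) (measurableTypeR R)) mw.
have mw2 := measurableT_comp (@measurable_snd _ _ (measurableTypeR R) (measurableTypeR R)) mw.
have my1 : measurable_fun setT (fun u : plane * T => u.1.1).
  exact: (measurableT_comp measurable_fst measurable_fst).
have my2 : measurable_fun setT (fun u : plane * T => u.1.2).
  exact: (measurableT_comp measurable_snd measurable_fst).
have mhom (t : T -> R) : measurable_fun setT (t : T -> measurableTypeR R) ->
    measurable_fun setT (fun u : plane * T => hom h (X u.2 + t u.2 *: w u.2) u.1 : plane).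
  move=> mt; apply: measurable_fun_pair; rewrite /= /GRing.scale /=.
    apply: measurable_funD; last exact: (measurable_funM (measurable_cst h) my1).
    apply: (measurable_funM (measurable_cst (1 - h))); apply: measurable_funD.
      exact: (msnd (fst \o X)).
    by apply: measurable_funM; [exact: (msnd t)|exact: (msnd (fst \o w))].
  apply: measurable_funD; last exact: (measurable_funM (measurable_cst h) my2).
  apply: (measurable_funM (measurable_cst (1 - h))); apply: measurable_funD.
    exact: (msnd (snd \o X)).
  by apply: measurable_funM; [exact: (msnd t)|exact: (msnd (snd \o w))].
have mGp (a : R * R -> R) : measurable_fun [set: plane] a -> (forall x, 0 <= a x) ->
    measurable_fun [set: plane] (fun x => a x `^ p).
  by move=> ma _; exact: (measurableT_comp (measurable_powR p) ma).
have mid : measurable_fun setT (fun u : (plane * T) * measurableTypeR R => ((u.1.1, (u.1.2, u.2)) : plane * (T * measurableTypeR R))).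
  apply: measurable_fun_pair; first exact: (measurableT_comp measurable_fst measurable_fst).
  apply: measurable_fun_pair; last exact: measurable_snd.
  exact: (measurableT_comp measurable_snd measurable_fst).
have mT g : measurable_fun setT (g : T -> measurableTypeR R) ->
    measurable_fun setT (fun u : (plane * T) * measurableTypeR R => g u.1.2 : measurableTypeR R).
  move=> mg; apply: (measurableT_comp mg).
  exact: (measurableT_comp measurable_snd measurable_fst).
have mS : measurable_fun setT S.
  apply: measurable_fun_ifT.
  - by apply: measurable_and; apply: measurable_fun_ler => //; [exact: mT|exact: mT].
  - apply: (measurableT_comp (mGp _ mG G0)).
    apply: measurable_fun_pair; rewrite /= /GRing.scale /=.
      apply: measurable_funD; last first.
        apply: (measurable_funM (measurable_cst h)).
        exact: (measurableT_comp my1 measurable_fst).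
      apply: (measurable_funM (measurable_cst (1 - h))); apply: measurable_funD.
        exact: (mT (fst \o X)).
      by apply: measurable_funM; [exact: measurable_snd|exact: (mT (fst \o w))].
    apply: measurable_funD; last first.
      apply: (measurable_funM (measurable_cst h)).
      exact: (measurableT_comp my2 measurable_fst).
    apply: (measurable_funM (measurable_cst (1 - h))); apply: measurable_funD.
      exact: (mT (snd \o X)).
    by apply: measurable_funM; [exact: measurable_snd|exact: (mT (snd \o w))].
  - exact: measurable_cst.
have S0 u : 0 <= S u by rewrite /S; case: ifP => // _; exact: powR_ge0.
have mL : measurable_fun setT L.
  apply/measurable_EFinP; apply: measurable_funM; first exact: (msnd k).
  apply: (measurableT_comp (measurable_powR p)).
  apply: (measurableT_comp (@normr_measurable R setT)).
  by apply: measurable_funB; [exact: (measurableT_comp mf (mhom _ mt1))|exact: (measurableT_comp mf (mhom _ mt0))].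
have mQ : measurable_fun setT Q.
  apply: emeasurable_funM; first by apply/measurable_EFinP; exact: (msnd k).
  apply: emeasurable_funM; first by apply/measurable_EFinP; exact: (msnd c).
  apply: (measurable_fun_fubini_tonelli_F (m2 := mu) (fun u => (S u)%:E)).
    exact/measurable_EFinP.
  by move=> u; rewrite lee_fin.
have QE y z : Q (y, z) = ((k z)%:E * ((c z)%:E *
    \int[mu]_(s in `[t0 z, t1 z]) (G (hom h (X z + s *: w z) y) `^ p)%:E))%E.
  rewrite /Q /=; congr (_ * (_ * _))%E; rewrite [RHS]integral_mkcond.
  apply: eq_integral => s _; rewrite patchE /S /= mem_setE in_itv /=.
  by case: ifP.
(* The pairs that violate the inequality; every section at a fixed segment is null by
   [ae_line_powR]. *)
pose B : set (plane * T) := [set u | D u.1 /\ (0 < k u.2) && (Q u < L u)%E].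
have mB : measurable B.
  have -> : B = (fst @^-1` D) `&` ([set u | 0 < k u.2] `&` [set u | (Q u < L u)%E]).
    by apply/seteqP; split => u /=; [move=> [? /andP[]]|move=> [? [? ?]]; split => //; exact/andP].
  apply: measurableI.
    by rewrite -[_ @^-1` _]setTI; apply: measurable_fst => //; exact: open_measurable_plane.
  apply: measurableI; last first.
    by rewrite -[X in measurable X]setTI; exact: emeasurable_fun_lt.
  rewrite (_ : [set u | _] = (fun u : plane * T => k u.2) @^-1` `]0, +oo[%classic); last first.
    by apply/seteqP; split => u /=; rewrite in_itv /= andbT.
  by rewrite -[_ @^-1` _]setTI; apply: (msnd k mk) => //; exact: measurable_itv.
have B0 z : mu2 [set y | B (y, z)] = 0%E.
  have [kz|kz] := boolP (0 < k z); last first.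
    by rewrite (_ : [set y | _] = set0) ?measure0//; apply/seteqP; split => // y [_ /=]; rewrite (negbTE kz).
  have [[A1 A2 A3 A4 A5] [A6 A7]] := adm kz.
  have := ae_line_powR A1 A2 A3 A4 A5 A6 A7.
  have mBz : measurable [set y : plane | B (y, z)].
    have := measurable_ysection z mB; rewrite /ysection.
    by rewrite (_ : [set x | _] = [set y | B (y, z)])//; apply/seteqP; split => x /=; rewrite ?inE.
  move=> H; apply: (measure_negligible mBz); apply: negligibleS H => y /= [Dy /andP[_ QL]] /(_ Dy).
  apply/negP; rewrite -ltNge; move: QL; rewrite QE /L /= EFinM lte_pmul2l//.
have := null_sections nu mB B0.
move=> H; apply: (ae2_imp H) => y By Dy.
have my : measurable_fun setT (fun z : T => ((y, z) : plane * T)).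
  by apply: measurable_fun_pair; [exact: measurable_cst|exact: measurable_id].
rewrite (_ : (fun z => _ * (_ * _))%E = fun z => Q (y, z)); last by apply/funext => z; rewrite QE.
split; first exact: (measurableT_comp mQ my).
apply: (ae_ge0_le_integral measurableT).
- by move=> z _; rewrite lee_fin mulr_ge0// powR_ge0.
- exact: (measurableT_comp mL my).
- move=> z _; rewrite /Q /=; have [kz|kz] := boolP (0 < k z); last first.
    by have -> : k z = 0; [apply/eqP; rewrite eq_le k0 leNgt kz|rewrite mul0e].
  have [_ [/andP[c0 _] _]] := adm kz.
  rewrite !mule_ge0 ?lee_fin//.
  by apply: integral_ge0 => s _; rewrite lee_fin.
- exact: (measurableT_comp mQ my).
- apply: filterS By => z nB _; have [kz|kz] := boolP (0 < k z).
    by rewrite leNgt; apply/negP => QL; apply: nB; split => //=; rewrite kz.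
  have -> : k z = 0 by apply/eqP; rewrite eq_le k0 leNgt kz.
  by rewrite mul0r /Q /=; have -> : k z = 0; [apply/eqP; rewrite eq_le k0 leNgt kz|rewrite mul0e].
Qed.

End SegmentFamilies.

End LineEstimates.

(** * Means over edges *)

Section Tonelli.
Context {R : realType}.
Notation mu := (@lebesgue_measure R).
Notation mu2 := (@lebesgue2 R).
Notation plane := (measurableTypeR R * measurableTypeR R)%type.
Local Open Scope ereal_scope.

Lemma tonelli_plane (f : plane -> \bar R) : measurable_fun setT f -> (forall z, 0 <= f z) ->
  \int[mu2]_z f z = \int[mu]_s \int[mu]_t f (s, t).
Proof. move=> mf f0; exact: (fubini_tonelli1 (m1 := mu) (m2 := mu) f mf f0). Qed.

Lemma tonelli_plane2 (f : plane * plane -> \bar R) : measurable_fun setT f -> (forall z, 0 <= f z) ->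
  \int[product_measure (@plane_measure R) (@plane_measure R)]_z f z =
    \int[mu2]_x \int[mu2]_y f (x, y).
Proof.
by move=> mf f0; exact: (fubini_tonelli1 (m1 := @plane_measure R) (m2 := @plane_measure R) f mf f0).
Qed.

Lemma tonelli_plane2_sym (f : plane * plane -> \bar R) : measurable_fun setT f -> (forall z, 0 <= f z) ->
  \int[mu2]_x \int[mu2]_y f (x, y) = \int[mu2]_y \int[mu2]_x f (x, y).
Proof.
by move=> mf f0; exact: (fubini_tonelli (m1 := @plane_measure R) (m2 := @plane_measure R) f mf f0).
Qed.

Lemma measurable_tonelli_plane2 (f : plane * plane -> \bar R) :
  measurable_fun setT f -> (forall z, 0 <= f z) ->
  measurable_fun setT (fun x => \int[mu2]_y f (x, y)).
Proof.
move=> mf f0; exact: (measurable_fun_fubini_tonelli_F (m2 := @plane_measure R) f mf f0).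
Qed.

Lemma measurable_lin d (T : measurableType d) (X w : T -> R * R) (t : T -> R) :
  measurable_fun setT (X : T -> plane) -> measurable_fun setT (w : T -> plane) ->
  measurable_fun setT (t : T -> measurableTypeR R) ->
  measurable_fun setT (fun z => X z + t z *: w z : plane)%R.
Proof.
move=> mX mw mt; apply: measurable_fun_pair; rewrite /= /GRing.scale /=.
  apply: measurable_funD; first exact: (measurableT_comp measurable_fst mX).
  by apply: measurable_funM => //; exact: (measurableT_comp measurable_fst mw).
apply: measurable_funD; first exact: (measurableT_comp measurable_snd mX).
by apply: measurable_funM => //; exact: (measurableT_comp measurable_snd mw).
Qed.

Lemma measurable_ray d (T : measurableType d) (X : T -> R * R) (w : R * R) (t : T -> R) :
  measurable_fun setT (X : T -> plane) ->
  measurable_fun setT (t : T -> measurableTypeR R) ->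
  measurable_fun setT (fun z => X z + t z *: w : plane)%R.
Proof. by move=> mX mt; exact: (measurable_lin (w := fun=> w) mX). Qed.

Lemma measurable_hom d (T : measurableType d) (X : T -> R * R) (h : R) (y : R * R) :
  measurable_fun setT (X : T -> plane) ->
  measurable_fun setT (fun z => hom h (X z) y : plane).
Proof.
move=> mX; rewrite /hom.
apply: measurable_fun_pair; rewrite /= /GRing.scale /=.
  apply: measurable_funD => //; apply: measurable_funM => //.
  exact: (measurableT_comp measurable_fst mX).
apply: measurable_funD => //; apply: measurable_funM => //.
exact: (measurableT_comp measurable_snd mX).
Qed.

Lemma measurable_homl (h : R) (y : R * R) : measurable_fun [set: plane] (fun X : plane => hom h X y : plane).
Proof. by apply: measurable_hom; exact: measurable_id. Qed.

Lemma integral_homothety_le (c : R * R) (k C : R) (F : R * R -> \bar R) :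
  (0 < k)%R -> (1 <= C * k ^+ 2)%R -> measurable_fun [set: plane] F -> (forall x, 0 <= F x) ->
  \int[mu2]_x F (c + k *: x)%R <= C%:E * \int[mu2]_x F x.
Proof.
move=> k0 Ck mF F0.
have C0 : (0 <= C)%R.
  by rewrite -(@pmulr_lge0 _ (k ^+ 2)) ?exprn_gt0//; exact: le_trans Ck.
rewrite (ge0_integral_homothety c (lt0r_neq0 k0) mF F0) muleA -EFinM.
rewrite -[leLHS]mul1e lee_wpmul2r ?lee_fin//.
exact: integral_ge0.
Qed.

Lemma powRD_le (a b p : R) : (1 <= p)%R -> (0 <= a)%R -> (0 <= b)%R ->
  ((a + b) `^ p <= 2 `^ p * (a `^ p + b `^ p))%R.
Proof.
move=> p1 a0 b0; have p0 : (0 <= p)%R by exact: le_trans p1.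
have [ab|ba] := leP a b.
  apply: (@le_trans _ _ ((2 * b) `^ p)%R).
    by rewrite ge0_ler_powR ?nnegrE ?addr_ge0 ?mulr_ge0//; lra.
  by rewrite powRM// ler_wpM2l ?powR_ge0// lerDr powR_ge0.
apply: (@le_trans _ _ ((2 * a) `^ p)%R).
  by rewrite ge0_ler_powR ?nnegrE ?addr_ge0 ?mulr_ge0//; lra.
by rewrite powRM// ler_wpM2l ?powR_ge0// lerDl powR_ge0.
Qed.

Lemma powR_distD (a b c p : R) : (1 <= p)%R ->
  (`|a - c| `^ p <= 2 `^ p * (`|a - b| `^ p + `|b - c| `^ p))%R.
Proof.
move=> p1; apply: le_trans (powRD_le p1 (normr_ge0 _) (normr_ge0 _)).
rewrite ge0_ler_powR ?nnegrE ?addr_ge0 ?(le_trans ler01 p1)//.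
exact: ler_distD.
Qed.

Lemma ge0_integral_scale d (T : measurableType d) (m : {measure set T -> \bar R})
    (f : T -> \bar R) (k : R) : measurable_fun setT f -> (forall x, 0 <= f x) -> (0 <= k)%R ->
  k%:E * \int[m]_x f x = \int[m]_x (k%:E * f x).
Proof. by move=> mf f0 k0; rewrite ge0_integralZl. Qed.

Lemma integral_indicZ d (T : measurableType d) (m : {measure set T -> \bar R})
    (A : set T) (k : \bar R) : measurable A -> 0 <= k ->
  \int[m]_x ((\1_A x)%:E * k) = m A * k.
Proof.
move=> mA k0; rewrite ge0_integralZr//; first by rewrite integral_indic// setIT.
by apply/measurable_EFinP; exact: measurable_indic.
Qed.

Lemma integral_indic01 : \int[mu]_t (\1_`[0%R, 1%R]%classic t)%:E = 1 :> \bar R.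
Proof.
rewrite integral_indic; [|exact: measurableT|exact: (measurable_itv `[0%R, 1%R])].
by rewrite setIT; apply: etrans (lebesgue_measure_itv _) _; rewrite /= lte_fin ltr01 oppr0 adde0.
Qed.

(** Up to the constant [cross p q], the Jacobian of Duffy's map (s, t) -> P + s p + s t (q - p),
    which sends the unit square onto the triangle P, P + p, P + q and collapses the side s = 0 to
    P. *)
Definition tri_weight (z : R * R) : R :=
  if (0 <= z.1 <= 1)%R && (0 <= z.2 <= 1)%R then z.1 else 0%R.

Lemma tri_weight_ge0 z : (0 <= tri_weight z)%R.
Proof. by rewrite /tri_weight; case: ifP => // /andP[/andP[]]. Qed.

Lemma measurable_tri_weight : measurable_fun [set: plane] (tri_weight : plane -> measurableTypeR R).
Proof.
apply: measurable_fun_ifT => //.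
by apply: measurable_and; apply: measurable_and; exact: measurable_fun_ler.
Qed.

(** The substitution t -> s t at fixed s produces the weight. There is only an inequality because
    the right-hand side is integrated over the plane instead of the triangle. *)
Lemma duffy (P p q : R * R) (F : R * R -> \bar R) : (cross p q != 0)%R ->
  measurable_fun [set: plane] F -> (forall x, 0 <= F x) ->
  `|cross p q|%:E * \int[mu2]_z ((tri_weight z)%:E * F (P + z.1 *: p + (z.1 * z.2) *: (q - p))%R) <=
  \int[mu2]_x F x.
Proof.
move=> pq mF F0.
have pqp : (cross p (q - p) = cross p q)%R by rewrite /cross /=; ring.
rewrite (@ge0_integral_plane _ P p (q - p)%R F) ?pqp//.
apply: lee_wpmul2l; first by rewrite lee_fin.
have mG : measurable_fun [set: plane] (fun z : plane => F (P + z.1 *: p + z.2 *: (q - p))%R).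
  by apply: (measurableT_comp mF); exact: measurable_plane.
have mX : measurable_fun [set: plane] (fun z : plane => (P + z.1 *: p + (z.1 * z.2) *: (q - p) : plane)%R).
  apply: (measurable_ray (X := fun z : plane => (P + z.1 *: p)%R)); last exact: measurable_funM.
  exact: (measurable_ray (X := fun=> P)).
have mH : measurable_fun [set: plane]
    (fun z : plane => (tri_weight z)%:E * F (P + z.1 *: p + (z.1 * z.2) *: (q - p))%R).
  apply: emeasurable_funM; first by apply/measurable_EFinP; exact: measurable_tri_weight.
  exact: (measurableT_comp mF mX).
have H0 z : 0 <= (tri_weight z)%:E * F (P + z.1 *: p + (z.1 * z.2) *: (q - p))%R.
  by rewrite mule_ge0// lee_fin tri_weight_ge0.
rewrite !tonelli_plane//.
apply: ge0_le_integral => //.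
- by move=> s _; exact: integral_ge0.
- exact: (measurable_fun_fubini_tonelli_F (m2 := mu) _ mH H0).
- exact: (measurable_fun_fubini_tonelli_F (m2 := mu) _ mG (fun z => F0 _)).
move=> s _ /=.
have ms : measurable_fun [set: measurableTypeR R] (fun t : R => ((s, t) : plane)).
  by apply: measurable_fun_pair; [exact: measurable_cst|exact: measurable_id].
have [/andP[s0 s1]|ns] := boolP (0 < s <= 1)%R; last first.
  rewrite integral0_eq; first exact: integral_ge0.
  move=> t _; rewrite (_ : tri_weight _ = 0%R) ?mul0e//.
  rewrite /tri_weight /=; case: ifP => // /andP[/andP[s0 s1] _].
  by apply/eqP; rewrite eq_le s0 andbT leNgt; apply: contra ns => ->; rewrite s1.
have mGs : measurable_fun [set: measurableTypeR R] (fun t : R => F (P + s *: p + t *: (q - p))%R).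
  by apply: (measurableT_comp mF); exact: (measurable_ray (X := fun=> P + s *: p)%R).
have sn0 : s != 0%R by rewrite gt_eqF.
rewrite (ge0_integral_affine 0 sn0 mGs)//.
have mGs' : measurable_fun [set: measurableTypeR R] (fun t : R => F (P + s *: p + (s * t + 0) *: (q - p))%R).
  apply: (measurableT_comp mF); apply: (measurable_ray (X := fun=> P + s *: p)%R) => //.
  by apply: measurable_funD => //; exact: mulrl_measurable.
rewrite -ge0_integralZl//.
apply: ge0_le_integral => //.
- exact: (measurableT_comp mH ms).
- exact: emeasurable_funM.
move=> t _; rewrite addr0; apply: lee_wpmul2r => //.
rewrite lee_fin /tri_weight /= gtr0_norm//; case: ifP => // _; exact: ltW.
Qed.

End Tonelli.

Section EdgeMeans.
Context {R : realType}.
Notation mu := (@lebesgue_measure R).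
Notation mu2 := (@lebesgue2 R).
Notation plane := (measurableTypeR R * measurableTypeR R)%type.
Variables (K : set (R * R)) (F : R * R -> R) (p : R).
Hypothesis p1 : 1 <= p.
Hypothesis mF : measurable_fun [set: plane] F.
Hypothesis mK : measurable (K : set plane).
Hypothesis convK : forall X Y t, K X -> K Y -> 0 <= t <= 1 -> K (X + t *: (Y - X)).
Local Open Scope ereal_scope.

Definition power_dist (k : R) : \bar R :=
  \int[mu2]_X ((\1_K X)%:E * (`|F X - k| `^ p)%:E).

Lemma measurable_powR_dist d (T : measurableType d) (a b : T -> R) :
  measurable_fun setT (a : T -> measurableTypeR R) ->
  measurable_fun setT (b : T -> measurableTypeR R) ->
  measurable_fun setT (fun x => (`|a x - b x| `^ p)%:E).
Proof.
move=> ma mb; apply/measurable_EFinP; apply: (measurableT_comp (measurable_powR p)).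
apply: (measurableT_comp (@normr_measurable R setT)); exact: measurable_funB.
Qed.

Lemma triangle_in (P a b : R * R) z : K P -> K (P + a)%R -> K (P + b)%R ->
  (0 <= z.1 <= 1)%R && (0 <= z.2 <= 1)%R -> K (P + z.1 *: a + (z.1 * z.2) *: (b - a))%R.
Proof.
move=> KP Ka Kb /andP[z1 z2].
have Kab : K (P + a + z.2 *: (b - a))%R.
  have -> : (b - a = (P + b) - (P + a))%R by vec.
  exact: convK.
have := convK KP Kab z1; congr K; vec.
Qed.

(** The value at P + r a is compared with those on the chord through it parallel to b - a, and these
    with k. E controls the first comparison; Duffy's map turns the second into an integral over K.
    The weight r, proportional to the chord, degenerates at P. *)
Lemma weighted_edge (P a b : R * R) (E : \bar R) (k : R) : cross a b != 0%R ->
  K P -> K (P + a)%R -> K (P + b)%R ->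
  `|cross a b|%:E * \int[mu2]_z ((tri_weight z)%:E *
     (`|F (P + z.1 *: a + (z.1 * z.2) *: (b - a))%R - F (P + z.1 *: a)%R| `^ p)%:E) <= E ->
  `|cross a b|%:E * \int[mu]_(r in `[0%R, 1%R]) (r%:E * (`|F (P + r *: a)%R - k| `^ p)%:E) <=
  (2 `^ p)%:E * (E + power_dist k).
Proof.
move=> ab KP Ka Kb HE.
have mX : measurable_fun [set: plane] (fun z : plane => (P + z.1 *: a + (z.1 * z.2) *: (b - a) : plane)%R).
  apply: (measurable_ray (X := fun z : plane => (P + z.1 *: a)%R)); last exact: measurable_funM.
  exact: (measurable_ray (X := fun=> P)).
have mX1 : measurable_fun [set: plane] (fun z : plane => (P + z.1 *: a : plane)%R).
  exact: (measurable_ray (X := fun=> P)).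
have mFX := measurableT_comp mF mX; have mFX1 := measurableT_comp mF mX1.
have mtw : measurable_fun [set: plane] (fun z : plane => (tri_weight z)%:E).
  by apply/measurable_EFinP; exact: measurable_tri_weight.
have tw0 z : 0 <= (tri_weight z)%:E :> \bar R by rewrite lee_fin tri_weight_ge0.
have mP k' := measurable_powR_dist (a := fun z : plane => F (P + z.1 *: a)%R) mFX1 (measurable_cst k').
have mK1 : measurable_fun [set: plane] (fun x : plane => (\1_K x)%:E : \bar R).
  by apply/measurable_EFinP; exact: measurable_indic.
pose Phi x := (\1_K x)%:E * (`|F x - k| `^ p)%:E.
have mPhi : measurable_fun [set: plane] Phi.
  by apply: emeasurable_funM => //; exact: measurable_powR_dist.
have Phi0 x : 0 <= Phi x by rewrite /Phi mule_ge0// lee_fin.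
have D1 := duffy P ab mPhi Phi0.
pose I1 z := (tri_weight z)%:E * (`|F (P + z.1 *: a + (z.1 * z.2) *: (b - a))%R - F (P + z.1 *: a)%R| `^ p)%:E.
pose I2 z := (tri_weight z)%:E * Phi (P + z.1 *: a + (z.1 * z.2) *: (b - a))%R.
have mI1 : measurable_fun [set: plane] I1.
  by apply: emeasurable_funM => //; exact: measurable_powR_dist.
have mI2 : measurable_fun [set: plane] I2.
  by apply: emeasurable_funM => //; exact: (measurableT_comp mPhi mX).
have I10 z : 0 <= I1 z by rewrite mule_ge0// lee_fin.
have I20 z : 0 <= I2 z by rewrite mule_ge0.
pose I3 (z : R * R) := (tri_weight z)%:E * (`|F (P + z.1 *: a)%R - k| `^ p)%:E.
have mI3 : measurable_fun [set: plane] I3 by apply: emeasurable_funM => //; exact: mP.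
have I30 z : 0 <= I3 z by rewrite mule_ge0// lee_fin.
have -> : \int[mu]_(r in `[0%R, 1%R]) (r%:E * (`|F (P + r *: a)%R - k| `^ p)%:E) = \int[mu2]_z I3 z.
  rewrite tonelli_plane// [LHS]integral_mkcond; apply: eq_integral => s _.
  rewrite patchE mem_setE in_itv /=; case: ifPn => s01; last first.
    by rewrite integral0_eq// => t _; rewrite /I3 /tri_weight /= (negbTE s01) mul0e.
  transitivity (\int[mu]_(t in `[0%R, 1%R]) (cst (s%:E * (`|F (P + s *: a)%R - k| `^ p)%:E)) t).
    rewrite integral_cst//= lebesgue_measure_itv /= lte_fin ltr01 oppr0 adde0.
    by rewrite mule1.
  rewrite [LHS]integral_mkcond; apply: eq_integral => t _.
  rewrite patchE mem_setE in_itv /= /I3 /tri_weight /= s01 /=; case: ifP => //.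
  by rewrite mul0e.
apply: (@le_trans _ _ (`|cross a b|%:E * \int[mu2]_z ((2 `^ p)%:E * (I1 z + I2 z)))).
  apply: lee_wpmul2l; first by rewrite lee_fin.
  apply: ge0_le_integral => //.
  - by apply: emeasurable_funM => //; exact: emeasurable_funD.
  move=> z _; rewrite /I1 /I2 /I3 -ge0_muleDr; [|by rewrite lee_fin powR_ge0|exact: Phi0].
  rewrite muleCA; have [zt|zt] := boolP ((0 <= z.1 <= 1)%R && (0 <= z.2 <= 1)%R); last first.
    by rewrite /tri_weight (negbTE zt) !mul0e.
  apply: lee_wpmul2l => //.
  rewrite /Phi indicE mem_set; last exact: triangle_in.
  rewrite mul1e -EFinD -EFinM lee_fin.
  have := powR_distD (F (P + z.1 *: a)%R) (F (P + z.1 *: a + (z.1 * z.2) *: (b - a))%R) k p1.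
  by rewrite [(`|F (P + _)%R - F (_ + _ *: (b - a))%R|)%R]distrC.
rewrite ge0_integralZl ?lee_fin ?powR_ge0//; last 2 first.
- exact: emeasurable_funD.
- by move=> z _; rewrite adde_ge0.
rewrite muleCA lee_wpmul2l ?lee_fin ?powR_ge0//.
by rewrite ge0_integralD// ge0_muleDr ?integral_ge0// leeD.
Qed.

End EdgeMeans.

Section IntervalMeans.
Context {R : realType}.
Notation mu := (@lebesgue_measure R).
Variables (g : R -> R) (p : R).
Hypothesis p1 : 1 <= p.
Hypothesis mg : measurable_fun [set: measurableTypeR R] g.
Local Open Scope ereal_scope.

Let mA : measurable (`[0%R, 1%R]%classic : set (measurableTypeR R)).
Proof. exact: measurable_itv. Qed.

Let mI : mu `[0%R, 1%R]%classic = 1.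
Proof. by rewrite lebesgue_measure_itv /= lte_fin ltr01 oppr0 adde0. Qed.

Lemma measurable_powR_norm : measurable_fun [set: measurableTypeR R] (fun r => (`|g r| `^ p)%:E).
Proof.
apply/measurable_EFinP; apply: (measurableT_comp (measurable_powR p)).
exact: (measurableT_comp (@normr_measurable R setT)).
Qed.

Lemma mean_powR_le : mu.-integrable `[0%R, 1%R] (EFin \o g) ->
  (`|\int[mu]_(r in `[0%R, 1%R]) g r|%R `^ p)%:E <= \int[mu]_(r in `[0%R, 1%R]) (`|g r| `^ p)%:E.
Proof.
move=> ig.
have I1 : mu `[0%R, 1%R]%classic <= 1 by rewrite mI.
apply: le_trans (integral_powR_le p1 mA I1 mg).
have fin : (\int[mu]_(s in `[0%R, 1%R]) `|g s|%:E) \is a fin_num.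
  rewrite ge0_fin_numE; last exact: integral_ge0.
  by have /integrableP[] := ig.
rewrite -(fineK fin) poweR_EFin lee_fin ge0_ler_powR//.
- exact: le_trans p1.
- by rewrite nnegrE fine_ge0// integral_ge0.
have J' := le_normr_Rintegral mA ig; exact: J'.
Qed.

(** Each ramp degenerates at one end of the edge and is estimated from that end by
    [weighted_edge]. *)
Lemma integral_split_ramps :
  \int[mu]_(r in `[0%R, 1%R]) (`|g r| `^ p)%:E =
    \int[mu]_(r in `[0%R, 1%R]) (r%:E * (`|g r| `^ p)%:E) +
    \int[mu]_(r in `[0%R, 1%R]) ((1 - r)%:E * (`|g r| `^ p)%:E).
Proof.
have mP := measurable_powR_norm.
rewrite -ge0_integralD; [|exact: mA| | | |].
- apply: eq_integral => r; rewrite inE /= in_itv /= => /andP[r0 r1].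
  by rewrite -!EFinM -EFinD; congr EFin; ring.
- by move=> r; rewrite /= in_itv /= => /andP[r0 _]; rewrite mule_ge0 ?lee_fin ?powR_ge0.
- apply: measurable_funTS; apply: emeasurable_funM => //.
- by move=> r; rewrite /= in_itv /= => /andP[_ r1]; rewrite mule_ge0 ?lee_fin ?powR_ge0 ?subr_ge0.
- apply: measurable_funTS; apply: emeasurable_funM => //.
  by apply/measurable_EFinP; exact: measurable_funB.
Qed.

Lemma integral_reverse_ramp :
  \int[mu]_(r in `[0%R, 1%R]) (r%:E * (`|g (1 - r)| `^ p)%:E) =
  \int[mu]_(r in `[0%R, 1%R]) ((1 - r)%:E * (`|g r| `^ p)%:E).
Proof.
have mr : measurable_fun [set: measurableTypeR R] (fun r => g (1 - r)%R).
  by apply: (measurableT_comp mg); exact: measurable_funB.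
rewrite integral_mkcond [RHS]integral_mkcond.
pose H := (fun r : measurableTypeR R => (r%:E * (`|g (1 - r)| `^ p)%:E)) \_ `[0%R, 1%R].
have mH : measurable_fun setT H.
  apply/(measurable_restrictT _ mA); apply: measurable_funTS.
  apply: emeasurable_funM => //; apply/measurable_EFinP; apply: (measurableT_comp (measurable_powR p)).
  exact: (measurableT_comp (@normr_measurable R setT)).
have H0 r : 0 <= H r.
  rewrite /H patchE mem_setE in_itv /=; case: ifP => // /andP[r0 _].
  by rewrite mule_ge0 ?lee_fin ?powR_ge0.
have n1 : (-1 != 0 :> R)%R by rewrite oppr_eq0 oner_eq0.
rewrite (ge0_integral_affine (c := (-1)%R) 1 n1 mH H0) normrN normr1 mul1e.
apply: eq_integral => r _; rewrite /H !patchE !mem_setE !in_itv /= mulN1r addrC.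
rewrite subr_ge0 lerBlDl lerDr andbC; case: ifP => // _.
by rewrite (_ : (1 - (1 - r) = r)%R); last by ring.
Qed.

End IntervalMeans.

Section EdgeMeans.
Context {R : realType}.
Notation mu := (@lebesgue_measure R).
Notation mu2 := (@lebesgue2 R).
Notation plane := (measurableTypeR R * measurableTypeR R)%type.
Variables (K : set (R * R)) (F : R * R -> R) (p : R).
Hypothesis p1 : 1 <= p.
Hypothesis mF : measurable_fun [set: plane] F.
Hypothesis mK : measurable (K : set plane).
Hypothesis convK : forall X Y t, K X -> K Y -> 0 <= t <= 1 -> K (X + t *: (Y - X)).
Local Open Scope ereal_scope.

(** [weighted_edge] is used from both ends of the edge with the same third vertex P + b. The two
    weights add up to 1, which gives the factor 2, and Jensen passes from the values to their
    mean. *)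
Lemma edge_mean (P a b : R * R) (E : \bar R) (k : R) : cross a b != 0%R ->
  K P -> K (P + a)%R -> K (P + b)%R ->
  mu.-integrable `[0%R, 1%R] (fun r => (F (P + r *: a)%R)%:E) ->
  `|cross a b|%:E * \int[mu2]_z ((tri_weight z)%:E *
     (`|F (P + z.1 *: a + (z.1 * z.2) *: (b - a))%R - F (P + z.1 *: a)%R| `^ p)%:E) <= E ->
  `|cross a b|%:E * \int[mu2]_z ((tri_weight z)%:E *
     (`|F (P + a + z.1 *: - a + (z.1 * z.2) *: (b - a - - a))%R - F (P + a + z.1 *: - a)%R| `^ p)%:E) <= E ->
  `|cross a b|%:E * (`|\int[mu]_(r in `[0%R, 1%R]) F (P + r *: a)%R - k|%R `^ p)%:E <=
  (2 * 2 `^ p)%:E * (E + power_dist K F p k).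
Proof.
move=> ab KP Ka Kb iF E1 E2.
have E0 : 0 <= E.
  apply: le_trans E1; rewrite mule_ge0 ?lee_fin//; apply: integral_ge0 => z _.
  by rewrite mule_ge0 ?lee_fin ?tri_weight_ge0 ?powR_ge0.
have P0 : 0 <= power_dist K F p k.
  by apply: integral_ge0 => x _; rewrite mule_ge0 ?lee_fin ?powR_ge0.
have ab' : cross (- a)%R (b - a)%R = (- cross a b)%R by rewrite /cross /=; ring.
have W1 := weighted_edge p1 mF mK convK k ab KP Ka Kb E1.
have := @weighted_edge _ _ _ _ p1 mF mK convK (P + a)%R (- a)%R (b - a)%R E k.
rewrite ab' normrN oppr_eq0 addrK => /(_ ab Ka KP).
have -> : (P + a + (b - a) = P + b)%R by vec.
move=> /(_ Kb E2) W2; clear E1 E2.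
have mA : measurable (`[0%R, 1%R]%classic : set (measurableTypeR R)) by exact: measurable_itv.
pose g r := (F (P + r *: a) - k)%R.
have mg : measurable_fun [set: measurableTypeR R] g.
  apply: measurable_funB => //; apply: (measurableT_comp mF).
  exact: (measurable_ray (X := fun=> P)).
have ik : mu.-integrable `[0%R, 1%R] (EFin \o (fun _ : R => k)).
  apply/integrableP; split; first exact: measurable_cst.
  by rewrite integral_cst//= lebesgue_measure_itv /= lte_fin ltr01 -EFinB -EFinM ltry.
have ig : mu.-integrable `[0%R, 1%R] (EFin \o g) by exact: integrable_EFinB.
have gE : (\int[mu]_(r in `[0%R, 1%R]) F (P + r *: a) - k = \int[mu]_(r in `[0%R, 1%R]) g r)%R.
  rewrite /g RintegralB//.
  by rewrite Rintegral_cst//= lebesgue_measure_itv /= lte_fin ltr01 oppr0 adde0 /= mulr1.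
have E3 : \int[mu]_(r in `[0%R, 1%R]) (r%:E * (`|F (P + a + r *: - a)%R - k| `^ p)%:E) =
  \int[mu]_(r in `[0%R, 1%R]) ((1 - r)%:E * (`|g r| `^ p)%:E).
  rewrite -(integral_reverse_ramp p mg); apply: eq_integral => r _.
  by do 4 f_equal; rewrite /g; do 2 f_equal; vec.
rewrite gE; apply: (@le_trans _ _ (`|cross a b|%:E * \int[mu]_(r in `[0%R, 1%R]) (`|g r| `^ p)%:E)).
  by apply: lee_wpmul2l; [rewrite lee_fin|exact: mean_powR_le].
rewrite (integral_split_ramps p mg) ge0_muleDr; last 2 first.
- by apply: integral_ge0 => r; rewrite /= in_itv /= => /andP[r0 _]; rewrite mule_ge0 ?lee_fin ?powR_ge0.
- by apply: integral_ge0 => r; rewrite /= in_itv /= => /andP[_ r1]; rewrite mule_ge0 ?lee_fin ?powR_ge0 ?subr_ge0.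
rewrite -E3 mulrDl mul1r EFinD ge0_muleDl; [|by rewrite lee_fin powR_ge0|by rewrite lee_fin powR_ge0].
exact: (leeD W1 W2).
Qed.

End EdgeMeans.

(** * Poincare inequality and edge means on homothetic copies *)

Section HomotheticEstimates.
Context {R : realType}.
Notation mu := (@lebesgue_measure R).
Notation mu2 := (@lebesgue2 R).
Notation plane := (measurableTypeR R * measurableTypeR R)%type.
Variables (D K : set (R * R)) (f f1 f2 G : R * R -> R) (p h : R).
Hypothesis oD : open D.
Hypothesis convK : forall X Y t, K X -> K Y -> 0 <= t <= 1 -> K (X + t *: (Y - X)).
Hypothesis h01 : 0 < h <= 2^-1.
Hypothesis homD : forall X y, K X -> D y -> D (hom h X y).
Hypothesis wd1 : plane_wd D (e1 R) f f1.
Hypothesis wd2 : plane_wd D (e2 R) f f2.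
Hypothesis mG : measurable_fun [set: plane] G.
Hypothesis G0 : forall x, 0 <= G x.
Hypothesis p1 : 1 <= p.
Hypothesis mK : measurable (K : set plane).
Hypothesis KG : forall X Y, K X -> K Y -> gradient_le f1 f2 G (Y - X) 1.
Local Open Scope ereal_scope.

Definition energy : \bar R := \int[mu2]_x (G x `^ p)%:E.

Let h01' : (0 < h < 1)%R. Proof. by have /andP[? ?] := h01; apply/andP; split => //; lra. Qed.

Let mGp : measurable_fun [set: plane] (fun x : plane => (G x `^ p)%:E).
Proof. by apply/measurable_EFinP; exact: (measurableT_comp (measurable_powR p) mG). Qed.

Let Gp0 x : 0 <= (G x `^ p)%:E. Proof. by rewrite lee_fin powR_ge0. Qed.

Let mf : measurable_fun [set: plane] f.
Proof. by case: wd1 => /integrableP[/measurable_EFinP]. Qed.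

Lemma energy_ge0 : 0 <= energy. Proof. exact: integral_ge0. Qed.

Lemma measurable_energy_hom y : measurable_fun [set: plane] (fun X : plane => (G (hom h X y) `^ p)%:E).
Proof. exact: (measurableT_comp mGp (@measurable_homl R h y)). Qed.

(** The ratio 1 - h is at least 1/2, hence the factor 4 in the plane. *)
Lemma energy_hom_le y : \int[mu2]_X (G (hom h X y) `^ p)%:E <= 4%:E * energy.
Proof.
have /andP[h0 h1] := h01.
have := @integral_homothety_le _ (h *: y)%R (1 - h)%R 4 (fun x => (G x `^ p)%:E) _ _ mGp Gp0.
rewrite (_ : (fun x => (G (h *: y + _)%R `^ p)%:E) = fun X => (G (hom h X y) `^ p)%:E).
  by apply; [lra|nra].
by apply/funext => X; rewrite /hom addrC.
Qed.

(** Provides the quantity E of [edge_mean]. The chord from P + z.1 a to P + z.1 b has direction z.1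
    (b - a), so the line estimate yields a factor c = z.1: this is Duffy's weight for the integral
    along the chord, while the weight already present is bounded by 1. *)
Lemma ae_link (P a b : R * R) : cross a b != 0%R -> K P -> K (P + a)%R -> K (P + b)%R ->
  {ae mu2, forall y, D y ->
    `|cross a b|%:E * \int[mu2]_z ((tri_weight z)%:E *
     (`|f (hom h (P + z.1 *: a + (z.1 * z.2) *: (b - a))%R y) - f (hom h (P + z.1 *: a)%R y)| `^ p)%:E)
    <= 4%:E * energy}.
Proof.
move=> ab KP Ka Kb.
have mX1 : measurable_fun [set: plane] (fun z : plane => (P + z.1 *: a : plane)%R).
  exact: (measurable_ray (X := fun=> P)).
have mw : measurable_fun [set: plane] (fun z : plane => (z.1 *: (b - a) : plane)%R).
  have := @measurable_ray _ _ plane (fun=> 0%R) (b - a)%R fst (measurable_cst _) measurable_fst.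
  by apply: eq_measurable_fun => z _; rewrite add0r.
have KX z r : (0 < tri_weight z)%R -> (0 <= r <= 1)%R ->
    [/\ K (P + z.1 *: a + (r * z.1) *: (b - a))%R, (0 <= z.1 <= 1)%R & (0 <= z.2 <= 1)%R].
  rewrite /tri_weight; case: ifP; last by rewrite ltxx.
  move=> /andP[z1 z2] _ r01; split => //; rewrite mulrC.
  by apply: (@triangle_in _ _ convK P a b (z.1, r)) => //=; rewrite z1.
have adm (z : plane) : (0 < tri_weight z)%R ->
   [/\ K (P + z.1 *: a)%R, K (P + z.1 *: a + z.1 *: (b - a))%R, (0 <= 0 :> R)%R, (0 <= z.2)%R & (z.2 <= 1)%R] /\
   ((0 <= z.1 <= 1)%R /\ gradient_le f1 f2 G (z.1 *: (b - a))%R z.1).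
  move=> kz; have [K0 z1 /andP[z20 z21]] := KX z 0%R kz (introT andP (conj (lexx _) ler01)).
  have [K1 _ _] := KX z 1%R kz (introT andP (conj ler01 (lexx _))).
  split; first split => //.
  - by move: K0; rewrite mul0r scale0r addr0.
  - by move: K1; rewrite mul1r.
  split => // x; rewrite /= /GRing.scale /=.
  have := KG Ka Kb x; rewrite (_ : (P + b - (P + a) = b - a)%R); last by vec.
  rewrite mul1r -!mulrA -mulrDr normrM => H; have /andP[z10 _] := z1.
  by rewrite ger0_norm// ler_wpM2l.
have H := ae_lines_powR oD convK h01' homD wd1 wd2 mG G0 p1 (@plane_measure R) (X := fun z => (P + z.1 *: a)%R)
  (w := fun z => (z.1 *: (b - a))%R) (t0 := fun=> 0%R) (t1 := snd) (c := fst) (k := tri_weight)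
  mX1 mw (measurable_cst _) measurable_snd measurable_fst (@measurable_tri_weight R) (@tri_weight_ge0 R) adm.
apply: (ae2_imp H) => y Hy Dy; have {Hy} [mQ] := Hy Dy.
have -> : (fun z : plane => (tri_weight z * `|f (hom h (P + z.1 *: a + z.2 *: (z.1 *: (b - a))) y) -
   f (hom h (P + z.1 *: a + 0 *: (z.1 *: (b - a))) y)| `^ p)%:E) = (fun z => (tri_weight z)%:E *
     (`|f (hom h (P + z.1 *: a + (z.1 * z.2) *: (b - a))%R y) - f (hom h (P + z.1 *: a)%R y)| `^ p)%:E).
  by apply/funext => z; rewrite EFinM scale0r addr0 scalerA [(z.2 * z.1)%R]mulrC.
move=> Hy; apply: le_trans (energy_hom_le y).
have mPsi : measurable_fun [set: plane] (fun X : plane => (G (hom h X y) `^ p)%:E).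
  exact: measurable_energy_hom.
apply: le_trans (duffy P ab mPsi (fun X => Gp0 _)).
apply: lee_wpmul2l; first by rewrite lee_fin.
apply: le_trans Hy _.
have mX2 : measurable_fun [set: plane] (fun z : plane => (P + z.1 *: a + (z.1 * z.2) *: (b - a) : plane)%R).
  apply: (measurable_ray (X := fun z : plane => (P + z.1 *: a)%R)) => //; exact: measurable_funM.
pose A (s : R) := \int[mu]_(t in `[0%R, 1%R]) (G (hom h (P + s *: a + (s * t) *: (b - a))%R y) `^ p)%:E.
pose L (z : R * R) := (tri_weight z)%:E * (G (hom h (P + z.1 *: a + (z.1 * z.2) *: (b - a))%R y) `^ p)%:E.
have mtw : measurable_fun [set: plane] (fun z : plane => (tri_weight z)%:E).
  by apply/measurable_EFinP; exact: measurable_tri_weight.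
have mL : measurable_fun [set: plane] L.
  by apply: emeasurable_funM => //; exact: (measurableT_comp mPsi mX2).
have tw0 z : 0 <= (tri_weight z)%:E :> \bar R by rewrite lee_fin tri_weight_ge0.
have L0 z : 0 <= L z by rewrite mule_ge0.
have A0 s : 0 <= A s by apply: integral_ge0 => t _; exact: Gp0.
have AL s : (0 <= s <= 1)%R -> s%:E * A s = \int[mu]_t L (s, t).
  move=> /andP[s0 s1]; rewrite /A -ge0_integralZl//; last first.
    apply: measurable_funTS; apply: (measurableT_comp mPsi).
    apply: (measurable_ray (X := fun=> (P + s *: a)%R)) => //; exact: mulrl_measurable.
  rewrite [LHS]integral_mkcond; apply: eq_integral => t _.
  rewrite patchE mem_setE in_itv /L /tri_weight /= s0 s1 /=; case: ifP => //.
  by rewrite mul0e.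
have mL1 := measurable_fun_fubini_tonelli_F (m2 := mu) L mL L0.
rewrite [leRHS]tonelli_plane//.
pose B s := \int[mu]_t L (s, t).
have B0 s : 0 <= B s by exact: integral_ge0.
have m01 : measurable (`[0%R, 1%R]%classic : set (measurableTypeR R)) by exact: measurable_itv.
have mI : measurable_fun [set: measurableTypeR R] (fun t : R => (\1_`[0%R, 1%R]%classic t)%:E : \bar R).
  by apply/measurable_EFinP; exact: measurable_indic.
have mR : measurable_fun [set: plane] (fun z : plane => (\1_`[0%R, 1%R]%classic z.2)%:E * B z.1).
  apply: emeasurable_funM; first exact: (measurableT_comp mI measurable_snd).
  exact: (measurableT_comp mL1 measurable_fst).
have R0 (z : plane) : 0 <= (\1_`[0%R, 1%R]%classic z.2)%:E * B z.1 by rewrite mule_ge0// lee_fin.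
(* The upper limit z.2 of the inner integral is raised to 1; then z.2 only runs through an interval
   of length 1. *)
apply: (@le_trans _ _ (\int[mu2]_z ((\1_`[0%R, 1%R]%classic z.2)%:E * B z.1))).
  apply: ge0_le_integral => //.
  - move=> z _; have [kz|kz] := ltP 0%R (tri_weight z); last first.
      by rewrite (_ : tri_weight z = 0%R) ?mul0e//; apply/eqP; rewrite eq_le kz tri_weight_ge0.
    have [_ /andP[z10 _] _] := KX z 0%R kz (introT andP (conj (lexx _) ler01)).
    rewrite !mule_ge0// ?lee_fin//; apply: integral_ge0 => t _; exact: Gp0.
  move=> z _; have [kz|kz] := ltP 0%R (tri_weight z); last first.
    by rewrite (_ : tri_weight z = 0%R) ?mul0e//; apply/eqP; rewrite eq_le kz tri_weight_ge0.
  have [_ /andP[z10 z11] /andP[z20 z21]] := KX z 0%R kz (introT andP (conj (lexx _) ler01)).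
  rewrite indicE mem_set/=; last by rewrite in_itv /= z20.
  rewrite mul1e /B -AL ?z10//.
  rewrite /tri_weight z10 z11 z20 z21 /=; apply: lee_wpmul2l; first by rewrite lee_fin.
  rewrite -[leRHS]mul1e; apply: lee_pmul.
  - by rewrite lee_fin.
  - by apply: integral_ge0 => t _; exact: Gp0.
  - by rewrite lee_fin.
  - rewrite /A (_ : (fun s => (G (hom h (P + z.1 *: a + s *: _)%R y) `^ p)%:E) =
      fun t => (G (hom h (P + z.1 *: a + (z.1 * t) *: (b - a))%R y) `^ p)%:E); last first.
      by apply/funext => t; rewrite scalerA mulrC.
    apply: ge0_subset_integral => //.
    + apply: measurable_funTS; apply: (measurableT_comp mPsi).
      apply: (measurable_ray (X := fun=> (P + z.1 *: a)%R)) => //; exact: mulrl_measurable.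
    + by move=> t /=; rewrite !in_itv /= => /andP[-> t1]; exact: le_trans t1 z21.
rewrite tonelli_plane//.
apply: ge0_le_integral => //.
- by move=> s _; exact: integral_ge0.
- exact: (measurable_fun_fubini_tonelli_F (m2 := mu) _ mR R0).
move=> s _ /=; rewrite ge0_integralZr//.
by rewrite integral_indic01 mul1e.
Qed.

(** One of s and 1 - s is at least 1/2, and the substitution is made in the end point with that
    coefficient. Together with 1 - h >= 1/2 the ratio is at least 1/4, hence 16; the other end point
    contributes the measure of K. *)
Lemma segment_energy_le y s : (0 <= s <= 1)%R ->
  \int[mu2]_X1 \int[mu2]_X2 ((\1_K X1 * \1_K X2)%:E * (G (hom h (X1 + s *: (X2 - X1))%R y) `^ p)%:E)
   <= mu2 K * (16%:E * energy).
Proof.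
move=> /andP[s0 s1]; have /andP[h0 h1] := h01.
pose H (z : plane * plane) := (\1_K z.1 * \1_K z.2)%:E * (G (hom h (z.1 + s *: (z.2 - z.1))%R y) `^ p)%:E.
have mK1 : measurable_fun setT (fun X : plane => \1_K X : measurableTypeR R) by exact: measurable_indic.
have mKE : measurable_fun setT (fun X : plane => (\1_K X)%:E : \bar R) by exact/measurable_EFinP.
have mH : measurable_fun setT H.
  apply: emeasurable_funM.
    apply/measurable_EFinP; apply: measurable_funM.
      exact: (measurableT_comp mK1 measurable_fst).
    exact: (measurableT_comp mK1 measurable_snd).
  apply: (measurableT_comp mGp); apply: measurable_hom.
  apply: (measurable_lin (X := fst) (w := fun z : plane * plane => (z.2 - z.1)%R) (t := fun=> s)) => //.
  apply: measurable_fun_pair; rewrite /=.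
    apply: measurable_funB; apply: (measurableT_comp measurable_fst); [exact: measurable_snd|exact: measurable_fst].
  apply: measurable_funB; apply: (measurableT_comp measurable_snd); [exact: measurable_snd|exact: measurable_fst].
have H0 z : 0 <= H z by rewrite mule_ge0.
have E0 := energy_ge0.
have key (c : R * R) (r : R) : (2^-1 <= r)%R ->
    \int[mu2]_X (G (c + ((1 - h) * r) *: X)%R `^ p)%:E <= 16%:E * energy.
  move=> r1; apply: (@integral_homothety_le _ c ((1 - h) * r) 16 (fun x => (G x `^ p)%:E)) => //.
    by nra.
  have q : (4^-1 <= (1 - h) * r)%R by nra.
  by rewrite expr2; nra.
have sum1 (J : R * R -> \bar R) : measurable_fun [set: plane] J -> (forall x, 0 <= J x) ->
    (forall X, J X <= (\1_K X)%:E * (16%:E * energy)) -> \int[mu2]_X J X <= mu2 K * (16%:E * energy).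
  move=> mJ J0 JK; apply: (@le_trans _ _ (\int[mu2]_X ((\1_K X)%:E * (16%:E * energy)))).
    apply: ge0_le_integral; [exact: measurableT|by move=> x _|exact: mJ| |by move=> x _].
    by apply: emeasurable_funM => //; exact: measurable_cst.
  by rewrite integral_indicZ ?mule_ge0.
have mGc (c : R * R) (r : R) : measurable_fun [set: plane] (fun X : plane => (G (c + ((1 - h) * r) *: X)%R `^ p)%:E).
  exact: (measurableT_comp mGp (measurable_affine2 c ((1 - h) * r))).
have [s2|s2] := leP s (2^-1)%R.
  rewrite (tonelli_plane2_sym mH H0); apply: sum1.
  - exact: (measurable_fun_fubini_tonelli_G (m1 := @plane_measure R) H mH H0).
  - by move=> X; apply: integral_ge0 => x _; exact: H0.
  move=> X2; rewrite /H /=; have r1 : (2^-1 <= 1 - s)%R by lra.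
  apply: le_trans (lee_wpmul2l _ (key ((1 - h) * s *: X2 + h *: y)%R (1 - s)%R r1)); last first.
    by rewrite lee_fin.
  rewrite (ge0_integral_scale _ (mGc _ _) (fun X => Gp0 _)); last by [].
  apply: ge0_le_integral => //.
  - by move=> X1 _; exact: (H0 (X1, X2)).
  - exact: (measurableT_comp mH (@measurable_pair2 _ _ plane plane X2)).
  - by apply: emeasurable_funM => //; exact: measurable_cst.
  move=> X1 _; rewrite EFinM -muleA [leRHS](_ : _ = 1 * ((\1_K X2)%:E *
      (G ((1 - h) * s *: X2 + h *: y + (1 - h) * (1 - s) *: X1)%R `^ p)%:E)); last by rewrite mul1e.
  apply: lee_pmul.
  - by rewrite lee_fin.
  - by rewrite mule_ge0.
  - by rewrite lee_fin indicE; case: (_ \in _).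
  apply: lee_wpmul2l; first by rewrite lee_fin.
  by rewrite (_ : hom _ _ _ = ((1 - h) * s *: X2 + h *: y + (1 - h) * (1 - s) *: X1)%R)//; rewrite /hom; vec.
apply: sum1.
- exact: measurable_tonelli_plane2 mH H0.
- by move=> X; apply: integral_ge0 => x _; exact: (H0 (X, x)).
move=> X1; have r1 : (2^-1 <= s)%R by exact: ltW.
apply: le_trans (lee_wpmul2l _ (key ((1 - h) * (1 - s) *: X1 + h *: y)%R s r1)); last first.
  by rewrite lee_fin.
rewrite (ge0_integral_scale _ (mGc _ _) (fun X => Gp0 _)); last by [].
apply: ge0_le_integral => //.
- by move=> X2 _; exact: (H0 (X1, X2)).
- exact: (measurableT_comp mH (@measurable_pair1 _ _ plane plane X1)).
- by apply: emeasurable_funM => //; exact: measurable_cst.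
move=> X2 _; rewrite EFinM -muleA; apply: lee_wpmul2l; first by rewrite lee_fin.
rewrite -[leRHS]mul1e; apply: lee_pmul.
- by rewrite lee_fin.
- exact: Gp0.
- by rewrite lee_fin indicE; case: (_ \in _).
by rewrite (_ : hom _ _ _ = ((1 - h) * (1 - s) *: X1 + h *: y + (1 - h) * s *: X2)%R)//; rewrite /hom; vec.
Qed.

(** Integration over all pairs of points of the convex set K: the difference of the values is
    bounded along the connecting segment, and [segment_energy_le] is applied at each parameter s. No
    diameter appears since G bounds the derivative along every chord. *)
Lemma ae_poincare : {ae mu2, forall y, D y ->
  \int[mu2]_X ((\1_K X)%:E * power_dist K (fun x => f (hom h x y)) p (f (hom h X y))) <=
    mu2 K * (16%:E * energy)}.
Proof.
pose nu := product_measure (@plane_measure R) (@plane_measure R).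
have mK1 : measurable_fun setT (fun X : plane => \1_K X : measurableTypeR R) by exact: measurable_indic.
have mk : measurable_fun setT (fun z : plane * plane => (\1_K z.1 * \1_K z.2 : measurableTypeR R)%R).
  apply: measurable_funM.
    exact: (measurableT_comp mK1 measurable_fst).
  exact: (measurableT_comp mK1 measurable_snd).
have mw : measurable_fun setT (fun z : plane * plane => (z.2 - z.1 : plane)%R).
  apply: measurable_fun_pair; rewrite /=.
    apply: measurable_funB; apply: (measurableT_comp measurable_fst); [exact: measurable_snd|exact: measurable_fst].
  apply: measurable_funB; apply: (measurableT_comp measurable_snd); [exact: measurable_snd|exact: measurable_fst].
have k0 (z : plane * plane) : (0 <= \1_K z.1 * \1_K z.2 :> R)%R by rewrite mulr_ge0.
have adm (z : plane * plane) : (0 < \1_K z.1 * \1_K z.2 :> R)%R ->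
   [/\ K z.1, K (z.1 + (z.2 - z.1))%R, (0 <= 0 :> R)%R, (0 <= 1 :> R)%R & (1 <= 1 :> R)%R] /\
   ((0 <= (1 : R) <= 1)%R /\ gradient_le f1 f2 G (z.2 - z.1)%R 1).
  rewrite !indicE; case: (boolP (z.1 \in K)); rewrite ?inE ?mul0r ?ltxx// => z1.
  case: (boolP (z.2 \in K)); rewrite ?inE ?mulr0 ?ltxx// => z2 _.
  by split; split => //; [rewrite addrC subrK|rewrite ler01 lexx|exact: KG].
have H := ae_lines_powR oD convK h01' homD wd1 wd2 mG G0 p1 nu
  (X := fst) (w := fun z => (z.2 - z.1)%R) (t0 := fun=> 0%R) (t1 := fun=> 1%R) (c := fun=> 1%R)
  (k := fun z => (\1_K z.1 * \1_K z.2)%R) measurable_fst mw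
  (measurable_cst _) (measurable_cst _) (measurable_cst _) mk k0 adm.
apply: (ae2_imp H) => y Hy Dy; have {Hy} [mQ Hy] := Hy Dy.
pose L (z : plane * plane) := ((\1_K z.1 * \1_K z.2) * `|f (hom h z.2 y) - f (hom h z.1 y)| `^ p)%:E.
have mfh : measurable_fun [set: plane] (fun X : plane => f (hom h X y) : measurableTypeR R).
  exact: (measurableT_comp mf (@measurable_homl R h y)).
have mL : measurable_fun setT L.
  apply/measurable_EFinP; apply: measurable_funM => //.
  apply: (measurableT_comp (measurable_powR p)); apply: (measurableT_comp (@normr_measurable R setT)).
  apply: measurable_funB; [exact: (measurableT_comp mfh measurable_snd)|exact: (measurableT_comp mfh measurable_fst)].
have L0 z : 0 <= L z by rewrite lee_fin mulr_ge0// powR_ge0.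
have -> : \int[mu2]_X ((\1_K X)%:E * power_dist K (fun x => f (hom h x y)) p (f (hom h X y))) =
    \int[nu]_z L z.
  rewrite (tonelli_plane2 mL L0); apply: eq_integral => X _; rewrite -ge0_integralZl//.
  - by apply: eq_integral => X' _; rewrite /L /= muleA -!EFinM.
  - apply: emeasurable_funM; first exact/measurable_EFinP.
    apply/measurable_EFinP; apply: (measurableT_comp (measurable_powR p)).
    by apply: (measurableT_comp (@normr_measurable R setT)); exact: measurable_funB.
have -> : \int[nu]_z L z = \int[nu]_z (\1_K z.1 * \1_K z.2 * `|f (hom h (z.1 + 1 *: (z.2 - z.1)) y) -
     f (hom h (z.1 + 0 *: (z.2 - z.1)) y)| `^ p)%:E.
  by apply: eq_integral => z _; rewrite /L scale1r scale0r addr0 [(z.1 + _)%R]addrC subrK.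
apply: le_trans Hy _.
pose S (u : (plane * plane) * measurableTypeR R) := (\1_K u.1.1 * \1_K u.1.2)%:E *
  ((\1_`[0%R, 1%R]%classic u.2)%:E * (G (hom h (u.1.1 + u.2 *: (u.1.2 - u.1.1))%R y) `^ p)%:E).
have m01 : measurable (`[0%R, 1%R]%classic : set (measurableTypeR R)) by exact: measurable_itv.
have mI : measurable_fun [set: measurableTypeR R] (fun t : R => (\1_`[0%R, 1%R]%classic t)%:E : \bar R).
  by apply/measurable_EFinP; exact: measurable_indic.
have mS : measurable_fun setT S.
  apply: emeasurable_funM.
    by apply/measurable_EFinP; exact: (measurableT_comp mk measurable_fst).
  apply: emeasurable_funM; first exact: (measurableT_comp mI measurable_snd).
  apply: (measurableT_comp (measurable_energy_hom y)).
  apply: (measurable_lin (X := fun u : (plane * plane) * measurableTypeR R => u.1.1)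
    (w := fun u => (u.1.2 - u.1.1)%R) (t := snd)) => //.
  - exact: (measurableT_comp measurable_fst measurable_fst).
  - exact: (measurableT_comp mw measurable_fst).
have S0 u : 0 <= S u by rewrite !mule_ge0.
have SE z : (\1_K z.1 * \1_K z.2)%:E * (1%:E * \int[mu]_(s in `[0%R, 1%R]) (G (hom h (z.1 + s *: (z.2 - z.1))%R y) `^ p)%:E) =
   \int[mu]_s S (z, s).
  rewrite mul1e -ge0_integralZl//; last first.
    apply: measurable_funTS; apply: (measurableT_comp (measurable_energy_hom y)).
    exact: (measurable_ray (X := fun=> z.1)).
  rewrite [LHS]integral_mkcond; apply: eq_integral => s _.
  rewrite patchE /S /= [in RHS](_ : \1_`[0%R, 1%R]%classic s = (s \in `[0%R, 1%R]%classic)%:R); last by rewrite indicE.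
  by case: ifP => _; rewrite ?mul1e// mul0e mule0.
rewrite (eq_integral (fun z => \int[mu]_s S (z, s))); last by move=> z _; exact: SE.
rewrite (fubini_tonelli (m1 := nu) (m2 := mu) S mS S0).
apply: (@le_trans _ _ (\int[mu]_s ((\1_`[0%R, 1%R]%classic s)%:E * (mu2 K * (16%:E * energy))))).
  apply: ge0_le_integral; first exact: measurableT.
  - by move=> s _; exact: integral_ge0.
  - exact: (measurable_fun_fubini_tonelli_G (m1 := nu) S mS S0).
  - by apply: emeasurable_funM => //; exact: measurable_cst.
  move=> s _; rewrite tonelli_plane2//; last first.
    exact: (measurableT_comp mS (@measurable_pair2 _ _ (plane * plane)%type (measurableTypeR R) s)).
  have [s01|s01] := boolP (0 <= s <= 1)%R; last first.
    rewrite integral0_eq; first by rewrite !mule_ge0 ?energy_ge0.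
    move=> X1 _; rewrite integral0_eq// => X2 _.
    rewrite /S /= [X in X%:E * (_ `^ p)%:E](_ : _ = 0%R) ?mul0e ?mule0//.
    by rewrite indicE memNset//= in_itv /=; exact/negP.
  rewrite [\1_`[0%R, 1%R]%classic s]indicE mem_set/= ?in_itv// mul1e.
  apply: le_trans (segment_energy_le y s01).
  rewrite le_eqVlt; apply/orP; left; apply/eqP; apply: eq_integral => X1 _; apply: eq_integral => X2 _.
  rewrite /S /= [X in _ * (X%:E * (_ `^ p)%:E)](_ : _ = 1%R) ?mul1e//.
  by rewrite indicE mem_set//= in_itv.
rewrite ge0_integralZr//; last by rewrite !mule_ge0// energy_ge0.
by rewrite integral_indic01 mul1e.
Qed.

Lemma ae_integrable_edge (P a : R * R) :
  {ae mu2, forall y, mu.-integrable `[0%R, 1%R] (fun r => (f (hom h (P + r *: a)%R y))%:E)}.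
Proof.
have [if1 _ _] := wd1.
have hn0 : h != 0%R by have /andP[h0 _] := h01; rewrite gt_eqF.
have := ae2_affine ((1 - h) *: P)%R hn0 (ae_integrable_line ((1 - h) *: a)%R 0%R 1%R if1).
move=> H; apply: (ae2_imp H) => y; apply: eq_integrable => // r _.
by congr (f _)%:E; rewrite /hom; vec.
Qed.

(** [edge_mean] is integrated over the comparison values k = F X with X in K, and [ae_poincare]
    bounds the remaining double integral. The constant is 2 * 2^p * (4 + 16). *)
Lemma ae_edge_mean (P a b : R * R) : cross a b != 0%R -> K P -> K (P + a)%R -> K (P + b)%R ->
  {ae mu2, forall y, D y ->
    mu.-integrable `[0%R, 1%R] (fun r => (f (hom h (P + r *: a)%R y))%:E) /\
    `|cross a b|%:E * power_dist K (fun x => f (hom h x y)) p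
       (\int[mu]_(r in `[0%R, 1%R]) f (hom h (P + r *: a) y))%R <=
    (40 * 2 `^ p)%:E * (mu2 K * energy)}.
Proof.
move=> ab KP Ka Kb; have E0 := energy_ge0.
have ab' : cross (- a)%R (b - a)%R != 0%R.
  by rewrite (_ : cross _ _ = - cross a b)%R ?oppr_eq0// /cross /=; ring.
have L1 := ae_link ab KP Ka Kb.
have KP' : K (P + a + - a)%R by rewrite addrK.
have Kb' : K (P + a + (b - a))%R by rewrite (_ : (P + a + (b - a))%R = (P + b)%R)//; vec.
have L2 := ae_link ab' Ka KP' Kb'.
have H := ae2_and (ae2_and L1 L2) (ae2_and ae_poincare (ae_integrable_edge P a)).
apply: (ae2_imp H) => y [[l1 l2] [po iF]] Dy; split => //.
have {}l1 := l1 Dy; have {}l2 := l2 Dy; have {}po := po Dy.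
rewrite (_ : cross (- a)%R _ = - cross a b)%R in l2; last by rewrite /cross /=; ring.
rewrite normrN in l2.
pose F x := f (hom h x y).
have mF : measurable_fun [set: plane] F by exact: (measurableT_comp mf (@measurable_homl R h y)).
set M := (\int[mu]_(r in _) _)%R.
have key k : `|cross a b|%:E * (`|M - k|%R `^ p)%:E <= (2 * 2 `^ p)%:E * (4%:E * energy + power_dist K F p k).
  exact: (@edge_mean _ K F p p1 mF mK convK P a b _ k ab KP Ka Kb iF l1 l2).
have mKE : measurable_fun setT (fun X : plane => (\1_K X)%:E : \bar R).
  by apply/measurable_EFinP; exact: measurable_indic.
have mP (k : R) : measurable_fun [set: plane] (fun X : plane => (`|F X - k| `^ p)%:E).
  exact: (measurable_powR_dist p mF (measurable_cst k)).
have mPD : measurable_fun [set: plane] (fun X : plane => power_dist K F p (F X)).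
  pose H2 (z : plane * plane) := (\1_K z.2)%:E * (`|F z.2 - F z.1| `^ p)%:E.
  apply: (@measurable_tonelli_plane2 R H2); last by move=> z; rewrite mule_ge0.
  apply: emeasurable_funM; first exact: (measurableT_comp mKE measurable_snd).
  exact: (measurable_powR_dist p (measurableT_comp mF measurable_snd) (measurableT_comp mF measurable_fst)).
have PD0 k : 0 <= power_dist K F p k by apply: integral_ge0 => X _; rewrite mule_ge0.
have mC : measurable_fun [set: plane] (fun X : plane => 4%:E * energy + power_dist K F p (F X)).
  by apply: emeasurable_funD => //; exact: measurable_cst.
pose J X := (\1_K X)%:E * (`|F X - M| `^ p)%:E.
have mJ : measurable_fun [set: plane] J by apply: emeasurable_funM => //; exact: (mP M).
have J0 X : 0 <= J X by rewrite mule_ge0.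
have c0 : (0 <= 2 * 2 `^ p)%R by rewrite mulr_ge0 ?powR_ge0.
have p4 : 0 <= 4%:E * energy by rewrite mule_ge0.
pose J1 X := (\1_K X)%:E * (4%:E * energy).
pose J2 X := (\1_K X)%:E * power_dist K F p (F X).
have mJ1 : measurable_fun [set: plane] J1.
  by apply: emeasurable_funM => //; exact: measurable_cst.
have mJ2 : measurable_fun [set: plane] J2 by exact: emeasurable_funM.
have J10 X : 0 <= J1 X by rewrite mule_ge0.
have J20 X : 0 <= J2 X by rewrite mule_ge0.
clear l1 l2.
have mJ12 : measurable_fun [set: plane] (fun X => J1 X + J2 X) by exact: emeasurable_funD.
apply: (@le_trans _ _ ((2 * 2 `^ p)%:E * \int[mu2]_X (J1 X + J2 X))).
  rewrite (ge0_integral_scale _ mJ J0 (normr_ge0 _)).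
  rewrite (ge0_integral_scale _ mJ12 (fun X => adde_ge0 (J10 X) (J20 X)) c0).
  apply: ge0_le_integral; first exact: measurableT.
  - by move=> X _; rewrite mule_ge0.
  - by apply: emeasurable_funM => //; exact: measurable_cst.
  - by apply: emeasurable_funM => //; exact: measurable_cst.
  move=> X _; rewrite -ge0_muleDr; [|exact: p4|exact: PD0].
  rewrite /J muleCA [leRHS]muleCA; apply: lee_wpmul2l; first by rewrite lee_fin.
  by rewrite (distrC (F X) M); exact: key.
have -> : \int[mu2]_X (J1 X + J2 X) = \int[mu2]_X J1 X + \int[mu2]_X J2 X.
  by rewrite ge0_integralD.
rewrite {1}/J1 (integral_indicZ _ mK p4).
rewrite (_ : 40 * 2 `^ p = 2 * 2 `^ p * 20)%R; last by ring.
rewrite (EFinM (2 * 2 `^ p)) -(muleA (2 * 2 `^ p)%:E); apply: lee_wpmul2l; first by rewrite lee_fin.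
apply: (@le_trans _ _ (mu2 K * (4%:E * energy) + mu2 K * (16%:E * energy))).
  by apply: leeD2l; exact: po.
rewrite -ge0_muleDr; [|exact: p4|by rewrite mule_ge0].
rewrite -ge0_muleDl; [|by rewrite lee_fin|by rewrite lee_fin].
by rewrite -EFinD muleCA (_ : 4 + 16 = 20 :> R)%R//; lra.
Qed.

End HomotheticEstimates.

(** * Continuity of functions with integrable second derivatives *)

Section LinearFunctions.
Context {R : realType}.
Implicit Types (l x v : R * R).

Lemma is_derive_dot l x v : is_derive x v (dot l : R * R -> R) (dot l v).
Proof.
have -> : x = x + 0 *: v by rewrite scale0r addr0.
apply/is_derive_line.
have -> : (fun t : R => dot l (x + t *: v)) = (fun t : R => dot l x + t * dot l v).
  by apply/funext => t; rewrite /dot /= /GRing.scale /=; ring.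
have := is_deriveD (is_derive_cst (dot l x) (0 : R) (1 : R))
  (is_deriveM (is_derive_id (0 : R) 1) (is_derive_cst (dot l v) (0 : R) (1 : R))).
by move/is_derive_eq; apply; rewrite /= scaler0 !add0r /GRing.scale /= mulr1.
Qed.

Lemma continuous_dot l : continuous (dot l : R * R -> R).
Proof.
move=> x; apply: cvgD; apply: cvgM; try exact: cvg_cst; [exact: cvg_fst|exact: cvg_snd].
Qed.

Lemma Ck_dot k l : Ck k (dot l : R * R -> R).
Proof.
case: k => [|k]; split => //; try exact: continuous_dot.
move=> v _; split; first by move=> x; case: (is_derive_dot l x v).
rewrite (_ : 'D_v _ = fun=> dot l v); first exact: Ck_cst.
by apply/funext => x; have ? := is_derive_dot l x v; exact: derive_val.
Qed.

End LinearFunctions.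

(** * Taylor formulas for weakly differentiable functions *)

Section WeakTaylor.
Context {R : realType}.
Notation mu := (@lebesgue_measure R).
Notation mu2 := (@lebesgue2 R).
Notation plane := (measurableTypeR R * measurableTypeR R)%type.
Implicit Types (f g phi : R * R -> R) (D U : set (R * R)) (v w p q : R * R).

(** The product rule is obtained by testing with [dot l] times phi. The bound on [dot l] over D and
    the vanishing of f and g outside keep the products integrable. *)
Lemma plane_wd_dot D l w f g (M : R) : plane_wd D w f g -> open D ->
  (forall x, D x -> `|dot l x| <= M) ->
  (forall x, ~ D x -> f x = 0) -> (forall x, ~ D x -> g x = 0) ->
  plane_wd D w (fun x => dot l x * f x) (fun x => dot l x * g x + dot l w * f x).
Proof.
move=> [fi gi wd] oD DM f0 g0.
have mD := open_measurable_plane oD.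
have il k : mu2.-integrable setT (EFin \o k) -> (forall x, ~ D x -> k x = 0) ->
    mu2.-integrable setT (EFin \o (fun x => dot l x * k x)).
  move=> ki k0; have := @integrable_bounded_mul R k (fun x => dot l x * \1_D x) `|M| ki.
  rewrite (_ : (fun x => k x * _) = fun x => dot l x * k x).
    apply => [|x].
      apply: measurable_funM; last exact: measurable_indic.
      by apply: continuous_measurable_plane; exact: continuous_dot.
    rewrite indicE; have [Dx|nDx] := pselect (D x).
      by rewrite mem_set// mulr1 (le_trans (DM x Dx)) ?ler_norm.
    by rewrite memNset// mulr0 normr0.
  apply/funext => x; rewrite indicE; have [Dx|nDx] := pselect (D x).
    by rewrite mem_set// mulr1 mulrC.
  by rewrite memNset// mulr0 k0// !mulr0.
split.
- exact: il.
- by apply: integrable_EFinD => //; [exact: il|exact: integrable_EFinZ].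
move=> phi tp.
have tlp : test_function D (fun x => dot l x * phi x).
  apply: (test_function_of_Ck tp).
    by move=> k; apply: CkM; [exact: Ck_dot|exact: test_function_Ck tp].
  by apply: closed_supportS => x ->; rewrite mulr0.
have dE x : 'D_w (fun x => dot l x * phi x) x = dot l x * 'D_w phi x + dot l w * phi x.
  have d1 := is_derive_dot l x w.
  have d2 := test_is_derive x w tp; rewrite -(test_deriveE x w tp) in d2.
  have d3 := is_deriveM d1 d2.
  by rewrite (@derive_val _ _ _ _ _ _ _ d3) /GRing.scale /= [phi x * _]mulrC.
have tw := test_derive w tp.
have i1 : mu2.-integrable setT (EFin \o (fun x => dot l x * f x * 'D_w phi x)).
  exact: (integrable_mul_test tw (il f fi f0)).
have i2 : mu2.-integrable setT (EFin \o (fun x => dot l w * (f x * phi x))).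
  by apply: integrable_EFinZ => //; exact: (integrable_mul_test tp).
transitivity (\int[mu2]_x (f x * 'D_w (fun x => dot l x * phi x) x) -
    \int[mu2]_x (dot l w * (f x * phi x))).
  rewrite -RintegralB//; first by apply: eq_Rintegral => x _; rewrite dE; ring.
  exact: (integrable_mul_test (test_derive w tlp) fi).
rewrite wd// -opprD; congr (- _); rewrite -RintegralD//.
  by apply: eq_Rintegral => x _; ring.
exact: (integrable_mul_test tlp gi).
Qed.

(* Combines the fundamental theorem along w for f and for its product with an affine
   function whose derivative along w is 1. *)
Lemma weak_taylor D U w f g (M : R) : plane_wd D w f g -> open D -> w != 0 ->
  (forall x, D x -> `|x.1| <= M /\ `|x.2| <= M) ->
  (forall x, ~ D x -> f x = 0) -> (forall x, ~ D x -> g x = 0) -> open U ->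
  (forall x r, U x -> 0 <= r <= 1 -> D (x + r *: w)) ->
  {ae mu2, forall x, U x ->
    mu.-integrable `[0, 1] (fun r => (f (x + r *: w) - (1 - r) * g (x + r *: w))%:E) /\
    f x = \int[mu]_(r in `[0, 1]) (f (x + r *: w) - (1 - r) * g (x + r *: w))}.
Proof.
move=> wd oD w0 DM f0 g0 oU UD.
have ww : dot w w != 0.
  rewrite /dot paddr_eq0 -?expr2 ?sqr_ge0// !sqrf_eq0; apply: contra w0 => /andP[/eqP a /eqP b].
  by rewrite [w]surjective_pairing a b.
pose l : R * R := (dot w w)^-1 *: w.
have lw : dot l w = 1 by rewrite /l /dot /= /GRing.scale /= -!mulrA -mulrDr mulVf.
have lM x : D x -> `|dot l x| <= (`|l.1| + `|l.2|) * M.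
  move=> /DM[x1 x2]; rewrite /dot (le_trans (ler_normD _ _))// !normrM mulrDl.
  by apply: lerD; apply: ler_wpM2l.
have wdl := plane_wd_dot wd oD lM f0 g0.
have [A1 _] := weak_ftc wd oU ler01 UD.
have [A2 B2] := weak_ftc wdl oU ler01 UD.
have [fi gi _] := wd.
have Bf := ae_integrable_line w 0 1 fi; have Bg := ae_integrable_line w 0 1 gi.
apply: (ae2_imp (ae2_and (ae2_and A1 A2) (ae2_and B2 (ae2_and Bf Bg)))) => x [[a1 a2] [b2 [bf bg]]] Ux.
have mA : measurable (`[0, 1]%classic : set (measurableTypeR R)) by exact: measurable_itv.
have E r : dot l (x + r *: w) * g (x + r *: w) + dot l w * f (x + r *: w) =
    dot l x * g (x + r *: w) + r * g (x + r *: w) + f (x + r *: w).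
  have -> : dot l (x + r *: w) = dot l x + r * dot l w by rewrite /dot /= /GRing.scale /=; ring.
  by rewrite lw; ring.
have irg : mu.-integrable `[0, 1] (fun r => (r * g (x + r *: w))%:E).
  have := integrable_EFinB mA (integrable_EFinB mA b2 bf) (integrable_EFinZ mA (dot l x) bg).
  by apply: eq_integrable => // r _ /=; rewrite E; congr EFin; ring.
have ix : mu.-integrable `[0, 1] (fun r => (f (x + r *: w) - g (x + r *: w) + r * g (x + r *: w))%:E).
  by apply: (integrable_EFinD mA) => //; exact: integrable_EFinB.
split.
  by move: ix; apply: eq_integrable => // r _; congr EFin; ring.
have {a1} := a1 Ux; have {a2} := a2 Ux; rewrite scale1r scale0r addr0.
set Ig := \int[mu]_(r in _) g _ => a2 a1.
pose Irg := \int[mu]_(r in `[0, 1]) (r * g (x + r *: w)).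
pose If := \int[mu]_(r in `[0, 1]) f (x + r *: w).
have e2 : \int[mu]_(r in `[0, 1]) (dot l (x + r *: w) * g (x + r *: w) + dot l w * f (x + r *: w)) =
    dot l x * Ig + Irg + If.
  transitivity (\int[mu]_(r in `[0, 1]) (dot l x * g (x + r *: w) + r * g (x + r *: w) + f (x + r *: w))).
    by apply: eq_Rintegral => r _; exact: E.
  have i1 := integrable_EFinZ mA (dot l x) bg.
  rewrite RintegralD//; last exact: (integrable_EFinD mA).
  by rewrite RintegralD// RintegralZl.
have e3 : \int[mu]_(r in `[0, 1]) (f (x + r *: w) - (1 - r) * g (x + r *: w)) = If - Ig + Irg.
  transitivity (\int[mu]_(r in `[0, 1]) (f (x + r *: w) - g (x + r *: w) + r * g (x + r *: w))).
    by apply: eq_Rintegral => r _; ring.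
  rewrite RintegralD//; last exact: (integrable_EFinB mA).
  by rewrite RintegralB.
(* Subtracting [dot l x] times the identity for f from the one for the product leaves f (x + w) = If
   + Irg; the identity for f then gives f x. *)
have lxw : dot l (x + w) = dot l x + 1 by rewrite -[in RHS]lw /dot /=; ring.
rewrite e3; move: a2; rewrite e2 lxw -a1 => a2.
apply: (@addIr _ (dot l x * f (x + w) - dot l x * f x)).
move: a2; lra.
Qed.


Lemma integrable_plane_map (o p q : R * R) f : cross p q != 0 -> mu2.-integrable setT (EFin \o f) ->
  mu2.-integrable setT (EFin \o (fun s : R * R => f (o + s.1 *: p + s.2 *: q))).
Proof.
move=> pq fi; have /integrableP[/measurable_EFinP mf ff] := fi.
have mT : measurable_fun [set: plane] (fun s : plane => f (o + s.1 *: p + s.2 *: q)).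
  exact: (measurableT_comp mf (measurable_plane o p q)).
apply/integrableP; split; first exact/measurable_EFinP.
have m1 : measurable_fun [set: plane] (fun x : plane => `|f x|%:E).
  by apply/measurable_EFinP; exact: (measurableT_comp (@normr_measurable R setT)).
have E := ge0_integral_plane o pq m1 (fun x => normr_ge0 (f x)).
move: ff; rewrite /= E => ff.
rewrite ltey; apply/eqP => Z; move: ff; rewrite Z gt0_muley ?ltxx//.
by rewrite lte_fin normr_gt0.
Qed.

(** The result of [weak_taylor] along p for f, followed by [weak_taylor] along q for f and for fp;
    fpq is the derivative of fp along q. The point x is a corner of the parallelogram of
    integration. *)
Definition corner_integrand p q f fp fq fpq x (s : R * R) : R :=
  f (x + s.1 *: p + s.2 *: q) - (1 - s.2) * fq (x + s.1 *: p + s.2 *: q)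
  - (1 - s.1) * (fp (x + s.1 *: p + s.2 *: q) - (1 - s.2) * fpq (x + s.1 *: p + s.2 *: q)).

Definition unit_sq (s : R * R) : R := \1_`[0, 1]%classic s.1 * \1_`[0, 1]%classic s.2.

Lemma measurable_unit_sq : measurable_fun [set: plane] (unit_sq : plane -> measurableTypeR R).
Proof.
have m01 : measurable (`[0, 1]%classic : set (measurableTypeR R)) by exact: measurable_itv.
have m1 : measurable_fun [set: measurableTypeR R] (\1_`[0, 1]%classic : R -> measurableTypeR R).
  exact: measurable_indic.
by apply: measurable_funM; [exact: (measurableT_comp m1 measurable_fst)|exact: (measurableT_comp m1 measurable_snd)].
Qed.

Lemma unit_sqE s : unit_sq s = ((0 <= s.1 <= 1) && (0 <= s.2 <= 1))%:R.
Proof. by rewrite /unit_sq !indicE !mem_setE !in_itv /=; case: (_ <= _ <= _); case: (_ <= _ <= _); rewrite ?mul0r ?mul1r. Qed.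

Definition corner_rep p q f fp fq fpq x : R :=
  \int[mu2]_s (unit_sq s * corner_integrand p q f fp fq fpq x s).

Lemma unit_sq_mul_integrable p q f (k : R * R -> R) x : cross p q != 0 ->
  mu2.-integrable setT (EFin \o f) -> measurable_fun [set: plane] k ->
  (forall s, unit_sq s != 0 -> `|k s| <= 1) ->
  mu2.-integrable setT (EFin \o (fun s : R * R => unit_sq s * k s * f (x + s.1 *: p + s.2 *: q))).
Proof.
move=> pq fi mk k1.
have := @integrable_bounded_mul R _ (fun s => unit_sq s * k s) 1 (integrable_plane_map x pq fi).
rewrite (_ : (fun s => _ * (unit_sq _ * _)) = fun s : R * R => unit_sq s * k s * f (x + s.1 *: p + s.2 *: q)).
  apply; first by apply: measurable_funM => //; exact: measurable_unit_sq.
  move=> s; have [->|n0] := eqVneq (unit_sq s) 0; first by rewrite mul0r normr0.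
  rewrite normrM; have -> : unit_sq s = 1 by move: n0; rewrite unit_sqE; case: (_ && _); rewrite ?eqxx.
  by rewrite normr1 mul1r k1.
by apply/funext => s; rewrite mulrC.
Qed.

Lemma norm_onemB_le1 (r : R) : 0 <= r <= 1 -> `|1 - r| <= 1.
Proof. by move=> /andP[r0 r1]; rewrite ger0_norm; lra. Qed.

Lemma corner_integrable p q f fp fq fpq x : cross p q != 0 ->
  mu2.-integrable setT (EFin \o f) -> mu2.-integrable setT (EFin \o fp) ->
  mu2.-integrable setT (EFin \o fq) -> mu2.-integrable setT (EFin \o fpq) ->
  mu2.-integrable setT (EFin \o (fun s => unit_sq s * corner_integrand p q f fp fq fpq x s)).
Proof.
move=> pq i1 i2 i3 i4.
have mk2 : measurable_fun [set: plane] (fun s : plane => 1 - s.2) by exact: measurable_funB.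
have mk1 : measurable_fun [set: plane] (fun s : plane => 1 - s.1) by exact: measurable_funB.
have sq01 s : unit_sq s != 0 -> 0 <= s.1 <= 1 /\ 0 <= s.2 <= 1.
  by rewrite unit_sqE; case: (boolP (_ && _)); rewrite ?eqxx// => /andP[].
have j1 := @unit_sq_mul_integrable p q f (fun=> 1) x pq i1 (measurable_cst _).
have j2 := unit_sq_mul_integrable x pq i2 mk1.
have j3 := unit_sq_mul_integrable x pq i3 mk2.
have mk12 : measurable_fun [set: plane] (fun s : plane => (1 - s.1) * (1 - s.2)) by exact: measurable_funM.
have j4 := unit_sq_mul_integrable x pq i4 mk12.
have {}j1 := j1 _; have := integrable_EFinD measurableT (integrable_EFinB measurableT (j1 _) (j3 _))
   (integrable_EFinB measurableT (j4 _) (j2 _)).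
rewrite (_ : (fun s => _ - _ + _) = fun s => unit_sq s * corner_integrand p q f fp fq fpq x s); last first.
  by apply/funext => s; rewrite /corner_integrand; ring.
apply=> s /sq01[s1 s2]; rewrite ?normr1// ?normrM ?norm_onemB_le1//.
by rewrite mulr_ile1// norm_onemB_le1.
Qed.

Lemma ae_line_points (P : R * R -> Prop) w : {ae mu2, forall x, P x} ->
  {ae mu2, forall x, {ae mu, forall s, P (x + s *: w)}}.
Proof.
move=> [N [mN N0 PN]].
pose B : set (plane * measurableTypeR R) := [set u | N (u.1 + u.2 *: w)].
have mB : measurable B.
  have mline : measurable_fun setT (fun u : plane * measurableTypeR R => (u.1 + u.2 *: w : plane)).
    by apply: (measurable_ray (X := fst)); [exact: measurable_fst|exact: measurable_snd].
  by rewrite -[B]setTI; exact: mline.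
have B0 s : mu2 [set y | B (y, s)] = 0%E.
  have mBs : measurable ([set y | B (y, s)] : set plane).
    by rewrite -[X in measurable X]setTI; exact: (measurable_shift (s *: w)).
  apply: (measure_negligible mBs).
  have nN : {ae mu2, forall x, ~ N x} by exists N; split => // x /= /contrapT.
  have := ae2_affine (s *: w) (oner_neq0 R) nN.
  by apply: negligibleS => x /= Bx; rewrite scale1r addrC => /(_ Bx).
have := null_sections mu mB B0.
move=> H; apply: (ae2_imp H) => x; apply: filterS => s nN; apply: contrapT => nP.
by apply: nN; exact: PN.
Qed.

(** The inner formulas hold at almost every point of the line x + s p by [ae_line_points]. Convexity
    keeps the whole parallelogram in D once its four corners are there. *)
Lemma weak_taylor2 D p q f fp fq fpq (M : R) : open D ->
  (forall X Y t, D X -> D Y -> 0 <= t <= 1 -> D (X + t *: (Y - X))) ->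
  (forall x, D x -> `|x.1| <= M /\ `|x.2| <= M) -> cross p q != 0 ->
  plane_wd D p f fp -> plane_wd D q f fq -> plane_wd D q fp fpq ->
  (forall x, ~ D x -> [/\ f x = 0, fp x = 0, fq x = 0 & fpq x = 0]) ->
  {ae mu2, forall x, D x -> D (x + p) -> D (x + q) -> D (x + p + q) ->
     f x = corner_rep p q f fp fq fpq x}.
Proof.
move=> oD convD DM pq wdp wdq wdpq z0.
have p0 : p != 0 by apply: contra_neq pq => ->; rewrite /cross /= !mul0r subrr.
have q0 : q != 0 by apply: contra_neq pq => ->; rewrite /cross /= !mulr0 subrr.
have oU w : open [set x | D x /\ D (x + w)].
  apply: openI => //; apply: open_comp => // x _; apply: cvgD; [exact: cvg_id|exact: cvg_cst].
have UD w x r : [set x | D x /\ D (x + w)] x -> 0 <= r <= 1 -> D (x + r *: w).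
  move=> [Dx Dxw] r01; have -> : w = x + w - x by rewrite addrC addrA addNr add0r.
  exact: convD.
have f0 x : ~ D x -> f x = 0 by case/z0.
have fp0 x : ~ D x -> fp x = 0 by case/z0.
have fq0 x : ~ D x -> fq x = 0 by case/z0.
have fpq0 x : ~ D x -> fpq x = 0 by case/z0.
have Tp := weak_taylor wdp oD p0 DM f0 fp0 (oU p) (@UD p).
have Tq := weak_taylor wdq oD q0 DM f0 fq0 (oU q) (@UD q).
have Tpq := weak_taylor wdpq oD q0 DM fp0 fpq0 (oU q) (@UD q).
have L := ae_line_points p (ae2_and Tq Tpq).
apply: (ae2_imp (ae2_and Tp L)) => x [tp l] Dx Dxp Dxq Dxpq.
have {tp} [ip tp] := tp (conj Dx Dxp).
have [[i1 i2 _] [_ i3 _]] := (wdp, wdq); have [_ i4 _] := wdpq.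
have iH := corner_integrable x pq i1 i2 i3 i4.
have mA : measurable (`[0, 1]%classic : set (measurableTypeR R)) by exact: measurable_itv.
apply: EFin_inj; rewrite /corner_rep /Rintegral fineK; last exact: integrable_fin_num.
rewrite -(integral12_prod_meas1 (m1 := mu) (m2 := mu) iH).
rewrite {1}tp /Rintegral fineK; last exact: integrable_fin_num.
rewrite [LHS]integral_mkcond; apply: ae_eq_integral => //.
- apply/(measurable_restrictT _ mA); exact: (measurable_int mu ip).
- exact: (measurable_fubini_F iH).
apply: negligibleS l => s /=; apply: contra_not => -[lq lpq] _.
rewrite /fubini_F patchE mem_setE in_itv /=.
case: ifPn => s01; last first.
  by rewrite integral0_eq// => t _; rewrite unit_sqE /= (negbTE s01) mul0r.
have Us : [set x | D x /\ D (x + q)] (x + s *: p).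
  split; first exact: UD.
  rewrite addrAC; apply: UD => //; split => //=; by rewrite addrAC.
have {lq} [jq lq] := lq Us; have {lpq} [jpq lpq] := lpq Us.
have jpq' := integrable_EFinZ mA (1 - s) jpq.
rewrite lq lpq -RintegralZl// -RintegralB// /Rintegral fineK; last first.
  by apply: integrable_fin_num => //; exact: integrable_EFinB.
rewrite integral_mkcond; apply: eq_integral => t _.
rewrite patchE mem_setE in_itv /= unit_sqE /= s01 /= /corner_integrand /=.
by case: ifP => _; rewrite ?mul1r ?mul0r//; congr EFin; ring.
Qed.

End WeakTaylor.

(** * Continuity of the averages over parallelograms *)

Section CornerContinuity.
Context {R : realType}.
Notation mu := (@lebesgue_measure R).
Notation mu2 := (@lebesgue2 R).
Notation plane := (measurableTypeR R * measurableTypeR R)%type.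
Implicit Types (f g : R * R -> R) (p q x : R * R).

Lemma coordsE p q x : cross p q != 0 ->
  x = (cross x q / cross p q) *: p + (cross p x / cross p q) *: q.
Proof.
case: p q x => [p1 p2] [q1 q2] [x1 x2]; rewrite /cross /= => pq.
by apply: injective_projections; rewrite /= /GRing.scale /=; field.
Qed.

(** Reduces continuity to sequences, for which dominated convergence is available. *)
Lemma plane_seq_continuous (W : R * R -> R) x :
  (forall xn : nat -> R * R, xn n @[n --> \oo] --> x -> W (xn n) @[n --> \oo] --> W x) ->
  {for x, continuous W}.
Proof.
move=> H; apply/(@cvgrPdist_lt _ R^o) => e e0; apply: contrapT => nn.
have ex n : exists y, ball x n.+1%:R^-1 y /\ e <= `|W x - W y|.
  apply: contrapT => nex; apply: nn.
  change (nbhs x [set t | `|W x - W t| < e]); apply/nbhs_ballP; exists n.+1%:R^-1 => /=.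
    by rewrite invr_gt0 ltr0n.
  by move=> y xy /=; rewrite ltNge; apply/negP => ey; apply: nex; exists y.
have [xn Hxn] := choice ex.
have /H /(@cvgrPdist_lt _ R^o) /(_ e e0) [N _ HN] : xn n @[n --> \oo] --> x.
  apply/cvg_ballP => d d0; near=> n.
  have [B _] := Hxn n; apply: (le_ball _ B).
  by apply: ltW; near: n; exact: (near_infty_natSinv_lt (PosNum d0)).
have := HN N (leqnn _); rewrite /= ltNge => /negP; apply.
by have [_] := Hxn N.
Unshelve. all: by end_near.
Qed.

Lemma ae_off_lines (c : R) : {ae mu2, forall s : R * R, s.1 <> c /\ s.2 <> c}.
Proof.
have null1 : mu2 ([set c] `*` setT) = 0%E.
  apply: etrans (product_measure1E mu mu (measurable_set1 c) measurableT) _.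
  by rewrite [X in (X * _)%E](lebesgue_measure_set1 c) mul0e.
have null2 : mu2 (setT `*` [set c]) = 0%E.
  apply: etrans (product_measure1E mu mu measurableT (measurable_set1 c)) _.
  by rewrite [X in (_ * X)%E](lebesgue_measure_set1 c) mule0.
apply: ae2_and.
- exists ([set c] `*` setT); split => //.
    by apply: measurableX => //; exact: measurable_set1.
  by move=> s /= /contrapT sc; split.
- exists (setT `*` [set c]); split => //.
    by apply: measurableX => //; exact: measurable_set1.
  by move=> s /= /contrapT sc; split.
Qed.

Lemma continuous_indic01 (r : R) : r <> 0 -> r <> 1 ->
  {for r, continuous (\1_`[0, 1]%classic : R -> R)}.
Proof.
move=> r0 r1.
have near_cst (c : R) : (\forall y \near r, \1_`[0, 1]%classic y = c :> R) ->
    {for r, continuous (\1_`[0, 1]%classic : R -> R)}.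
  by move=> H; apply: cvg_near_cst; apply: filterS (H) => y ->; rewrite (nbhs_singleton H).
have E (y : R) : \1_`[0, 1]%classic y = (0 <= y <= 1)%R%:R.
  by rewrite indicE mem_setE in_itv.
have [rl|rl|/esym//] := ltgtP r 0.
  apply: (near_cst 0); near=> y; rewrite E leNgt; suff -> : y < 0 by [].
  by near: y; exact: lt_nbhsl.
have [ru|ru|//] := ltgtP r 1.
  apply: (near_cst 1); near=> y; rewrite E; suff -> : 0 <= y <= 1 by [].
  apply/andP; split; apply: ltW; near: y; [exact: lt_nbhsr|exact: lt_nbhsl].
apply: (near_cst 0); near=> y; rewrite E andbC leNgt; suff -> : 1 < y by [].
by near: y; exact: lt_nbhsr.
Unshelve. all: by end_near.
Qed.

Lemma unit_sq_ae_continuous : {ae mu2, forall s, {for s, continuous (@unit_sq R)}}.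
Proof.
apply: (ae2_imp (ae2_and (ae_off_lines 0) (ae_off_lines 1))) => s [[a b] [c d]].
apply: cvgM.
- apply: (@continuous_comp _ _ _ fst (\1_`[0, 1]%classic : R -> R)); first exact: cvg_fst.
  exact: continuous_indic01.
- apply: (@continuous_comp _ _ _ snd (\1_`[0, 1]%classic : R -> R)); first exact: cvg_snd.
  exact: continuous_indic01.
Qed.

(** As f is merely integrable, the displacement of x is moved onto the kernel [ka], which is bounded
    and continuous off the four lines that carry the sides of the unit square; dominated convergence
    applies with |G| as bound. *)
Lemma continuous_corner_term p q f (k : R * R -> R) : cross p q != 0 ->
  mu2.-integrable setT (EFin \o f) -> continuous k ->
  (forall s, unit_sq s != 0 -> `|k s| <= 1) ->
  continuous (fun x => \int[mu2]_s (unit_sq s * k s * f (x + s.1 *: p + s.2 *: q))).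
Proof.
move=> pq fi ck k1 x0; apply: plane_seq_continuous => xn xn0.
pose G s := f (x0 + s.1 *: p + s.2 *: q).
pose v n : R * R := (cross (xn n - x0) q / cross p q, cross p (xn n - x0) / cross p q).
have vE n : xn n = x0 + (v n).1 *: p + (v n).2 *: q.
  by rewrite -addrA -(coordsE (xn n - x0) pq) addrC subrK.
have Gi : mu2.-integrable setT (EFin \o G) by exact: integrable_plane_map.
have mG : measurable_fun [set: plane] G by have /integrableP[/measurable_EFinP] := Gi.
pose ka s := unit_sq s * k s.
have mka : measurable_fun [set: plane] ka.
  by apply: measurable_funM; [exact: measurable_unit_sq|exact: continuous_measurable_plane].
have ka1 s : `|ka s| <= 1.
  rewrite /ka; have [->|n0] := eqVneq (unit_sq s) 0; first by rewrite mul0r normr0.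
  rewrite normrM; have -> : unit_sq s = 1 by move: n0; rewrite unit_sqE; case: (_ && _); rewrite ?eqxx.
  by rewrite normr1 mul1r k1.
have WE n : \int[mu2]_s (ka s * f (xn n + s.1 *: p + s.2 *: q)) = \int[mu2]_s (ka (s - v n) * G s).
  rewrite -[RHS](Rintegral_shift (v n) (f := fun s => ka (s - v n) * G s)).
    by apply: eq_Rintegral => s _; rewrite addrK; congr (_ * f _); rewrite vE; vec.
  apply: measurable_funM => //.
  exact: (measurableT_comp mka (measurable_shift (- v n))).
rewrite (_ : (fun n => _) = fun n => \int[mu2]_s (ka (s - v n) * G s)); last by apply/funext => n; exact: WE.
have v0 : v n @[n --> \oo] --> ((0, 0) : R * R).
  have d1 : (xn n).1 - x0.1 @[n --> \oo] --> (0 : R).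
    rewrite -[X in _ --> X](subrr x0.1); apply: cvgB; last exact: cvg_cst.
    by apply: (@cvg_comp _ _ _ xn fst); [exact: xn0|exact: cvg_fst].
  have d2 : (xn n).2 - x0.2 @[n --> \oo] --> (0 : R).
    rewrite -[X in _ --> X](subrr x0.2); apply: cvgB; last exact: cvg_cst.
    by apply: (@cvg_comp _ _ _ xn snd); [exact: xn0|exact: cvg_snd].
  have c1 : cross (xn n - x0) q / cross p q @[n --> \oo] --> (0 : R).
    rewrite -[X in _ --> X](mul0r (cross p q)^-1); apply: cvgMl; rewrite /cross /=.
    rewrite (_ : 0 = 0 * q.2 - 0 * q.1); last by rewrite !mul0r subrr.
    by apply: cvgB; apply: cvgMl.
  have c2 : cross p (xn n - x0) / cross p q @[n --> \oo] --> (0 : R).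
    rewrite -[X in _ --> X](mul0r (cross p q)^-1); apply: cvgMl; rewrite /cross /=.
    rewrite (_ : 0 = p.1 * 0 - p.2 * 0); last by rewrite !mulr0 subrr.
    by apply: cvgB; apply: cvgMr.
  exact: (cvg_pair c1 c2).
have mT n : measurable_fun [set: plane] (fun s => ka (s - v n) * G s).
  by apply: measurable_funM => //; exact: (measurableT_comp mka (measurable_shift (- v n))).
have [] := @dominated_convergence _ plane R mu2 setT measurableT
   (fun n s => (ka (s - v n) * G s)%:E) (fun s => (ka s * G s)%:E) (abse \o (EFin \o G)).
- by move=> n; apply/measurable_EFinP; exact: mT.
- by apply/measurable_EFinP; exact: measurable_funM.
- apply: (ae2_imp unit_sq_ae_continuous) => s cs _.
  apply: cvg_EFin; first exact: nearW.
  apply: cvgMl.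
  have cka : {for s, continuous ka} by apply: cvgM => //; exact: ck.
  have sv : s - v n @[n --> \oo] --> s - (0, 0) by apply: cvgB; [exact: cvg_cst|exact: v0].
  have e : s - (0, 0) = s by apply: injective_projections; rewrite /= subr0.
  rewrite e in sv.
  exact: (continuous_cvg (f := fun n => s - v n) (h := ka) _ cka sv).
- exact: integrable_abse.
- apply: ae2_of_all => s n _ /=; rewrite lee_fin normrM -[leRHS]mul1r ler_wpM2r//.
move=> ilim _ L.
have inn n : mu2.-integrable setT (fun s => (ka (s - v n) * G s)%:E).
  apply: (le_integrable measurableT _ _ (integrable_abse Gi)).
    by apply/measurable_EFinP; exact: mT.
  by move=> s _ /=; rewrite lee_fin normr_id normrM -[leRHS]mul1r ler_wpM2r.
rewrite /Rintegral; apply: fine_cvg.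
by rewrite fineK //; exact: integrable_fin_num.
Qed.

Lemma continuous_corner_rep p q f fp fq fpq : cross p q != 0 ->
  mu2.-integrable setT (EFin \o f) -> mu2.-integrable setT (EFin \o fp) ->
  mu2.-integrable setT (EFin \o fq) -> mu2.-integrable setT (EFin \o fpq) ->
  continuous (corner_rep p q f fp fq fpq).
Proof.
move=> pq i1 i2 i3 i4.
have c1 : continuous (fun s : R * R => 1 - s.1).
  by move=> s; apply: cvgB; [exact: cvg_cst|exact: cvg_fst].
have c2 : continuous (fun s : R * R => 1 - s.2).
  by move=> s; apply: cvgB; [exact: cvg_cst|exact: cvg_snd].
have c12 : continuous (fun s : R * R => (1 - s.1) * (1 - s.2)).
  by move=> s; apply: cvgM; [exact: c1|exact: c2].
have mc (k : R * R -> R) : continuous k -> measurable_fun [set: plane] k.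
  exact: continuous_measurable_plane.
have sq01 s : @unit_sq R s != 0 -> 0 <= s.1 <= 1 /\ 0 <= s.2 <= 1.
  by rewrite unit_sqE; case: (boolP (_ && _)); rewrite ?eqxx// => /andP[].
have k0 s : @unit_sq R s != 0 -> `|1 : R| <= 1 by rewrite normr1.
have k1 s : @unit_sq R s != 0 -> `|1 - s.1| <= 1 by case/sq01 => *; exact: norm_onemB_le1.
have k2 s : @unit_sq R s != 0 -> `|1 - s.2| <= 1 by case/sq01 => *; exact: norm_onemB_le1.
have k3 s : @unit_sq R s != 0 -> `|(1 - s.1) * (1 - s.2)| <= 1.
  by case/sq01 => *; rewrite normrM mulr_ile1// norm_onemB_le1.
have cc0 : continuous (fun _ : R * R => 1 : R) by move=> ?; exact: cvg_cst.
have C1 := continuous_corner_term pq i1 cc0 k0.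
have C2 := continuous_corner_term pq i2 c1 k1.
have C3 := continuous_corner_term pq i3 c2 k2.
have C4 := continuous_corner_term pq i4 c12 k3.
rewrite (_ : corner_rep p q f fp fq fpq = fun x =>
   \int[mu2]_s (unit_sq s * 1 * f (x + s.1 *: p + s.2 *: q))
   - \int[mu2]_s (unit_sq s * (1 - s.2) * fq (x + s.1 *: p + s.2 *: q))
   + (\int[mu2]_s (unit_sq s * ((1 - s.1) * (1 - s.2)) * fpq (x + s.1 *: p + s.2 *: q))
   - \int[mu2]_s (unit_sq s * (1 - s.1) * fp (x + s.1 *: p + s.2 *: q)))).
  move=> x; apply: cvgD; apply: cvgB; [exact: C1|exact: C3|exact: C4|exact: C2].
apply/funext => x.
have I1 := unit_sq_mul_integrable x pq i1 (mc _ cc0) k0.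
have I2 := unit_sq_mul_integrable x pq i2 (mc _ c1) k1.
have I3 := unit_sq_mul_integrable x pq i3 (mc _ c2) k2.
have I4 := unit_sq_mul_integrable x pq i4 (mc _ c12) k3.
rewrite -RintegralB// -RintegralB// -RintegralD//; last 2 first.
- exact: integrable_EFinB.
- exact: integrable_EFinB.
by apply: eq_Rintegral => s _; rewrite /corner_integrand; ring.
Qed.

End CornerContinuity.

Ltac I4 := match goal with i : 'I_4 |- _ =>
  move: i => [[|[|[|[|?]]]] ?] //; by apply/val_inj end.

(** * Convex quadrilaterals *)

Section QuadGeometry.
Context {R : realType}.
Implicit Types (x y : R * R) (i j k : 'I_4).

Lemma I4_nextE i : [/\ i + 1 + 1 = i + 2, i + 2 + 1 = i - 1, i - 1 + 1 = i & i - 1 + 2 = i + 1].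
Proof. by split; I4. Qed.

Lemma I4_prevE i : [/\ i + 1 - 1 = i, i + 2 - 1 = i + 1, i - 1 - 1 = i + 2, i + 1 + 2 = i - 1 & i + 2 + 2 = i].
Proof. by split; I4. Qed.

Lemma I4_cases i k : [\/ k = i, k = i + 1, k = i + 2 | k = i - 1].
Proof.
have E : [\/ k - i = 0, k - i = 1, k - i = 2 | k - i = - 1].
  move: (k - i) => [[|[|[|[|//]]]] ?]; [constructor 1|constructor 2|constructor 3|constructor 4];
  exact/val_inj.
have kE : k = i + (k - i) by rewrite addrC subrK.
by case: E => E; rewrite kE E ?addr0; [constructor 1|constructor 2|constructor 3|constructor 4].
Qed.

Lemma I4_neqE i : [/\ (i + 1 == i) = false, (i + 2 == i) = false, (i + 2 == i + 1) = false
  & (i - 1 == i) = false] /\ ((i - 1 == i + 1) = false /\ (i + 2 == i - 1) = false).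
Proof. by do !split; move: i => [[|[|[|[|?]]]] ?]. Qed.

Lemma sum_I4 (M : zmodType) (F : 'I_4 -> M) i :
  \sum_k F k = F i + F (i + 1) + F (i + 2) + F (i - 1).
Proof.
rewrite (reindex_inj (addrI i)) /= !big_ord_recl big_ord0 !addr0 !(addrA (F _)).
have e1 : lift ord0 ord0 = 1 :> 'I_4 by apply/val_inj.
have e2 : lift ord0 (lift ord0 ord0) = 2 :> 'I_4 by apply/val_inj.
have e3 : lift ord0 (lift ord0 (lift ord0 ord0)) = - 1 :> 'I_4 by apply/val_inj.
by rewrite e1 e2 e3 !addrA.
Qed.

Variable V : 'I_4 -> R * R.

(** Twice the signed area of the triangle spanned by side i and x, positive on the inner side. *)
Definition side_form i x : R := cross (V (i + 1) - V i) (x - V i).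

Lemma side_form_line i x y (t : R) :
  side_form i (x + t *: (y - x)) = (1 - t) * side_form i x + t * side_form i y.
Proof. by rewrite /side_form /cross /= /GRing.scale /=; ring. Qed.

Lemma side_formD i x y : side_form i (x + y) = side_form i x + cross (V (i + 1) - V i) y.
Proof. by rewrite /side_form /cross /=; ring. Qed.

Lemma side_form_sum i j (t : 'I_4 -> R) : \sum_k t k = 1 ->
  side_form j (\sum_k t k *: V k) = \sum_k t k * side_form j (V k).
Proof.
rewrite !(sum_I4 _ i) => t1; rewrite /side_form /cross /= /GRing.scale /=.
have -> : t i = 1 - t (i + 1) - t (i + 2) - t (i - 1) by rewrite -t1; ring.
ring.
Qed.

Lemma continuous_side_form i : continuous (side_form i).
Proof.
move=> x; have -> : side_form i = fun x => dot (- (V (i + 1) - V i).2, (V (i + 1) - V i).1) x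
    - cross (V (i + 1) - V i) (V i).
  by apply/funext => z; rewrite /side_form /cross /dot /=; ring.
by apply: cvgB; [exact: continuous_dot|exact: cvg_cst].
Qed.

Hypothesis hV : convex_ccw V.

Lemma side_form_vertex i : [/\ side_form i (V i) = 0, side_form i (V (i + 1)) = 0,
  0 < side_form i (V (i + 2)) & 0 < side_form i (V (i - 1))].
Proof.
split.
- by rewrite /side_form /cross /= !subrr !mulr0 subrr.
- by rewrite /side_form /cross /=; ring.
- by have := hV i; rewrite /side_form /cross /=; congr (_ < _); ring.
- have := hV (i - 1); have [_ _ -> ->] := I4_nextE i.
  by rewrite /side_form /cross /=; congr (_ < _); ring.
Qed.

Lemma side_form_vertex_ge0 i k : 0 <= side_form i (V k).
Proof.
have [a b c d] := side_form_vertex i.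
by case: (I4_cases i k) => ->; rewrite ?a ?b// ltW.
Qed.

Lemma triangle_quad i (s t : R) : 0 <= s -> 0 <= t -> s + t <= 1 ->
  quad V (V i + s *: (V (i + 1) - V i) + t *: (V (i - 1) - V i)).
Proof.
move=> s0 t0 st.
pose T k : R := if k == i then 1 - s - t else if k == i + 1 then s else if k == i - 1 then t else 0.
have [[n1 n2 n3 n5] [n6 n4]] := I4_neqE i.
exists T; split.
- by move=> k; rewrite /T; case: ifP => _; [lra|case: ifP => _ //; case: ifP].
- by rewrite (sum_I4 _ i) /T !eqxx n1 n2 n3 n4 n5 n6; ring.
- rewrite (sum_I4 _ i) /T !eqxx n1 n2 n3 n4 n5 n6; vec.
Qed.

(** For the converse, the diagonal from V (i + 1) to V (i - 1) separates two triangles; on each of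
    them two of the side forms, suitably divided, are barycentric coordinates. *)
Lemma quadP x : quad V x <-> forall i, 0 <= side_form i x.
Proof.
split=> [[t [t0 t1 ->]] i|x0].
  rewrite (side_form_sum 0)//; apply: sumr_ge0 => k _.
  by rewrite mulr_ge0// side_form_vertex_ge0.
pose i : 'I_4 := 0.
pose A := V i; pose B := V (i + 1); pose C := V (i + 2); pose D := V (i - 1).
have [_ _ _ X] := side_form_vertex i; have [_ _ _ Y] := side_form_vertex (i + 2).
have [z1 z2 z3 z4] := I4_nextE i; have [y1 y2 y3 y4 y5] := I4_prevE i.
rewrite y2 in Y.
have xE (o p q : R * R) : cross p q != 0 ->
    x = o + (cross (x - o) q / cross p q) *: p + (cross p (x - o) / cross p q) *: q.
  by move=> pq; rewrite -addrA -coordsE// addrC subrK.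
have l0 := x0 i; have l1 := x0 (i + 1); have l2 := x0 (i + 2); have l3 := x0 (i - 1).
have X' : 0 < cross (B - A) (D - A) by [].
have Y' : 0 < cross (D - C) (B - C) by move: Y; rewrite /side_form z2.
have [st|st] := leP (cross (x - A) (D - A) + cross (B - A) (x - A)) (cross (B - A) (D - A)).
  rewrite (xE A (B - A) (D - A)) ?gt_eqF//; apply: triangle_quad.
  - apply: divr_ge0; last exact: ltW.
    by move: l3; rewrite /side_form z3 /A /D /cross /=; congr (_ <= _); ring.
  - by apply: divr_ge0; [exact: l0|exact: ltW].
  - by rewrite -mulrDl ler_pdivrMr// mul1r.
rewrite (xE C (D - C) (B - C)) ?gt_eqF//.
have := @triangle_quad (i + 2) (cross (x - C) (B - C) / cross (D - C) (B - C))
  (cross (D - C) (x - C) / cross (D - C) (B - C)).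
rewrite z2 y2; apply.
- apply: divr_ge0; last exact: ltW.
  by move: l1; rewrite /side_form z1 /C /B /cross /=; congr (_ <= _); ring.
- apply: divr_ge0; last exact: ltW.
  by move: l2; rewrite /side_form z2.
- rewrite -mulrDl ler_pdivrMr// mul1r; move: st; rewrite /cross /=; lra.
Qed.

Lemma open_side_forms : open [set x | forall i, 0 < side_form i x].
Proof.
have o i : open [set x | 0 < side_form i x].
  rewrite (_ : [set x | _] = side_form i @^-1` [set r | 0 < r])//.
  by apply: open_comp; [move=> x _; exact: continuous_side_form|exact: open_gt].
rewrite (_ : [set x | _] = ([set x | 0 < side_form 0 x] `&` [set x | 0 < side_form (0 + 1) x])
  `&` ([set x | 0 < side_form (0 + 2) x] `&` [set x | 0 < side_form (0 - 1) x])).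
  by apply: openI; apply: openI.
apply/seteqP; split=> [x h|x [[? ?] [? ?]] i]; first by do !split; exact: h.
by case: (I4_cases 0 i) => ->.
Qed.

Lemma interior_quadP x : (quad V)° x <-> forall i, 0 < side_form i x.
Proof.
split=> [Ix i|x0]; last first.
  suff : [set x | forall i, 0 < side_form i x] `<=` (quad V)° by apply.
  rewrite -open_subsetE; last exact: open_side_forms.
  by move=> y y0; apply/quadP => j; exact: ltW.
have xi : 0 <= side_form i x by apply: (quadP x).1; exact: interior_subset Ix.
rewrite lt_neqAle xi andbT; apply/eqP => z.
have [_ _ Vi _] := side_form_vertex i.
(* A point on the line of side i, pushed away from a vertex off that line, gets a negative side
   form. *)
pose d := x - V (i + 2).
have H : \forall t \near (0 : R), quad V (x + t *: d).
  have : (x + t *: d) @[t --> (0 : R)] --> x + 0 *: d.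
    by apply: cvgD; [exact: cvg_cst|apply: cvgZr_tmp; exact: cvg_id].
  by rewrite scale0r addr0 => /(_ _ Ix).
have /nbhs_ballP[e /= e0 He] := H.
have : ball 0 e (e / 2) by rewrite /ball /= sub0r normrN gtr0_norm; lra.
move/He/quadP/(_ i); rewrite side_formD -z add0r /d /= => N.
have E : cross (V (i + 1) - V i) ((e / 2) *: (x - V (i + 2))) =
    e / 2 * (side_form i x - side_form i (V (i + 2))).
  by rewrite /side_form /cross /= /GRing.scale /=; ring.
by move: N; rewrite E -z sub0r mulrN leNgt oppr_lt0 mulr_gt0//; lra.
Qed.

Lemma open_interior_quad : open (quad V)°. Proof. exact: open_interior. Qed.

Lemma closed_quad : closed (quad V).
Proof.
have c i : closed [set x | 0 <= side_form i x].
  rewrite (_ : [set x | _] = side_form i @^-1` [set r | 0 <= r])//.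
  by apply: closed_comp; [move=> x _; exact: continuous_side_form|exact: closed_ge].
rewrite (_ : quad V = ([set x | 0 <= side_form 0 x] `&` [set x | 0 <= side_form (0 + 1) x])
  `&` ([set x | 0 <= side_form (0 + 2) x] `&` [set x | 0 <= side_form (0 - 1) x])).
  by apply: closedI; apply: closedI.
apply/seteqP; split=> [x /quadP h|x [[? ?] [? ?]]]; first by do !split; exact: h.
by apply/quadP => i; case: (I4_cases 0 i) => ->.
Qed.

Lemma convex_quad x y t : quad V x -> quad V y -> 0 <= t <= 1 -> quad V (x + t *: (y - x)).
Proof.
move=> /quadP x0 /quadP y0 /andP[t0 t1]; apply/quadP => i; rewrite side_form_line.
by rewrite addr_ge0// mulr_ge0// subr_ge0.
Qed.

Lemma convex_interior_quad x y t : (quad V)° x -> (quad V)° y -> 0 <= t <= 1 ->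
  (quad V)° (x + t *: (y - x)).
Proof.
move=> /interior_quadP x0 /interior_quadP y0 /andP[t0 t1]; apply/interior_quadP => i.
rewrite side_form_line; have [->|tn] := eqVneq t 0.
  by rewrite subr0 mul1r mul0r addr0.
apply: ltr_wpDl; first by apply: mulr_ge0; [rewrite subr_ge0|exact: ltW].
by rewrite mulr_gt0// lt_neqAle eq_sym tn.
Qed.

Lemma hom_interior_quad h x y : 0 < h < 1 -> quad V x -> (quad V)° y -> (quad V)° (hom h x y).
Proof.
move=> /andP[h0 h1] /quadP x0 /interior_quadP y0; apply/interior_quadP => i.
have -> : hom h x y = x + h *: (y - x) by rewrite /hom; vec.
by rewrite side_form_line ltr_wpDl// ?mulr_gt0// mulr_ge0// subr_ge0 ltW.
Qed.

Lemma quad_bounded : exists M : R, forall x, quad V x -> `|x.1| <= M /\ `|x.2| <= M.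
Proof.
exists (\sum_k (`|(V k).1| + `|(V k).2|)) => _ [t [t0 t1 ->]].
have tk k : t k <= 1.
  by rewrite -t1 (bigD1 k)//= lerDl sumr_ge0.
have e1 : (\sum_k t k *: V k).1 = \sum_k t k * (V k).1.
  by rewrite !(sum_I4 _ 0).
have e2 : (\sum_k t k *: V k).2 = \sum_k t k * (V k).2.
  by rewrite !(sum_I4 _ 0).
have b (r : R) k : `|t k * r| <= `|r| by rewrite normrM ger0_norm// ler_piMl.
split; [rewrite e1|rewrite e2]; apply: le_trans (ler_norm_sum _ _ _) _; apply: ler_sum => k _;
  by apply: le_trans (b _ k) _; rewrite ?lerDl ?lerDr.
Qed.

Lemma interior_quad_nonempty : exists x, (quad V)° x.
Proof.
exists (\sum_k (fun=> 4^-1 : R) k *: V k); apply/interior_quadP => i.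
have [a b c d] := side_form_vertex i.
rewrite (side_form_sum 0); last by rewrite !(sum_I4 _ 0); lra.
by rewrite (sum_I4 _ i) a b; lra.
Qed.

(** The two margins concern the sides that do not contain V j. Where both are positive, x can be
    moved by a combination of the two sides at V j with coefficients of sum at most 1/8 and stay in
    the interior. *)
Definition corner_margin j x : R := side_form (j + 1) x - 8^-1 * side_form (j + 1) (V j).
Definition corner_margin' j x : R := side_form (j + 2) x - 8^-1 * side_form (j + 2) (V j).

Lemma side_form_dir k j m x (t : R) :
  side_form k (x + t *: (V m - V j)) = side_form k x + t * (side_form k (V m) - side_form k (V j)).
Proof. by rewrite /side_form /cross /= /GRing.scale /=; ring. Qed.

Lemma corner_shift j x (s t : R) : (quad V)° x -> 0 < corner_margin j x -> 0 < corner_margin' j x ->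
  0 <= s -> 0 <= t -> s + t <= 8^-1 ->
  (quad V)° (x + s *: (V (j + 1) - V j) + t *: (V (j - 1) - V j)).
Proof.
move=> /interior_quadP x0 m1 m2 s0 t0 st; apply/interior_quadP => k.
rewrite !side_form_dir.
have v k' := side_form_vertex_ge0 k k'.
have n1 : 0 <= s * side_form k (V (j + 1)) by rewrite mulr_ge0.
have n2 : 0 <= t * side_form k (V (j - 1)) by rewrite mulr_ge0.
have [z1 z2 z3 z4] := I4_nextE j.
have zero : side_form k (V j) = 0 -> 0 < side_form k x + s * (side_form k (V (j + 1)) - side_form k (V j))
    + t * (side_form k (V (j - 1)) - side_form k (V j)).
  by move=> ->; rewrite !subr0; have := x0 k; lra.
have pos : 0 < side_form k x - 8^-1 * side_form k (V j) ->
    0 < side_form k x + s * (side_form k (V (j + 1)) - side_form k (V j))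
    + t * (side_form k (V (j - 1)) - side_form k (V j)).
  have : (s + t) * side_form k (V j) <= 8^-1 * side_form k (V j) by rewrite ler_wpM2r.
  move: n1 n2; set a := side_form k x; set b := side_form k (V j).
  by rewrite !mulrBr mulrDl; lra.
case: (I4_cases j k) => kE; [apply: zero|apply: pos|apply: pos|apply: zero]; rewrite kE.
- by have [] := side_form_vertex j.
- exact: m1.
- exact: m2.
- by have [_] := side_form_vertex (j - 1); rewrite z3.
Qed.

(** Some barycentric weight of x is at least 1/4, which exceeds the 1/8 in the margins. *)
Lemma corner_cover x : quad V x -> exists j, 0 < corner_margin j x /\ 0 < corner_margin' j x.
Proof.
move=> [t [t0 t1 xE]].
have [j tj] : exists j, 4^-1 <= t j.
  apply: contrapT => n.
  have lt k : t k < 4^-1 by rewrite ltNge; apply/negP => h; apply: n; exists k.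
  have := t1; rewrite (sum_I4 _ 0).
  have := lt 0; have := lt (0 + 1); have := lt (0 + 2); have := lt (0 - 1); lra.
exists j.
have [z1 z2 z3 z4] := I4_nextE j; have [y1 y2 y3 y4 y5] := I4_prevE j.
have key k : 0 < side_form k (V j) -> 0 < side_form k x - 8^-1 * side_form k (V j).
  move=> kj; rewrite xE (side_form_sum 0)// (bigD1 j)//=.
  have : 0 <= \sum_(i0 < 4 | i0 != j) t i0 * side_form k (V i0).
    by apply: sumr_ge0 => m _; rewrite mulr_ge0// side_form_vertex_ge0.
  have : 4^-1 * side_form k (V j) <= t j * side_form k (V j) by rewrite ler_wpM2r// ltW.
  lra.
split; apply: key.
- by have [_ _ _] := side_form_vertex (j + 1); rewrite y1.
- by have [_ _ + _] := side_form_vertex (j + 2); rewrite y5.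
Qed.

Section Gluing.
Variables (u : R * R -> R) (W : 'I_4 -> R * R -> R).
Hypothesis cW : forall j, continuous (W j).
Hypothesis uW : forall j, {ae (@lebesgue2 R), forall x, (quad V)° x ->
  (quad V)° (x + 16^-1 *: (V (j + 1) - V j)) -> (quad V)° (x + 16^-1 *: (V (j - 1) - V j)) ->
  (quad V)° (x + 16^-1 *: (V (j + 1) - V j) + 16^-1 *: (V (j - 1) - V j)) -> u x = W j x}.

(** Twice the positive part. *)
Let pos_part (r : R) : R := r + `|r|.

Let pos_part_ge0 r : 0 <= pos_part r.
Proof. by rewrite /pos_part; have := ler_norm (- r); rewrite normrN; lra. Qed.

Let pos_part_gt0 r : (0 < pos_part r) = (0 < r).
Proof.
rewrite /pos_part; case: (ltP 0 r) => r0; first by rewrite gtr0_norm// addr_gt0.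
by rewrite ler0_norm// subrr ltxx.
Qed.

Let cutoff j x := pos_part (corner_margin j x) * pos_part (corner_margin' j x).

Let cutoff_ge0 j x : 0 <= cutoff j x. Proof. by rewrite mulr_ge0. Qed.

Let continuous_cutoff j : continuous (cutoff j).
Proof.
have cp (g : R * R -> R) : continuous g -> continuous (fun x => pos_part (g x)).
  by move=> cg x; apply: cvgD; [exact: cg|apply: cvg_norm; exact: cg].
move=> x; apply: cvgM; apply: cp => y; apply: cvgB; try exact: cvg_cst; exact: continuous_side_form.
Qed.

(** A partition of unity: [cutoff j] is nonzero only where the representation at V j is valid, and
    the four cutoffs have a positive sum on K by [corner_cover]. The scale 1/16 makes the two
    displacements add up to the 1/8 of [corner_shift]. *)
Lemma exists_glued : exists w, is_continuous_rep (quad V) u w.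
Proof.
have h0 : 0 <= 16^-1 :> R by rewrite invr_ge0.
have h1 : 16^-1 + 0 <= 8^-1 :> R by lra.
have h2 : 0 + 16^-1 <= 8^-1 :> R by lra.
have h3 : 16^-1 + 16^-1 <= 8^-1 :> R by lra.
pose S x := cutoff 0 x + cutoff (0 + 1) x + cutoff (0 + 2) x + cutoff (0 - 1) x.
pose T x := cutoff 0 x * W 0 x + cutoff (0 + 1) x * W (0 + 1) x
   + cutoff (0 + 2) x * W (0 + 2) x + cutoff (0 - 1) x * W (0 - 1) x.
have S0 x : quad V x -> 0 < S x.
  move=> /corner_cover[j [m1 m2]].
  have cj : 0 < cutoff j x by rewrite mulr_gt0// pos_part_gt0.
  have := cutoff_ge0 0 x; have := cutoff_ge0 (0 + 1) x; have := cutoff_ge0 (0 + 2) x.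
  have := cutoff_ge0 (0 - 1) x; rewrite /S.
  by case: (I4_cases 0 j) cj => ->; lra.
have cD (f g : R * R -> R) : continuous f -> continuous g -> continuous (fun x => f x + g x).
  by move=> cf cg x; apply: cvgD; [exact: cf|exact: cg].
have cM j : continuous (fun x => cutoff j x * W j x).
  by move=> x; apply: cvgM; [exact: continuous_cutoff|exact: cW].
have cT : continuous T by exact: (cD _ _ (cD _ _ (cD _ _ (cM _) (cM _)) (cM _)) (cM _)).
have cc := continuous_cutoff.
have cS : continuous S by exact: (cD _ _ (cD _ _ (cD _ _ (cc _) (cc _)) (cc _)) (cc _)).
exists (fun x => T x / S x); split.
  apply: continuous_in_subspaceT => x; rewrite inE => Kx.
  apply: cvgM; first exact: cT.
  by apply: cvgV; [rewrite gt_eqF// S0|exact: cS].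
have A := ae2_and (ae2_and (uW 0) (uW (0 + 1))) (ae2_and (uW (0 + 2)) (uW (0 - 1))).
apply: (ae2_imp A) => x [[u0 u1] [u2 u3]] Dx.
have Kx := interior_subset Dx.
have key j : ((quad V)° x ->
  (quad V)° (x + 16^-1 *: (V (j + 1) - V j)) -> (quad V)° (x + 16^-1 *: (V (j - 1) - V j)) ->
  (quad V)° (x + 16^-1 *: (V (j + 1) - V j) + 16^-1 *: (V (j - 1) - V j)) -> u x = W j x) ->
    cutoff j x * W j x = cutoff j x * u x.
  move=> H; have [c0|c0] := eqVneq (cutoff j x) 0; first by rewrite c0 !mul0r.
  have : 0 < cutoff j x by rewrite lt_neqAle eq_sym c0 cutoff_ge0.
  rewrite /cutoff => c; have m1 : 0 < corner_margin j x.
    by rewrite -pos_part_gt0 lt_neqAle pos_part_ge0 andbT eq_sym; apply: contraTneq c => ->; rewrite mul0r ltxx.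
  have m2 : 0 < corner_margin' j x.
    by rewrite -pos_part_gt0 lt_neqAle pos_part_ge0 andbT eq_sym; apply: contraTneq c => ->; rewrite mulr0 ltxx.
  rewrite H//.
  - rewrite (_ : x + _ = x + 16^-1 *: (V (j + 1) - V j) + 0 *: (V (j - 1) - V j)).
      exact: corner_shift.
    by rewrite scale0r addr0.
  - rewrite (_ : x + _ = x + 0 *: (V (j + 1) - V j) + 16^-1 *: (V (j - 1) - V j)).
      exact: corner_shift.
    by rewrite scale0r addr0.
  - exact: corner_shift.
apply: (@mulIf _ (S x)); first by rewrite gt_eqF// S0.
rewrite divfK ?gt_eqF ?S0// /T !key// /S; ring.
Qed.

End Gluing.

End QuadGeometry.

Section LinearCombinations.
Context {R : realType}.
Notation mu2 := (@lebesgue2 R).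

Lemma plane_wd_lincomb D (v : R * R) (f f' g g' : R * R -> R) (c d : R) :
  plane_wd D v f f' -> plane_wd D v g g' ->
  plane_wd D v (fun x => c * f x + d * g x) (fun x => c * f' x + d * g' x).
Proof.
move=> [fi fi' wf] [gi gi' wg].
split; try by apply: integrable_EFinD => //; exact: integrable_EFinZ.
move=> phi tp; have tv := test_derive v tp.
have iZ k h psi : test_function D psi -> mu2.-integrable setT (EFin \o h) ->
    mu2.-integrable setT (EFin \o (fun x => k * (h x * psi x))).
  by move=> t' hi; apply: integrable_EFinZ => //; exact: (integrable_mul_test t').
have E (h h' psi : R * R -> R) : test_function D psi -> mu2.-integrable setT (EFin \o h) ->
    mu2.-integrable setT (EFin \o h') ->
    \int[mu2]_x ((c * h x + d * h' x) * psi x) =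
    c * \int[mu2]_x (h x * psi x) + d * \int[mu2]_x (h' x * psi x).
  move=> tpsi hi hi'; transitivity (\int[mu2]_x (c * (h x * psi x) + d * (h' x * psi x))).
    by apply: eq_Rintegral => x _; ring.
  rewrite RintegralD//; [|exact: iZ|exact: iZ].
  by rewrite !RintegralZl//; exact: (integrable_mul_test tpsi).
by rewrite !E// wf// wg//; ring.
Qed.

End LinearCombinations.

Section ContinuousRepresentative.
Context {R : realType}.
Notation mu2 := (@lebesgue2 R).
Variable V : 'I_4 -> R * R.
Hypothesis hV : convex_ccw V.
Local Notation D := (quad V)°.

(** The embedding of W^{2,1}, with p and q equal to 1/16 of the sides at each corner. It guarantees
    that [continuous_rep] is not the default of [xget]. *)
Lemma exists_continuous_rep (u u1 u2 u11 u12 u21 u22 : R * R -> R) :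
  plane_wd D (e1 R) u u1 -> plane_wd D (e2 R) u u2 ->
  plane_wd D (e1 R) u1 u11 -> plane_wd D (e2 R) u1 u12 ->
  plane_wd D (e1 R) u2 u21 -> plane_wd D (e2 R) u2 u22 ->
  (forall x, ~ D x -> [/\ u x = 0, u1 x = 0 & u2 x = 0] /\
     [/\ u11 x = 0, u12 x = 0, u21 x = 0 & u22 x = 0]) ->
  exists w, is_continuous_rep (quad V) u w.
Proof.
move=> w1 w2 w11 w12 w21 w22 z0.
pose p j := 16^-1 *: (V (j + 1) - V j); pose q j := 16^-1 *: (V (j - 1) - V j).
pose dir (v : R * R) (g1 g2 : R * R -> R) x := v.1 * g1 x + v.2 * g2 x.
have pq j : cross (p j) (q j) != 0.
  have [_ _ _ X] := side_form_vertex hV j.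
  have -> : cross (p j) (q j) = 16^-1 * 16^-1 * side_form V j (V (j - 1)).
    by rewrite /side_form /cross /= /GRing.scale /=; ring.
  by rewrite gt_eqF// !mulr_gt0.
have wp v := plane_wd_dir v w1 w2.
have wpq v v' : plane_wd D v' (dir v u1 u2) (dir v' (dir v u11 u21) (dir v u12 u22)).
  by apply: plane_wd_dir; exact: plane_wd_lincomb.
have [M HM] := quad_bounded V.
have DM x : D x -> `|x.1| <= M /\ `|x.2| <= M by move=> /interior_subset; exact: HM.
apply: (@exists_glued _ _ hV u (fun j => corner_rep (p j) (q j) u (dir (p j) u1 u2)
  (dir (q j) u1 u2) (dir (q j) (dir (p j) u11 u21) (dir (p j) u12 u22)))) => j.
  have [[i1 i2 _] [_ i3 _] [_ i4 _]] := And3 (wp (p j)) (wp (q j)) (wpq (p j) (q j)).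
  exact: continuous_corner_rep.
apply: (weak_taylor2 (D := D) (M := M)) => //.
- exact: open_interior_quad.
- by move=> X Y t DX DY t01; exact: convex_interior_quad.
all: try exact: pq.
all: try exact: wp.
all: try exact: wpq.
move=> x /z0[[a b c] [d e f g]].
by rewrite /dir a b c d e f g !mulr0 !addr0 !mulr0 addr0.
Qed.

End ContinuousRepresentative.

(** * Derivatives along a side and differences of values at the vertices *)

Section HomotheticStage.
Context {R : realType}.
Notation mu := (@lebesgue_measure R).
Notation mu2 := (@lebesgue2 R).
Notation plane := (measurableTypeR R * measurableTypeR R)%type.

(** A nonempty open set contains a rectangle of positive measure. This is how a centre y is finally
    chosen. *)
Lemma open_ae_point (D : set (R * R)) (P : R * R -> Prop) : open D -> D !=set0 ->
  {ae mu2, forall x, P x} -> exists2 x, D x & P x.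
Proof.
move=> oD [x Dx] aeP; apply: contrapT => n.
have [F [FD DE]] := open_bigcup_orect oD.
have [k _ kx] : (\bigcup_k orect (F k)) x by rewrite -DE.
have nP : mu2.-negligible (orect (F k)).
  apply: negligibleS aeP => z kz /= Pz; apply: n; exists z => //.
  by rewrite DE; exists k.
have Z := measure_negligible (measurable_orect (F k)) nP.
have E : mu2 (orect (F k)) = (mu `](F k).1.1, (F k).2.1[%classic * mu `](F k).1.2, (F k).2.2[%classic)%E.
  by apply: product_measure1E; exact: measurable_itv.
have := etrans (esym E) Z.
case: kx => /=; rewrite !in_itv /= => /andP[a b] /andP[c d].
have ab := lt_trans a b; have cd := lt_trans c d.
move/eqP; rewrite mule_eq0 !lebesgue_measure_itv /= !lte_fin ab cd.
by rewrite -!EFinB !eqe !subr_eq0 !gt_eqF.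
Qed.

Section PowerDist.
Variables (K : set (R * R)) (F : R * R -> R) (p : R).
Hypothesis p1 : 1 <= p.
Hypothesis mF : measurable_fun [set: plane] F.
Hypothesis mK : measurable (K : set plane).
Local Open Scope ereal_scope.

Lemma power_dist_ge0 k : 0 <= power_dist K F p k.
Proof. by apply: integral_ge0 => x _; rewrite mule_ge0 ?lee_fin ?powR_ge0. Qed.

Lemma measure_power_dist m m' :
  mu2 K * (`|m - m'| `^ p)%:E <= (2 `^ p)%:E * (power_dist K F p m + power_dist K F p m').
Proof.
have mKE : measurable_fun setT (fun X : plane => (\1_K X)%:E : \bar R).
  by apply/measurable_EFinP; exact: measurable_indic.
have mP (k : R) : measurable_fun [set: plane] (fun X : plane => (\1_K X)%:E * (`|F X - k| `^ p)%:E).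
  by apply: emeasurable_funM => //; exact: (measurable_powR_dist p mF (measurable_cst k)).
have P0 k x : 0 <= (\1_K x)%:E * (`|F x - k| `^ p)%:E by rewrite mule_ge0 ?lee_fin ?powR_ge0.
rewrite -integral_indicZ ?lee_fin ?powR_ge0//.
have -> : power_dist K F p m + power_dist K F p m' =
    \int[mu2]_x ((\1_K x)%:E * (`|F x - m| `^ p)%:E + (\1_K x)%:E * (`|F x - m'| `^ p)%:E).
  by rewrite ge0_integralD.
have mS : measurable_fun [set: plane] (fun x => (\1_K x)%:E * (`|F x - m| `^ p)%:E + (\1_K x)%:E * (`|F x - m'| `^ p)%:E).
  exact: emeasurable_funD.
rewrite (ge0_integral_scale _ mS (fun x => adde_ge0 (P0 m x) (P0 m' x)) (powR_ge0 _ _)).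
apply: ge0_le_integral; first exact: measurableT.
- by move=> x _; rewrite mule_ge0 ?lee_fin ?powR_ge0.
- by apply: emeasurable_funM => //; exact: measurable_cst.
- by apply: emeasurable_funM => //; exact: measurable_cst.
move=> x _; rewrite -ge0_muleDr; [|by rewrite lee_fin powR_ge0|by rewrite lee_fin powR_ge0].
rewrite [leRHS]muleCA; apply: lee_wpmul2l; first by rewrite lee_fin.
rewrite -EFinD -EFinM lee_fin; have := powR_distD m (F x) m' p1.
by rewrite (distrC m (F x)).
Qed.

(** Two constants close to the same F in L^p(K) are close to each other. The measure of K cancels,
    and the two equal bounds give the factor 2. *)
Lemma mean_gap m m' (c s : R) (E : \bar R) : (0 <= c)%R -> (0 <= s)%R -> 0 <= E ->
  0 < mu2 K < +oo -> c%:E * power_dist K F p m <= s%:E * (mu2 K * E) ->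
  c%:E * power_dist K F p m' <= s%:E * (mu2 K * E) ->
  (c * `|m - m'| `^ p)%:E <= (2 * (2 `^ p * s))%:E * E.
Proof.
move=> c0 s0 E0 /andP[k0 kfin] H H'; have kf : mu2 K \is a fin_num by rewrite ge0_fin_numE// ltW.
have P0 := power_dist_ge0 m; have P'0 := power_dist_ge0 m'.
move: H H' k0 P0 P'0 (measure_power_dist m m'); rewrite -(fineK kf).
move: (fine _) (power_dist K F p m) (power_dist K F p m') => r P P' H H' r0 P0 P'0 mpd.
rewrite -(@lee_pmul2l _ r%:E)//.
apply: (@le_trans _ _ (c%:E * ((2 `^ p)%:E * (P + P')))).
  rewrite EFinM muleCA; apply: lee_wpmul2l; first by rewrite lee_fin.
  by rewrite muleC; rewrite muleC in mpd.
rewrite muleCA ge0_muleDr//.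
apply: (@le_trans _ _ ((2 `^ p)%:E * (s%:E * (r%:E * E) + s%:E * (r%:E * E)))).
  by apply: lee_wpmul2l; [rewrite lee_fin powR_ge0|exact: leeD].
have r0' : (0 <= r)%R by move: r0; rewrite lte_fin => /ltW.
rewrite -ge0_muleDr ?mule_ge0 ?lee_fin// -ge0_muleDr ?mule_ge0 ?lee_fin//.
rewrite -[X in X + _]mul1e -[X in _ + X]mul1e -ge0_muleDl// -EFinD.
by rewrite !muleA -!EFinM (_ : 2 `^ p * s * r * (1 + 1) = r * (2 * (2 `^ p * s)))%R//; ring.
Qed.

End PowerDist.

Lemma cancel_measure (X s : R) (k P E : \bar R) : 0 < X -> 0 <= s -> (0 <= E)%E ->
  (k <= X%:E)%E -> (X%:E * P <= s%:E * (k * E))%E -> (P <= s%:E * E)%E.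
Proof.
move=> X0 s0 E0 kX H; rewrite -(@lee_pmul2l _ X%:E) ?lte_fin//; apply: le_trans H _.
rewrite [leRHS]muleCA; apply: lee_wpmul2l; first by rewrite lee_fin.
exact: lee_wpmul2r.
Qed.

(** The factors 1 - h and al are bounded by 1, but 1 - be is kept: it compensates later for a side b
    that is much longer than a. *)
Lemma combine_gaps (e d1 d2 c h al be s p : R) (E1 E2 : \bar R) : 1 <= p -> 0 <= c ->
  0 <= h <= 1 -> 0 <= al <= 1 -> 0 <= be <= 1 -> (0 <= E1)%E -> (0 <= E2)%E ->
  ((c * `|d1| `^ p)%:E <= s%:E * E1)%E -> ((c * `|d2| `^ p)%:E <= s%:E * E2)%E ->
  e = (1 - h) * (al * d1 + (1 - be) * d2) ->
  ((c * `|e| `^ p)%:E <= (2 `^ p * s)%:E * (E1 + ((1 - be) `^ p)%:E * E2))%E.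
Proof.
move=> p1 c0 /andP[h0 h1] /andP[al0 al1] /andP[be0 be1] E10 E20 g1 g2 eE.
have b0 : 0 <= 1 - be by rewrite subr_ge0.
have le : `|e| `^ p <= 2 `^ p * (`|d1| `^ p + (1 - be) `^ p * `|d2| `^ p).
  rewrite -powRM//; apply: le_trans (powRD_le p1 (normr_ge0 _) (mulr_ge0 b0 (normr_ge0 _))).
  rewrite ge0_ler_powR ?nnegrE ?addr_ge0 ?mulr_ge0 ?(le_trans ler01 p1)//.
  rewrite eE normrM ger0_norm ?subr_ge0//.
  apply: (@le_trans _ _ `|al * d1 + (1 - be) * d2|).
    by rewrite ler_piMl// lerBlDr lerDl.
  apply: le_trans (ler_normD _ _) _; rewrite !normrM (ger0_norm al0) (ger0_norm b0).
  by rewrite lerD2r ler_piMl.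
apply: (@le_trans _ _ ((2 `^ p * (c * `|d1| `^ p + (1 - be) `^ p * (c * `|d2| `^ p)))%:E)).
  rewrite lee_fin; apply: (@le_trans _ _ (c * (2 `^ p * (`|d1| `^ p + (1 - be) `^ p * `|d2| `^ p)))).
    by rewrite ler_wpM2l.
  by rewrite le_eqVlt; apply/orP; left; apply/eqP; ring.
have t0 : (0 <= ((1 - be) `^ p)%:E * E2)%E by rewrite mule_ge0 ?lee_fin ?powR_ge0.
rewrite !(EFinM (2 `^ p)) -muleA; apply: lee_wpmul2l; first by rewrite lee_fin powR_ge0.
rewrite ge0_muleDr// EFinD; apply: leeD; first exact: g1.
rewrite EFinM muleCA; apply: lee_wpmul2l; [by rewrite lee_fin powR_ge0|exact: g2].
Qed.

Variables (D K : set (R * R)) (A a b : R * R) (al be h p : R).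
Variables (u u1 u2 u11 u12 u21 u22 w G1 G2 : R * R -> R).
Hypothesis oD : open D.
Hypothesis D0 : D !=set0.
Hypothesis convK : forall X Y t, K X -> K Y -> 0 <= t <= 1 -> K (X + t *: (Y - X)).
Hypothesis h01 : 0 < h <= 2^-1.
Hypothesis homD : forall X y, K X -> D y -> D (hom h X y).
Hypothesis w1 : plane_wd D (e1 R) u u1.
Hypothesis w2 : plane_wd D (e2 R) u u2.
Hypothesis w11 : plane_wd D (e1 R) u1 u11.
Hypothesis w12 : plane_wd D (e2 R) u1 u12.
Hypothesis w21 : plane_wd D (e1 R) u2 u21.
Hypothesis w22 : plane_wd D (e2 R) u2 u22.
Hypothesis p1 : 1 <= p.
Hypothesis mK : measurable (K : set plane).
Hypothesis mG1 : measurable_fun [set: plane] G1.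
Hypothesis mG2 : measurable_fun [set: plane] G2.
Hypothesis G10 : forall x, 0 <= G1 x.
Hypothesis G20 : forall x, 0 <= G2 x.
Definition dir_comb (v : R * R) (f g : R * R -> R) (x : R * R) : R := v.1 * f x + v.2 * g x.
Hypothesis KG1 : forall X Y, K X -> K Y ->
  gradient_le (dir_comb a u11 u21) (dir_comb a u12 u22) G1 (Y - X) 1.
Hypothesis KG2 : forall X Y, K X -> K Y ->
  gradient_le (dir_comb b u11 u21) (dir_comb b u12 u22) G2 (Y - X) 1.
Hypothesis uw : {ae mu2, forall x, D x -> u x = w x}.
Hypothesis ab : cross a b != 0.
Hypothesis al01 : 0 <= al <= 1.
Hypothesis be01 : 0 <= be <= 1.
Hypothesis eps0 : 0 < al + be - 1.
Local Notation C := (A + al *: a + be *: b).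
Hypothesis KA : K A.
Hypothesis KB : K (A + a).
Hypothesis KD : K (A + b).
Hypothesis KC : K C.
Hypothesis Kfin : (0 < mu2 K <= `|cross a b|%:E)%E.

Local Notation E1 := (energy G1 p).
Local Notation E2 := (energy G2 p).

(** The value of g at C minus that of the affine function with the same values at A, B and D,
    arranged in differences along the edges DC, AB and AD. *)
Definition edge_defect (g : R * R -> R) (A B C D : R * R) : R :=
  (g C - g D) - al * (g B - g A) + (1 - be) * (g D - g A).

(** The edges AB and AD are seen from the triangle ABD, the edge DC from the triangle DCB, whose
    area is smaller by the factor al + be - 1. The derivative along DC is al times the one along a
    plus be - 1 times the one along b, so the defect becomes a combination of two gaps, each between
    means of one function over two edges. *)
Lemma homothetic_estimate : exists y m, [/\ D y,
  (1 - h) * m = w (hom h (A + a) y) - w (hom h A y),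
  (power_dist K (fun x => dir_comb a u1 u2 (hom h x y)) p m <= (40 * 2 `^ p)%:E * E1)%E &
  (((al + be - 1) * `|cross a b| * `|edge_defect (fun X => w (hom h X y)) A (A + a) C (A + b)| `^ p)%:E <=
    (2 `^ p * (2 * (2 `^ p * (40 * 2 `^ p))))%:E * (E1 + ((1 - be) `^ p)%:E * E2))%E].
Proof.
have h01' : 0 < h < 1 by have /andP[? ?] := h01; apply/andP; split => //; lra.
have /andP[h0 h1] := h01'.
have e11 : al + be - 1 <= 1.
  have /andP[_ a1] := al01; have /andP[_ b1] := be01.
  by rewrite lerBlDr lerD.
have wd v g g1 g2 g11 g12 g21 g22 : plane_wd D (e1 R) g1 g11 -> plane_wd D (e1 R) g2 g21 ->
    plane_wd D (e2 R) g1 g12 -> plane_wd D (e2 R) g2 g22 ->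
    plane_wd D (e1 R) (dir_comb v g1 g2) (dir_comb v g11 g21) /\
    plane_wd D (e2 R) (dir_comb v g1 g2) (dir_comb v g12 g22) /\ g = g :> (R * R -> R).
  by move=> *; split; [exact: plane_wd_lincomb|split => //; exact: plane_wd_lincomb].
have [wa1 [wa2 _]] := wd a u u1 u2 u11 u12 u21 u22 w11 w21 w12 w22.
have [wb1 [wb2 _]] := wd b u u1 u2 u11 u12 u21 u22 w11 w21 w12 w22.
have ba : cross b a != 0 by rewrite (_ : cross b a = - cross a b) ?oppr_eq0// /cross; ring.
pose c := al *: a + (be - 1) *: b.
have cab : cross c (a - b) = - ((al + be - 1) * cross a b) by rewrite /c /cross /= /GRing.scale /=; ring.
have cn : cross c (a - b) != 0 by rewrite cab oppr_eq0 mulf_neq0// gt_eqF.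
have Dc : A + b + c = C by rewrite /c; vec.
have Dab : A + b + (a - b) = A + a by vec.
have KDc : K (A + b + c) by rewrite Dc.
have KDab : K (A + b + (a - b)) by rewrite Dab.
have M1AB := ae_edge_mean oD convK h01 homD wa1 wa2 mG1 G10 p1 mK KG1 ab KA KB KD.
have M1DC := ae_edge_mean oD convK h01 homD wa1 wa2 mG1 G10 p1 mK KG1 cn KD KDc KDab.
have M2AD := ae_edge_mean oD convK h01 homD wb1 wb2 mG2 G20 p1 mK KG2 ba KA KD KB.
have M2DC := ae_edge_mean oD convK h01 homD wb1 wb2 mG2 G20 p1 mK KG2 cn KD KDc KDab.
have [FAB _] := ae_line_ftc oD convK h01' homD w1 w2 KA KB (lexx 0) ler01 (lexx 1).
have [FAD _] := ae_line_ftc oD convK h01' homD w1 w2 KA KD (lexx 0) ler01 (lexx 1).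
have [FDC _] := ae_line_ftc oD convK h01' homD w1 w2 KD KDc (lexx 0) ler01 (lexx 1).
have hn0 : h != 0 by rewrite gt_eqF.
have uwh X : {ae mu2, forall y, D (hom h X y) -> u (hom h X y) = w (hom h X y)}.
  exact: (ae2_affine ((1 - h) *: X) hn0 uw).
(* A single y at which all the almost-everywhere statements hold. *)
have [y Dy [[[m1 m2] [m3 m4]] [[[f1 f2] f3] [[wA wB] [wC wD]]]]] := open_ae_point oD D0
  (ae2_and (ae2_and (ae2_and M1AB M1DC) (ae2_and M2AD M2DC))
   (ae2_and (ae2_and (ae2_and FAB FAD) FDC)
    (ae2_and (ae2_and (uwh A) (uwh (A + a))) (ae2_and (uwh C) (uwh (A + b)))))).
have {m1} [iAB m1] := m1 Dy; have {m2} [iDC m2] := m2 Dy.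
have {m3} [iAD m3] := m3 Dy; have {m4} [jDC m4] := m4 Dy.
have {f1} := f1 Dy; have {f2} := f2 Dy; have {f3} := f3 Dy.
rewrite !scale1r !scale0r !addr0 Dc.
rewrite (wA (homD KA Dy)) (wB (homD KB Dy)) (wC (homD KC Dy)) (wD (homD KD Dy)).
move: m1 m2 m3 m4.
set N1 := \int[mu]_(r in _) dir_comb a u1 u2 (hom h (A + r *: a) y).
set N2 := \int[mu]_(r in _) dir_comb a u1 u2 (hom h (A + b + r *: c) y).
set N3 := \int[mu]_(r in _) dir_comb b u1 u2 (hom h (A + r *: b) y).
set N4 := \int[mu]_(r in _) dir_comb b u1 u2 (hom h (A + b + r *: c) y).
move=> m1 m2 m3 m4.
have -> : \int[mu]_(s in `[0, 1]) (c.1 * u1 (hom h (A + b + s *: c) y) + c.2 * u2 (hom h (A + b + s *: c) y)) =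
    al * N2 + (be - 1) * N4.
  have mA : measurable (`[0, 1]%classic : set (measurableTypeR R)) by exact: measurable_itv.
  rewrite /N2 /N4 -!RintegralZl// -RintegralD//; last 2 first.
  - exact: (integrable_EFinZ mA al iDC).
  - exact: (integrable_EFinZ mA (be - 1) jDC).
  by apply: eq_Rintegral => s _; rewrite /dir_comb /c /= /GRing.scale /=; ring.
move=> f3 f2 f1.
have X0 : 0 < `|cross a b| by rewrite normr_gt0.
have /andP[Kp KX] := Kfin.
have Koo : (0 < mu2 K < +oo)%E by rewrite Kp (le_lt_trans KX)// ltry.
have E10 := energy_ge0 G1 p; have E20 := energy_ge0 G2 p.
have s0 : 0 <= 40 * 2 `^ p by rewrite mulr_ge0 ?powR_ge0.
exists y, N1; split; [exact: Dy|by rewrite f1| |].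
  exact: (cancel_measure X0 s0 E10 KX m1).
have mfh v : measurable_fun [set: plane] (fun x => dir_comb v u1 u2 (hom h x y)).
  have [_ /integrableP[/measurable_EFinP mg1 _] _] := w1.
  have [_ /integrableP[/measurable_EFinP mg2 _] _] := w2.
  apply: (measurableT_comp (f := dir_comb v u1 u2)); last exact: measurable_homl.
  by apply: measurable_funD; apply: measurable_funM.
have cX : `|cross c (a - b)| = (al + be - 1) * `|cross a b| by rewrite cab normrN normrM gtr0_norm.
have cba : `|cross b a| = `|cross a b|.
  by rewrite (_ : cross b a = - cross a b) ?normrN// /cross; ring.
rewrite cX in m2 m4; rewrite cba in m3.
have epsX : 0 <= (al + be - 1) * `|cross a b| by rewrite mulr_ge0// ltW.
(* The bounds over AB and AD are weakened to the factor of the one over DC, since [mean_gap] takes a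
   common constant. *)
have shrink (P S : \bar R) : (0 <= P)%E -> (`|cross a b|%:E * P <= S)%E ->
    (((al + be - 1) * `|cross a b|)%:E * P <= S)%E.
  move=> P0; apply: le_trans; apply: lee_wpmul2r => //.
  by rewrite lee_fin ler_piMl// ltW.
have g1 := mean_gap p1 (mfh a) mK epsX s0 E10 Koo m2 (shrink _ _ (power_dist_ge0 _ _ _ _) m1).
have g2 := mean_gap p1 (mfh b) mK epsX s0 E20 Koo (shrink _ _ (power_dist_ge0 _ _ _ _) m3) m4.
have h01c : 0 <= h <= 1 by rewrite !ltW.
have eE : edge_defect (fun X => w (hom h X y)) A (A + a) C (A + b) =
    (1 - h) * (al * (N2 - N1) + (1 - be) * (N3 - N4)).
  rewrite /edge_defect f3 f2 f1.
  transitivity ((1 - h) * (al * N2 + (be - 1) * N4) - al * ((1 - h) * N1) + (1 - be) * ((1 - h) * N3)) => //.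
  ring.
exact: (combine_gaps p1 epsX h01c al01 be01 E10 E20 g1 g2 eE).
Qed.

End HomotheticStage.

(** * The limit as the homothetic copies fill K *)

Section Limits.
Context {R : realType}.

Lemma continuous_powR_norm (p : R) : 1 <= p -> continuous (fun t : R => `|t| `^ p).
Proof.
move=> p1 t; have p0 : 0 < p by exact: lt_le_trans p1.
have [->|tn] := eqVneq t 0.
  rewrite /continuous_at normr0 powR0 ?gt_eqF//; apply/cvgrPdist_le => e e0; near=> s.
  rewrite sub0r normrN ger0_norm ?powR_ge0//.
  have s1 : `|s| <= 1.
    near: s; apply/nbhs_ballP; exists 1 => //= s; rewrite /ball /= sub0r normrN; exact: ltW.
  have se : `|s| <= e.
    near: s; apply/nbhs_ballP; exists e => //= s; rewrite /ball /= sub0r normrN; exact: ltW.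
  have [->|sn] := eqVneq s 0; first by rewrite normr0 powR0 ?gt_eqF// ltW.
  apply: le_trans se; have := @ger_powR _ `|s| _ 1 p p1; rewrite powRr1//; apply.
  by rewrite normr_gt0 sn s1.
have t0 : 0 < `|t| by rewrite normr_gt0.
apply: (@continuous_comp _ _ _ (fun t : R => `|t|) (fun r : R => r `^ p)).
  exact: (@norm_continuous _ R^o).
apply: differentiable_continuous; apply/derivable1_diffP; apply: derivable_powR.
by rewrite in_itv /= t0.
Unshelve. all: by end_near.
Qed.

Lemma cvg_perturb (P : R * R) (k : nat -> R) (z : nat -> R * R) (M : R) :
  k n @[n --> \oo] --> (0 : R) -> (forall n, `|(z n).1| <= M /\ `|(z n).2| <= M) ->
  (P + k n *: z n) @[n --> \oo] --> P.
Proof.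
case: P => P1 P2 k0 zM.
have sq (f : nat -> R) : (forall n, `|f n| <= M) -> k n * f n @[n --> \oo] --> (0 : R).
  move=> fM; apply/cvgr0Pnorm_le => e e0.
  have M0 : 0 < `|M| + 1 by rewrite ltr_wpDl.
  have e1 : 0 < e / (`|M| + 1) by rewrite divr_gt0.
  move/cvgr0Pnorm_le : k0 => /(_ _ e1); apply: filterS => n kn.
  rewrite normrM -(divfK (lt0r_neq0 M0) e); apply: ler_pM => //.
  by apply: le_trans (fM n) _; apply: le_trans (ler_norm M) _; rewrite lerDl.
have c1 : P1 + k n * (z n).1 @[n --> \oo] --> P1.
  rewrite -[X in _ --> X]addr0; apply: cvgD; first exact: cvg_cst.
  by apply: sq => n; case: (zM n).
have c2 : P2 + k n * (z n).2 @[n --> \oo] --> P2.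
  rewrite -[X in _ --> X]addr0; apply: cvgD; first exact: cvg_cst.
  by apply: sq => n; case: (zM n).
exact: (cvg_pair c1 c2).
Qed.

Lemma within_cvg (K : set (R * R)) (w : R * R -> R) (P : R * R) (z : nat -> R * R) :
  {within K, continuous w} -> K P -> (forall n, K (z n)) ->
  z n @[n --> \oo] --> P -> w (z n) @[n --> \oo] --> w P.
Proof.
move=> cw KP Kz zP.
have : w x @[x --> within K (nbhs P)] --> w P.
  have := cw P; rewrite /continuous_at /prop_for /=.
  by rewrite nbhs_subspace_in.
apply: cvg_trans => Q /= nQ.
have H : \forall n \near \oo, K (z n) -> Q (w (z n)) := zP _ nQ.
by apply: filterS H => n; apply; exact: Kz.
Qed.

Lemma limn_einf_le (f : nat -> \bar R) (C : \bar R) : (forall n, f n <= C)%E ->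
  (limn_einf f <= C)%E.
Proof.
move=> fC; rewrite limn_einf_lim; apply: lime_le; first exact: is_cvg_einfs.
apply: nearW => n; apply: le_trans (fC n); apply: ereal_inf_lbound.
by exists n => //=.
Qed.

End Limits.

Section MainEstimate.
Context {R : realType}.
Notation mu := (@lebesgue_measure R).
Notation mu2 := (@lebesgue2 R).
Notation plane := (measurableTypeR R * measurableTypeR R)%type.
Variables (D K : set (R * R)) (A a b : R * R) (al be p M : R).
Variables (u u1 u2 u11 u12 u21 u22 w G1 G2 : R * R -> R).
Hypothesis oD : open D.
Hypothesis D0 : D !=set0.
Hypothesis DK : D `<=` K.
Hypothesis convK : forall X Y t, K X -> K Y -> 0 <= t <= 1 -> K (X + t *: (Y - X)).
Hypothesis homD : forall h X y, 0 < h < 1 -> K X -> D y -> D (hom h X y).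
Hypothesis KM : forall x, K x -> `|x.1| <= M /\ `|x.2| <= M.
Hypothesis w1 : plane_wd D (e1 R) u u1.
Hypothesis w2 : plane_wd D (e2 R) u u2.
Hypothesis w11 : plane_wd D (e1 R) u1 u11.
Hypothesis w12 : plane_wd D (e2 R) u1 u12.
Hypothesis w21 : plane_wd D (e1 R) u2 u21.
Hypothesis w22 : plane_wd D (e2 R) u2 u22.
Hypothesis p1 : 1 <= p.
Hypothesis mK : measurable (K : set plane).
Hypothesis mG1 : measurable_fun [set: plane] G1.
Hypothesis mG2 : measurable_fun [set: plane] G2.
Hypothesis G10 : forall x, 0 <= G1 x.
Hypothesis G20 : forall x, 0 <= G2 x.
Hypothesis KG1 : forall X Y, K X -> K Y ->
  gradient_le (dir_comb a u11 u21) (dir_comb a u12 u22) G1 (Y - X) 1.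
Hypothesis KG2 : forall X Y, K X -> K Y ->
  gradient_le (dir_comb b u11 u21) (dir_comb b u12 u22) G2 (Y - X) 1.
Hypothesis uw : {ae mu2, forall x, D x -> u x = w x}.
Hypothesis cw : {within K, continuous w}.
Hypothesis ab : cross a b != 0.
Hypothesis al01 : 0 <= al <= 1.
Hypothesis be01 : 0 <= be <= 1.
Hypothesis eps0 : 0 < al + be - 1.
Local Notation C := (A + al *: a + be *: b).
Hypothesis KA : K A.
Hypothesis KB : K (A + a).
Hypothesis KD : K (A + b).
Hypothesis KC : K C.
Hypothesis Kfin : (0 < mu2 K <= `|cross a b|%:E)%E.

Local Notation E1 := (energy G1 p).
Local Notation E2 := (energy G2 p).

(** The centres y depend on h but stay in the bounded set K, so the copies of the vertices converge
    to the vertices. The means m converge because (1 - h) m is a difference of values of the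
    continuous w. The first bound passes to the limit by Fatou, the second by continuity. *)
Theorem main_estimate :
  (\int[mu2]_(x in D) (`|dir_comb a u1 u2 x - (w (A + a)%R - w A)| `^ p)%:E <=
     (40 * 2 `^ p)%:E * E1)%E /\
  (((al + be - 1) * `|cross a b| * `|edge_defect al be w A (A + a) C (A + b)| `^ p)%:E <=
    (2 `^ p * (2 * (2 `^ p * (40 * 2 `^ p))))%:E * (E1 + ((1 - be) `^ p)%:E * E2))%E.
Proof.
(* The shift by 2 makes h at most 1/2 from the start. *)
pose h n : R := n.+2%:R^-1.
have h0 n : 0 < h n by rewrite invr_gt0 ltr0n.
have h2 n : h n <= 2^-1 by rewrite lef_pV2 ?posrE ?ltr0n// ler_nat.
have h1 n : h n < 1 by apply: le_lt_trans (h2 n) _; rewrite invf_lt1 ?ltr1n.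
have h01 n : 0 < h n < 1 by rewrite h0 h1.
have h02 n : 0 < h n <= 2^-1 by rewrite h0 h2.
have ch : h n @[n --> \oo] --> (0 : R).
  have := @cvg_harmonic R; rewrite -(cvg_shiftS (@harmonic R)) => H.
  exact: H.
have ck : h n / (1 - h n) @[n --> \oo] --> (0 : R).
  rewrite -[X in _ --> X](mul0r (1 - 0)^-1); apply: cvgM => //.
  apply: cvgV; first by rewrite subr0 oner_eq0.
  by apply: cvgB => //; exact: cvg_cst.
have [y Hy] := choice (fun n => homothetic_estimate oD D0 convK (h02 n) (fun X y => homD (h01 n)) w1 w2 w11 w12 w21 w22
  p1 mK mG1 mG2 G10 G20 KG1 KG2 uw ab al01 be01 eps0 KA KB KD KC Kfin).
have [m Hm] := choice Hy; clear Hy.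
have Dy n : D (y n) by case: (Hm n).
have yM n : `|(y n).1| <= M /\ `|(y n).2| <= M by apply: KM; exact: DK.
have subM z : K z -> forall n, `|(y n - z).1| <= M + M /\ `|(y n - z).2| <= M + M.
  move=> /KM[z1 z2] n; have [? ?] := yM n.
  by split; apply: le_trans (ler_normB _ _) _; exact: lerD.
have wc z : K z -> w (hom (h n) z (y n)) @[n --> \oo] --> w z.
  move=> Kz; apply: (within_cvg cw) => //.
    by move=> n; apply: DK; exact: homD.
  rewrite (_ : (fun n => _) = fun n => z + h n *: (y n - z)).
    exact (@cvg_perturb R z h (fun n => y n - z) (M + M) ch (subM z Kz)).
  by apply/funext => n; rewrite /hom; vec.
split; last first.
  set RHS := (_ * _)%E in Hm *.
  have c0 : 0 <= (al + be - 1) * `|cross a b| by rewrite mulr_ge0// ltW.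
  pose e n := edge_defect al be (fun X => w (hom (h n) X (y n))) A (A + a) C (A + b).
  have ce : e n @[n --> \oo] --> edge_defect al be w A (A + a) C (A + b).
    apply: cvgD; last by apply: cvgMr; apply: cvgB; exact: wc.
    by apply: cvgB; [apply: cvgB; exact: wc|apply: cvgMr; apply: cvgB; exact: wc].
  have cE : ((al + be - 1) * `|cross a b| * `|e n| `^ p)%:E @[n --> \oo] -->
      ((al + be - 1) * `|cross a b| * `|edge_defect al be w A (A + a) C (A + b)| `^ p)%:E.
    apply: cvg_EFin; first exact: nearW.
    apply: cvgMr; exact: (continuous_cvg _ (@continuous_powR_norm R p p1 _) ce).
  rewrite -(cvg_lim (@ereal_hausdorff R) cE); apply: lime_le; first exact: (cvgP _ cE).
  by apply: nearW => n; case: (Hm n).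
have cm : m n @[n --> \oo] --> w (A + a) - w A.
  have -> : m = fun n => (1 - h n)^-1 * (w (hom (h n) (A + a) (y n)) - w (hom (h n) A (y n))).
    apply/funext => n; have [_ <- _ _] := Hm n.
    by rewrite mulKf// subr_eq0 eq_sym lt_eqF.
  rewrite -[X in _ --> X]mul1r; apply: cvgM; last by apply: cvgB; exact: wc.
  rewrite -[X in _ --> X]invr1; apply: cvgV; first exact: oner_neq0.
  by rewrite -[X in _ --> X]subr0; apply: cvgB => //; exact: cvg_cst.
pose v := dir_comb a u1 u2.
have mv : measurable_fun [set: plane] v.
  have [_ /integrableP[/measurable_EFinP mg1 _] _] := w1.
  have [_ /integrableP[/measurable_EFinP mg2 _] _] := w2.
  by apply: measurable_funD; apply: measurable_funM.
(* The inverse of the homothety with centre y n. The indicator of K at [X n x] tells whether x lies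
   in the shrunken copy, and it is eventually 1 at each point of D. *)
pose X n (x : R * R) := x + (h n / (1 - h n)) *: (x - y n).
have XE n x : X n (hom (h n) x (y n)) = x.
  have n1 : 1 - h n != 0 by rewrite subr_eq0 eq_sym lt_eqF.
  by apply: injective_projections; rewrite /X /hom /= /GRing.scale /=; field.
have mX n : measurable_fun [set: plane] (X n : plane -> plane).
  apply: (measurable_lin (X := fun x => x) (w := fun x : plane => (x - y n)%R) (t := fun=> h n / (1 - h n))) => //.
  exact: (measurable_shift (- y n)).
have mKE : measurable_fun setT (fun X : plane => (\1_K X)%:E : \bar R).
  by apply/measurable_EFinP; exact: measurable_indic.
pose f n x := ((\1_K (X n x))%:E * (`|v x - m n| `^ p)%:E)%E.
have mf n : measurable_fun [set: plane] (f n).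
  apply: emeasurable_funM; first exact: (measurableT_comp mKE (mX n)).
  exact: (measurable_powR_dist p mv (measurable_cst (m n))).
have f0 n x : (0 <= f n x)%E by rewrite mule_ge0 ?lee_fin ?powR_ge0.
have mD : measurable (D : set plane) by exact: open_measurable_plane.
have fC n : (\int[mu2]_(x in D) f n x <= (40 * 2 `^ p)%:E * E1)%E.
  apply: (@le_trans _ _ (\int[mu2]_x f n x)%E).
    by apply: ge0_subset_integral => //; exact: mf.
  have n1 : 1 - h n != 0 by rewrite subr_eq0 eq_sym lt_eqF.
  (* Transport back to K costs the Jacobian (1 - h n)^2, which is at most 1. *)
  rewrite (ge0_integral_homothety (h n *: y n) n1 (mf n) (f0 n)).
  rewrite (_ : \int[mu2]_x _ = power_dist K (fun x => v (hom (h n) x (y n))) p (m n))%E; last first.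
    apply: eq_integral => x _; rewrite /f (_ : h n *: y n + (1 - h n) *: x = hom (h n) x (y n)); last by rewrite addrC.
    by rewrite XE.
  have [_ _ + _] := Hm n; apply: le_trans.
  rewrite -[leRHS]mul1e; apply: lee_wpmul2r; first exact: power_dist_ge0.
  have a0 : 0 <= 1 - h n by rewrite subr_ge0 ltW.
  have a1 : 1 - h n <= 1 by rewrite lerBlDr lerDl ltW.
  by rewrite lee_fin exprn_ile1.
have lim x : D x -> (f n x @[n --> \oo] --> (`|v x - (w (A + a) - w A)| `^ p)%:E)%E.
  move=> Dx; have cX : X n x @[n --> \oo] --> x.
    have zM n : `|(x - y n).1| <= M + M /\ `|(x - y n).2| <= M + M.
      have [? ?] := KM (DK Dx); have [? ?] := yM n.
      by split; apply: le_trans (ler_normB _ _) _; exact: lerD.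
    exact (@cvg_perturb R x (fun n => h n / (1 - h n)) (fun n => x - y n) (M + M) ck zM).
  have nD : \forall n \near \oo, D (X n x).
    by apply: cX; apply: open_nbhs_nbhs.
  apply: (@cvg_trans _ ((`|v x - m n| `^ p)%:E @[n --> \oo])%E).
    apply: near_eq_cvg; apply: filterS nD => n Dn.
    by rewrite /f indicE mem_set ?mul1e//; exact: DK.
  apply: cvg_EFin; first exact: nearW.
  have cvm : v x - m n @[n --> \oo] --> v x - (w (A + a) - w A).
    by apply: cvgB => //; exact: cvg_cst.
  exact: (continuous_cvg _ (@continuous_powR_norm R p p1 _) cvm).
apply: (@le_trans _ _ (\int[mu2]_(x in D) limn_einf (f ^~ x))%E).
  rewrite le_eqVlt; apply/orP; left; apply/eqP; apply: eq_integral => x; rewrite inE => Dx.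
  have L := lim x Dx.
  by rewrite is_cvg_limn_einfE; [rewrite (cvg_lim (@ereal_hausdorff R) L)|exact: (cvgP _ L)].
have mfD n : measurable_fun D (f n) by apply: measurable_funTS; exact: mf.
have Fa := @fatou _ plane R mu2 D mD f mfD (fun n x _ => f0 n x).
exact: le_trans Fa (limn_einf_le fC).
Qed.

End MainEstimate.

(** * Consequences of the angle and side conditions *)

Section Euclidean.
Context {R : realType}.
Implicit Types (p q x y : R * R) (t : R).

Lemma dot_ge0 p : 0 <= dot p p.
Proof. by rewrite /dot -!expr2 addr_ge0 ?sqr_ge0. Qed.

Lemma enorm_ge0 p : 0 <= enorm p. Proof. exact: sqrtr_ge0. Qed.

Lemma sqr_enorm p : enorm p ^+ 2 = dot p p.
Proof. by rewrite sqr_sqrtr// dot_ge0. Qed.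

Lemma enorm_gt0 p : p != 0 -> 0 < enorm p.
Proof.
move=> p0; rewrite sqrtr_gt0 lt_neqAle dot_ge0 andbT eq_sym; apply: contra p0.
rewrite /dot paddr_eq0 -?expr2 ?sqr_ge0// !sqrf_eq0 => /andP[/eqP p1 /eqP p2].
by rewrite [p]surjective_pairing p1 p2.
Qed.

Lemma lagrange p q : dot p q ^+ 2 + cross p q ^+ 2 = (enorm p * enorm q) ^+ 2.
Proof. by rewrite exprMn !sqr_enorm /dot /cross; ring. Qed.

Lemma norm_dot_le p q : `|dot p q| <= enorm p * enorm q.
Proof.
rewrite -(@ler_pXn2r _ 2)// ?nnegrE ?mulr_ge0 ?enorm_ge0// -lagrange real_normK ?num_real//.
by rewrite lerDl sqr_ge0.
Qed.

Lemma norm_cross_le p q : `|cross p q| <= enorm p * enorm q.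
Proof.
rewrite -(@ler_pXn2r _ 2)// ?nnegrE ?mulr_ge0 ?enorm_ge0// -lagrange real_normK ?num_real//.
by rewrite lerDr sqr_ge0.
Qed.

Lemma enormZ t p : enorm (t *: p) = `|t| * enorm p.
Proof.
rewrite /enorm (_ : dot _ _ = t ^+ 2 * dot p p); last by rewrite /dot /= /GRing.scale /=; ring.
by rewrite sqrtrM ?sqr_ge0// sqrtr_sqr.
Qed.

Lemma enormN p : enorm (- p) = enorm p.
Proof. by rewrite /enorm /dot /= !mulrNN. Qed.

Lemma enormD p q : enorm (p + q) <= enorm p + enorm q.
Proof.
rewrite -(@ler_pXn2r _ 2)// ?nnegrE ?addr_ge0 ?enorm_ge0// sqrrD !sqr_enorm.
rewrite (_ : dot (p + q) (p + q) = dot p p + dot p q *+ 2 + dot q q); last first.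
  by rewrite /dot /=; ring.
by rewrite lerD2r lerD2l lerMn2r /= (le_trans (ler_norm _))// norm_dot_le.
Qed.

(* Angles larger than psi are excluded, so a vertex with a non-acute angle has a sine
   that is bounded from below. *)
Lemma obtuse_cross (psi : R) p q : 0 < psi < pi -> p != 0 -> q != 0 ->
  acos (dot p q / (enorm p * enorm q)) <= psi -> dot p q <= 0 ->
  sin psi * (enorm p * enorm q) <= `|cross p q|.
Proof.
move=> /andP[psi0 psi1] p0 q0 H d0.
have N0 : 0 < enorm p * enorm q by rewrite mulr_gt0// enorm_gt0.
set r := _ / _ in H.
have r1 : -1 <= r <= 1.
  by rewrite -ler_norml /r normrM normfV (gtr0_norm N0) ler_pdivrMr// mul1r norm_dot_le.
have p0I : psi \in `[0, pi]%R by rewrite in_itv /= !ltW.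
have aI : acos r \in `[0, pi]%R by rewrite in_itv /= acos_ge0// acos_lepi.
have cr : cos psi <= r.
  rewrite leNgt; apply/negP => lt; move: H; apply/negP; rewrite -ltNge.
  by rewrite -ltr_cos// acosK.
have sp0 : 0 < sin psi by apply: sin_gt0_pi; rewrite psi0.
have dr : dot p q = r * (enorm p * enorm q) by rewrite /r divfK// gt_eqF.
have r0 : r <= 0 by rewrite /r pmulr_lle0// invr_gt0.
have sN : 0 <= sin psi * (enorm p * enorm q) by rewrite mulr_ge0// ltW.
rewrite -(@ler_pXn2r _ 2)// real_normK ?num_real// -[leRHS](addKr (dot p q ^+ 2)) lagrange dr !exprMn addrC -mulNr.
have := cos2Dsin2 psi => cs.
rewrite (_ : sin psi ^+ 2 = 1 - cos psi ^+ 2); last by rewrite -cs; ring.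
rewrite -subr_ge0 (_ : _ - _ = (cos psi ^+ 2 - r ^+ 2) * (enorm p * enorm q) ^+ 2); last by rewrite !exprMn; ring.
rewrite mulr_ge0 ?sqr_ge0// subr_sqr.
by rewrite mulr_le0// ?subr_le0//; lra.
Qed.

End Euclidean.

(** * Shape constants; cb and cd are the vectors from B and from D to C *)

Section QuadConstants.
Context {R : realType}.
Variables (a b : R * R) (al be sg c : R).
Hypothesis X0 : 0 < cross a b.
Hypothesis al01 : 0 <= al <= 1.
Hypothesis be01 : 0 <= be <= 1.
Hypothesis eps0 : 0 < al + be - 1.
Hypothesis sg01 : 0 < sg <= 1.
Hypothesis c0 : 0 < c.
Local Notation cb := ((al - 1) *: a + be *: b).
Local Notation cd := (al *: a + (be - 1) *: b).
Hypothesis angA : dot a b <= 0 -> sg * (enorm a * enorm b) <= cross a b.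
Hypothesis angB : dot (- a) cb <= 0 -> sg * (enorm a * enorm cb) <= be * cross a b.
Hypothesis angD : dot (- b) cd <= 0 -> sg * (enorm b * enorm cd) <= al * cross a b.
Hypothesis angC : dot cb cd <= 0 -> sg * (enorm cb * enorm cd) <= (al + be - 1) * cross a b.
Hypothesis sideCD : c * enorm cd <= enorm a.
Hypothesis sideBC : c * enorm cb <= enorm b.
Hypothesis sideAB : c * enorm a <= enorm cd.
Hypothesis sideDA : c * enorm b <= enorm cb.

Let La0 : 0 < enorm a.
Proof. by apply: enorm_gt0; apply: contraTneq X0 => ->; rewrite /cross /= !mul0r subrr ltxx. Qed.
Let Lb0 : 0 < enorm b.
Proof. by apply: enorm_gt0; apply: contraTneq X0 => ->; rewrite /cross /= !mulr0 subrr ltxx. Qed.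

(** Passing from a to the opposite side and back multiplies by c^2. *)
Lemma clos_le1 : c <= 1.
Proof.
have cd0 : 0 < enorm cd by apply: lt_le_trans sideAB; rewrite mulr_gt0.
have : c ^+ 2 * enorm cd <= 1 * enorm cd.
  by rewrite mul1r expr2 -mulrA; apply: le_trans sideAB; rewrite ler_pM2l.
by rewrite ler_pM2r// -[leRHS](expr1n _ 2) ler_pXn2r// nnegrE ltW.
Qed.

(* A substitute for the fact that the angles add up to 2 pi. *)
Lemma some_nonacute : [\/ dot a b <= 0, dot (- a) cb <= 0, dot (- b) cd <= 0 | dot cb cd <= 0].
Proof.
have [?|m0] := leP (dot a b) 0; first by constructor 1.
have [?|B0] := leP (dot (- a) cb) 0; first by constructor 2.
have [?|D0] := leP (dot (- b) cd) 0; first by constructor 3.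
constructor 4; have /andP[al0 al1] := al01; have /andP[be0 be1] := be01.
have Be : dot (- a) cb = (1 - al) * dot a a - be * dot a b.
  by rewrite /dot /= /GRing.scale /=; ring.
have De : dot (- b) cd = (1 - be) * dot b b - al * dot a b.
  by rewrite /dot /= /GRing.scale /=; ring.
have Ce : dot cb cd = - al * dot (- a) cb - be * dot (- b) cd - (al + be - 1) * dot a b.
  by rewrite /dot /= /GRing.scale /=; ring.
have t1 : 0 <= al * dot (- a) cb by rewrite mulr_ge0// ltW.
have t2 : 0 <= be * dot (- b) cd by rewrite mulr_ge0// ltW.
have t3 : 0 <= (al + be - 1) * dot a b by rewrite mulr_ge0// ltW.
by rewrite Ce mulNr; lra.
Qed.

(** At a nonacute vertex the sine is at least sg. The cross product there is at most [cross a b],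
    and each side other than a and b is replaced by its opposite at the cost of a factor c; the
    vertex C needs two replacements. *)
Lemma cross_ge : sg * c ^+ 2 * (enorm a * enorm b) <= cross a b.
Proof.
have /andP[sg0 _] := sg01; have c1 := clos_le1.
have /andP[al0 al1] := al01; have /andP[be0 be1] := be01.
have L0 : 0 < enorm a * enorm b by rewrite mulr_gt0.
have step (t : R) : t <= 1 -> t * cross a b <= cross a b by move=> t1; rewrite ler_piMl// ltW.
have c2 : c ^+ 2 <= c by rewrite expr2 ler_piMl// ltW.
have scale (k t : R) : c ^+ 2 <= k -> k * (enorm a * enorm b) <= t -> sg * c ^+ 2 * (enorm a * enorm b) <= sg * t.
  move=> k1 kt; rewrite -mulrA ler_pM2l//; apply: le_trans kt; rewrite ler_pM2r//.
case: some_nonacute => [/angA|/angB|/angD|/angC] H.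
- have H' := scale 1 (enorm a * enorm b) (le_trans c2 c1).
  by apply: le_trans (H' _) H; rewrite mul1r.
- have H' := scale c (enorm a * enorm cb) c2.
  apply: le_trans (H' _) (le_trans H (step _ be1)).
  by rewrite mulrCA ler_pM2l//; exact: sideDA.
- have H' := scale c (enorm b * enorm cd) c2.
  apply: le_trans (H' _) (le_trans H (step _ al1)).
  by rewrite [_ * enorm b]mulrC mulrCA ler_pM2l//; exact: sideAB.
have H' := scale (c ^+ 2) (enorm cb * enorm cd) (lexx _).
apply: le_trans (H' _) (le_trans H (step _ _)); last lra.
rewrite expr2 mulrACA [leRHS]mulrC; apply: ler_pM => //; rewrite mulr_ge0// ltW//.
Qed.

(** The cross product of cb and cd is -(al + be - 1) times that of a and b. A nonacute angle at C
    concludes through its sine. Otherwise [Cle] shows that the scalar product is also of order al +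
    be - 1; Lagrange's identity bounds |cb| |cd| by 2 (al + be - 1) |a| |b|, while it is at least
    c^2 |a| |b|. *)
Lemma eps_ge : sg * c ^+ 2 / 2 <= al + be - 1.
Proof.
have /andP[sg0 sg1] := sg01.
have /andP[al0 al1] := al01; have /andP[be0 be1] := be01.
have L0 : 0 < enorm a * enorm b by rewrite mulr_gt0.
have XL : cross a b <= enorm a * enorm b.
  by apply: le_trans (ler_norm _) (norm_cross_le _ _).
have mL := norm_dot_le a b.
have cbcd : c ^+ 2 * (enorm a * enorm b) <= enorm cb * enorm cd.
  by rewrite expr2 mulrACA [leRHS]mulrC; apply: ler_pM => //; rewrite mulr_ge0// ltW.
have c20 : 0 < c ^+ 2 by rewrite exprn_gt0.
have [/angC H|C0] := leP (dot cb cd) 0.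
  have : sg * c ^+ 2 * (enorm a * enorm b) <= (al + be - 1) * (enorm a * enorm b).
    apply: (@le_trans _ _ (sg * (enorm cb * enorm cd))).
      by rewrite -mulrA ler_pM2l.
    by apply: le_trans H _; rewrite ler_pM2l.
  rewrite ler_pM2r// => H2; apply: le_trans H2; rewrite ler_pdivrMr// ler_peMr ?mulr_ge0 ?ltW//.
  by rewrite ltr1n.
have Cle : dot cb cd <= (al + be - 1) * `|dot a b|.
  have na := dot_ge0 (a - b); have nb := dot_ge0 b; have na' := dot_ge0 a.
  (* In both identities the terms other than the one in [dot a b] are nonpositive; the larger of al
     and be decides which identity has this property. *)
  have [ba|ab] := leP be al.
    rewrite (_ : dot cb cd = (al + be - 1) * ((al - (1 - al)) * dot a b - (al - be) * dot b b)
        - al * (1 - al) * dot (a - b) (a - b)); last first.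
      by rewrite /dot /= /GRing.scale /=; ring.
    have t1 : 0 <= al * (1 - al) * dot (a - b) (a - b) by rewrite !mulr_ge0// subr_ge0.
    have t2 : 0 <= (al - be) * dot b b by rewrite mulr_ge0// subr_ge0.
    have t3 : (al - (1 - al)) * dot a b <= `|dot a b|.
      apply: le_trans (ler_norm _) _; rewrite normrM ler_piMl// ler_norml; apply/andP; split; lra.
    apply: (@le_trans _ _ ((al + be - 1) * ((al - (1 - al)) * dot a b - (al - be) * dot b b))).
      by rewrite lerBlDr lerDl.
    by rewrite ler_pM2l// lerBlDr (le_trans t3)// lerDl.
  rewrite (_ : dot cb cd = (al + be - 1) * ((be - (1 - be)) * dot a b - (be - al) * dot a a)
      - be * (1 - be) * dot (a - b) (a - b)); last first.
    by rewrite /dot /= /GRing.scale /=; ring.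
  have t1 : 0 <= be * (1 - be) * dot (a - b) (a - b) by rewrite !mulr_ge0// subr_ge0.
  have t2 : 0 <= (be - al) * dot a a by rewrite mulr_ge0// subr_ge0 ltW.
  have t3 : (be - (1 - be)) * dot a b <= `|dot a b|.
    apply: le_trans (ler_norm _) _; rewrite normrM ler_piMl// ler_norml; apply/andP; split; lra.
  apply: (@le_trans _ _ ((al + be - 1) * ((be - (1 - be)) * dot a b - (be - al) * dot a a))).
    by rewrite lerBlDr lerDl.
  by rewrite ler_pM2l// lerBlDr (le_trans t3)// lerDl.
have crossC : cross cb cd = - ((al + be - 1) * cross a b).
  by rewrite /cross /= /GRing.scale /=; ring.
set N := enorm a * enorm b in L0 XL mL cbcd *; set ep := al + be - 1 in Cle crossC *.
have ep0 : 0 < ep := eps0.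
have dN : dot cb cd <= ep * N by apply: le_trans Cle _; rewrite ler_pM2l.
have xN : ep * cross a b <= ep * N by rewrite ler_pM2l.
have xX0 : 0 <= ep * cross a b by rewrite mulr_ge0// ltW.
have sq : (c ^+ 2 * N) ^+ 2 <= (2 * ep * N) ^+ 2.
  apply: (@le_trans _ _ ((enorm cb * enorm cd) ^+ 2)).
    by rewrite ler_pXn2r// nnegrE ?mulr_ge0 ?enorm_ge0// ltW.
  rewrite -lagrange crossC sqrrN.
  apply: (@le_trans _ _ ((ep * N) ^+ 2 + (ep * N) ^+ 2)).
    by apply: lerD; rewrite ler_pXn2r// nnegrE ?mulr_ge0// ltW.
  by rewrite -subr_ge0 (_ : _ - _ = 2 * (ep * N) ^+ 2); [rewrite mulr_ge0// sqr_ge0|ring].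
have H3 : c ^+ 2 * N <= 2 * ep * N.
  by rewrite -(@ler_pXn2r _ 2)// nnegrE; rewrite !mulr_ge0// ltW.
have H4 : c ^+ 2 <= 2 * ep by rewrite -(ler_pM2r L0).
rewrite ler_pdivrMr// [ep * 2]mulrC; apply: le_trans H4; by rewrite ler_piMl// ltW.
Qed.

(** (1 - be) b is the difference of al a and cd, of lengths at most |a| and |a| / c. *)
Lemma defect_b : (1 - be) * enorm b <= (1 + c^-1) * enorm a.
Proof.
have /andP[al0 al1] := al01; have /andP[be0 be1] := be01.
have -> : (1 - be) * enorm b = enorm (al *: a - cd).
  rewrite (_ : al *: a - cd = (1 - be) *: b); last by vec.
  by rewrite enormZ ger0_norm// subr_ge0.
apply: le_trans (enormD _ _) _; rewrite enormN enormZ ger0_norm// mulrDl mul1r; apply: lerD.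
  by rewrite ler_piMl// enorm_ge0.
by rewrite ler_pdivlMl.
Qed.

Lemma defect_a : (1 - al) * enorm a <= (1 + c^-1) * enorm b.
Proof.
have /andP[al0 al1] := al01; have /andP[be0 be1] := be01.
have -> : (1 - al) * enorm a = enorm (be *: b - cb).
  rewrite (_ : be *: b - cb = (1 - al) *: a); last by vec.
  by rewrite enormZ ger0_norm// subr_ge0.
apply: le_trans (enormD _ _) _; rewrite enormN enormZ ger0_norm// mulrDl mul1r; apply: lerD.
  by rewrite ler_piMl// enorm_ge0.
by rewrite ler_pdivlMl.
Qed.

End QuadConstants.

(** * The isoparametric interpolant *)

Section ReferenceCoordinates.
Context {R : realType}.
Implicit Types (z xh : R * R).

(* A bilinear function on the reference square read from the vertex number [i]. *)
Definition same_shapes (i : 'I_4) xh z : Prop :=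
  [/\ Q1_shape i xh = (1 - z.1) * (1 - z.2), Q1_shape (i + 1) xh = z.1 * (1 - z.2),
      Q1_shape (i + 2) xh = z.1 * z.2 & Q1_shape (i - 1) xh = (1 - z.1) * z.2].

Lemma rotate_from (i : 'I_4) xh : ref_square xh -> exists2 z, ref_square z & same_shapes i xh z.
Proof.
move: xh i => [x y] [[|[|[|[|?]]]] lt] // [/= /andP[x0 x1] /andP[y0 y1]];
  [exists (x, y)|exists (y, 1 - x)|exists (1 - x, 1 - y)|exists (1 - y, x)];
  by [split => /=; apply/andP; split; lra|split; rewrite /Q1_shape /=; ring].
Qed.

Lemma rotate_to (i : 'I_4) z : ref_square z -> exists2 xh, ref_square xh & same_shapes i xh z.
Proof.
move: z i => [x y] [[|[|[|[|?]]]] lt] // [/= /andP[x0 x1] /andP[y0 y1]];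
  [exists (x, y)|exists (1 - y, x)|exists (1 - x, 1 - y)|exists (y, 1 - x)];
  by [split => /=; apply/andP; split; lra|split; rewrite /Q1_shape /=; ring].
Qed.

Lemma Q1_interp_refE (uh : R * R -> R) xh :
  Q1_interp_ref uh xh = \sum_k uh (ref_vertex R k) * Q1_shape k xh.
Proof. by []. Qed.

Lemma FK_vertex (V : 'I_4 -> R * R) k : FK V (ref_vertex R k) = V k.
Proof.
rewrite /FK (sum_I4 _ k).
move: k => [[|[|[|[|?]]]] lt] //; rewrite /Q1_shape /= /ref_vertex /=;
  by rewrite ?(subr0, subrr, mulr0, mul0r, mulr1, scale0r, scale1r, addr0).
Qed.

(* Eliminating x leaves H y = 0; the condition x <= 1 restricts y to an interval, on which
   H changes sign. *)
Lemma bilinear_solve (al be s t : R) : 0 < al <= 1 -> 0 < be <= 1 -> 0 <= s -> 0 <= t ->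
  (1 - al) * t <= be * (1 - s) -> (1 - be) * s <= al * (1 - t) ->
  exists x y : R, [/\ 0 <= x <= 1, 0 <= y <= 1, s = x * (1 - (1 - al) * y) & t = y * (1 - (1 - be) * x)].
Proof.
move=> /andP[al0 al1] /andP[be0 be1] s0 t0 st ts.
have q0 : 0 <= 1 - al by lra.
have s1 : s <= 1.
  have : 0 <= be * (1 - s) by apply: le_trans st; rewrite mulr_ge0.
  by rewrite pmulr_rge0// subr_ge0.
pose H y := y * (1 - (1 - al) * y) - (1 - be) * s * y - t * (1 - (1 - al) * y).
have cH : continuous H.
  move=> y; apply: cvgB; first apply: cvgB.
  - by apply: cvgM => //; apply: cvgB; [exact: cvg_cst|apply: cvgMr].
  - exact: cvgMr.
  - by apply: cvgMr; apply: cvgB; [exact: cvg_cst|apply: cvgMr].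
have solve m : 0 <= m <= 1 -> 0 <= H m -> s <= 1 - (1 - al) * m ->
    exists x y : R, [/\ 0 <= x <= 1, 0 <= y <= 1, s = x * (1 - (1 - al) * y) & t = y * (1 - (1 - be) * x)].
  move=> /andP[m0 m1] Hm sm.
  have [||y + Hy] := @IVT R H 0 m 0 m0.
  - exact: continuous_subspaceT.
  - have H0 : H 0 <= 0 by rewrite (_ : H 0 = - t) ?oppr_le0// /H; ring.
    by rewrite ge_min H0 le_max Hm orbT.
  rewrite in_itv /= => /andP[y0 ym].
  have ly : (1 - al) * y <= (1 - al) * m by rewrite ler_wpM2l.
  have l1 : (1 - al) * m <= 1 - al by rewrite ler_piMr.
  have L0 : 0 < 1 - (1 - al) * y by lra.
  have Ln : 1 - (1 - al) * y != 0 by rewrite gt_eqF.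
  exists (s / (1 - (1 - al) * y)), y; split.
  - rewrite divr_ge0 ?(ltW L0)//= ler_pdivrMr// mul1r; lra.
  - by rewrite y0 /=; apply: le_trans ym m1.
  - by rewrite divfK.
  - apply: (mulIf Ln); apply/eqP; rewrite -subr_eq0; apply/eqP.
    rewrite -[RHS]oppr0 -Hy /H; field.
    exact: Ln.
(* The interval for y ends at 1, or earlier at the value of y for which x = 1. *)
have [sq|qs] := leP s al.
  apply: (solve 1); rewrite ?ler01 ?lexx// /H; lra.
have q1 : 0 < 1 - al by lra.
have qn : 1 - al != 0 by rewrite gt_eqF.
have mq : (1 - al) * ((1 - s) / (1 - al)) = 1 - s by rewrite mulrC divfK.
apply: (solve ((1 - s) / (1 - al))).
- rewrite divr_ge0 ?subr_ge0 ?(ltW q1)//= ler_pdivrMr// mul1r; lra.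
- rewrite /H mq (_ : _ - _ = s * (be * (1 - s) - (1 - al) * t) / (1 - al)); last by field.
  by rewrite divr_ge0 ?(ltW q1)// mulr_ge0// subr_ge0.
- by rewrite mq; lra.
Qed.

End ReferenceCoordinates.

(** * The interpolant in affine coordinates at one vertex *)

Section InterpolationFormula.
Context {R : realType}.
Variable V : 'I_4 -> R * R.
Hypothesis hV : convex_ccw V.
Variable i : 'I_4.
Local Notation A := (V i).
Local Notation a := (V (i + 1) - V i).
Local Notation b := (V (i - 1) - V i).
Variables al be : R.
Hypothesis hC : V (i + 2) = A + al *: a + be *: b.

Lemma cross_corner_gt0 : 0 < cross a b.
Proof. by have [_ _ _] := side_form_vertex hV i. Qed.

Lemma side_form_coords s t :
  let x := A + s *: a + t *: b in
  [/\ side_form V i x = t * cross a b, side_form V (i - 1) x = s * cross a b,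
      side_form V (i + 1) x = (be * (1 - s) - (1 - al) * t) * cross a b &
      side_form V (i + 2) x = (al * (1 - t) - (1 - be) * s) * cross a b].
Proof.
rewrite /side_form; have [-> -> -> _] := I4_nextE i; rewrite hC.
by split; rewrite /cross /= /GRing.scale /=; ring.
Qed.

(** Strict convexity at the side from V (i + 1) to V (i + 2), evaluated at V (i - 1), whose
    coordinates are (0, 1). *)
Lemma eps_gt0 : 0 < al + be - 1.
Proof.
have [_ _ _ +] := side_form_vertex hV (i + 1); have [-> _ _ _ _] := I4_prevE i.
move=> _; have [_ _ + _] := side_form_vertex hV (i + 1); have [_ _ _ -> _] := I4_prevE i.
have -> : V (i - 1) = A + 0 *: a + 1 *: b.
  by apply: injective_projections; rewrite /= /GRing.scale /=; ring.
have [_ _ -> _] := side_form_coords 0 1; rewrite pmulr_lgt0 ?cross_corner_gt0//; lra.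
Qed.

Lemma albe_gt0 : 0 < al /\ 0 < be.
Proof.
have X0 := cross_corner_gt0; have [s1 s2 _ _] := side_form_coords al be.
split.
  have [_ _ _ +] := side_form_vertex hV (i - 1); have [_ _ -> _ _] := I4_prevE i.
  by rewrite hC s2 pmulr_lgt0.
have [_ _ + _] := side_form_vertex hV i.
by rewrite hC s1 pmulr_lgt0.
Qed.

Definition coord1 x := cross (x - A) b / cross a b.
Definition coord2 x := cross a (x - A) / cross a b.

Lemma corner_coordsE x : x = A + coord1 x *: a + coord2 x *: b.
Proof.
have X0 : cross a b != 0 by rewrite gt_eqF// cross_corner_gt0.
by rewrite -addrA -(coordsE _ X0) addrC subrK.
Qed.

Lemma corner_coords_eq s t : coord1 (A + s *: a + t *: b) = s /\ coord2 (A + s *: a + t *: b) = t.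
Proof.
have X0 : cross a b != 0 by rewrite gt_eqF// cross_corner_gt0.
by split; apply: (mulIf X0); rewrite divfK// /cross /= /GRing.scale /=; ring.
Qed.

Hypothesis al1 : al <= 1.
Hypothesis be1 : be <= 1.

Lemma FK_shapes xh z : same_shapes i xh z ->
  FK V xh = A + (z.1 * (1 - (1 - al) * z.2)) *: a + (z.2 * (1 - (1 - be) * z.1)) *: b.
Proof.
move=> [s0 s1 s2 s3]; rewrite /FK (sum_I4 _ i) s0 s1 s2 s3 hC.
by apply: injective_projections; rewrite /= /GRing.scale /=; ring.
Qed.

(** The signs of the four side forms are exactly the hypotheses of [bilinear_solve], so [xget]
    returns a true preimage. *)
Lemma FK_inv_exists x : quad V x -> ref_square (FK_inv V x) /\ FK V (FK_inv V x) = x.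
Proof.
move=> Kx; rewrite /FK_inv; case: xgetP => [//|none].
have X0 := cross_corner_gt0; have [al0 be0] := albe_gt0.
have [f0 f3 f1 f2] := side_form_coords (coord1 x) (coord2 x); rewrite -corner_coordsE in f0 f1 f2 f3.
have sf k : 0 <= side_form V k x by have /(quadP hV) := Kx; apply.
have c1 : 0 <= coord1 x by have := sf (i - 1); rewrite f3 (pmulr_lge0 _ X0).
have c4 : 0 <= coord2 x by have := sf i; rewrite f0 (pmulr_lge0 _ X0).
have c2 := sf (i + 2); rewrite f2 (pmulr_lge0 _ X0) subr_ge0 in c2.
have c3 := sf (i + 1); rewrite f1 (pmulr_lge0 _ X0) subr_ge0 in c3.
have [||x1 [y1 [x01 y01 sE tE]]] := @bilinear_solve R al be (coord1 x) (coord2 x) _ _ c1 c4 c3 c2.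
- by rewrite al0.
- by rewrite be0.
have [xh sq sh] := rotate_to i (z := (x1, y1)) (conj x01 y01).
by case: (none xh); split => //; rewrite (FK_shapes sh) /= -sE -tE -corner_coordsE.
Qed.

(** xi and eta are the coordinates of [FK_inv V x], turned so that V i corresponds to the origin.
    They are chosen before u. Expressed with the affine coordinates, the only nonaffine part of the
    interpolant is the product xi eta. *)
Lemma Q1_interp_form : exists xi eta : R * R -> R, forall x, quad V x ->
  [/\ 0 <= xi x <= 1, 0 <= eta x <= 1, coord1 x = xi x * (1 - (1 - al) * eta x),
    coord2 x = eta x * (1 - (1 - be) * xi x) &
    forall u, let w := continuous_rep (quad V) u in
     Q1_interp V u x = w A + (w (V (i + 1)) - w A) * coord1 x + (w (V (i - 1)) - w A) * coord2 x +
       edge_defect al be w A (V (i + 1)) (V (i + 2)) (V (i - 1)) * (xi x * eta x)].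
Proof.
suff H x : exists z : R * R, quad V x ->
  [/\ 0 <= z.1 <= 1, 0 <= z.2 <= 1, coord1 x = z.1 * (1 - (1 - al) * z.2),
    coord2 x = z.2 * (1 - (1 - be) * z.1) &
    forall u, let w := continuous_rep (quad V) u in
     Q1_interp V u x = w A + (w (V (i + 1)) - w A) * coord1 x + (w (V (i - 1)) - w A) * coord2 x +
       edge_defect al be w A (V (i + 1)) (V (i + 2)) (V (i - 1)) * (z.1 * z.2)].
  have [z Hz] := choice H.
  by exists (fun x => (z x).1), (fun x => (z x).2) => x; exact: Hz.
(* Outside K any value serves. *)
have [Kx|nKx] := pselect (quad V x); last by exists 0.
have [sq FE] := FK_inv_exists Kx.
have [z [z1 z2] sh] := rotate_from i sq.
exists z => _; have [c1 c2] := corner_coords_eq (z.1 * (1 - (1 - al) * z.2)) (z.2 * (1 - (1 - be) * z.1)).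
rewrite -(FK_shapes sh) FE in c1 c2.
split=> // u w; rewrite /Q1_interp Q1_interp_refE (sum_I4 _ i) /= !FK_vertex -/w.
have [-> -> -> ->] := sh; rewrite c1 c2 /edge_defect; ring.
Qed.

End InterpolationFormula.

(** * Classical derivatives are weak derivatives *)

Section ClassicalWeakDerivatives.
Context {R : realType}.
Notation mu := (@lebesgue_measure R).
Notation mu2 := (@lebesgue2 R).
Notation plane := (measurableTypeR R * measurableTypeR R)%type.
Implicit Types (g : R * R -> R) (v : R * R).
Variable D : set (R * R).
Hypothesis oD : open D.

Let mD : measurable (D : set plane).
Proof. exact: open_measurable_plane. Qed.

Lemma continuous_on_measurable g : (forall x, D x -> {for x, continuous g}) ->
  measurable_fun (D : set plane) g.
Proof.
move=> cg; apply: (measurability _ (RGenOpens.measurableE R)).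
move=> _ [_ [a [b ->] <-]].
rewrite (_ : D `&` _ = (D `&` g @^-1` `]a, b[)°).
  by apply: open_measurable_plane; exact: open_interior.
apply/seteqP; split; last exact: interior_subset.
move=> x [Dx gx]; rewrite /interior /=; apply: filterI.
  by apply: open_nbhs_nbhs.
by apply: (cg x Dx); apply: open_nbhs_nbhs; split => //; exact: interval_open.
Qed.

Lemma test_near_eq0 phi x : test_function D phi -> ~ D x -> \forall y \near x, phi y = 0.
Proof.
move=> tp nDx; have [_ _ sD] := tp.
have : open (~` closed_support phi) by apply: closed_openC; exact: closed_closure.
rewrite openE => /(_ x) H; have {H} := H (fun cs => nDx (sD _ cs)).
rewrite /interior /=; apply: filterS => y ncs; apply: contrapT => py0.
by apply: ncs; apply: subset_closure; apply/eqP.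
Qed.

Lemma continuous_mul_test g phi : test_function D phi ->
  (forall x, D x -> {for x, continuous g}) -> continuous (fun x => g x * phi x).
Proof.
move=> tp cg x; have [Dx|nDx] := pselect (D x).
  by apply: cvgM; [exact: cg|exact: (Ck_continuous (test_function_Ck 0 tp))].
rewrite /continuous_at (test_function_support tp nDx) mulr0; apply: cvg_near_cst.
by apply: filterS (test_near_eq0 tp nDx) => y ->; rewrite mulr0.
Qed.

Lemma bounded_patch_integrable g (M : R) : (mu2 D < +oo)%E ->
  (forall x, D x -> {for x, continuous g}) -> (forall x, D x -> `|g x| <= M) ->
  mu2.-integrable setT (EFin \o (g \_ D)).
Proof.
move=> fD cg gM; rewrite -restrict_EFin; apply/(integrable_mkcond _ mD).1.
apply: measurable_bounded_integrable => //; first exact: continuous_on_measurable.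
exists M; split; first exact: num_real.
by move=> x Mx y Dy; apply: le_trans (gM y Dy) (ltW Mx).
Qed.

(** The integral of F (x + v) - F x vanishes by translation invariance; writing this difference as
    the integral of F' (x + r v) over r in [0, 1], it equals the integral of F' by Fubini and
    translation invariance again. *)
Lemma integral_derive_eq0 v (F F' : R * R -> R) : continuous F -> continuous F' ->
  (forall x, is_derive x v F (F' x)) -> mu2.-integrable setT (EFin \o F) ->
  mu2.-integrable setT (EFin \o F') -> \int[mu2]_x F' x = 0.
Proof.
move=> cF cF' dF iF iF'.
have mF := continuous_measurable_plane cF; have mF' := continuous_measurable_plane cF'.
have mgs := measurable_line_shift v mF'.
have mA : measurable (`[(0:R), 1]%classic : set (measurableTypeR R)) by exact: measurable_itv.
have muA : mu `[(0:R), 1]%classic = 1%E by rewrite lebesgue_measure_itv /= lte_fin ltr01 -EFinB subr0.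
have finA : (mu `[0%R, 1%R]%classic < +oo)%E by rewrite muA ltry.
have /integrableP[_ gf] := iF'.
have gfin : (\int[mu2]_x `|F' x|%:E)%E \is a fin_num.
  by rewrite ge0_fin_numE//; exact: integral_ge0.
have Nshift (r : R) : (\int[mu2]_x `|F' (x + r *: v)|%:E = \int[mu2]_x `|F' x|%:E)%E.
  apply: (integral_shift (r *: v) (F := fun x => `|F' x|%:E)%E).
  by apply/measurable_EFinP; exact: measurableT_comp.
have [] := @Rfubini2 R (fun z => F' (z.1 + z.2 *: v)) `[0, 1]%classic
  (fine (\int[mu2]_x `|F' x|%:E)%E) mgs mA finA.
  by move=> r _; rewrite fineK//= Nshift.
move=> _ _ /=.
rewrite (_ : \int[mu]_(r in `[0, 1]) _ = \int[mu2]_x F' x) => [<-|]; last first.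
  transitivity (\int[mu]_(r in `[0, 1]) \int[mu2]_x F' x).
    by apply: eq_Rintegral => r _; exact: Rintegral_shift.
  transitivity ((\int[mu2]_x F' x) * fine (mu `[0%R, 1%R]%classic)); first exact: Rintegral_cst.
  by rewrite muA /= mulr1.
transitivity (\int[mu2]_x (F (x + v) - F x)); last first.
  by rewrite RintegralB// ?Rintegral_shift ?subrr//; exact: integrable_shift.
apply: eq_Rintegral => x _.
transitivity (F (x + 1 *: v) - F (x + 0 *: v)); last by rewrite scale1r scale0r addr0.
apply: (@continuous_integral_derive R (fun r => F (x + r *: v)) (fun r => F' (x + r *: v))) => //.
  by move=> t; apply/is_derive_line; exact: dF.
move=> t; apply: (@continuous_comp _ _ _ (fun r : R => x + r *: v) F'); last exact: cF'.
by apply: cvgD; [exact: cvg_cst|apply: cvgZl; exact: cvg_id].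
Qed.

(** The product of g and phi is continuously differentiable along v in the whole plane, since phi
    vanishes near every point outside D. [integral_derive_eq0] then is the integration by parts. *)
Lemma classical_weak_derivative v g g' (M : R) : (mu2 D < +oo)%E ->
  (forall x, D x -> is_derive x v g (g' x)) ->
  (forall x, D x -> {for x, continuous g}) -> (forall x, D x -> {for x, continuous g'}) ->
  (forall x, D x -> `|g x| <= M) -> (forall x, D x -> `|g' x| <= M) ->
  plane_wd D v (g \_ D) (g' \_ D).
Proof.
move=> fD dg cg cg' gM g'M.
have ig := bounded_patch_integrable fD cg gM; have ig' := bounded_patch_integrable fD cg' g'M.
split=> // phi tp; have tdp := test_derive v tp.
have ptE (k psi : R * R -> R) x : test_function D psi -> (k \_ D) x * psi x = k x * psi x.
  move=> tpsi; rewrite patchE; case: ifPn => // /negP nDx.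
  by rewrite (test_function_support tpsi) ?mulr0// => Dx; apply: nDx; exact/mem_set.
have i1 : mu2.-integrable setT (EFin \o (fun x => g x * 'D_v phi x)).
  have E : (fun x => (g \_ D) x * 'D_v phi x) = (fun x => g x * 'D_v phi x).
    by apply/funext => x; exact: (ptE g _ x tdp).
  by rewrite -E; exact: integrable_mul_test tdp ig.
have i2 : mu2.-integrable setT (EFin \o (fun x => g' x * phi x)).
  have E : (fun x => (g' \_ D) x * phi x) = (fun x => g' x * phi x).
    by apply/funext => x; exact: (ptE g' _ x tp).
  by rewrite -E; exact: integrable_mul_test tp ig'.
have i0 : mu2.-integrable setT (EFin \o (fun x => g x * phi x)).
  have E : (fun x => (g \_ D) x * phi x) = (fun x => g x * phi x).
    by apply/funext => x; exact: (ptE g _ x tp).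
  by rewrite -E; exact: integrable_mul_test tp ig.
transitivity (\int[mu2]_x (g x * 'D_v phi x)); first by apply: eq_Rintegral => x _; exact: (ptE g _ x tdp).
transitivity (- \int[mu2]_x (g' x * phi x)); last first.
  by congr (- _); apply: eq_Rintegral => x _; exact: esym (ptE g' _ x tp).
apply/eqP; rewrite -addr_eq0 -RintegralD//; apply/eqP.
apply: (@integral_derive_eq0 v (fun x => g x * phi x)) => //.
- exact: continuous_mul_test.
- have c1 := continuous_mul_test tdp cg; have c2 := continuous_mul_test tp cg'.
  by move=> x; apply: cvgD; [exact: c1|exact: c2].
- move=> x; have [Dx|nDx] := pselect (D x).
    have d1 := dg x Dx.
    have d2 := test_is_derive x v tp; rewrite -(test_deriveE x v tp) in d2.
    have := is_deriveM d1 d2; move/is_derive_eq; apply.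
    by rewrite /GRing.scale /= [phi x * _]mulrC.
  rewrite (test_function_support tp nDx) (test_function_support tdp nDx) !mulr0 addr0.
  apply: (@near_eq_is_derive _ _ _ (fun=> 0)) => //.
  by apply: filterS (test_near_eq0 tp nDx) => y ->; rewrite mulr0.
- exact: integrable_EFinD.
Qed.

End ClassicalWeakDerivatives.

(** * Derivatives of the interpolant *)

Section BilinearDerivatives.
Context {R : realType}.
Variable V : 'I_4 -> R * R.
Hypothesis hV : convex_ccw V.
Variable i : 'I_4.
Local Notation A := (V i).
Local Notation a := (V (i + 1) - V i).
Local Notation b := (V (i - 1) - V i).
Local Notation K := (quad V).
Local Notation D := (quad V)°.
Variables (al be : R) (xi eta : R * R -> R).
Hypothesis al1 : al <= 1.
Hypothesis be1 : be <= 1.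
Hypothesis eps0 : 0 < al + be - 1.
Hypothesis coordsP : forall x, K x ->
  [/\ 0 <= xi x <= 1, 0 <= eta x <= 1, coord1 V i x = xi x * (1 - (1 - al) * eta x) &
    coord2 V i x = eta x * (1 - (1 - be) * xi x)].

Definition slope1 (v : R * R) := cross v b / cross a b.
Definition slope2 (v : R * R) := cross a v / cross a b.
(** The Jacobian determinant of (xi, eta) -> (coord1, coord2). *)
Definition jac x := 1 - (1 - al) * eta x - (1 - be) * xi x.

Lemma coord1D x v : coord1 V i (x + v) = coord1 V i x + slope1 v.
Proof. by rewrite /coord1 /slope1 /cross /=; ring. Qed.

Lemma coord2D x v : coord2 V i (x + v) = coord2 V i x + slope2 v.
Proof. by rewrite /coord2 /slope2 /cross /=; ring. Qed.

Lemma slope1Z (h : R) v : slope1 (h *: v) = h * slope1 v.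
Proof. by rewrite /slope1 /cross /= /GRing.scale /=; ring. Qed.

Lemma slope2Z (h : R) v : slope2 (h *: v) = h * slope2 v.
Proof. by rewrite /slope2 /cross /= /GRing.scale /=; ring. Qed.

(** Two points, because the denominator in [product_increment] takes eta at one and xi at the
    other. *)
Lemma mixed_jac_ge x y : K x -> K y -> al + be - 1 <= 1 - (1 - al) * eta x - (1 - be) * xi y.
Proof.
move=> /coordsP[_ /andP[_ e1] _ _] /coordsP[/andP[_ x1] _ _ _].
have : (1 - al) * eta x <= 1 - al by rewrite ler_piMr// subr_ge0.
have : (1 - be) * xi y <= 1 - be by rewrite ler_piMr// subr_ge0.
lra.
Qed.

(* xi and eta are affine functions of the coordinates and of their own product; so the
   increments of the product satisfy a linear equation, and no implicit function theorem is
   needed to differentiate it. *)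
Lemma product_increment x y : K x -> K y ->
  xi y * eta y - xi x * eta x =
  (eta x * (coord1 V i y - coord1 V i x) + xi y * (coord2 V i y - coord2 V i x)) /
  (1 - (1 - al) * eta x - (1 - be) * xi y).
Proof.
move=> Kx Ky; have J := mixed_jac_ge Kx Ky.
have J0 : 1 - (1 - al) * eta x - (1 - be) * xi y != 0.
  by rewrite gt_eqF//; exact: lt_le_trans J.
apply: (mulIf J0); rewrite divfK//.
have [_ _ -> ->] := coordsP Kx; have [_ _ -> ->] := coordsP Ky; ring.
Qed.

Lemma continuous_coord1 : continuous (coord1 V i).
Proof.
move=> x; have -> : coord1 V i = fun x => dot (b.2 / cross a b, - b.1 / cross a b) x - cross A b / cross a b.
  by apply/funext => z; rewrite /coord1 /cross /dot /=; ring.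
by apply: cvgB; [exact: continuous_dot|exact: cvg_cst].
Qed.

Lemma continuous_coord2 : continuous (coord2 V i).
Proof.
move=> x; have -> : coord2 V i = fun x => dot (- a.2 / cross a b, a.1 / cross a b) x - cross a A / cross a b.
  by apply/funext => z; rewrite /coord2 /cross /dot /=; ring.
by apply: cvgB; [exact: continuous_dot|exact: cvg_cst].
Qed.

Lemma near_interior x : D x -> \forall y \near x, K y.
Proof. by move=> Dx; have := open_nbhs_nbhs (conj (@open_interior_quad R V) Dx); apply: filterS; exact: interior_subset. Qed.

Lemma continuous_product x : D x -> {for x, continuous (fun x => xi x * eta x)}.
Proof.
move=> Dx; have Kx := interior_subset Dx.
pose bd y := (`|coord1 V i y - coord1 V i x| + `|coord2 V i y - coord2 V i x|) / (al + be - 1).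
have cb : bd y @[y --> x] --> (0 : R).
  rewrite -[X in _ --> X](mul0r (al + be - 1)^-1); apply: cvgM; last exact: cvg_cst.
  rewrite -[X in _ --> X](addr0 0); apply: cvgD.
    rewrite -[X in _ --> X](normr0 R) -[X in `|X|](subrr (coord1 V i x)).
    by apply: cvg_norm; apply: cvgB; [exact: continuous_coord1|exact: cvg_cst].
  rewrite -[X in _ --> X](normr0 R) -[X in `|X|](subrr (coord2 V i x)).
  by apply: cvg_norm; apply: cvgB; [exact: continuous_coord2|exact: cvg_cst].
apply/cvgrPdist_le => e e0.
have /cvgrPdist_le/(_ e e0) Hb := cb.
near=> y.
have Ky : K y by near: y; exact: near_interior.
have J := mixed_jac_ge Kx Ky; have J0 := lt_le_trans eps0 J.
have [_ /andP[e0' e1] _ _] := coordsP Kx; have [/andP[x0 x1] _ _ _] := coordsP Ky.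
rewrite distrC product_increment// normrM normfV (gtr0_norm J0).
apply: (@le_trans _ _ (bd y)).
  apply: ler_pM; rewrite ?invr_ge0 ?(ltW J0)//; last by rewrite lef_pV2.
  apply: le_trans (ler_normD _ _) _; rewrite !normrM.
  by apply: lerD; rewrite ler_piMl// ger0_norm.
have : `|0 - bd y| <= e by near: y; exact: Hb.
by rewrite sub0r normrN; apply: le_trans; exact: ler_norm.
Unshelve. all: by end_near. Qed.

Lemma continuous_xi x : D x -> {for x, continuous xi}.
Proof.
move=> Dx; have cp := continuous_product Dx.
have E y : K y -> coord1 V i y + (1 - al) * (xi y * eta y) = xi y.
  by move=> /coordsP[_ _ -> _]; ring.
change (xi y @[y --> x] --> xi x); rewrite -[X in _ --> X](E x (interior_subset Dx)).
apply: (@cvg_trans _ ((coord1 V i y + (1 - al) * (xi y * eta y)) @[y --> x])).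
  by apply: near_eq_cvg; apply: filterS (near_interior Dx) => y /E.
have c1 : coord1 V i y @[y --> x] --> coord1 V i x by exact: continuous_coord1.
have c2 : (1 - al) * (xi y * eta y) @[y --> x] --> (1 - al) * (xi x * eta x) by apply: cvgMr.
exact (cvgD c1 c2).
Qed.

Lemma continuous_eta x : D x -> {for x, continuous eta}.
Proof.
move=> Dx; have cp := continuous_product Dx.
have E y : K y -> coord2 V i y + (1 - be) * (xi y * eta y) = eta y.
  by move=> /coordsP[_ _ _ ->]; ring.
change (eta y @[y --> x] --> eta x); rewrite -[X in _ --> X](E x (interior_subset Dx)).
apply: (@cvg_trans _ ((coord2 V i y + (1 - be) * (xi y * eta y)) @[y --> x])).
  by apply: near_eq_cvg; apply: filterS (near_interior Dx) => y /E.
have c1 : coord2 V i y @[y --> x] --> coord2 V i x by exact: continuous_coord2.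
have c2 : (1 - be) * (xi y * eta y) @[y --> x] --> (1 - be) * (xi x * eta x) by apply: cvgMr.
exact (cvgD c1 c2).
Qed.

Lemma jac_neq0 x : K x -> jac x != 0.
Proof. by move=> Kx; rewrite gt_eqF//; apply: lt_le_trans (mixed_jac_ge Kx Kx). Qed.

Lemma continuous_jac x : D x -> {for x, continuous jac}.
Proof.
move=> Dx; apply: cvgB; last by apply: cvgMr; exact: continuous_xi.
by apply: cvgB; [exact: cvg_cst|apply: cvgMr; exact: continuous_eta].
Qed.

(** By [product_increment] the increment h cancels from the difference quotient, and the limit is
    read off from the continuity of xi. *)
Lemma is_derive_product x v : D x -> is_derive x v (fun x => xi x * eta x)
  ((eta x * slope1 v + xi x * slope2 v) / jac x).
Proof.
move=> Dx; have Kx := interior_subset Dx.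
pose f x := xi x * eta x.
suff L : (fun h => h^-1 *: ((f \o shift x) (h *: v) - f x)) @ (0 : R)^' -->
    (eta x * slope1 v + xi x * slope2 v) / jac x.
  exact: (DeriveDef (cvgP _ L) (cvg_lim (@Rhausdorff R) L)).
have cl : (h *: v + x) @[h --> (0:R)] --> x.
  rewrite -[X in _ --> X]add0r -[X in X + _](scale0r v).
  by apply: cvgD; [apply: cvgZl; exact: cvg_id|exact: cvg_cst].
have nK : \forall h \near (0:R)^', K (h *: v + x).
  apply: (@cvg_within _ (nbhs (0:R))); exact: (cl _ (near_interior Dx)).
have cx : xi (h *: v + x) @[h --> (0:R)^'] --> xi x.
  apply: cvg_within_filter.
  exact: (cvg_comp _ _ cl (continuous_xi Dx)).
apply: (@cvg_trans _ ((eta x * slope1 v + xi (h *: v + x) * slope2 v) /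
   (1 - (1 - al) * eta x - (1 - be) * xi (h *: v + x)) @[h --> (0:R)^'])).
  apply: near_eq_cvg; near=> h.
  have h0 : h != 0 by near: h; exact: nbhs_dnbhs_neq.
  have Kh : K (h *: v + x) by near: h; exact: nK.
  have c1 : coord1 V i (h *: v + x) - coord1 V i x = h * slope1 v.
    by rewrite [h *: v + x]addrC coord1D slope1Z addrC addKr.
  have c2 : coord2 V i (h *: v + x) - coord2 V i x = h * slope2 v.
    by rewrite [h *: v + x]addrC coord2D slope2Z addrC addKr.
  rewrite /f /= product_increment// c1 c2 /GRing.scale /=.
  field; rewrite h0 /=.
  by have := mixed_jac_ge Kx Kh => J; rewrite gt_eqF//; apply: lt_le_trans J.
apply: cvgM.
  by apply: cvgD; [exact: cvg_cst|apply: cvgMl].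
apply: cvgV; first exact: jac_neq0.
by apply: cvgB; [exact: cvg_cst|apply: cvgMr].
Unshelve. all: by end_near. Qed.

Lemma is_derive_coord1 x v : is_derive x v (coord1 V i) (slope1 v).
Proof.
have -> : coord1 V i = fun x => dot (b.2 / cross a b, - b.1 / cross a b) x - cross A b / cross a b.
  by apply/funext => z; rewrite /coord1 /cross /dot /=; ring.
have := is_deriveB (is_derive_dot (b.2 / cross a b, - b.1 / cross a b) x v)
  (is_derive_cst (cross A b / cross a b) x v).
by move/is_derive_eq; apply; rewrite subr0 /slope1 /cross /dot /=; ring.
Qed.

Lemma is_derive_coord2 x v : is_derive x v (coord2 V i) (slope2 v).
Proof.
have -> : coord2 V i = fun x => dot (- a.2 / cross a b, a.1 / cross a b) x - cross a A / cross a b.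
  by apply/funext => z; rewrite /coord2 /cross /dot /=; ring.
have := is_deriveB (is_derive_dot (- a.2 / cross a b, a.1 / cross a b) x v)
  (is_derive_cst (cross a A / cross a b) x v).
by move/is_derive_eq; apply; rewrite subr0 /slope2 /cross /dot /=; ring.
Qed.

Definition bilinear (c0 c1 c2 e : R) x :=
  c0 + c1 * coord1 V i x + c2 * coord2 V i x + e * (xi x * eta x).
Definition bilinear_deriv (c1 c2 e : R) v x :=
  c1 * slope1 v + c2 * slope2 v + e * ((eta x * slope1 v + xi x * slope2 v) / jac x).

Lemma ratio_le y x : K x -> 0 <= y <= 1 -> 0 <= y / jac x <= (al + be - 1)^-1.
Proof.
move=> Kx /andP[y0 y1]; have J := mixed_jac_ge Kx Kx; have J0 := lt_le_trans eps0 J.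
rewrite divr_ge0 ?(ltW J0)//= ler_pdivrMr//.
apply: le_trans y1 _; by rewrite ler_pdivlMl// mulr1.
Qed.

(** With c1 and c2 the differences of w along the sides, these are the derivatives of the
    interpolant along a and b: a constant plus e times a ratio that [ratio_le] bounds. *)
Lemma bilinear_deriv_sides c1 c2 e x : cross a b != 0 ->
  a.1 * bilinear_deriv c1 c2 e (e1 R) x + a.2 * bilinear_deriv c1 c2 e (e2 R) x = c1 + e * (eta x / jac x) /\
  b.1 * bilinear_deriv c1 c2 e (e1 R) x + b.2 * bilinear_deriv c1 c2 e (e2 R) x = c2 + e * (xi x / jac x).
Proof.
move=> X0.
have comb (l : R * R) : l.1 * bilinear_deriv c1 c2 e (e1 R) x + l.2 * bilinear_deriv c1 c2 e (e2 R) x =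
    c1 * slope1 l + c2 * slope2 l + e * ((eta x * slope1 l + xi x * slope2 l) / jac x).
  have -> : slope1 l = l.1 * slope1 (e1 R) + l.2 * slope1 (e2 R).
    by rewrite /slope1 /cross /e1 /e2 /=; ring.
  have -> : slope2 l = l.1 * slope2 (e1 R) + l.2 * slope2 (e2 R).
    by rewrite /slope2 /cross /e1 /e2 /=; ring.
  rewrite /bilinear_deriv; ring.
have cv v : cross v v = 0 by rewrite /cross mulrC subrr.
by rewrite !comb /slope1 /slope2 !cv divff// !mul0r !mulr0 !mulr1 !addr0 !add0r.
Qed.

Lemma bilinear_weak_derivative c0 c1 c2 e v : (lebesgue2 R D < +oo)%E ->
  plane_wd D v (bilinear c0 c1 c2 e \_ D) (bilinear_deriv c1 c2 e v \_ D).
Proof.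
move=> fD.
(* One bound for the function and for its derivative: coord1, coord2 and xi eta all lie in [0, 1] on
   K. *)
pose M := `|c0| + `|c1| + `|c2| + `|e| + (`|c1 * slope1 v| + `|c2 * slope2 v| +
  `|e| * ((al + be - 1)^-1 * (`|slope1 v| + `|slope2 v|))).
have ieps : 0 <= (al + be - 1)^-1 by rewrite invr_ge0 ltW.
apply: (classical_weak_derivative (open_interior_quad (V := V)) (M := M) fD).
- move=> x Dx.
  have := is_deriveD (is_deriveD (is_deriveD (is_derive_cst c0 x v)
    (is_deriveM (is_derive_cst c1 x v) (is_derive_coord1 x v)))
    (is_deriveM (is_derive_cst c2 x v) (is_derive_coord2 x v)))
    (is_deriveM (is_derive_cst e x v) (is_derive_product v Dx)).
  by move/is_derive_eq; apply; rewrite /GRing.scale /= /bilinear_deriv; ring.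
- move=> x Dx.
  have k1 : c1 * coord1 V i y @[y --> x] --> c1 * coord1 V i x by apply: cvgMr; exact: continuous_coord1.
  have k2 : c2 * coord2 V i y @[y --> x] --> c2 * coord2 V i x by apply: cvgMr; exact: continuous_coord2.
  have k3 : e * (xi y * eta y) @[y --> x] --> e * (xi x * eta x) by apply: cvgMr; exact: continuous_product.
  exact (cvgD (cvgD (cvgD (cvg_cst c0) k1) k2) k3).
- move=> x Dx; have kx : xi y @[y --> x] --> xi x := continuous_xi Dx.
  have ky : eta y @[y --> x] --> eta x := continuous_eta Dx.
  have kj : jac y @[y --> x] --> jac x := continuous_jac Dx.
  have kn : eta y * slope1 v + xi y * slope2 v @[y --> x] --> eta x * slope1 v + xi x * slope2 v.
    exact (cvgD (cvgMl ky) (cvgMl kx)).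
  have kq : (eta y * slope1 v + xi y * slope2 v) / jac y @[y --> x] -->
      (eta x * slope1 v + xi x * slope2 v) / jac x.
    exact: (cvgM kn (cvgV (jac_neq0 (interior_subset Dx)) kj)).
  exact (cvgD (cvg_cst _) (cvgMr kq)).
- move=> x Dx; have [/andP[x0 x1] /andP[y0 y1] E1 E2] := coordsP (interior_subset Dx).
  have n1 (z t : R) : 0 <= z <= 1 -> `|t * z| <= `|t|.
    by move=> /andP[z0 z1]; rewrite normrM (ger0_norm z0) ler_piMr.
  have l1 (z t k : R) : 0 <= z <= 1 -> 0 <= t <= 1 -> 0 <= k <= 1 -> 0 <= z * (1 - k * t) <= 1.
    move=> /andP[? ?] /andP[? ?] /andP[? ?].
    have kt : 0 <= k * t <= 1 by rewrite mulr_ge0//= mulr_ile1.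
    have /andP[? ?] := kt; rewrite mulr_ge0 ?mulr_ile1 ?subr_ge0//; lra.
  have al0 : 0 <= 1 - al <= 1.
    by rewrite subr_ge0 al1 lerBlDr lerDl /=; move: eps0 be1; lra.
  have be0 : 0 <= 1 - be <= 1.
    by rewrite subr_ge0 be1 lerBlDr lerDl /=; move: eps0 al1; lra.
  have c1' : 0 <= coord1 V i x <= 1 by rewrite E1; apply: l1; rewrite ?x0 ?y0.
  have c2' : 0 <= coord2 V i x <= 1 by rewrite E2; apply: l1; rewrite ?x0 ?y0.
  have c3' : 0 <= xi x * eta x <= 1 by rewrite mulr_ge0//= mulr_ile1.
  apply: (@le_trans _ _ (`|c0| + `|c1| + `|c2| + `|e|)).
    apply: le_trans (ler_normD _ _) _; apply: lerD; last exact: n1.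
    apply: le_trans (ler_normD _ _) _; apply: lerD; last exact: n1.
    by apply: le_trans (ler_normD _ _) _; apply: lerD => //; exact: n1.
  by rewrite lerDl !addr_ge0// mulr_ge0// mulr_ge0// addr_ge0.
- move=> x Dx; have Kx := interior_subset Dx; have [x01 y01 _ _] := coordsP Kx.
  have /andP[r0 r1] := ratio_le Kx y01; have /andP[s0 s1] := ratio_le Kx x01.
  rewrite -[leLHS]add0r; apply: lerD; first by rewrite !addr_ge0.
  apply: le_trans (ler_normD _ _) _; apply: lerD; first exact: ler_normD.
  rewrite normrM ler_wpM2l// (_ : _ / _ = eta x / jac x * slope1 v + xi x / jac x * slope2 v); last by ring.
  apply: le_trans (ler_normD _ _) _; rewrite mulrDr (normrM (eta x / jac x)) (normrM (xi x / jac x)) (ger0_norm r0) (ger0_norm s0).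
  by apply: lerD; rewrite ler_wpM2r.
Qed.

End BilinearDerivatives.

(** * Uniqueness of weak derivatives *)

Section LocalWeakDerivatives.
Context {R : realType}.
Notation mu2 := (@lebesgue2 R).
Notation plane := (measurableTypeR R * measurableTypeR R)%type.
Implicit Types (f g : R * R -> R) (v : R * R).
Variable D : set (R * R).
Hypothesis oD : open D.

Let mD : measurable (D : set plane).
Proof. exact: open_measurable_plane. Qed.

Lemma patch_in f x : D x -> (f \_ D) x = f x.
Proof. by move=> Dx; rewrite patchE mem_set. Qed.

Lemma patch_out f x : ~ D x -> (f \_ D) x = 0.
Proof. by move=> nDx; rewrite patchE memNset. Qed.

Lemma patch_mul_test f phi x : test_function D phi -> (f \_ D) x * phi x = f x * phi x.
Proof.
move=> tp; have [Dx|nDx] := pselect (D x); first by rewrite patch_in.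
by rewrite (test_function_support tp nDx) !mulr0.
Qed.

Lemma Rintegral_mul_test f phi : test_function D phi ->
  \int[mu2]_(x in D) (f x * phi x) = \int[mu2]_x (f x * phi x).
Proof.
move=> tp; rewrite Rintegral_mkcond; apply: eq_Rintegral => x _.
have [Dx|nDx] := pselect (D x); first by rewrite patch_in.
by rewrite patch_out// (test_function_support tp nDx) mulr0.
Qed.

Lemma Rintegral_patch_test f phi : test_function D phi ->
  \int[mu2]_x ((f \_ D) x * phi x) = \int[mu2]_x (f x * phi x).
Proof. by move=> tp; apply: eq_Rintegral => x _; exact: patch_mul_test. Qed.

Lemma loc_integrable_mul_test f phi : loc_integrable D f -> test_function D phi ->
  mu2.-integrable setT (EFin \o (fun x => f x * phi x)).
Proof.
move=> lf tp; have [_ cS sD] := tp.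
set S := closed_support phi in cS sD.
have mS : measurable (S : set plane) by apply: closed_measurable_plane; exact: closed_closure.
have iS : mu2.-integrable setT (EFin \o (f \_ S)).
  by rewrite -restrict_EFin; apply/(integrable_mkcond _ mS).1; exact: lf.
have := integrable_mul_test tp iS.
rewrite (_ : (fun x => (f \_ S) x * phi x) = (fun x => f x * phi x))//; apply/funext => x.
have [Sx|nSx] := pselect (S x); first by rewrite patchE mem_set.
have -> : phi x = 0.
  by apply: contrapT => /eqP p0; apply: nSx; apply: subset_closure.
by rewrite !mulr0.
Qed.

Lemma integrable_loc f : mu2.-integrable setT (EFin \o (f \_ D)) -> loc_integrable D f.
Proof.
move=> fi S cS SD.
have mS : measurable (S : set plane).
  by apply: closed_measurable_plane; apply: compact_closed => //; exact: @norm_hausdorff.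
apply: (integrableS mD mS SD).
by rewrite -restrict_EFin in fi; exact/(integrable_mkcond _ mD).
Qed.

Lemma plane_wd_weak v f g : plane_wd D v (f \_ D) (g \_ D) -> is_weak_derivative D v f g.
Proof.
move=> [fi gi wd]; split; [exact: integrable_loc|exact: integrable_loc|].
move=> phi tp; have tdp := test_derive v tp.
rewrite (Rintegral_mul_test _ tdp) (Rintegral_mul_test _ tp).
by have := wd phi tp; rewrite (Rintegral_patch_test _ tdp) (Rintegral_patch_test _ tp).
Qed.

Lemma weak_plane_wd v f g : mu2.-integrable setT (EFin \o (f \_ D)) ->
  mu2.-integrable setT (EFin \o (g \_ D)) -> is_weak_derivative D v f g ->
  plane_wd D v (f \_ D) (g \_ D).
Proof.
move=> fi gi [_ _ wd]; split=> // phi tp; have tdp := test_derive v tp.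
have := wd phi tp; rewrite (Rintegral_mul_test _ tdp) (Rintegral_mul_test _ tp).
by rewrite (Rintegral_patch_test _ tdp) (Rintegral_patch_test _ tp).
Qed.

Lemma loc_integrable_measurable f : loc_integrable D f -> measurable_fun (D : set plane) f.
Proof.
move=> lf; have [F [FD DE]] := open_bigcup_orect oD.
rewrite [X in measurable_fun X](_ : _ = \bigcup_k (orect (F k) : set plane)) //.
apply/measurable_fun_bigcup; first by move=> k; exact: measurable_orect.
move=> k; have := lf _ (@compact_crect R (F k)) (FD k).
move=> /integrableP[/measurable_EFinP mf _].
apply: measurable_funS mf; first exact: (closed_measurable_plane (@closed_crect R (F k))).
move=> x [/= x1 x2]; split => /=; move: x1 x2; rewrite !in_itv /= => /andP[? ?] /andP[? ?];
  by rewrite !ltW.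
Qed.

(** h is cut off to each closed rectangle of a countable family; there it is integrable and
    [fundamental_lemma] applies to the open rectangle. *)
Lemma loc_fundamental_lemma h : loc_integrable D h ->
  (forall phi, test_function D phi -> \int[mu2]_x (h x * phi x) = 0) ->
  {ae mu2, forall x, D x -> h x = 0}.
Proof.
move=> lh H; have [F [FD DE]] := open_bigcup_orect oD.
have sub k : orect (F k) `<=` crect (F k).
  move=> x [/= x1 x2]; split => /=; move: x1 x2; rewrite !in_itv /= => /andP[? ?] /andP[? ?];
  by rewrite !ltW.
suff Hk k : {ae mu2, forall x, orect (F k) x -> h x = 0}.
  have := ae_foralln Hk; move=> /ae2_imp; apply => x Hx Dx.
  by move: Dx; rewrite {1}DE => -[k _]; exact: Hx.
have mF := closed_measurable_plane (@closed_crect R (F k)).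
have iF : mu2.-integrable setT (EFin \o (h \_ (crect (F k)))).
  rewrite -restrict_EFin; apply/(integrable_mkcond _ mF).1.
  exact: (lh _ (@compact_crect R (F k)) (FD k)).
have oF : open (orect (F k)).
  rewrite [orect _](_ : _ = fst @^-1` `](F k).1.1, (F k).2.1[ `&` snd @^-1` `](F k).1.2, (F k).2.2[)//.
  by apply: openI; apply: open_comp; [move=> x _; exact: cvg_fst|exact: interval_open|
    move=> x _; exact: cvg_snd|exact: interval_open].
have := @fundamental_lemma R (orect (F k)) _ oF iF.
move=> /(_ _)/ae2_imp; apply.
  move=> phi tp; rewrite -(H phi); last first.
    by apply: test_functionS tp; exact: subset_trans (FD k).
  apply: eq_Rintegral => x _.
  have [Fx|nFx] := pselect (orect (F k) x).
    by rewrite patchE mem_set//; exact: sub.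
  by rewrite (test_function_support tp nFx) !mulr0.
move=> x Hx Fx; rewrite -(Hx Fx) patchE mem_set//; exact: sub.
Qed.

Lemma weak_derivative_unique v f g g' : is_weak_derivative D v f g ->
  is_weak_derivative D v f g' -> {ae mu2, forall x, D x -> g x = g' x}.
Proof.
move=> [lf lg wg] [_ lg' wg'].
have lB : loc_integrable D (fun x => g x - g' x).
  move=> S cS SD; apply: integrable_EFinB; [|exact: lg|exact: lg'].
  by apply: closed_measurable_plane; apply: compact_closed => //; exact: @norm_hausdorff.
have := loc_fundamental_lemma lB; move=> /(_ _)/ae2_imp; apply.
  move=> phi tp; have i1 := loc_integrable_mul_test lg tp; have i2 := loc_integrable_mul_test lg' tp.
  have tdp := test_derive v tp.
  transitivity (\int[mu2]_x (g x * phi x) - \int[mu2]_x (g' x * phi x)).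
    by rewrite -RintegralB//; apply: eq_Rintegral => x _; rewrite mulrBl.
  rewrite -!(Rintegral_mul_test _ tp) -[X in X - _]opprK -[X in _ - X]opprK -wg// -wg'//.
  by rewrite subrr.
by move=> x Hx Dx; apply/eqP; rewrite -subr_eq0 Hx.
Qed.

Lemma weak_derivativeP v f g : is_weak_derivative D v f g ->
  is_weak_derivative D v f (weak_derivative D v f).
Proof. by move=> H; rewrite /weak_derivative; case: xgetP => [//|/(_ g)]. Qed.

Lemma ae_weak_derivative v f g : is_weak_derivative D v f g ->
  {ae mu2, forall x, D x -> weak_derivative D v f x = g x}.
Proof. by move=> H; exact: weak_derivative_unique (weak_derivativeP H) H. Qed.

Lemma is_weak_derivative_ae v f f' g : {ae mu2, forall x, D x -> f x = f' x} ->
  loc_integrable D f' -> is_weak_derivative D v f g -> is_weak_derivative D v f' g.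
Proof.
move=> ff' lf' [lf lg wd]; split=> // phi tp; have tdp := test_derive v tp.
rewrite -wd// !(Rintegral_mul_test _ tdp).
have i1 := loc_integrable_mul_test lf tdp; have i2 := loc_integrable_mul_test lf' tdp.
rewrite /Rintegral; congr fine; apply: ae_eq_integral => //.
- exact: measurable_int i2.
- exact: measurable_int i1.
- have : {ae mu2, forall x, f' x * 'D_v phi x = f x * 'D_v phi x}.
    apply: (ae2_imp (P := fun x => D x -> f x = f' x) ff') => x Hx; have [Dx|nDx] := pselect (D x); first by rewrite Hx.
    by rewrite (test_function_support tdp nDx) !mulr0.
  by move=> /ae2_imp; apply => x Hx _; congr EFin.
Qed.

(** |f| <= 1 + |f|^p, and D has finite measure. *)
Lemma in_Lp_integrable p f : 1 <= p -> (mu2 D < +oo)%E -> in_Lp p D f ->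
  mu2.-integrable setT (EFin \o (f \_ D)).
Proof.
move=> p1 fD /andP[]; rewrite inE /= => mf; rewrite inE /= /finite_norm => Nf.
have p0 : p != 0 by rewrite gt_eqF//; apply: lt_le_trans p1.
have Pf : (\int[mu2]_x (`|(f \_ D) x| `^ p)%:E < +oo)%E.
  have := poweR_lty p Nf; rewrite poweR_Lnorm//.
apply/integrableP; split; first exact/measurable_EFinP.
have mp : measurable_fun setT (fun x : plane => (`|(f \_ D) x| `^ p)%:E).
  apply/measurable_EFinP; apply: (measurableT_comp (measurable_powR p)).
  exact: (measurableT_comp (@normr_measurable R setT) mf).
have m1 : measurable_fun setT (fun x : plane => (\1_D x)%:E : \bar R).
  by apply/measurable_EFinP; exact: measurable_indic.
apply: (@le_lt_trans _ _ (\int[mu2]_x ((\1_D x)%:E + (`|(f \_ D) x| `^ p)%:E))%E).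
  apply: ge0_le_integral => //.
  - by apply/measurable_EFinP; exact: (measurableT_comp (@normr_measurable R setT) mf).
  - exact: emeasurable_funD.
  - move=> x _ /=; rewrite -EFinD lee_fin; have [Dx|nDx] := pselect (D x).
      rewrite indicE mem_set// patch_in//=.
      have [le1|gt1] := leP `|f x| 1.
        by apply: le_trans le1 _; rewrite lerDl powR_ge0.
      rewrite -[leLHS]powRr1//; apply: (@le_trans _ _ (`|f x| `^ p)); last by rewrite lerDr.
      by apply: ler_powR => //; exact: ltW.
    by rewrite patch_out// normr0 addr_ge0// powR_ge0.
rewrite ge0_integralD//.
by rewrite integral_indic// setIT lte_add_pinfty.
Qed.

End LocalWeakDerivatives.

(** * The interpolation error *)

Section AlgebraicBounds.
Context {R : realType}.
Implicit Types (a b g w : R * R) (s t : R).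

(** Cramer's rule: [cross a b] times g is a combination of the rotated vectors b and a with
    coefficients [dot a g] and [dot b g]. *)
Lemma enorm_le_dots a b g : 0 < cross a b ->
  cross a b * enorm g <= enorm b * `|dot a g| + enorm a * `|dot b g|.
Proof.
move=> X0; rewrite -{1}(ger0_norm (ltW X0)) -enormZ.
have -> : cross a b *: g = dot a g *: (b.2, - b.1) + dot b g *: (- a.2, a.1).
  by apply: injective_projections; rewrite /cross /dot /= /GRing.scale /=; ring.
have rot z : enorm (z.2, - z.1) = enorm z.
  by rewrite /enorm /dot /= mulrNN addrC.
have -> : (- a.2, a.1) = - (a.2, - a.1) :> R * R.
  by apply: injective_projections; rewrite /= ?opprK.
apply: le_trans (enormD _ _) _.
by rewrite !enormZ enormN !rot ![`|_| * _]mulrC.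
Qed.

Lemma enorm_le_scaled_dots (c : R) a b g : 0 < c -> 0 < cross a b ->
  c * (enorm a * enorm b) <= cross a b ->
  enorm g <= c^-1 * ((enorm a)^-1 * `|dot a g| + (enorm b)^-1 * `|dot b g|).
Proof.
move=> c0 X0 cX.
have La : 0 < enorm a.
  by apply: enorm_gt0; apply: contraTneq X0 => ->; rewrite /cross /= !mul0r subrr ltxx.
have Lb : 0 < enorm b.
  by apply: enorm_gt0; apply: contraTneq X0 => ->; rewrite /cross /= !mulr0 subrr ltxx.
have k0 : 0 < c * (enorm a * enorm b) by rewrite !mulr_gt0.
rewrite -(ler_pM2l k0); apply: (@le_trans _ _ (cross a b * enorm g)).
  by rewrite ler_wpM2r// enorm_ge0.
apply: le_trans (enorm_le_dots _ X0) _; rewrite le_eqVlt; apply/orP; left; apply/eqP.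
by field; rewrite !gt_eqF.
Qed.

Lemma norm_sub_le1 s t : 0 <= s <= 1 -> 0 <= t <= 1 -> `|t - s| <= 1.
Proof.
by move=> /andP[s0 s1] /andP[t0 t1]; rewrite ler_norml; apply/andP; split; lra.
Qed.

(** For fjk the derivative of the j-th component of the gradient along the k-th axis, A and B are
    the derivatives of the gradient along a and b, and the left side is the scalar product of l with
    s A + t B. The order of differentiation is never exchanged. *)
Lemma gradient_bound a b l w s t (f11 f12 f21 f22 : R) : `|s| <= 1 -> `|t| <= 1 -> w = s *: a + t *: b ->
  `|w.1 * (l.1 * f11 + l.2 * f21) + w.2 * (l.1 * f12 + l.2 * f22)| <=
  enorm l * (enorm (a.1 * f11 + a.2 * f12, a.1 * f21 + a.2 * f22) +
             enorm (b.1 * f11 + b.2 * f12, b.1 * f21 + b.2 * f22)).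
Proof.
move=> s1 t1 ->; set A := (_, _) : R * R; set B := (_, _) : R * R.
have -> : (s *: a + t *: b).1 * (l.1 * f11 + l.2 * f21) + (s *: a + t *: b).2 * (l.1 * f12 + l.2 * f22)
    = dot l (s *: A + t *: B).
  by rewrite /dot /= /GRing.scale /=; ring.
apply: le_trans (norm_dot_le _ _) _; rewrite ler_wpM2l ?enorm_ge0//.
apply: le_trans (enormD _ _) _; rewrite !enormZ.
by apply: lerD; rewrite ler_piMl// enorm_ge0.
Qed.

End AlgebraicBounds.

(** * Integral bounds for the error along one side *)

Section IntegralBounds.
Context {R : realType}.
Notation mu := (@lebesgue_measure R).
Notation mu2 := (@lebesgue2 R).
Notation plane := (measurableTypeR R * measurableTypeR R)%type.
Implicit Types (f g : R * R -> R).

Lemma unit_sq_integral : (\int[mu2]_z (unit_sq z)%:E = 1)%E.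
Proof.
have mI : measurable (`[(0:R), 1]%classic : set (measurableTypeR R)) by exact: measurable_itv.
have -> : (fun z : R * R => (unit_sq z)%:E) = (fun z : R * R => (\1_(`[(0:R), 1] `*` `[(0:R), 1]) z)%:E).
  by apply/funext => z; rewrite /unit_sq !indicE -natrM mulnb in_setX.
rewrite integral_indic//; last exact: measurableX.
rewrite setIT; transitivity (mu `[0%R, 1%R]%classic * mu `[0%R, 1%R]%classic)%E.
  exact: product_measure1E.
by rewrite lebesgue_measure_itv /= lte_fin ltr01 -EFinB subr0 mule1.
Qed.

(** In the coordinates along p - o and q - o, the set K lies in the unit square. *)
Lemma measure_parallelogram_le (K : set (R * R)) (o p q : R * R) : cross (p - o) (q - o) != 0 ->
  measurable (K : set plane) -> K `<=` parallelogram o p q ->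
  (mu2 K <= `|cross (p - o) (q - o)|%:E)%E.
Proof.
move=> pq0 mK KP.
rewrite -[K]setIT -integral_indic//.
have mI : measurable_fun [set: plane] (fun x : plane => (\1_K x)%:E : \bar R).
  by apply/measurable_EFinP; exact: measurable_indic.
rewrite (ge0_integral_plane o pq0)//.
rewrite -[leRHS]mule1 -unit_sq_integral; apply: lee_wpmul2l; first by rewrite lee_fin.
apply: ge0_le_integral; first exact: measurableT.
- by move=> x _; rewrite lee_fin.
- exact: (measurableT_comp mI (measurable_plane o (p - o) (q - o))).
- by apply/measurable_EFinP; exact: measurable_unit_sq.
- move=> z _; rewrite lee_fin indicE unit_sqE.
  have [Kz|nKz] := pselect (K (o + z.1 *: (p - o) + z.2 *: (q - o))); last by rewrite memNset.
  have [s [t [s01 t01 E]]] := KP _ Kz.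
  have pqE (x y : R) : cross (x *: (p - o) + y *: (q - o)) (q - o) = x * cross (p - o) (q - o) /\
     cross (p - o) (x *: (p - o) + y *: (q - o)) = y * cross (p - o) (q - o).
    by split; rewrite /cross /= /GRing.scale /=; ring.
  have E' : z.1 *: (p - o) + z.2 *: (q - o) = s *: (p - o) + t *: (q - o).
    by apply: (addrI o); rewrite !addrA.
  have [h1 h2] := pqE z.1 z.2; rewrite E' in h1 h2; have [h3 h4] := pqE s t.
  have -> : z.1 = s by apply: (mulIf pq0); rewrite -h1 h3.
  have -> : z.2 = t by apply: (mulIf pq0); rewrite -h2 h4.
  by rewrite s01 t01 ler_nat leq_b1.
Qed.

Lemma measure_gt0 (D K : set (R * R)) : open D -> D !=set0 -> D `<=` K ->
  measurable (K : set plane) -> (0 < mu2 K)%E.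
Proof.
move=> oD D0 DK mK; rewrite lt0e measure_ge0 andbT; apply/negP => /eqP K0.
have : {ae mu2, forall x, ~ K x}.
  by exists K; split=> // x; rewrite /= not_notE.
move=> /(open_ae_point oD D0)[x Dx]; apply; exact: DK.
Qed.

Lemma energyZ (p k : R) f : 0 <= k -> measurable_fun [set: plane] f -> (forall x, 0 <= f x) ->
  energy (fun x => k * f x) p = ((k `^ p)%:E * energy f p)%E.
Proof.
move=> k0 mf f0; rewrite /energy ge0_integral_scale ?powR_ge0//.
- by apply: eq_integral => x _; rewrite powRM.
- apply/measurable_EFinP; exact: (measurableT_comp (measurable_powR p) mf).
- by move=> x; rewrite lee_fin powR_ge0.
Qed.

(** The constant e contributes |e|^p times the measure of D, which is at most X |e|^p and hence at
    most I2 / eps. *)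
Lemma error_bound (D : set (R * R)) (p X eps k m e : R) (v P : R * R -> R) (I1 I2 : \bar R) :
  1 <= p -> measurable (D : set plane) ->
  measurable_fun [set: plane] v -> measurable_fun [set: plane] P ->
  0 <= k -> (forall x, D x -> `|P x| <= k) ->
  0 < eps -> 0 <= X -> (mu2 D <= X%:E)%E -> (0 <= I2)%E ->
  (\int[mu2]_(x in D) (`|v x - m| `^ p)%:E <= I1)%E ->
  ((eps * X * `|e| `^ p)%:E <= I2)%E ->
  (\int[mu2]_(x in D) (`|v x - m - e * P x| `^ p)%:E <= (2 `^ p)%:E * (I1 + (k `^ p / eps)%:E * I2))%E.
Proof.
move=> p1 mD mv mP k0 Pk eps0 X0 DX I20 H1 H2.
have p0 : 0 <= p by apply: le_trans p1.
have mf (c : R) (h : R * R -> R) : measurable_fun [set: plane] h ->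
    measurable_fun [set: plane] (fun x => (`|h x - c| `^ p)%:E).
  move=> mh; exact: (measurable_powR_dist p mh (measurable_cst c)).
apply: (@le_trans _ _ (\int[mu2]_(x in D) ((2 `^ p)%:E * ((`|v x - m| `^ p)%:E + ((k * `|e|) `^ p)%:E)))%E).
  apply: ge0_le_integral => //.
  - apply: measurable_funTS.
    have mg : measurable_fun [set: plane] (fun x => m + e * P x).
      by apply: measurable_funD => //; apply: measurable_funM.
    have := measurable_powR_dist p mv mg.
    by apply: eq_measurable_fun => x _; rewrite opprD addrA.
  - apply: measurable_funTS; apply: emeasurable_funM => //; apply: emeasurable_funD => //.
    exact: mf.
  - move=> x Dx; rewrite -EFinD -EFinM lee_fin; have ePk : `|- (e * P x)| <= k * `|e|.
      by rewrite normrN normrM mulrC ler_wpM2r// Pk.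
    apply: le_trans (powRD_le p1 _ _); rewrite ?mulr_ge0//.
    apply: ge0_ler_powR => //; rewrite ?nnegrE ?addr_ge0 ?mulr_ge0//.
    by apply: le_trans (ler_normD _ _) _; rewrite lerD2l.
rewrite ge0_integralZl//; last first.
- by move=> x _; rewrite -EFinD lee_fin addr_ge0// powR_ge0.
- apply: measurable_funTS; apply: emeasurable_funD => //; exact: mf.
apply: lee_wpmul2l; first by rewrite lee_fin powR_ge0.
have mfD : measurable_fun (D : set plane) (fun x => (`|v x - m| `^ p)%:E).
  by apply: measurable_funTS; exact: mf.
rewrite (_ : \int[mu2]_(x in D) _ = \int[mu2]_(x in D) (`|v x - m| `^ p)%:E +
    \int[mu2]_(x in D) ((k * `|e|) `^ p)%:E)%E; last first.
  by apply: ge0_integralD => // x _; rewrite lee_fin powR_ge0.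
apply: leeD => //.
rewrite integral_cst//; apply: (@le_trans _ _ (((k * `|e|) `^ p)%:E * X%:E)%E).
  by apply: lee_wpmul2l => //; rewrite lee_fin powR_ge0.
apply: (@le_trans _ _ ((k `^ p / eps)%:E * (eps * X * `|e| `^ p)%:E)%E).
  rewrite -!EFinM lee_fin powRM// le_eqVlt; apply/orP; left; apply/eqP; field.
  by rewrite gt_eqF.
by apply: lee_wpmul2l => //; rewrite lee_fin divr_ge0 ?powR_ge0// ltW.
Qed.

End IntegralBounds.

(** * The shape constants of a quadrilateral *)

Section ShapeRegularity.
Context {R : realType}.
Variables (psi c d : R) (V : 'I_4 -> R * R) (i : 'I_4).
Hypothesis psi01 : 0 < psi < pi.
Hypothesis c0 : 0 < c.
Hypothesis hV : convex_ccw V.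
Hypothesis hMAC : MAC psi V.
Hypothesis hclos : clos c d V.
Hypothesis hpar : quad V `<=` parallelogram (V i) (V (i + 1)) (V (i - 1)).
Local Notation A := (V i).
Local Notation a := (V (i + 1) - V i).
Local Notation b := (V (i - 1) - V i).

Lemma side_neq0 j : V (j + 1) - V j != 0.
Proof.
by apply: contraTneq (hV j) => ->; rewrite /cross /= !mul0r subrr ltxx.
Qed.

Lemma obtuse_vertex j : dot (V (j - 1) - V j) (V (j + 1) - V j) <= 0 ->
  sin psi * (enorm (V (j - 1) - V j) * enorm (V (j + 1) - V j)) <=
  `|cross (V (j - 1) - V j) (V (j + 1) - V j)|.
Proof.
move=> H; apply: obtuse_cross => //; last exact: hMAC.
  have := side_neq0 (j - 1); have [_ _ -> _] := I4_nextE j.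
  by rewrite -opprB oppr_eq0.
exact: side_neq0.
Qed.

Lemma clos_le j : c * enorm (V (j + 2 + 1) - V (j + 2)) <= enorm (V (j + 1) - V j).
Proof.
have /andP[+ _] := hclos j; rewrite /side_length ler_pdivlMr//.
by apply: enorm_gt0; exact: side_neq0.
Qed.

Lemma quad_vertex k : quad V (V k).
Proof. by apply/(quadP hV) => j; exact: side_form_vertex_ge0. Qed.

Lemma shape_regularity : exists al be, [/\ V (i + 2) = A + al *: a + be *: b, 0 <= al <= 1 & 0 <= be <= 1] /\
  [/\ sin psi * c ^+ 2 * (enorm a * enorm b) <= cross a b, sin psi * c ^+ 2 / 2 <= al + be - 1,
    (1 - be) * enorm b <= (1 + c^-1) * enorm a & (1 - al) * enorm a <= (1 + c^-1) * enorm b].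
Proof.
have [al [be [al01 be01 hC]]] := hpar (quad_vertex (i + 2)).
exists al, be; split=> //.
have X0 := cross_corner_gt0 hV i; have eps0 := eps_gt0 hV hC.
have /andP[psi0 psi1] := psi01.
have sg0 : 0 < sin psi by apply: sin_gt0_pi; rewrite psi0.
have sg01 : 0 < sin psi <= 1 by rewrite sg0 sin_le1.
have [n1 n2 n3 n4] := I4_nextE i; have [m1 m2 m3 m4 m5] := I4_prevE i.
have /andP[al0 al1] := al01; have /andP[be0 be1] := be01.
set cb := (al - 1) *: a + be *: b; set cd := al *: a + (be - 1) *: b.
have EC : V (i + 2) - V (i + 1) = cb.
  by rewrite hC; apply: injective_projections; rewrite /= /GRing.scale /=; ring.
have ED : V (i + 2) - V (i - 1) = cd.
  by rewrite hC; apply: injective_projections; rewrite /= /GRing.scale /=; ring.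
have EC' : V (i + 1) - V (i + 2) = - cb by rewrite -EC opprB.
have ED' : V (i - 1) - V (i + 2) = - cd by rewrite -ED opprB.
have EA : V i - V (i + 1) = - a by rewrite opprB.
have EB : V i - V (i - 1) = - b by rewrite opprB.
(* The four angle hypotheses come from [obtuse_vertex] at the four vertices, the four length
   hypotheses from [clos_le] at the four sides. *)
have angA : dot a b <= 0 -> sin psi * (enorm a * enorm b) <= cross a b.
  have := obtuse_vertex (j := i); rewrite (_ : dot b a = dot a b); last by rewrite /dot; ring.
  rewrite (_ : cross b a = - cross a b); last by rewrite /cross; ring.
  by rewrite normrN (ger0_norm (ltW X0)) [enorm b * _]mulrC.
have angB : dot (- a) cb <= 0 -> sin psi * (enorm a * enorm cb) <= be * cross a b.
  have := obtuse_vertex (j := i + 1); rewrite m1 n1 EC EA enormN.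
  rewrite (_ : cross (- a) cb = - (be * cross a b)); last by rewrite /cross /= /GRing.scale /=; ring.
  by rewrite normrN ger0_norm// mulr_ge0// ltW.
have angD : dot (- b) cd <= 0 -> sin psi * (enorm b * enorm cd) <= al * cross a b.
  have := obtuse_vertex (j := i - 1); rewrite m3 n3 ED EB enormN.
  rewrite (_ : dot cd (- b) = dot (- b) cd); last by rewrite /dot /=; ring.
  rewrite (_ : cross cd (- b) = - (al * cross a b)); last by rewrite /cross /= /GRing.scale /=; ring.
  by rewrite normrN ger0_norm ?[enorm cd * _]mulrC// mulr_ge0// ltW.
have angC : dot cb cd <= 0 -> sin psi * (enorm cb * enorm cd) <= (al + be - 1) * cross a b.
  have := obtuse_vertex (j := i + 2); rewrite m2 n2 EC' ED' !enormN.
  rewrite (_ : dot (- cb) (- cd) = dot cb cd); last by rewrite /dot /=; ring.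
  rewrite (_ : cross (- cb) (- cd) = - ((al + be - 1) * cross a b)); last by rewrite /cross /= /GRing.scale /=; ring.
  by rewrite normrN ger0_norm// mulr_ge0// ltW.
have sideCD : c * enorm cd <= enorm a by have := clos_le i; rewrite n2 ED' enormN.
have sideBC : c * enorm cb <= enorm b by have := clos_le (i - 1); rewrite n4 n1 n3 EC EB enormN.
have sideAB : c * enorm a <= enorm cd by have := clos_le (i + 2); rewrite m5 n2 ED' enormN.
have sideDA : c * enorm b <= enorm cb by have := clos_le (i + 1); rewrite m4 n1 n3 EC EB enormN.
split.
- exact: (cross_ge X0 al01 be01 eps0 sg01 c0 angA angB angD angC sideCD sideAB sideDA).
- exact: (eps_ge X0 al01 be01 eps0 sg01 c0 angC sideAB sideDA).
- exact: (defect_b al01 be01 c0 sideCD).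
- exact: (defect_a al01 be01 c0 sideBC).
Qed.

End ShapeRegularity.

(** Converts the power of the other side length Lb, so that the error along a is measured with |a|
    alone. *)
Lemma defect_energy_le (R : realType) (s k La Lb be p : R) (E : \bar R) : 1 <= p ->
  0 <= s -> 0 <= k -> 0 <= La -> 0 <= Lb -> be <= 1 -> (0 <= E)%E -> (1 - be) * Lb <= k * La ->
  (s%:E * ((La `^ p)%:E * E + ((1 - be) `^ p)%:E * ((Lb `^ p)%:E * E)) <=
   (s * (1 + k `^ p))%:E * ((La `^ p)%:E * E))%E.
Proof.
move=> p1 s0 k0 La0 Lb0 be1 E0 H; have p0 : 0 <= p by apply: le_trans p1.
rewrite EFinM -muleA; apply: lee_wpmul2l; first by rewrite lee_fin.
rewrite EFinD ge0_muleDl ?lee_fin ?powR_ge0// mul1e leeD2l//.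
rewrite muleA -EFinM -powRM ?subr_ge0// muleA -EFinM -powRM//.
apply: lee_wpmul2r => //; rewrite lee_fin; apply: ge0_ler_powR => //; rewrite nnegrE mulr_ge0// subr_ge0//.
Qed.

Section DirectionError.
Context {R : realType}.
Notation mu2 := (@lebesgue2 R).
Notation plane := (measurableTypeR R * measurableTypeR R)%type.
Variables (D K : set (R * R)) (A a b : R * R) (al be p M : R).
Variables (u u1 u2 u11 u12 u21 u22 w H : R * R -> R).
Hypothesis oD : open D.
Hypothesis D0 : D !=set0.
Hypothesis DK : D `<=` K.
Hypothesis convK : forall X Y t, K X -> K Y -> 0 <= t <= 1 -> K (X + t *: (Y - X)).
Hypothesis homD : forall h X y, 0 < h < 1 -> K X -> D y -> D (hom h X y).
Hypothesis KM : forall x, K x -> `|x.1| <= M /\ `|x.2| <= M.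
Hypothesis w1 : plane_wd D (e1 R) u u1.
Hypothesis w2 : plane_wd D (e2 R) u u2.
Hypothesis w11 : plane_wd D (e1 R) u1 u11.
Hypothesis w12 : plane_wd D (e2 R) u1 u12.
Hypothesis w21 : plane_wd D (e1 R) u2 u21.
Hypothesis w22 : plane_wd D (e2 R) u2 u22.
Hypothesis p1 : 1 <= p.
Hypothesis mK : measurable (K : set plane).
Hypothesis mH : measurable_fun [set: plane] H.
Hypothesis H0 : forall x, 0 <= H x.
Hypothesis KH : forall l X Y, K X -> K Y ->
  gradient_le (dir_comb l u11 u21) (dir_comb l u12 u22) (fun x => enorm l * H x) (Y - X) 1.
Hypothesis uw : {ae mu2, forall x, D x -> u x = w x}.
Hypothesis cw : {within K, continuous w}.
Hypothesis ab : cross a b != 0.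
Hypothesis al01 : 0 <= al <= 1.
Hypothesis be01 : 0 <= be <= 1.
Variables (eps k : R).
Hypothesis eps0 : 0 < eps.
Hypothesis eps1 : eps <= al + be - 1.
Hypothesis k0 : 0 <= k.
Hypothesis kab : (1 - be) * enorm b <= k * enorm a.
Local Notation C := (A + al *: a + be *: b).
Hypothesis KA : K A.
Hypothesis KB : K (A + a).
Hypothesis KD : K (A + b).
Hypothesis KC : K C.
Hypothesis Kfin : (0 < mu2 K <= `|cross a b|%:E)%E.

(** The constant of [error_bound] for a factor P bounded by 1 / e: the first summand is the bound of
    [main_estimate] for the derivative, the second its bound for the defect after
    [defect_energy_le]. *)
Definition error_const (q e r : R) : R :=
  2 `^ q * (40 * 2 `^ q + (e^-1) `^ q / e * (2 `^ q * (2 * (2 `^ q * (40 * 2 `^ q))) * (1 + r `^ q))).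

Lemma error_const_gt0 (q e r : R) : 0 < e -> 0 < error_const q e r.
Proof.
move=> e0; have t0 : 0 < 40 * 2 `^ q by rewrite mulr_gt0 ?powR_gt0.
rewrite mulr_gt0 ?powR_gt0// ltr_pwDl// mulr_ge0 ?divr_ge0 ?powR_ge0 ?(ltW e0)//.
by rewrite !mulr_ge0 ?addr_ge0 ?powR_ge0.
Qed.

(** P stands for eta or xi divided by [jac], so that the integrand is the derivative of the
    interpolation error along a. *)
Lemma direction_error (P : R * R -> R) : measurable_fun [set: plane] P ->
  (forall x, D x -> `|P x| <= eps^-1) ->
  (\int[mu2]_(x in D) (`|dir_comb a u1 u2 x - (w (A + a)%R - w A) -
       edge_defect al be w A (A + a) C (A + b) * P x| `^ p)%:E <=
   (error_const p eps k)%:E * ((enorm a `^ p)%:E * energy H p))%E.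
Proof.
move=> mP Pe; have mD : measurable (D : set plane) by exact: open_measurable_plane.
have mG (l : R * R) : measurable_fun [set: plane] (fun x => enorm l * H x) by exact: measurable_funM.
have G0 (l : R * R) x : 0 <= enorm l * H x by rewrite mulr_ge0// enorm_ge0.
have ep0 : 0 < al + be - 1 := lt_le_trans eps0 eps1.
have [h1 h2] := main_estimate oD D0 DK convK homD KM w1 w2 w11 w12 w21 w22 p1 mK (mG a) (mG b)
  (G0 a) (G0 b) (KH a) (KH b) uw cw ab al01 be01 ep0 KA KB KD KC Kfin.
have E0 : (0 <= energy H p)%E := energy_ge0 H p.
rewrite (energyZ p (enorm_ge0 a) mH H0) in h1 h2; rewrite (energyZ p (enorm_ge0 b) mH H0) in h2.
have /andP[_ be1] := be01.
have mv : measurable_fun [set: plane] (dir_comb a u1 u2).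
  have [_ /integrableP[/measurable_EFinP mg1 _] _] := w1.
  have [_ /integrableP[/measurable_EFinP mg2 _] _] := w2.
  by apply: measurable_funD; apply: measurable_funM.
have s0 : 0 <= 2 `^ p * (2 * (2 `^ p * (40 * 2 `^ p))) by rewrite !mulr_ge0// powR_ge0.
have h3 := le_trans h2 (defect_energy_le p1 s0 k0 (enorm_ge0 a) (enorm_ge0 b) be1 E0 kab).
set e := edge_defect _ _ _ _ _ _ _ in h3 *.
have h4 : ((eps * `|cross a b| * `|e| `^ p)%:E <= (2 `^ p * (2 * (2 `^ p * (40 * 2 `^ p))) * (1 + k `^ p))%:E *
    ((enorm a `^ p)%:E * energy H p))%E.
  apply: le_trans h3; rewrite lee_fin; apply: ler_wpM2r; first exact: powR_ge0.
  by apply: ler_wpM2r.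
have DX : (mu2 D <= `|cross a b|%:E)%E.
  have /andP[_] := Kfin; apply: le_trans; apply: le_measure; rewrite ?inE//.
have I20 : (0 <= (enorm a `^ p)%:E * energy H p)%E by rewrite mule_ge0// lee_fin powR_ge0.
move: h1 h4 I20; move: ((enorm a `^ p)%:E * energy H p)%E => J h1 h4 J0.
have c0 : 0 <= 2 `^ p * (2 * (2 `^ p * (40 * 2 `^ p))) * (1 + k `^ p).
  by rewrite mulr_ge0// addr_ge0// powR_ge0.
have J0' : (0 <= (2 `^ p * (2 * (2 `^ p * (40 * 2 `^ p))) * (1 + k `^ p))%:E * J)%E.
  by rewrite mule_ge0.
have ie0 : 0 <= eps^-1 by rewrite invr_ge0 ltW.
apply: le_trans (error_bound p1 mD mv mP ie0 Pe eps0 (normr_ge0 _) DX J0' h1 h4) _.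
rewrite muleA -EFinM -ge0_muleDl ?lee_fin ?mulr_ge0 ?powR_ge0 ?invr_ge0 ?(ltW eps0)//.
- by rewrite muleA -EFinD -EFinM /error_const.
- by rewrite addr_ge0// powR_ge0.
Qed.

End DirectionError.

Section NormIntegrals.
Context {R : realType}.
Notation mu2 := (@lebesgue2 R).
Notation plane := (measurableTypeR R * measurableTypeR R)%type.
Variables (D : set (R * R)) (p : R).
Hypothesis p1 : 1 <= p.
Hypothesis mD : measurable (D : set plane).

(** The powers of La and Lb in the two directional bounds cancel the inverse lengths of
    [enorm_le_scaled_dots], so that the result depends on neither. *)
Lemma combined_bound (c La Lb Ca : R) (N ga gb : R * R -> R) (E : \bar R) :
  0 < c -> 0 < La -> 0 < Lb -> 0 <= Ca -> (0 <= E)%E ->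
  measurable_fun (D : set plane) N -> measurable_fun (D : set plane) ga ->
  measurable_fun (D : set plane) gb ->
  (forall x, D x -> 0 <= N x <= c^-1 * (La^-1 * `|ga x| + Lb^-1 * `|gb x|)) ->
  (\int[mu2]_(x in D) (`|ga x| `^ p)%:E <= Ca%:E * ((La `^ p)%:E * E))%E ->
  (\int[mu2]_(x in D) (`|gb x| `^ p)%:E <= Ca%:E * ((Lb `^ p)%:E * E))%E ->
  (\int[mu2]_(x in D) (N x `^ p)%:E <= ((c^-1) `^ p * 2 `^ p * (2 * Ca))%:E * E)%E.
Proof.
move=> c0 La0 Lb0 Ca0 E0 mN mga mgb HN Ha Hb.
have p0 : 0 <= p by apply: le_trans p1.
have mpw (h : R * R -> R) : measurable_fun (D : set plane) h -> measurable_fun (D : set plane) (fun x => (`|h x| `^ p)%:E).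
  move=> mh; apply/measurable_EFinP; apply: (measurableT_comp (measurable_powR p)).
  exact: (measurableT_comp (@normr_measurable R setT) mh).
have mNp : measurable_fun (D : set plane) (fun x => (N x `^ p)%:E).
  by apply/measurable_EFinP; apply: (measurableT_comp (measurable_powR p)).
have La' : 0 <= La^-1 by rewrite invr_ge0 ltW.
have Lb' : 0 <= Lb^-1 by rewrite invr_ge0 ltW.
have c' : 0 <= c^-1 by rewrite invr_ge0 ltW.
pose ka := (La^-1) `^ p; pose kb := (Lb^-1) `^ p.
have ka0 : 0 <= ka by exact: powR_ge0.
have kb0 : 0 <= kb by exact: powR_ge0.
have kc0 : 0 <= (c^-1) `^ p * 2 `^ p by rewrite mulr_ge0// powR_ge0.
apply: (@le_trans _ _ (\int[mu2]_(x in D) (((c^-1) `^ p * 2 `^ p)%:E *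
    (ka%:E * (`|ga x| `^ p)%:E + kb%:E * (`|gb x| `^ p)%:E)))%E).
  apply: ge0_le_integral => //.
  - by move=> x _; rewrite lee_fin powR_ge0.
  - apply: emeasurable_funM => //; apply: emeasurable_funD; apply: emeasurable_funM => //; exact: mpw.
  - move=> x Dx; have /andP[N0 Nle] := HN x Dx.
    rewrite -2![(_%:E * (_ `^ p)%:E)%E]EFinM -EFinD -EFinM lee_fin.
    apply: (@le_trans _ _ ((c^-1 * (La^-1 * `|ga x| + Lb^-1 * `|gb x|)) `^ p)).
      by apply: ge0_ler_powR => //; rewrite nnegrE// (le_trans N0 Nle).
    rewrite powRM ?addr_ge0 ?mulr_ge0// -mulrA; apply: ler_wpM2l; first exact: powR_ge0.
    rewrite /ka /kb -!powRM//; apply: powRD_le => //; by rewrite mulr_ge0.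
have mA : measurable_fun (D : set plane) (fun x => ka%:E * (`|ga x| `^ p)%:E)%E.
  by apply: emeasurable_funM => //; exact: mpw.
have mB : measurable_fun (D : set plane) (fun x => kb%:E * (`|gb x| `^ p)%:E)%E.
  by apply: emeasurable_funM => //; exact: mpw.
rewrite ge0_integralZl//; last 2 first.
- exact: emeasurable_funD.
- by move=> x _; rewrite adde_ge0// mule_ge0// lee_fin powR_ge0.
rewrite [leRHS](_ : _ = ((c^-1) `^ p * 2 `^ p)%:E * ((2 * Ca)%:E * E))%E; last by rewrite muleA -EFinM.
apply: lee_wpmul2l; first by rewrite lee_fin.
rewrite ge0_integralD//; last 2 first.
- by move=> x _; rewrite mule_ge0// lee_fin powR_ge0.
- by move=> x _; rewrite mule_ge0// lee_fin powR_ge0.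
rewrite !ge0_integralZl//; [|exact: mpw..].
have cancel (L : R) (J : \bar R) : 0 < L -> (J <= Ca%:E * ((L `^ p)%:E * E))%E ->
    (((L^-1) `^ p)%:E * J <= Ca%:E * E)%E.
  move=> L0 HJ; apply: (@le_trans _ _ (((L^-1) `^ p)%:E * (Ca%:E * ((L `^ p)%:E * E))))%E.
    by apply: lee_wpmul2l => //; rewrite lee_fin powR_ge0.
  have L1 : (L^-1) `^ p * L `^ p = 1.
    have L0' := ltW L0; by rewrite -powRM ?invr_ge0// mulVf ?gt_eqF// powR1.
  by rewrite !muleA -!EFinM mulrAC L1 mul1r.
rewrite (_ : 2 * Ca = Ca + Ca) ?EFinD ?ge0_muleDl ?lee_fin//; last by rewrite mulr_natl mulr2n.
by apply: leeD; exact: cancel.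
Qed.

Lemma Lp_norm_vect_powR (F : R * R -> R * R) :
  (Lp_norm_vect p D F `^ p = \int[mu2]_(x in D) (enorm (F x) `^ p)%:E)%E.
Proof.
have p0 : p != 0 by rewrite gt_eqF//; apply: lt_le_trans p1.
rewrite /Lp_norm_vect [RHS]integral_mkcond.
apply: (etrans (poweR_Lnorm (lebesgue2 R) (EFin \o ((fun x => enorm (F x)) \_ D)) p0)).
apply: eq_integral => x _.
rewrite /= !patchE; case: ifPn => _; first by rewrite ger0_norm ?enorm_ge0.
by rewrite normr0 powR0.
Qed.

Lemma measurable_enorm (f g : R * R -> R) : measurable_fun (D : set plane) f ->
  measurable_fun (D : set plane) g -> measurable_fun (D : set plane) (fun x => enorm (f x, g x)).
Proof.
move=> mf mg; have mfg : measurable_fun (D : set plane) (fun x => f x * f x + g x * g x).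
  by apply: measurable_funD; apply: measurable_funM.
apply: (eq_measurable_fun (fun x => (f x * f x + g x * g x) `^ 2^-1)).
  by move=> x _; rewrite /enorm -powR12_sqrt ?dot_ge0.
exact: (measurableT_comp (measurable_powR 2^-1) mfg).
Qed.

Lemma ae_enorm_integral (f g f' g' : R * R -> R) :
  measurable_fun (D : set plane) f -> measurable_fun (D : set plane) g ->
  measurable_fun (D : set plane) f' -> measurable_fun (D : set plane) g' ->
  {ae mu2, forall x, D x -> f x = f' x} -> {ae mu2, forall x, D x -> g x = g' x} ->
  (\int[mu2]_(x in D) (enorm (f x, g x) `^ p)%:E = \int[mu2]_(x in D) (enorm (f' x, g' x) `^ p)%:E)%E.
Proof.
move=> mf mg mf' mg' ff' gg'.
have mpw (h k : R * R -> R) : measurable_fun (D : set plane) h -> measurable_fun (D : set plane) k ->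
    measurable_fun (D : set plane) (fun x => (enorm (h x, k x) `^ p)%:E).
  move=> mh mk; apply/measurable_EFinP; apply: (measurableT_comp (measurable_powR p)).
  exact: measurable_enorm.
apply: ae_eq_integral => //; [exact: mpw|exact: mpw|].
have := ae2_and ff' gg'; move=> /ae2_imp; apply => x [Hf Hg] Dx.
by rewrite Hf// Hg.
Qed.

End NormIntegrals.

Lemma poweR_le_cancel (R : realType) (p : R) (x y : \bar R) : 0 < p -> (0 <= x)%E -> (0 <= y)%E ->
  (x `^ p <= y `^ p)%E -> (x <= y)%E.
Proof.
move=> p0 x0 y0 H; have pn : p != 0 by rewrite gt_eqF.
have root (z : \bar R) : (0 <= z)%E -> ((z `^ p) `^ p^-1 = z)%E.
  by move=> z0; rewrite -poweRrM mulfV// poweRe1.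
rewrite -(root x x0) -(root y y0); apply: gt0_ler_poweR => //.
- by rewrite invr_ge0 ltW.
- by rewrite in_itv /= poweR_ge0 leey.
- by rewrite in_itv /= poweR_ge0 leey.
Qed.

(** Takes the p-th root, using that each of x^p and y^p is at most (x + y)^p; the norms are extended
    reals, so infinite ones are covered. *)
Lemma poweR_sum_le (R : realType) (p La Lb Cg : R) (N0 N1 N2 E J1 J2 : \bar R) : 1 <= p ->
  0 <= La -> 0 <= Lb -> 0 <= Cg -> (0 <= N0)%E -> (0 <= N1)%E -> (0 <= N2)%E -> (0 <= E)%E ->
  (N1 `^ p = J1)%E -> (N2 `^ p = J2)%E ->
  (E <= (2 `^ p)%:E * ((La `^ p)%:E * J1 + (Lb `^ p)%:E * J2))%E ->
  (N0 `^ p <= Cg%:E * E)%E ->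
  (N0 <= ((Cg * (2 `^ p * 2)) `^ p^-1)%:E * (La%:E * N1 + Lb%:E * N2))%E.
Proof.
move=> p1 La0 Lb0 Cg0 N00 N10 N20 E0 <- <- HE HN.
have p0 : 0 < p by apply: lt_le_trans p1.
have pn : p != 0 by rewrite gt_eqF.
have a0 : (0 <= La%:E * N1)%E by rewrite mule_ge0.
have b0 : (0 <= Lb%:E * N2)%E by rewrite mule_ge0.
set S := (La%:E * N1 + Lb%:E * N2)%E.
have S0 : (0 <= S)%E by rewrite adde_ge0.
apply: (@poweR_le_cancel _ p) => //; first by rewrite mule_ge0// lee_fin powR_ge0.
rewrite poweRM ?lee_fin ?powR_ge0// poweR_EFin -powRrM mulVf// powRr1; last by rewrite !mulr_ge0// powR_ge0.
have mono (x y : \bar R) : (0 <= x)%E -> (x <= y)%E -> (x `^ p <= y `^ p)%E.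
  move=> x0 xy; apply: gt0_ler_poweR => //; first exact: ltW.
  - by rewrite in_itv /= x0 leey.
  - by rewrite in_itv /= (le_trans x0 xy) leey.
have H1 : ((La `^ p)%:E * N1 `^ p <= S `^ p)%E.
  by rewrite -poweR_EFin -poweRM//; apply: mono => //; rewrite leeDl.
have H2 : ((Lb `^ p)%:E * N2 `^ p <= S `^ p)%E.
  by rewrite -poweR_EFin -poweRM//; apply: mono => //; rewrite leeDr.
apply: le_trans HN _; rewrite EFinM -muleA; apply: lee_wpmul2l; first by rewrite lee_fin.
apply: le_trans HE _; rewrite EFinM -muleA; apply: lee_wpmul2l; first by rewrite lee_fin powR_ge0.
rewrite (_ : (2%:E * S `^ p = S `^ p + S `^ p)%E); first exact: leeD.
by rewrite mule_natl mule2n.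
Qed.

Section SobolevData.
Context {R : realType}.
Notation mu2 := (@lebesgue2 R).
Notation plane := (measurableTypeR R * measurableTypeR R)%type.
Variables (D : set (R * R)) (p : R).
Hypothesis oD : open D.
Hypothesis p1 : 1 <= p.

Let mD : measurable (D : set plane).
Proof. exact: open_measurable_plane. Qed.

Lemma patch_dir_comb (l : R * R) (f g : R * R -> R) :
  (fun x => l.1 * (f \_ D) x + l.2 * (g \_ D) x) = (fun x => l.1 * f x + l.2 * g x) \_ D.
Proof.
by apply/funext => x; rewrite !patchE; case: ifP => // _; rewrite !mulr0 addr0.
Qed.

(** The statement differentiates the chosen representative [weak_derivative D v f], which agrees
    with fv almost everywhere and so has the same weak derivatives. *)
Lemma weak_directional (v l : R * R) (f fv f1 f2 : R * R -> R) :
  is_weak_derivative D v f fv -> is_weak_derivative D (e1 R) fv f1 -> is_weak_derivative D (e2 R) fv f2 ->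
  mu2.-integrable setT (EFin \o (fv \_ D)) -> mu2.-integrable setT (EFin \o (f1 \_ D)) ->
  mu2.-integrable setT (EFin \o (f2 \_ D)) ->
  is_weak_derivative D l (weak_derivative D v f) (fun x => l.1 * f1 x + l.2 * f2 x).
Proof.
move=> wf w1 w2 i0 i1 i2.
have := plane_wd_dir l (weak_plane_wd i0 i1 w1) (weak_plane_wd i0 i2 w2).
rewrite patch_dir_comb => /(plane_wd_weak oD); apply: is_weak_derivative_ae.
- by apply: (ae2_imp (ae_weak_derivative oD wf)) => x Hx Dx; rewrite Hx.
- by have [_ lg _] := weak_derivativeP wf.
Qed.

(** Uniqueness almost everywhere replaces the chosen weak derivatives by explicit ones inside the
    norm. *)
Lemma gradient_norm_powR (v v' : R * R) (f f' g g' : R * R -> R) (F : R * R -> R * R) :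
  is_weak_derivative D v f g -> is_weak_derivative D v' f' g' ->
  F = (fun x => (weak_derivative D v f x, weak_derivative D v' f' x)) ->
  (Lp_norm_vect p D F `^ p = \int[mu2]_(x in D) (enorm (g x, g' x) `^ p)%:E)%E.
Proof.
move=> wf wf' ->; rewrite (Lp_norm_vect_powR D p1).
have [_ lg _] := wf; have [_ lg' _] := wf'.
have [_ lw _] := weak_derivativeP wf; have [_ lw' _] := weak_derivativeP wf'.
exact: (ae_enorm_integral p mD (loc_integrable_measurable oD lw) (loc_integrable_measurable oD lw')
  (loc_integrable_measurable oD lg) (loc_integrable_measurable oD lg')
  (ae_weak_derivative oD wf) (ae_weak_derivative oD wf')).
Qed.

Lemma integral_patch_enorm (l : R * R) (L : R) (f11 f12 f21 f22 : R * R -> R) : 0 <= L ->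
  measurable_fun (D : set plane) f11 -> measurable_fun (D : set plane) f12 ->
  measurable_fun (D : set plane) f21 -> measurable_fun (D : set plane) f22 ->
  (\int[mu2]_x (enorm (dir_comb (L *: l) (f11 \_ D) (f12 \_ D) x,
       dir_comb (L *: l) (f21 \_ D) (f22 \_ D) x) `^ p)%:E =
  (L `^ p)%:E * \int[mu2]_(x in D) (enorm (l.1 * f11 x + l.2 * f12 x, l.1 * f21 x + l.2 * f22 x) `^ p)%:E)%E.
Proof.
move=> L0 m11 m12 m21 m22; have p0 : p != 0 by rewrite gt_eqF//; apply: lt_le_trans p1.
rewrite -ge0_integralZl//; last 3 first.
- apply/measurable_EFinP; apply: (measurableT_comp (measurable_powR p)).
  by apply: measurable_enorm; apply: measurable_funD; apply: measurable_funM.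
- by move=> x _; rewrite lee_fin powR_ge0.
- by rewrite lee_fin powR_ge0.
rewrite [RHS]integral_mkcond; apply: eq_integral => x _.
rewrite patchE /dir_comb !patchE; case: ifP => _; last first.
  by rewrite !mulr0 !addr0 (_ : enorm (0, 0) = 0) ?powR0// /enorm /dot /= mulr0 addr0 sqrtr0.
rewrite -EFinM -powRM ?enorm_ge0// -[X in (X * enorm _) `^ _](ger0_norm L0) -enormZ.
by congr ((enorm _ `^ p)%:E); apply: injective_projections; rewrite /= /GRing.scale /=; ring.
Qed.

Lemma sobolev_data (u : R * R -> R) : (mu2 D < +oo)%E -> sobolev 2 p D u ->
  exists u1 u2 u11 u12 u21 u22,
  [/\ is_weak_derivative D (e1 R) u u1, is_weak_derivative D (e2 R) u u2,
      is_weak_derivative D (e1 R) u1 u11, is_weak_derivative D (e2 R) u1 u12 &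
      is_weak_derivative D (e1 R) u2 u21 /\ is_weak_derivative D (e2 R) u2 u22] /\
  forall f, List.In f [:: u; u1; u2; u11; u12; u21; u22] -> mu2.-integrable setT (EFin \o (f \_ D)).
Proof.
move=> fD [Lu H].
have [u1 w1 [L1 H1]] := H _ e1_mem; have [u2 w2 [L2 H2]] := H _ e2_mem.
have [u11 w11 [L11 _]] := H1 _ e1_mem; have [u12 w12 [L12 _]] := H1 _ e2_mem.
have [u21 w21 [L21 _]] := H2 _ e1_mem; have [u22 w22 [L22 _]] := H2 _ e2_mem.
exists u1, u2, u11, u12, u21, u22; split=> //.
have I f : in_Lp p D f -> mu2.-integrable setT (EFin \o (f \_ D)) by exact: in_Lp_integrable.
by move=> f /= [<-|[<-|[<-|[<-|[<-|[<-|[<-|[]]]]]]]]; exact: I.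
Qed.

End SobolevData.

(** * The error estimate in terms of p-th powers *)

Section InterpolationError.
Context {R : realType}.
Notation mu2 := (@lebesgue2 R).
Notation plane := (measurableTypeR R * measurableTypeR R)%type.
Variables (p psi c d : R) (V : 'I_4 -> R * R) (i : 'I_4).
Hypothesis p1 : 1 <= p.
Hypothesis psi01 : 0 < psi < pi.
Hypothesis c0 : 0 < c.
Hypothesis hV : convex_ccw V.
Hypothesis hMAC : MAC psi V.
Hypothesis hclos : clos c d V.
Hypothesis hpar : quad V `<=` parallelogram (V i) (V (i + 1)) (V (i - 1)).
Local Notation A := (V i).
Local Notation a := (V (i + 1) - V i).
Local Notation b := (V (i - 1) - V i).
Local Notation K := (quad V).
Local Notation D := (quad V)°.

Let X0 : 0 < cross a b := cross_corner_gt0 hV i.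
Let mK : measurable (K : set plane).
Proof. by apply: closed_measurable_plane; exact: closed_quad. Qed.

Lemma quad_measure : (0 < mu2 K <= `|cross a b|%:E)%E.
Proof.
apply/andP; split.
  by apply: (measure_gt0 (@open_interior_quad R V) (interior_quad_nonempty hV)) => //; exact: interior_subset.
by apply: measure_parallelogram_le => //; rewrite gt_eqF.
Qed.

Lemma interior_quad_finite : (mu2 D < +oo)%E.
Proof.
have /andP[_ H] := quad_measure.
apply: (@le_lt_trans _ _ `|cross a b|%:E%E); last exact: ltry.
apply: le_trans H; apply: le_measure; rewrite ?inE//; last exact: interior_subset.
by apply: open_measurable_plane; exact: open_interior_quad.
Qed.

(** The lower bound for the sine at A; its half is the lower bound for al + be - 1. *)
Definition shape_const : R := sin psi * c ^+ 2.
Definition gradient_const : R :=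
  (shape_const^-1) `^ p * 2 `^ p * (2 * error_const p (shape_const / 2) (1 + c^-1)).

(** a and b are not normalized, so the side lengths are already included. *)
Definition hessian_sum (u11 u12 u21 u22 : R * R -> R) x : R :=
  enorm (dir_comb a (u11 \_ D) (u12 \_ D) x, dir_comb a (u21 \_ D) (u22 \_ D) x) +
  enorm (dir_comb b (u11 \_ D) (u12 \_ D) x, dir_comb b (u21 \_ D) (u22 \_ D) x).

(** [direction_error] is used twice, the second time with a and b, and al and be, exchanged; the
    defect e is symmetric under this exchange. The two directional errors then bound the full
    gradient through the sine at A. *)
Lemma interpolation_error u u1 u2 u11 u12 u21 u22 :
  is_weak_derivative D (e1 R) u u1 -> is_weak_derivative D (e2 R) u u2 ->
  is_weak_derivative D (e1 R) u1 u11 -> is_weak_derivative D (e2 R) u1 u12 ->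
  is_weak_derivative D (e1 R) u2 u21 -> is_weak_derivative D (e2 R) u2 u22 ->
  (forall f, List.In f [:: u; u1; u2; u11; u12; u21; u22] -> mu2.-integrable setT (EFin \o (f \_ D))) ->
  (sobolev_seminorm1 p D (fun x => u x - Q1_interp V u x)%R `^ p <=
   gradient_const%:E * energy (hessian_sum u11 u12 u21 u22) p)%E.
Proof.
move=> w1 w2 w11 w12 w21 w22 I.
have i0 := I u ltac:(by left); have i1 := I u1 ltac:(by do 1 right; left).
have i2 := I u2 ltac:(by do 2 right; left); have i11 := I u11 ltac:(by do 3 right; left).
have i12 := I u12 ltac:(by do 4 right; left); have i21 := I u21 ltac:(by do 5 right; left).
have i22 := I u22 ltac:(by do 6 right; left).
have oD := @open_interior_quad R V; have DK : D `<=` K := @interior_subset _ K.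
have [al [be [[hC al01 be01] [cX epsL kb ka]]]] := shape_regularity psi01 c0 hV hMAC hclos hpar.
have /andP[al0 al1] := al01; have /andP[be0 be1] := be01.
have eps0 : 0 < al + be - 1 := eps_gt0 hV hC.
have /andP[psi0 psi1] := psi01.
have cc0 : 0 < shape_const by rewrite mulr_gt0 ?exprn_gt0// sin_gt0_pi// psi0.
have cc2 : 0 < shape_const / 2 by rewrite divr_gt0.
have W1 := weak_plane_wd i0 i1 w1; have W2 := weak_plane_wd i0 i2 w2.
have W11 := weak_plane_wd i1 i11 w11; have W12 := weak_plane_wd i1 i12 w12.
have W21 := weak_plane_wd i2 i21 w21; have W22 := weak_plane_wd i2 i22 w22.
have out (f : R * R -> R) x : ~ D x -> (f \_ D) x = 0 by move=> nDx; exact: patch_out.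
(* With a representative at hand, the one selected by [continuous_rep] is a genuine one. *)
have [w0 [cw0 uw0]] : exists w, is_continuous_rep K (u \_ D) w.
  by apply: (exists_continuous_rep hV W1 W2 W11 W12 W21 W22) => x nDx; split; split; exact: out.
set w := continuous_rep K u.
have [cw uw'] : is_continuous_rep K u w.
  rewrite /w /continuous_rep; case: xgetP => // /(_ w0)[]; split => //.
  by apply: (ae2_imp uw0) => x Hx Dx; rewrite -Hx// patch_in.
have uw : {ae mu2, forall x, D x -> (u \_ D) x = w x}.
  by apply: (ae2_imp uw') => x Hx Dx; rewrite patch_in// Hx.
have [M KM] := quad_bounded V.
set H := hessian_sum _ _ _ _.
have mU (f : R * R -> R) : mu2.-integrable setT (EFin \o (f \_ D)) -> measurable_fun [set: plane] (f \_ D).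
  by move=> /integrableP[/measurable_EFinP].
have mH : measurable_fun [set: plane] H.
  by apply: measurable_funD; apply: measurable_enorm; apply: measurable_funD; apply: measurable_funM => //; exact: mU.
have H0 x : 0 <= H x by rewrite addr_ge0// enorm_ge0.
have KH l X Y : K X -> K Y -> gradient_le (dir_comb l (u11 \_ D) (u21 \_ D))
    (dir_comb l (u12 \_ D) (u22 \_ D)) (fun x => enorm l * H x) (Y - X) 1.
  move=> /hpar[s [t [s01 t01 ->]]] /hpar[s' [t' [s01' t01' ->]]] x.
  rewrite mul1r; apply: (@gradient_bound R a b l _ (s' - s) (t' - t)).
  - exact: norm_sub_le1.
  - exact: norm_sub_le1.
  - by apply: injective_projections; rewrite /= /GRing.scale /=; ring.
have [xi [eta form]] := Q1_interp_form hV hC al1 be1.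
have coordsP x : K x -> [/\ 0 <= xi x <= 1, 0 <= eta x <= 1,
    coord1 V i x = xi x * (1 - (1 - al) * eta x) & coord2 V i x = eta x * (1 - (1 - be) * xi x)].
  by move=> /form[].
have fD := interior_quad_finite.
set e := edge_defect al be w A (V (i + 1)) (V (i + 2)) (V (i - 1)).
set d1 := w (V (i + 1)) - w A; set d2 := w (V (i - 1)) - w A.
pose q := bilinear_deriv V i al be xi eta d1 d2 e.
have Wq v := bilinear_weak_derivative al1 be1 eps0 coordsP (w A) d1 d2 e v fD.
pose err x := u x - Q1_interp V u x.
have errE v (f : R * R -> R) : plane_wd D v (u \_ D) (f \_ D) ->
    is_weak_derivative D v err (fun x => f x - q v x).
  move=> Wf; apply: (plane_wd_weak oD).
  have := plane_wd_lincomb 1 (-1) Wf (Wq v).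
  rewrite (_ : (fun x => 1 * (u \_ D) x + _) = err \_ D); last first.
    apply/funext => x; rewrite !patchE; case: ifPn => [/set_mem Dx|_]; last by rewrite !mulr0 addr0.
    by rewrite mul1r mulN1r /err; have [_ _ _ _ ->] := form x (DK x Dx).
  rewrite (_ : (fun x => 1 * (f \_ D) x + _) = (fun x => f x - q v x) \_ D)//.
  apply/funext => x; rewrite !patchE; case: ifPn => _; last by rewrite !mulr0 addr0.
  by rewrite mul1r mulN1r.
have e1d := errE _ _ W1; have e2d := errE _ _ W2.
rewrite (gradient_norm_powR oD p1 e1d e2d (erefl _)).
have Kfin := quad_measure.
have EB : A + a = V (i + 1) by rewrite addrC subrK.
have ED : A + b = V (i - 1) by rewrite addrC subrK.
have KV k : K (V k) by exact: quad_vertex.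
have D0 := interior_quad_nonempty hV.
have hom_in h X y : 0 < h < 1 -> K X -> D y -> D (hom h X y) by exact: hom_interior_quad.
have k0 : 0 <= 1 + c^-1 by rewrite addr_ge0// invr_ge0 ltW.
have mD : measurable (D : set plane) by exact: open_measurable_plane.
have ratio y x : D x -> 0 <= y <= 1 -> `|y / jac al be xi eta x| <= (shape_const / 2)^-1.
  move=> Dx y01; have /andP[r0 r1] := ratio_le al1 be1 eps0 coordsP (DK x Dx) y01.
  by rewrite ger0_norm//; apply: le_trans r1 _; rewrite lef_pV2.
have cxi x : D x -> {for x, continuous xi} := continuous_xi al1 be1 eps0 coordsP (x := x).
have ceta x : D x -> {for x, continuous eta} := continuous_eta al1 be1 eps0 coordsP (x := x).
have cjac x : D x -> {for x, continuous (jac al be xi eta)} := continuous_jac al1 be1 eps0 coordsP (x := x).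
have mP (h : R * R -> R) : (forall x, D x -> {for x, continuous h}) -> (forall x, D x -> 0 <= h x <= 1) ->
    measurable_fun [set: plane] ((fun x => h x / jac al be xi eta x) \_ D) /\
    forall x, D x -> `|((fun x => h x / jac al be xi eta x) \_ D) x| <= (shape_const / 2)^-1.
  move=> ch h01; split; last by move=> x Dx; rewrite patch_in//; apply: ratio => //; exact: h01.
  apply: mU; apply: (@bounded_patch_integrable R D oD _ ((shape_const / 2)^-1) fD).
  - move=> x Dx; have kj : jac al be xi eta y @[y --> x] --> jac al be xi eta x := cjac x Dx.
    exact: (cvgM (ch x Dx) (cvgV (jac_neq0 al1 be1 eps0 coordsP (DK x Dx)) kj)).
  - by move=> x Dx; apply: ratio => //; exact: h01.
have [meta Peta] := mP eta ceta (fun x Dx => let: And4 _ h _ _ := coordsP x (DK x Dx) in h).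
have [mxi Pxi] := mP xi cxi (fun x Dx => let: And4 h _ _ _ := coordsP x (DK x Dx) in h).
have X0' : cross a b != 0 by rewrite gt_eqF.
have nba : cross b a = - cross a b by rewrite /cross; ring.
have X0'' : cross b a != 0 by rewrite nba oppr_eq0.
have Kfin' : (0 < mu2 K <= `|cross b a|%:E)%E by rewrite nba normrN.
have epsR : shape_const / 2 <= be + al - 1 by rewrite [be + al]addrC.
have KB : K (A + a) by rewrite EB.
have KD : K (A + b) by rewrite ED.
have KC : K (A + al *: a + be *: b) by rewrite -hC.
have KC' : K (A + be *: b + al *: a) by rewrite addrAC -hC.
have Da := direction_error oD D0 DK (@convex_quad R V hV) hom_in KM W1 W2 W11 W12 W21 W22 p1 mK mH H0 KH uw cw
  X0' al01 be01 cc2 epsL k0 kb (KV i) KB KD KC Kfin meta Peta.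
have Db := direction_error oD D0 DK (@convex_quad R V hV) hom_in KM W1 W2 W11 W12 W21 W22 p1 mK mH H0 KH uw cw
  X0'' be01 al01 cc2 epsR k0 ka (KV i) KD KB KC' Kfin' mxi Pxi.
rewrite [A + be *: b + al *: a]addrAC -hC EB ED -/d2 in Db; rewrite -hC EB ED -/d1 -/e in Da.
have eE : edge_defect be al w A (V (i - 1)) (V (i + 2)) (V (i + 1)) = e by rewrite /e /edge_defect; ring.
rewrite eE in Db.
have La0 : 0 < enorm a by apply: enorm_gt0; exact: side_neq0.
have Lb0 : 0 < enorm b.
  apply: enorm_gt0; have := side_neq0 hV (i - 1); have [_ _ -> _] := I4_nextE i.
  by rewrite -opprB oppr_eq0.
have mdir (l : R * R) (m : R) (P : R * R -> R) : measurable_fun [set: plane] P ->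
    measurable_fun (D : set plane) (fun x => dir_comb l (u1 \_ D) (u2 \_ D) x - m - e * P x).
  move=> mP'; apply: measurable_funTS; apply: measurable_funB; last exact: measurable_funM.
  by apply: measurable_funB => //; apply: measurable_funD; apply: measurable_funM => //; exact: mU.
have mN : measurable_fun (D : set plane) (fun x => enorm (u1 x - q (e1 R) x, u2 x - q (e2 R) x)).
  have [_ l1 _] := e1d; have [_ l2 _] := e2d.
  by apply: measurable_enorm; exact: loc_integrable_measurable.
have Ca0 : 0 <= error_const p (shape_const / 2) (1 + c^-1) by exact/ltW/error_const_gt0.
apply: (combined_bound p1 mD cc0 La0 Lb0 Ca0 (energy_ge0 H p) mN (mdir _ _ _ meta) (mdir _ _ _ mxi) _ Da Db).
move=> x Dx; rewrite enorm_ge0 /=.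
have := enorm_le_scaled_dots (u1 x - q (e1 R) x, u2 x - q (e2 R) x) cc0 X0 cX.
have [Ea Eb] := bilinear_deriv_sides al be xi eta d1 d2 e x X0'.
rewrite /dir_comb !(patch_in _ Dx) /dot /= -/q.
rewrite (_ : a.1 * (u1 x - q (e1 R) x) + a.2 * (u2 x - q (e2 R) x) = a.1 * u1 x + a.2 * u2 x - d1 -
  e * (eta x / jac al be xi eta x)); last by rewrite -addrA -opprD -Ea -/q; ring.
rewrite (_ : b.1 * (u1 x - q (e1 R) x) + b.2 * (u2 x - q (e2 R) x) = b.1 * u1 x + b.2 * u2 x - d2 -
  e * (xi x / jac al be xi eta x)) //; last by rewrite -addrA -opprD -Eb -/q; ring.
Qed.

End InterpolationError.

Lemma energy_sum_le (R : realType) (p : R) (f g : R * R -> R) : 1 <= p ->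
  measurable_fun [set: measurableTypeR R * measurableTypeR R] f ->
  measurable_fun [set: measurableTypeR R * measurableTypeR R] g ->
  (forall x, 0 <= f x) -> (forall x, 0 <= g x) ->
  (energy (fun x => f x + g x)%R p <= (2 `^ p)%:E * (energy f p + energy g p))%E.
Proof.
move=> p1 mf mg f0 g0.
have mpw (h : R * R -> R) : measurable_fun [set: measurableTypeR R * measurableTypeR R] h ->
    measurable_fun [set: measurableTypeR R * measurableTypeR R] (fun x => (h x `^ p)%:E).
  by move=> mh; apply/measurable_EFinP; exact: (measurableT_comp (measurable_powR p) mh).
have mF := mpw _ mf; have mG := mpw _ mg.
have mS := mpw _ (measurable_funD mf mg).
rewrite /energy -ge0_integralD//; do ?by move=> x _; rewrite lee_fin powR_ge0.
rewrite ge0_integral_scale ?powR_ge0//; last 2 first.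
- exact: emeasurable_funD.
- by move=> x; rewrite adde_ge0// lee_fin powR_ge0.
apply: ge0_le_integral; first exact: measurableT.
- by move=> x _; rewrite lee_fin powR_ge0.
- exact: mS.
- by apply: emeasurable_funM => //; exact: emeasurable_funD.
- by move=> x _; rewrite -EFinD -EFinM lee_fin powRD_le.
Qed.

Theorem theorem6p2 (R : realType) (p psiM Clow Cup : R)
    (hp : 1 <= p) (hpsi : 0 < psiM < pi) (hC : 0 < Clow <= Cup) :
  exists2 C : R, 0 < C &
    forall (V : 'I_4 -> R * R) (hV : convex_ccw V)
      (hMAC : MAC psiM V) (hclos : clos Clow Cup V)
      (i : 'I_4)
      (hpar : quad V `<=` parallelogram (V i) (V (i + 1)) (V (i - 1))),
    let D := (quad V)° in
    let l1 := unit_dir (V i) (V (i + 1)) in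
    let l2 := unit_dir (V i) (V (i - 1)) in
    forall (u : R * R -> R) (hu : sobolev 2 p D u),
    (sobolev_seminorm1 p D (fun x => u x - Q1_interp V u x)%R <=
      C%:E * ((enorm (V (i + 1) - V i))%:E *
                Lp_norm_vect p D (weak_derivative_vect D l1 (weak_grad D u)) +
              (enorm (V (i - 1) - V i))%:E *
                Lp_norm_vect p D (weak_derivative_vect D l2 (weak_grad D u))))%E.
Proof.
have /andP[c0 _] := hC; have /andP[psi0 psi1] := hpsi.
have cc0 : 0 < shape_const psiM Clow by rewrite mulr_gt0 ?exprn_gt0// sin_gt0_pi// psi0.
have G0 : 0 < gradient_const p psiM Clow.
  apply: mulr_gt0; first by rewrite mulr_gt0 ?powR_gt0 ?invr_gt0.
  by apply: mulr_gt0 => //; apply: error_const_gt0; rewrite divr_gt0.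
(* 2^p comes from [energy_sum_le], the further 2 from bounding both p-th powers by that of the sum,
   and the root from passing from powers to norms. *)
exists ((gradient_const p psiM Clow * (2 `^ p * 2)) `^ p^-1).
  apply: powR_gt0; apply: mulr_gt0; first exact: G0.
  by rewrite mulr_gt0 ?powR_gt0.
move=> V hV hMAC hclos i hpar D l1 l2 u hu.
have oD : open D by exact: open_interior_quad.
have [u1 [u2 [u11 [u12 [u21 [u22 [[w1 w2 w11 w12 [w21 w22]] I]]]]]]] :=
  sobolev_data oD hp (interior_quad_finite hV hpar) hu.
have HN := interpolation_error hp hpsi c0 hV hMAC hclos hpar w1 w2 w11 w12 w21 w22 I.
have i1 := I u1 ltac:(by do 1 right; left).
have i2 := I u2 ltac:(by do 2 right; left); have i11 := I u11 ltac:(by do 3 right; left).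
have i12 := I u12 ltac:(by do 4 right; left); have i21 := I u21 ltac:(by do 5 right; left).
have i22 := I u22 ltac:(by do 6 right; left).
have wl l := weak_directional oD l w1 w11 w12 i1 i11 i12.
have wl' l := weak_directional oD l w2 w21 w22 i2 i21 i22.
have J1 := gradient_norm_powR oD hp (wl l1) (wl' l1) (erefl _).
have J2 := gradient_norm_powR oD hp (wl l2) (wl' l2) (erefl _).
have dirE j : V j - V i = enorm (V j - V i) *: unit_dir (V i) (V j).
  have [E0|ji] := eqVneq (V j - V i) 0; first by rewrite /unit_dir E0 !scaler0.
  by rewrite /unit_dir scalerA divff ?scale1r// gt_eqF// enorm_gt0.
have [_ m11 _] := w11; have [_ m12 _] := w12; have [_ m21 _] := w21; have [_ m22 _] := w22.
apply: (poweR_sum_le hp (enorm_ge0 _) (enorm_ge0 _) (ltW G0) (Lnorm_ge0 _ _ _) (Lnorm_ge0 _ _ _)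
  (Lnorm_ge0 _ _ _) (energy_ge0 _ p) J1 J2 _ HN).
have mU (f : R * R -> R) : (lebesgue2 R).-integrable setT (EFin \o (f \_ D)) ->
    measurable_fun [set: measurableTypeR R * measurableTypeR R] (f \_ D).
  by move=> /integrableP[/measurable_EFinP].
have mdir (l : R * R) : measurable_fun [set: measurableTypeR R * measurableTypeR R] (fun x =>
    enorm (dir_comb l (u11 \_ D) (u12 \_ D) x, dir_comb l (u21 \_ D) (u22 \_ D) x)).
  by apply: measurable_enorm; apply: measurable_funD; apply: measurable_funM => //; exact: mU.
have ml f : loc_integrable D f -> measurable_fun (D : set (measurableTypeR R * measurableTypeR R)) f.
  exact: loc_integrable_measurable.
have scaled j := integral_patch_enorm (D := D) oD hp (unit_dir (V i) (V j)) (enorm_ge0 (V j - V i))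
  (ml _ m11) (ml _ m12) (ml _ m21) (ml _ m22).
rewrite -(scaled (i + 1)) -(scaled (i - 1)) -!dirE.
exact: (energy_sum_le hp (mdir _) (mdir _) (fun x => enorm_ge0 _) (fun x => enorm_ge0 _)).
Qed.
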